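(* Let $X_0$ be a complex Banach space, let $A:\mathcal{D}(A)\subset X_0\to X_0$ be a linear operator such that $-A$ is a sectorial operator of angle $\psi_0\in[0,\pi/2)$, and let $g\in L^1_{loc}([0,\infty);\mathbb{C})$ be a non identically zero Laplace transformable function with Laplace transform $\widehat g$. Suppose that, for some $\omega_0\ge 0$ and $\eta_0\in(0,\pi/2]$, the following conditions hold: (B1) $\widehat{g}$ admits a meromorphic extension to $\Sigma(\omega_0,\eta_0+\pi/2)$ and $\widehat{g}(\lambda)\neq 0$ for all $\lambda\in\Sigma(\omega_0,\eta_0+\pi/2)$; (B2) for each $\omega_1>\omega_0$ and $\eta_1\in(0,\eta_0)$ there exists $\psi_1\in(\psi_0,\pi/2)$ such that $-\lambda/\widehat{g}(\lambda)\in\mathbb{C}\setminus\Sigma[0,\psi_1]$ for all $\lambda\in\Sigma(\omega_1,\eta_1+\pi/2)$; (B3) for some $\omega>\omega_0$ and $\eta\in(0,\eta_0)$ there is $\zeta_g>1$ such that $$\limsup_{|\lambda|\to\infty,\ \lambda\in\Sigma(\omega,\eta+\pi/2)}\frac{1}{|\widehat{g}(\lambda)||\lambda|^{\zeta_g-1}}<\infty.$$ Then there exists the analytic resolvent family $\{S(t)\}_{t\ge0}$ associated with the pair $(A,g)$. Furthermore, with $\omega,\eta,\zeta_g$ as in (B3), there is $M\ge1$ such that $$\|S(t)\|_{\mathcal{B}(X_0)}\le Me^{\omega t},\quad t\ge0,$$ $$\|S(t)\|_{\mathcal{B}(X_0,X_1)}\le Me^{\omega t}(1+t^{-\zeta_g}),\quad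 t>0,$$ and $$\|S(t_1)-S(t_0)\|_{\mathcal{B}(X_0)}\le\frac{Me^{\omega(1+\sin(\eta))t_1}}{\sin(\eta)}\ln(t_1/t_0),\quad 0<t_0<t_1,$$ where $X_1=\mathcal{D}(A)$ with the norm $\|x\|_{X_1}=\|(I-A)x\|_{X_0}$.
   Context: Sectors: for $\omega\in\mathbb{R}$, $\Sigma[\omega,\eta]=\{\omega+re^{i\psi}: r\ge0,\ -\eta\le\psi\le\eta\}$ for $\eta\in[0,\pi]$, and $\Sigma(\omega,\eta)=\{\omega+re^{i\psi}: r>0,\ -\eta<\psi<\eta\}$ for $\eta\in(0,\pi)$. Sectorial operator: a closed, unbounded, densely defined linear operator $B:\mathcal{D}(B)\subset X_0\to X_0$ is sectorial of angle $\psi_0\in[0,\pi/2)$ if $\sigma(B)\subset\Sigma[0,\psi_0]$ and for each $\psi_1\in(\psi_0,\pi)$ there is $C=C(\psi_1)$ such that $\|(z-B)^{-1}\|_{\mathcal{B}(X_0)}\le C/|z|$ for $z\in\mathbb{C}\setminus\Sigma[0,\psi_1]$. Resolvent family: a family $\{S(t)\}_{t\ge0}$ of bounded linear operators in $X_0$ is a resolvent family associated with $(A,g)$ if (i) $S$ is strongly continuous on $[0,\infty)$ and $S(0)=I$; (ii) for each $t\ge0$ and $x\in\mathcal{D}(A)$, $S(t)x\in\mathcal{D}(A)$ and $AS(t)x=S(t)Ax$; (iii) $S(t)x=x+\int_0^t\int_0^{t-s}g(t-s-r)\,dr\,AS(s)x\,ds$ for all $x\in\mathcal{D}(A)$, $t\ge0$.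 It is called analytic if $S(\cdot):(0,\infty)\to\mathcal{B}(X_0)$ admits an analytic extension to a sector $\Sigma(0,\eta_0')$ for some $0<\eta_0'\le\pi/2$. $\mathcal{B}(X,Y)$ is the space of bounded linear operators from $X$ to $Y$, and $\mathcal{B}(X)=\mathcal{B}(X,X)$. *)

(* Defs.v *)
From HB Require Import structures.
From mathcomp Require Import all_boot all_order all_algebra.
From mathcomp Require Import complex.
From mathcomp Require Import all_classical all_reals all_analysis.
Import numFieldNormedType.Exports.
Set Implicit Arguments.
Unset Strict Implicit.
Unset Printing Implicit Defensive.
Import Order.TTheory GRing.Theory Num.Theory.
Local Open Scope classical_set_scope.
Local Open Scope ring_scope.
Local Open Scope complex_scope.

(* R[i] as a normed module over itself. *)
HB.instance Definition _ (R : realType) :=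
  NormedModule.copy R[i] R[i]^o.

Section ComplexNumbers.
Context {R : realType}.

(* Norms of modules over R[i] take values in R[i]; this is the same norm,
   read in R. It also serves as the modulus on R[i]. *)
Definition rnorm {X : normedModType R[i]} (x : X) : R := complex.Re `|x|.

Definition cis (psi : R) : R[i] := cos psi +i* sin psi.

Definition cexp (z : R[i]) : R[i] :=
  (expR (complex.Re z))%:C * cis (complex.Im z).

Definition csector (w eta : R) : set R[i] :=
  [set z | exists r psi : R,
    [/\ 0 <= r, - eta <= psi <= eta & z = w%:C + r%:C * cis psi]].

Definition osector (w eta : R) : set R[i] :=
  [set z | exists r psi : R,
    [/\ 0 < r, - eta < psi < eta & z = w%:C + r%:C * cis psi]].

(* The filter of |z| -> oo with z in U. *)
Definition infty_in (U : set R[i]) : set_system R[i] :=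
  filter_from setT (fun r : R => [set z | U z /\ r < rnorm z]).

(* G is meromorphic on the open set U with set of poles P; the values of the
   total function G on P are irrelevant. The second clause says that P is
   discrete and closed in U. *)
Definition meromorphic_on (U : set R[i]) (G : R[i] -> R[i]) (P : set R[i]) :=
  [/\ P `<=` U,
      forall z, U z -> \forall w \near z^', ~ P w,
      forall z, U z -> ~ P z -> derivable G z 1
    & forall z, P z -> (fun w => rnorm (G w)) @ z^' --> +oo].

(* The meromorphic function 1/G, which vanishes at the poles of G. *)
Definition recip (G : R[i] -> R[i]) (P : set R[i]) (z : R[i]) : R[i] :=
  if `[< P z >] then 0 else (G z)^-1.

End ComplexNumbers.

Section ComplexIntegrals.
Context {R : realType}.
Local Notation mu := (@lebesgue_measure R).

Definition cintegrable (D : set R) (f : R -> R[i]) :=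
  mu.-integrable D (fun t => (complex.Re (f t))%:E) /\
  mu.-integrable D (fun t => (complex.Im (f t))%:E).

Definition cintegral (D : set R) (f : R -> R[i]) : R[i] :=
  Rintegral mu D (fun t => complex.Re (f t)) +i*
  Rintegral mu D (fun t => complex.Im (f t)).

(* L^1_loc([0, oo); C); only the values of g on [0, oo) matter. *)
Definition L1loc (g : R -> R[i]) :=
  forall T : R, 0 <= T -> cintegrable `[0, T] g.

Definition laplace_integrand (g : R -> R[i]) (z : R[i]) (t : R) : R[i] :=
  cexp (- (z * t%:C)) * g t.

Definition laplace_cvg (g : R -> R[i]) (z : R[i]) :=
  cintegrable `[0, +oo[ (laplace_integrand g z).

Definition laplace (g : R -> R[i]) (z : R[i]) : R[i] :=
  cintegral `[0, +oo[ (laplace_integrand g z).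

Definition laplace_transformable (g : R -> R[i]) :=
  exists z : R[i], laplace_cvg g z.

Definition meromorphic_extension (f : R[i] -> R[i]) (V U : set R[i])
    (G : R[i] -> R[i]) (P : set R[i]) :=
  meromorphic_on U G P /\
  forall z, V z -> U z -> ~ P z -> G z = f z.

End ComplexIntegrals.

Section Operators.
Context {R : realType} {X : completeNormedModType R[i]}.

(* A linear operator D(B) in X -> X; the values of op outside dom are
   irrelevant. *)
Record linop := LinOp {
  dom : set X;
  op :> X -> X;
  dom0 : dom 0;
  dom_lin : forall (a : R[i]) x y, dom x -> dom y -> dom (a *: x + y);
  op_lin : forall (a : R[i]) x y, dom x -> dom y ->
    op (a *: x + y) = a *: op x + op y
}.

Lemma oppop_lin (B : linop) (a : R[i]) x y : dom B x -> dom B y ->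
  - B (a *: x + y) = a *: (- B x) + (- B y).
Proof. by move=> Bx By; rewrite op_lin// opprD scalerN. Qed.

Definition oppop (B : linop) : linop :=
  LinOp (dom0 B) (@dom_lin B) (@oppop_lin B).

(* Membership in, and norm of, B(X, Y), where Y is a subspace of X with its
   own norm nY. For T not in B(X, Y) the value of opnorm is meaningless. *)
Definition bounded_linop (nY : X -> R) (T : X -> X) :=
  linear T /\ exists c : R, forall x, nY (T x) <= c * rnorm x.

Definition opnorm (nY : X -> R) (T : X -> X) : R :=
  sup [set nY (T x) | x in [set x : X | rnorm x <= 1]].

Definition norm1 (A : linop) (x : X) : R := rnorm (x - A x).

Definition is_resolvent (B : linop) (z : R[i]) (Q : X -> X) :=
  [/\ bounded_linop rnorm Q,
      forall x, dom B (Q x) /\ z *: Q x - B (Q x) = x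
    & forall x, dom B x -> Q (z *: x - B x) = x].

Definition spectrum (B : linop) : set R[i] :=
  [set z | ~ exists Q, is_resolvent B z Q].

Definition closed_op (B : linop) :=
  closed [set p : X * X | dom B p.1 /\ B p.1 = p.2].

Definition unbounded_op (B : linop) :=
  ~ exists c : R, forall x, dom B x -> rnorm (B x) <= c * rnorm x.

Definition sectorial (B : linop) (psi0 : R) :=
  [/\ closed_op B, unbounded_op B, dense (dom B),
      spectrum B `<=` csector 0 psi0
    & forall psi1 : R, psi0 < psi1 < pi -> exists C : R,
        forall (z : R[i]) (Q : X -> X), ~ csector 0 psi1 z ->
        is_resolvent B z Q -> opnorm rnorm Q <= C / rnorm z].

(* v is the Riemann integral of the X-valued function f over [a, b] (a <= b),
   as limit of the Riemann sums over tagged partitions. *)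
Definition is_rint (f : R -> X) (a b : R) (v : X) :=
  forall e : R, 0 < e -> exists2 d : R, 0 < d &
    forall (n : nat) (p xi : nat -> R), p 0%N = a -> p n = b ->
      (forall i, (i < n)%N ->
        p i <= xi i <= p i.+1 /\ p i.+1 - p i < d) ->
      rnorm (\sum_(i < n) (p i.+1 - p i)%:C *: f (xi i) - v) < e.

(* In the last clause the integrand over s is continuous, the inner integral
   being continuous in s and A (S s x) being equal to S s (A x). *)
Definition resolvent_family (A : linop) (g : R -> R[i]) (S : R -> X -> X) :=
  [/\ forall t, 0 <= t -> bounded_linop rnorm (S t),
      forall x, {within `[0, +oo[, continuous (fun t => S t x)},
      forall x, S 0 x = x,
      forall t x, 0 <= t -> dom A x ->
        dom A (S t x) /\ A (S t x) = S t (A x)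
    & forall t x, 0 <= t -> dom A x -> exists2 v : X,
        is_rint (fun s => cintegral `[0, t - s] (fun r => g (t - s - r))
                            *: A (S s x)) 0 t v &
        S t x = x + v].

Definition op_holomorphic_on (U : set R[i]) (T : R[i] -> X -> X) :=
  forall z, U z -> bounded_linop rnorm (T z) /\
    exists2 T' : X -> X, bounded_linop rnorm T' &
      (fun h : R[i] => opnorm rnorm
         (fun x => h^-1 *: (T (z + h) x - T z x) - T' x)) @ 0^' --> 0.

Definition analytic_family (S : R -> X -> X) :=
  exists eta : R, 0 < eta <= pi / 2 /\
  exists T : R[i] -> X -> X, op_holomorphic_on (osector 0 eta) T /\
    forall t x, 0 < t -> T t%:C x = S t x.

End Operators.

Arguments linop {R} X.

(* Main.v *)
Require Import Defs.
From HB Require Import structures.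
From mathcomp Require Import all_boot all_order all_algebra.
From mathcomp Require Import complex.
From mathcomp Require Import all_classical all_reals all_analysis.
From mathcomp Require Import ring lra measurable_realfun.
Import numFieldNormedType.Exports.
Import Order.TTheory GRing.Theory Num.Theory.
Local Open Scope classical_set_scope.
Local Open Scope ring_scope.
Local Open Scope complex_scope.
Set Implicit Arguments.
Unset Strict Implicit.
Unset Printing Implicit Defensive.

(** If [S] is a resolvent family for [(A, g)] then its Laplace transform is
    [F l = (l - ghat l A)^-1 = m l (l m l - A)^-1] with [m = 1 / ghat], and the proof
    consists in inverting this transform.

    Condition (B2) places [- l m l] outside a sector that contains the spectrum of
    [- A], so that [F] is holomorphic and bounded by [C / |l|] on a sector of
    half-angle [pi / 2 + eta] with vertex [w1 < omega] ([transform_data_ex]). Hence the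
    integral of [e^(l z) F l] over the two rays from [omega] at the angles
    [pi / 2 + eta / 2] and its opposite converges for [|arg z| < eta / 4]; it defines
    a holomorphic family [T z]. Deforming the contour near its vertex into an arc of
    radius [1 / |z|] gives all bounds by scaling ([sector_integral]): [T] is of order
    [e^(omega t)], its derivative of order [e^(omega t) / t], which integrates to the
    logarithmic estimate ([rfam_log]). Writing [F = Q (F - m (l F - 1))] with
    [Q = (1 - A)^-1] and using the growth of [m] from (B3), the values of the family
    lie in the domain of [A] with a norm of order [e^(omega t) (1 + t^-zeta)]
    ([rfam_smoothing]). Put [S t = T t] for [t > 0] and [S 0 = 1].

    The resolvent equation is the inverse transform of [F x - x / l = ghat F (A x) / l]
    for [x] in the domain of [A]. The transform of [g] converges on a right half-plane
    only, whereas the contour reaches to the left. But [e^(l t) ghat l / l] may be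
    replaced by the Laplace-type integral of [s |-> a (t - s) e^(l s)] over [[0, t]],
    where [a] is the primitive of [g]: that function is holomorphic off the origin, the
    difference is of order [1 / |l|] on the right, and Jordan's lemma applies
    ([sector_int_kernel_exp]). That integral being a limit of Riemann sums, the contour integral
    becomes the convolution of [a] with the truncated families [S_n], and
    [n -> oo] gives the equation ([rfam_equation]). On the way the uniform bound for
    [S_n] gives [|S t x - x| <= C t], hence strong continuity at [0] by density.

    Two resolvent families [S] and [S'] coincide: expanding either factor of
    the convolution of [S] and [S'] by its own resolvent equation leaves
    the same double integral, so that [S] and [S'] have the same integrals
    ([resolvent_primitives]).

    Integrals of vector-valued functions are increments of primitives throughout.
    Contour integrals rest on the existence of primitives of holomorphic functions on
    star-shaped sets, which follows from the theorem of Goursat ([star_primitive]). *)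

(** * Identities in modules over the complex numbers *)

Section ModuleIdentities.
Context {K : comNzRingType} {V : lmodType K}.

(** Formal linear combinations of vectors; two of them have the same value as
    soon as the coefficients of each variable agree, which is a ring identity. *)
Inductive mexp : Type :=
  | MVar of nat | MZero | MAdd of mexp & mexp | MOpp of mexp
  | MScale of K & mexp.

Fixpoint meval (l : seq V) (e : mexp) : V :=
  match e with
  | MVar n => nth 0 l n
  | MZero => 0
  | MAdd a b => meval l a + meval l b
  | MOpp a => - meval l a
  | MScale c a => c *: meval l a
  end.

Fixpoint mcoef (e : mexp) (n : nat) : K :=
  match e with
  | MVar m => if Nat.eqb m n then 1 else 0
  | MZero => 0
  | MAdd a b => mcoef a n + mcoef b n
  | MOpp a => - mcoef a n
  | MScale c a => c * mcoef a n
  end.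

Fixpoint mcoef_eq (a b : mexp) (n : nat) : Prop :=
  match n with
  | 0%N => True
  | n'.+1 => mcoef a n' = mcoef b n' /\ mcoef_eq a b n'
  end.

Lemma meval_coef (l : seq V) (e : mexp) :
  meval l e = \sum_(i < size l) mcoef e i *: nth 0 l i.
Proof.
elim: e => [n||a IHa b IHb|a IHa|c a IHa] /=.
- have eqbE m : Nat.eqb n m = (n == m) by elim: n m => [|n IHn] [|m] //=.
  have [nl|ln] := ltnP n (size l).
    rewrite (bigD1 (Ordinal nl)) //= eqbE eqxx scale1r big1 ?addr0// => i ni.
    rewrite eqbE ifF ?scale0r//; apply/negbTE/eqP => e.
    by move/eqP: ni; apply; apply: val_inj.
  rewrite nth_default// big1// => i _; rewrite eqbE ifF ?scale0r//.
  by apply/eqP => e; move: (ltn_ord i); rewrite -e ltnNge ln.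
- by rewrite big1// => i _; rewrite scale0r.
- by rewrite IHa IHb -big_split /=; apply: eq_bigr => i _; rewrite scalerDl.
- by rewrite IHa -sumrN; apply: eq_bigr => i _; rewrite scaleNr.
- by rewrite IHa scaler_sumr; apply: eq_bigr => i _; rewrite scalerA.
Qed.

Lemma meval_eq (l : seq V) (a b : mexp) :
  mcoef_eq a b (size l) -> meval l a = meval l b.
Proof.
move=> h; rewrite !meval_coef; apply: eq_bigr => i _; congr (_ *: _).
elim: (size l) h i => [|n IHn] /=; first by move=> _ [].
move=> [h1 h2] i; have := ltn_ord i; rewrite ltnS leq_eqVlt.
by move=> /orP[/eqP -> //|lt]; have := IHn h2 (Ordinal lt).
Qed.

End ModuleIdentities.
Arguments mexp : clear implicits.

(* Atoms are compared up to unification, since the same vector may carry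
   different but convertible canonical instances. *)
Ltac m_same x y :=
  first [constr_eq x y |
    lazymatch x with ?f ?a => lazymatch y with ?g ?b =>
      constr_eq f g; unify x y end end].
Ltac m_mem x l :=
  lazymatch l with
  | cons ?y ?t => first [m_same x y | m_mem x t]
  end.
Ltac m_add x l :=
  match goal with
  | _ => let _ := match goal with _ => m_mem x l end in l
  | _ => constr:(cons x l)
  end.
Ltac m_index x l :=
  lazymatch l with
  | cons ?y ?t =>
    match goal with
    | _ => let _ := match goal with _ => m_same x y end in constr:(0%N)
    | _ => let n := m_index x t in constr:(S n)
    end
  end.
Ltac m_atoms l t :=
  lazymatch t with
  | 0%R => l
  | (?a + ?b)%R => let l1 := m_atoms l a in m_atoms l1 b
  | (- ?a)%R => m_atoms l a
  | (?c *: ?a)%R => m_atoms l a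
  | ?x => m_add x l
  end.
Ltac m_reify K l t :=
  lazymatch t with
  | 0%R => constr:(@MZero K)
  | (?a + ?b)%R =>
      let a' := m_reify K l a in let b' := m_reify K l b in
      constr:(@MAdd K a' b')
  | (- ?a)%R => let a' := m_reify K l a in constr:(@MOpp K a')
  | (?c *: ?a)%R => let a' := m_reify K l a in constr:(@MScale K c a')
  | ?x => let n := m_index x l in constr:(@MVar K n)
  end.
(** Proves identities between linear combinations of vectors over [R[i]]; scalar
    identities that [ring] does not settle are left as goals. *)
Ltac module :=
  lazymatch goal with
  | R : realType |- @eq ?T ?a ?b =>
    let K := constr:(((R[i])%type : comNzRingType)) in
    let l := m_atoms (@nil T) a in let l := m_atoms l b in
    let a' := m_reify K l a in let b' := m_reify K l b in
    change (@meval K _ l a' = @meval K _ l b');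
    apply: meval_eq; cbn [mcoef_eq mcoef size Nat.eqb];
    repeat (split; [try ring|]); try exact I
  end.

(** * The real-valued norm and the complex exponential *)

Section Norm.
Context {R : realType}.

Lemma ltr0c (k : R) : (0 < k%:C) = (0 < k).
Proof. exact: ltcR 0 k. Qed.

Lemma rcD (a b : R) : (a + b)%:C = a%:C + b%:C. Proof. exact: rmorphD. Qed.
Lemma rcN (a : R) : (- a)%:C = - a%:C. Proof. exact: rmorphN. Qed.
Lemma rcM (a b : R) : (a * b)%:C = a%:C * b%:C. Proof. exact: rmorphM. Qed.
Lemma rcV (a : R) : (a^-1)%:C = a%:C^-1. Proof. exact: fmorphV. Qed.
Lemma rcX (a : R) n : (a ^+ n)%:C = a%:C ^+ n. Proof. exact: rmorphXn. Qed.
Lemma rc0 : (0 : R)%:C = 0. Proof. by []. Qed.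
Lemma rc1 : (1 : R)%:C = 1. Proof. by []. Qed.
Lemma rc_nat n : (n%:R : R)%:C = n%:R. Proof. exact: rmorph_nat. Qed.
Definition rcE := (rcD, rcN, rcM, rcV, rcX, rc0, rc1, rc_nat).

Section Module.
Context {X : normedModType R[i]}.
Implicit Types x y z : X.

Lemma rnormE x : (rnorm x)%:C = `|x|.
Proof. by rewrite /rnorm RRe_real// ger0_real. Qed.

Lemma rnorm_ge0 x : 0 <= rnorm x.
Proof. by rewrite -ler0c rnormE. Qed.

Lemma rnorm0 : rnorm (0 : X) = 0.
Proof. by rewrite /rnorm normr0. Qed.

Lemma rnorm_eq0 x : rnorm x = 0 -> x = 0.
Proof. by move=> h; apply/normr0_eq0; rewrite -rnormE h. Qed.

Lemma rnormN x : rnorm (- x) = rnorm x.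
Proof. by rewrite /rnorm normrN. Qed.

Lemma rnormD x y : rnorm (x + y) <= rnorm x + rnorm y.
Proof. by rewrite -lecR rmorphD /= !rnormE ler_normD. Qed.

Lemma rdistC x y : rnorm (x - y) = rnorm (y - x).
Proof. by rewrite -rnormN opprB. Qed.

Lemma rdist_triangle y x z : rnorm (x - z) <= rnorm (x - y) + rnorm (y - z).
Proof. by apply: le_trans (rnormD _ _); rewrite addrA subrK. Qed.

Lemma rnormZ (a : R[i]) x : rnorm (a *: x) = rnorm a * rnorm x.
Proof.
apply: (@fmorph_inj _ _ (real_complex R)); rewrite rmorphM /=.
by rewrite !rnormE normrZ.
Qed.

Lemma rnorm_sum (n : nat) (u : nat -> X) :
  rnorm (\sum_(i < n) u i) <= \sum_(i < n) rnorm (u i).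
Proof.
elim: n => [|n IHn]; first by rewrite !big_ord0 rnorm0.
by rewrite !big_ord_recr /=; apply: le_trans (rnormD _ _) _; rewrite lerD2r.
Qed.

Lemma rnorm_near (A : set X) x :
  nbhs x A <-> exists2 e : R, 0 < e & forall y, rnorm (y - x) < e -> A y.
Proof.
split.
  move=> /nbhs_ballP[e /= e0 eA].
  have er : (complex.Re e)%:C = e by rewrite RRe_real// gtr0_real.
  exists (complex.Re e); first by rewrite -ltr0c er.
  move=> y; rewrite -ltcR rnormE er -normrN opprB => ye; apply/eA.
  by rewrite -ball_normE.
move=> [e e0 eA]; apply/nbhs_ballP; exists e%:C => /=; first by rewrite ltr0c.
by move=> y; rewrite -ball_normE /= -rnormE ltcR rdistC; apply: eA.
Qed.

Lemma cvg_rnorm (u : nat -> X) x : (u n @[n --> \oo] --> x) <->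
  forall e : R, 0 < e -> exists N, forall n, (N <= n)%N -> rnorm (u n - x) < e.
Proof.
split=> [ux e e0|ux A].
  have /ux[N _ Nu] : nbhs x [set y | rnorm (y - x) < e].
    by apply/rnorm_near; exists e.
  by exists N.
move=> /rnorm_near[e e0 eA]; have [N Nu] := ux e e0.
by exists N => // n /= /Nu; apply: eA.
Qed.

Lemma rnorm_lim_le (u : nat -> X) x y (k : R) : (u n @[n --> \oo] --> x) ->
  (exists N, forall n, (N <= n)%N -> rnorm (u n - y) <= k) -> rnorm (x - y) <= k.
Proof.
move=> /cvg_rnorm ux [N uk]; apply/ler_addgt0Pr => e /ux[M uM].
apply: le_trans (rdist_triangle (u (maxn N M)) _ _) _; rewrite rdistC addrC.
by apply: lerD; [apply: uk; rewrite leq_maxl|apply/ltW/uM; rewrite leq_maxr].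
Qed.

Lemma rnorm_small x : (forall e : R, 0 < e -> rnorm x <= e) -> x = 0.
Proof.
move=> h; apply: rnorm_eq0; apply/eqP; rewrite eq_le rnorm_ge0 andbT.
by apply/ler_addgt0Pr => e e0; rewrite add0r; apply: h.
Qed.

End Module.

Lemma rnorm_cauchy (X : completeNormedModType R[i]) (u : nat -> X) :
  (forall e : R, 0 < e ->
    exists N, forall n m, (N <= n)%N -> (N <= m)%N -> rnorm (u n - u m) < e) ->
  cvg (u n @[n --> \oo]).
Proof.
move=> uC; apply: cauchy_cvg; apply/cauchy_ballP => e e0.
have er : (complex.Re e)%:C = e by rewrite RRe_real// gtr0_real.
have [N Nu] : exists N, forall n m, (N <= n)%N -> (N <= m)%N ->
    rnorm (u n - u m) < complex.Re e.
  by apply: uC; rewrite -ltr0c er.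
exists (u @` [set n | (N <= n)%N], u @` [set n | (N <= n)%N]) => /=.
  by split; exists N => // n /= nN; exists n.
move=> [x y] /= [[n nN <-] [m mN <-]].
by rewrite -ball_normE /= -rnormE -er ltcR; apply: Nu.
Qed.

Implicit Types z w : R[i].

Lemma rnormM z w : rnorm (z * w) = rnorm z * rnorm w.
Proof. exact: rnormZ. Qed.

Lemma rnormV z : rnorm z^-1 = (rnorm z)^-1.
Proof.
apply: (@fmorph_inj _ _ (real_complex R)).
by rewrite fmorphV /= !rnormE normfV.
Qed.

Lemma rnormX z n : rnorm (z ^+ n) = rnorm z ^+ n.
Proof.
apply: (@fmorph_inj _ _ (real_complex R)).
by rewrite rmorphXn /= !rnormE normrX.
Qed.

Lemma rnormR (r : R) : rnorm r%:C = `|r|.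
Proof. by rewrite /rnorm normc_def /= expr0n /= addr0 sqrtr_sqr. Qed.

Lemma rnorm1 : rnorm (1 : R[i]) = 1.
Proof. by rewrite /rnorm normr1. Qed.

Lemma rnorm_i : rnorm ('i : R[i]) = 1.
Proof. by rewrite /rnorm normc_def /= expr0n /= add0r expr1n sqrtr1. Qed.

Lemma rnorm_sqr z : rnorm z ^+ 2 = complex.Re z ^+ 2 + complex.Im z ^+ 2.
Proof.
by rewrite /rnorm normc_def /= sqr_sqrtr// addr_ge0// sqr_ge0.
Qed.

Lemma Re_rnorm z : `|complex.Re z| <= rnorm z.
Proof.
rewrite -(@ler_pXn2r _ 2)// ?nnegrE ?rnorm_ge0//.
by rewrite rnorm_sqr real_normK ?num_real// lerDl sqr_ge0.
Qed.

Lemma Im_rnorm z : `|complex.Im z| <= rnorm z.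
Proof.
rewrite -(@ler_pXn2r _ 2)// ?nnegrE ?rnorm_ge0//.
by rewrite rnorm_sqr real_normK ?num_real// lerDr sqr_ge0.
Qed.

Lemma rnorm_ReIm z : rnorm z <= `|complex.Re z| + `|complex.Im z|.
Proof.
rewrite -(@ler_pXn2r _ 2)// ?nnegrE ?rnorm_ge0 ?addr_ge0//.
rewrite rnorm_sqr -(real_normK (num_real (complex.Re z))).
rewrite -(real_normK (num_real (complex.Im z))).
have := normr_ge0 (complex.Re z); have := normr_ge0 (complex.Im z); nra.
Qed.

Lemma ReD z w : complex.Re (z + w) = complex.Re z + complex.Re w.
Proof. by case: z; case: w. Qed.
Lemma ImD z w : complex.Im (z + w) = complex.Im z + complex.Im w.
Proof. by case: z; case: w. Qed.
Lemma ReN z : complex.Re (- z) = - complex.Re z. Proof. by case: z. Qed.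
Lemma ImN z : complex.Im (- z) = - complex.Im z. Proof. by case: z. Qed.
Lemma ReM z w :
  complex.Re (z * w) = complex.Re z * complex.Re w - complex.Im z * complex.Im w.
Proof. by case: z; case: w. Qed.
Lemma ImM z w :
  complex.Im (z * w) = complex.Re z * complex.Im w + complex.Im z * complex.Re w.
Proof. by case: z; case: w. Qed.

Lemma complex_eq z w :
  complex.Re z = complex.Re w -> complex.Im z = complex.Im w -> z = w.
Proof. by case: z => a b; case: w => c d /= -> ->. Qed.

Lemma cis_add (a b : R) : cis (a + b) = cis a * cis b.
Proof.
by apply: complex_eq; rewrite ?ReM ?ImM /= ?cosD ?sinD; ring.
Qed.

Lemma rnorm_cis (a : R) : rnorm (cis a) = 1.
Proof.
apply/eqP; rewrite -(@eqrXn2 _ 2)// ?rnorm_ge0// rnorm_sqr /= cos2Dsin2.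
by rewrite expr1n.
Qed.

Lemma cexpD z w : cexp (z + w) = cexp z * cexp w.
Proof.
by rewrite /cexp ReD ImD cis_add expRD rmorphM /=; ring.
Qed.

Lemma rnorm_cexp z : rnorm (cexp z) = expR (complex.Re z).
Proof. by rewrite /cexp rnormM rnormR rnorm_cis mulr1 gtr0_norm ?expR_gt0. Qed.

Lemma cexp0 : cexp (0 : R[i]) = 1.
Proof. by rewrite /cexp /= expR0 mul1r /cis cos0 sin0. Qed.

Lemma cexp_neq0 z : cexp z != 0.
Proof.
apply/eqP => h; have := rnorm_cexp z.
by rewrite h rnorm0 => /esym/eqP; rewrite gt_eqF// expR_gt0.
Qed.

End Norm.

(** * Bisection and complex derivatives *)

Lemma half_pow_small {R : realType} (D e : R) : 0 < e ->
  exists k : nat, D / 2 ^+ k < e.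
Proof.
move=> e0; have [k Dk] : exists k : nat, `|D| / e < k%:R.
  by exists (Num.bound (`|D| / e)); rewrite archi_boundP// divr_ge0// ltW.
exists k; rewrite ltr_pdivrMr ?exprn_gt0//.
apply: le_lt_trans (ler_norm _) _; rewrite -ltr_pdivrMl// mulrC.
apply: lt_le_trans Dk _; rewrite -natrX ler_nat ltnW//; exact: ltn_expl.
Qed.

Section Cousin.
Context {R : realType}.
Variable P : R -> R -> R -> R -> Prop.

Let quarter (q : R * R * R * R) : R * R * R * R :=
  let: (x, y, u, v) := q in
  let m := (x + y) / 2 in let n := (u + v) / 2 in
  if ~~ `[< P x m u n >] then (x, m, u, n) else
  if ~~ `[< P x m n v >] then (x, m, n, v) else
  if ~~ `[< P m y u n >] then (m, y, u, n) else (m, y, n, v).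

(** If the property fails on the whole rectangle it fails on one of its quarters,
    and so on; the nested failing quarters shrink to a point, where the local
    hypothesis is violated. This form of compactness yields the mean value
    inequality, uniform continuity and the theorem of Goursat. *)
Lemma cousin2 (a b c d : R) : a <= b -> c <= d ->
  (forall x y u v, a <= x -> x <= y -> y <= b -> c <= u -> u <= v -> v <= d ->
     let m := (x + y) / 2 in let n := (u + v) / 2 in
     P x m u n -> P x m n v -> P m y u n -> P m y n v -> P x y u v) ->
  (forall s t, a <= s <= b -> c <= t <= d -> exists2 e : R, 0 < e &
     forall x y u v, a <= x -> x <= s -> s <= y -> y <= b ->
       c <= u -> u <= t -> t <= v -> v <= d ->
       y - x < e -> v - u < e -> P x y u v) ->
  P a b c d.
Proof.
move=> ab cd Psplit Ploc; apply: contrapT => nP.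
pose q := fun k => iter k quarter (a, b, c, d).
pose X k := (q k).1.1.1; pose Y k := (q k).1.1.2.
pose U k := (q k).1.2; pose V k := (q k).2.
have qS k : q k.+1 = quarter (X k, Y k, U k, V k).
  by rewrite /q iterS /X /Y /U /V /q; case: (iter k _ _) => [[[]]].
have inv k : [/\ a <= X k, X k <= Y k & Y k <= b] /\
    [/\ c <= U k, U k <= V k & V k <= d] /\
    [/\ Y k - X k = (b - a) / 2 ^+ k, V k - U k = (d - c) / 2 ^+ k &
        ~ P (X k) (Y k) (U k) (V k)].
  elim: k => [|k [[aX XY Yb] [[cU UV Vd] [eX eU nPk]]]].
    by rewrite /X /Y /U /V /q /= expr0 !divr1.
  have E2 (D : R) : D / 2 ^+ k.+1 = D / 2 ^+ k / 2.
    by rewrite exprSr invfM mulrA.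
  rewrite !E2 -eX -eU /X /Y /U /V qS /quarter.
  case: ifPn => [/asboolPn h|/negPn/asboolP h1] /=.
    by split; split => //; try split => //; clear -aX XY Yb cU UV Vd eX eU; lra.
  case: ifPn => [/asboolPn h|/negPn/asboolP h2] /=.
    by split; split => //; try split => //; clear -aX XY Yb cU UV Vd eX eU; lra.
  case: ifPn => [/asboolPn h|/negPn/asboolP h3] /=.
    by split; split => //; try split => //; clear -aX XY Yb cU UV Vd eX eU; lra.
  split; split => //; try split => //; try by clear -aX XY Yb cU UV Vd eX eU; lra.
  by move=> h4; apply: nPk; apply: Psplit.
have mono k : [/\ X k <= X k.+1, Y k.+1 <= Y k, U k <= U k.+1 & V k.+1 <= V k].
  have [[_ XY _] [[_ UV _] _]] := inv k.
  rewrite /X /Y /U /V qS /quarter -/(X k) -/(Y k) -/(U k) -/(V k).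
  by do 3?[case: ifPn => _ /=]; split; clear -XY UV; lra.
have monoX : {homo X : n m / (n <= m)%N >-> n <= m}.
  by apply: homo_leq => //; [exact: le_trans|move=> k; have [] := mono k].
have monoU : {homo U : n m / (n <= m)%N >-> n <= m}.
  by apply: homo_leq => //; [exact: le_trans|move=> k; have [] := mono k].
have monoY : {homo Y : n m / (n <= m)%N >-> m <= n}.
  apply: homo_leq => //; first by move=> x y z xy yz; exact: le_trans yz xy.
  by move=> k; have [] := mono k.
have monoV : {homo V : n m / (n <= m)%N >-> m <= n}.
  apply: homo_leq => //; first by move=> x y z xy yz; exact: le_trans yz xy.
  by move=> k; have [] := mono k.
have XleY j k : X j <= Y k.
  apply: le_trans (monoX _ _ (leq_maxl j k)) _.
  apply: le_trans (monoY _ _ (leq_maxr j k)).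
  by have [[_ ]] := inv (maxn j k).
have UleV j k : U j <= V k.
  apply: le_trans (monoU _ _ (leq_maxl j k)) _.
  apply: le_trans (monoV _ _ (leq_maxr j k)).
  by have [_ [[_ ]]] := inv (maxn j k).
have [sX sY] : (forall k, X k <= sup (range X)) /\ (forall k, sup (range X) <= Y k).
  split=> k.
    apply: sup_upper_bound; last by exists k.
    by split; [exists (X 0%N), 0%N|exists (Y 0%N) => _ [j _ <-]].
  by apply: ge_sup; [exists (X 0%N), 0%N|move=> _ [j _ <-]].
have [sU sV] : (forall k, U k <= sup (range U)) /\ (forall k, sup (range U) <= V k).
  split=> k.
    apply: sup_upper_bound; last by exists k.
    by split; [exists (U 0%N), 0%N|exists (V 0%N) => _ [j _ <-]].
  by apply: ge_sup; [exists (U 0%N), 0%N|move=> _ [j _ <-]].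
have [e e0 Pe] : exists2 e : R, 0 < e & forall x y u v,
   a <= x -> x <= sup (range X) -> sup (range X) <= y -> y <= b ->
   c <= u -> u <= sup (range U) -> sup (range U) <= v -> v <= d ->
   y - x < e -> v - u < e -> P x y u v.
  by apply: Ploc; apply/andP; split;
    [exact: (sX 0%N)|exact: (sY 0%N)|exact: (sU 0%N)|exact: (sV 0%N)].
have [k1 h1] := half_pow_small (b - a) e0.
have [k2 h2] := half_pow_small (d - c) e0.
have le2 (D : R) j k : 0 <= D -> (j <= k)%N -> D / 2 ^+ k <= D / 2 ^+ j.
  move=> D0 jk; apply: ler_wpM2l => //; rewrite lef_pV2 ?posrE ?exprn_gt0//.
  by apply: ler_weXn2l => //; lra.
have [[aX _ Yb] [[cU _ Vd] [eX eU]]] := inv (maxn k1 k2).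
apply; apply: Pe => //.
  by rewrite eX; apply: le_lt_trans h1; apply: le2; rewrite ?subr_ge0 ?leq_maxl.
by rewrite eU; apply: le_lt_trans h2; apply: le2; rewrite ?subr_ge0 ?leq_maxr.
Qed.

End Cousin.

Lemma cousin {R : realType} (P : R -> R -> Prop) (a b : R) : a <= b ->
  (forall x y, a <= x -> x <= y -> y <= b ->
     P x ((x + y) / 2) -> P ((x + y) / 2) y -> P x y) ->
  (forall s, a <= s <= b -> exists2 e : R, 0 < e &
     forall x y, a <= x -> x <= s -> s <= y -> y <= b -> y - x < e -> P x y) ->
  P a b.
Proof.
move=> ab Psplit Ploc; apply: (@cousin2 _ (fun x y _ _ => P x y) a b 0 0) => //.
  by move=> x y u v ax xy yb _ _ _ m n Pxm _ Pmy _; exact: Psplit.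
move=> s t sab _; have [e e0 Pe] := Ploc s sab.
by exists e => // x y u v ax xs sy yb _ _ _ _ xye _; apply: Pe.
Qed.

Section Derivative.
Context {R : realType} {X : normedModType R[i]}.
Implicit Types (f g : R[i] -> X) (z w : R[i]).

Definition ccont f z := forall e : R, 0 < e -> exists2 r : R, 0 < r &
  forall w, rnorm (w - z) < r -> rnorm (f w - f z) < e.

(** For a scalar function this is [derivable f z 1]; stating it with real
    bounds allows vector values and composition without filters. *)
Definition cderiv f z (d : X) := forall e : R, 0 < e -> exists2 r : R, 0 < r &
  forall w, rnorm (w - z) < r ->
    rnorm (f w - f z - (w - z) *: d) <= e * rnorm (w - z).

Lemma cderiv_bound f z d : cderiv f z d -> forall e : R, 0 < e ->
  exists2 r : R, 0 < r & forall w, rnorm (w - z) < r ->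
    rnorm (f w - f z) <= (rnorm d + e) * rnorm (w - z).
Proof.
move=> fd e e0; have [r r0 fr] := fd e e0; exists r => // w /fr h.
rewrite -[f w - f z](subrK ((w - z) *: d)).
by apply: le_trans (rnormD _ _) _; rewrite rnormZ mulrDl [_ * rnorm d]mulrC addrC lerD2l.
Qed.

Lemma cderiv_cont f z d : cderiv f z d -> ccont f z.
Proof.
move=> /cderiv_bound fd e e0; have [r r0 fr] := fd 1 ltr01.
have d0 : 0 < rnorm d + 1 by rewrite ltr_wpDl// rnorm_ge0.
exists (Num.min r (e / (rnorm d + 1))); first by rewrite lt_min r0 divr_gt0.
move=> w; rewrite lt_min => /andP[/fr h1 h2]; apply: le_lt_trans h1 _.
by rewrite mulrC -ltr_pdivlMr.
Qed.

Lemma cderiv_cst (c : X) z : cderiv (fun=> c) z 0.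
Proof.
move=> e e0; exists 1 => // w _; rewrite subrr scaler0 subrr rnorm0.
by rewrite mulr_ge0 ?rnorm_ge0// ltW.
Qed.

Lemma cderivD f g z d d' :
  cderiv f z d -> cderiv g z d' -> cderiv (fun w => f w + g w) z (d + d').
Proof.
move=> fd gd e e0; have e2 : 0 < e / 2 by lra.
have [r r0 fr] := fd _ e2; have [s s0 gs] := gd _ e2.
exists (Num.min r s); first by rewrite lt_min r0.
move=> w; rewrite lt_min => /andP[/fr h1 /gs h2].
rewrite (_ : _ - _ = (f w - f z - (w - z) *: d) + (g w - g z - (w - z) *: d')).
  by apply: le_trans (rnormD _ _) _; nra.
by module.
Qed.

Lemma cderiv_eq f z d d' : d = d' -> cderiv f z d -> cderiv f z d'.
Proof. by move=> ->. Qed.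

Lemma cderiv_ext f g z d : (forall w, f w = g w) -> cderiv f z d -> cderiv g z d.
Proof. by move=> /funext ->. Qed.

End Derivative.

(** * Rules of differentiation and bounds for the exponential *)

Section DerivativeRules.
Context {R : realType} {X : normedModType R[i]}.
Implicit Types (f g : R[i] -> X) (phi : R[i] -> R[i]) (z w : R[i]).

Lemma cderiv_id z : cderiv (fun w : R[i] => w) z (1 : R[i]).
Proof.
move=> e e0; exists 1 => // w _.
rewrite (_ : _ - _ = 0 :> R[i]) ?rnorm0 ?mulr_ge0 ?rnorm_ge0// ?ltW//.
by rewrite scaler1 subrr.
Qed.

Lemma cderiv_mul phi f z (p : R[i]) (d : X) : cderiv phi z p -> cderiv f z d ->
  cderiv (fun w => phi w *: f w) z (p *: f z + phi z *: d).
Proof.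
move=> phid fd e e0.
pose M := rnorm (f z) + rnorm (phi z) + rnorm d + 1.
have M0 : 0 < M by rewrite ltr_wpDl// !addr_ge0// rnorm_ge0.
have [r1 r10 h1] := phid _ (divr_gt0 e0 (mulr_gt0 (ltr0n R 3) M0)).
have [r2 r20 h2] := fd _ (divr_gt0 e0 (mulr_gt0 (ltr0n R 3) M0)).
have [r3 r30 h3] := cderiv_bound fd ltr01.
have [r4 r40 h4] := cderiv_cont phid (divr_gt0 e0 (mulr_gt0 (ltr0n R 3) M0)).
exists (Num.min (Num.min r1 r2) (Num.min r3 r4)).
  by rewrite !lt_min r10 r20 r30.
move=> w; rewrite !lt_min => /andP[/andP[/h1 {}h1 /h2 {}h2] /andP[/h3 {}h3 /h4 {}h4]].
rewrite (_ : _ - _ = (phi w - phi z - (w - z) *: p) *: f z +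
   phi z *: (f w - f z - (w - z) *: d) + (phi w - phi z) *: (f w - f z)); last first.
  by rewrite [(w - z) *: p]mulrC; module.
have n0 := @rnorm_ge0 R _ (w - z).
have := @rnorm_ge0 R _ (f z); have := @rnorm_ge0 R _ (phi z).
have := @rnorm_ge0 R _ d => d0 p0 f0.
have sm (x : R) : 0 <= x -> x <= M -> e / (3 * M) * x <= e / 3.
  move=> x0 xM; rewrite invfM mulrA mulrAC ler_pdivrMr//.
  by apply: ler_wpM2l => //; apply: ltW; rewrite divr_gt0.
apply: le_trans (rnormD _ _) _; apply: le_trans (lerD (rnormD _ _) (lexx _)) _.
rewrite !rnormZ.
have a1 : rnorm (phi w - phi z - (w - z) *: p) * rnorm (f z) <= e / 3 * rnorm (w - z).
  apply: le_trans (ler_wpM2r f0 h1) _; rewrite mulrAC; apply: ler_wpM2r => //.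
  by apply: sm => //; rewrite /M; lra.
have a2 : rnorm (phi z) * rnorm (f w - f z - (w - z) *: d) <= e / 3 * rnorm (w - z).
  apply: le_trans (ler_wpM2l p0 h2) _; rewrite mulrCA mulrA; apply: ler_wpM2r => //.
  by apply: sm => //; rewrite /M; lra.
have a3 : rnorm (phi w - phi z) * rnorm (f w - f z) <= e / 3 * rnorm (w - z).
  apply: le_trans (ler_pM (rnorm_ge0 _) (rnorm_ge0 _) (ltW h4) h3) _.
  rewrite mulrA; apply: ler_wpM2r => //.
  by apply: sm; rewrite /M; lra.
by move: a1 a2 a3; lra.
Qed.

Lemma cderivZ f z d (c : R[i]) : cderiv f z d -> cderiv (fun w => c *: f w) z (c *: d).
Proof.
move=> fd; have := cderiv_mul (cderiv_cst c z) fd.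
by rewrite scale0r add0r.
Qed.

Lemma cderivB f g z d d' :
  cderiv f z d -> cderiv g z d' -> cderiv (fun w => f w - g w) z (d - d').
Proof.
move=> fd gd; have := cderivD fd (cderivZ (-1) gd).
rewrite scaleN1r; apply: cderiv_ext => w; by rewrite scaleN1r.
Qed.

Lemma cderiv_comp phi f z p d : cderiv phi z p -> cderiv f (phi z) d ->
  cderiv (fun w => f (phi w)) z (p *: d).
Proof.
move=> phid fd e e0.
pose M := rnorm p + rnorm d + 1.
have M0 : 0 < M by rewrite ltr_wpDl// !addr_ge0// rnorm_ge0.
have e2M : 0 < e / (2 * M) by rewrite divr_gt0// mulr_gt0.
have [r1 r10 h1] := phid _ e2M.
have [r2 r20 h2] := cderiv_bound phid ltr01.
have [r3 r30 h3] := fd _ e2M.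
have [r4 r40 h4] := cderiv_cont phid r30.
exists (Num.min r1 (Num.min r2 r4)); first by rewrite !lt_min r10 r20.
move=> w; rewrite !lt_min => /andP[/h1 {}h1 /andP[/h2 {}h2 /h4 /h3 {}h3]].
have n0 := @rnorm_ge0 R _ (w - z).
have p0 := @rnorm_ge0 R _ p; have d0 := @rnorm_ge0 R _ d.
rewrite (_ : _ - _ = (f (phi w) - f (phi z) - (phi w - phi z) *: d) +
   (phi w - phi z - (w - z) *: p) *: d); last by rewrite [(w - z) *: p]mulrC; module.
apply: le_trans (rnormD _ _) _; rewrite rnormZ.
have sm (x : R) : 0 <= x -> x <= M -> e / (2 * M) * x <= e / 2.
  move=> x0 xM; rewrite invfM mulrA mulrAC ler_pdivrMr//.
  by apply: ler_wpM2l => //; apply: ltW; rewrite divr_gt0.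
have a1 : rnorm (f (phi w) - f (phi z) - (phi w - phi z) *: d) <= e / 2 * rnorm (w - z).
  apply: le_trans h3 _; apply: le_trans (ler_wpM2l (ltW e2M) h2) _.
  by rewrite mulrA; apply: ler_wpM2r => //; apply: sm; rewrite /M; lra.
have a2 : rnorm (phi w - phi z - (w - z) *: p) * rnorm d <= e / 2 * rnorm (w - z).
  apply: le_trans (ler_wpM2r d0 h1) _; rewrite mulrAC; apply: ler_wpM2r => //.
  by apply: sm => //; rewrite /M; lra.
by move: a1 a2; lra.
Qed.

Lemma cderiv_inv z : z != 0 -> cderiv (fun w : R[i] => w^-1) z (- z ^- 2).
Proof.
move=> z0 e e0.
have nz : 0 < rnorm z by rewrite lt_neqAle rnorm_ge0 andbT eq_sym; apply: contra z0 => /eqP/rnorm_eq0->.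
exists (Num.min (rnorm z / 2) (e * rnorm z ^+ 3 / 2)).
  by rewrite lt_min !divr_gt0// mulr_gt0// exprn_gt0.
move=> w; rewrite lt_min => /andP[h1 h2].
have nw : rnorm z / 2 <= rnorm w.
  by have := rdist_triangle w z 0; rewrite !subr0 rdistC; lra.
have w0 : w != 0 by apply/eqP => w0; move: nw; rewrite w0 rnorm0; lra.
rewrite (_ : _ - _ = (w - z) * (w - z) * (w * z ^+ 2)^-1); last first.
  rewrite (_ : (w - z) *: - z ^- 2 = - ((w - z) * z ^- 2)); last by rewrite scalerN.
  by field; rewrite z0.
rewrite !rnormM rnormV rnormM rnormX mulrAC; apply: ler_wpM2r; first exact: rnorm_ge0.
rewrite ler_pdivrMr ?mulr_gt0 ?exprn_gt0//; last lra.
apply: le_trans (ltW h2) _; rewrite -mulrA; apply: ler_wpM2l; first exact: ltW.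
by rewrite exprS mulrAC; apply: ler_wpM2r; rewrite ?exprn_ge0 ?rnorm_ge0.
Qed.

Lemma derivable_cderiv phi z : derivable phi z 1 -> exists p, cderiv phi z p.
Proof.
move=> /cvg_ex[p hp]; exists p => e e0.
have : nbhs p [set y | rnorm (y - p) < e] by apply/rnorm_near; exists e.
move=> /hp hp'; have {hp'} /rnorm_near[r r0 hr] : nbhs (0 : R[i])
    [set h | h != 0 -> rnorm (h^-1 *: (phi (h *: 1 + z) - phi z) - p) < e] := hp'.
exists r => // w wr.
have [->|wz] := eqVneq w z.
  rewrite (_ : _ - _ = 0 :> R[i]) ?rnorm0 ?mulr_ge0 ?rnorm_ge0// ?ltW//.
  by rewrite !subrr scale0r subr0.
have wz0 : w - z != 0 by rewrite subr_eq0.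
have := hr (w - z); rewrite subr0 => /(_ wr wz0).
rewrite (_ : (w - z) *: 1 + z = w) => [h|]; last by rewrite scaler1 subrK.
rewrite (_ : phi w - phi z - (w - z) *: p =
   (w - z) *: ((w - z)^-1 *: (phi w - phi z) - p)); last first.
  by rewrite scalerBr scalerA mulfV// scale1r.
by rewrite rnormZ mulrC; apply: ler_wpM2r; [exact: rnorm_ge0|exact: ltW].
Qed.

End DerivativeRules.

Section ExpBounds.
Context {R : realType}.

Lemma sin_le_norm (y : R) : `|sin y| <= `|y|.
Proof.
wlog y0 : y / 0 <= y.
  move=> h; have [/h//|/ltW y0] := leP 0 y.
  by rewrite -normrN -sinN -(normrN y); apply: h; rewrite oppr_ge0.
have [c _] := @MVT_segment R sin cos 0 y y0 (fun x _ => is_derive_sin x)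
  (continuous_subspaceT (@continuous_sin R)).
rewrite sin0 !subr0 => ->; rewrite normrM -[leRHS]mul1r.
by apply: ler_wpM2r => //; exact: cos_max.
Qed.

Lemma cos_sub1_le (y : R) : `|cos y - 1| <= y ^+ 2.
Proof.
wlog y0 : y / 0 <= y.
  move=> h; have [/h//|/ltW y0] := leP 0 y.
  by rewrite -cosN -sqrrN; apply: h; rewrite oppr_ge0.
have [c] := @MVT_segment R cos (fun x => - sin x) 0 y y0 (fun x _ => is_derive_cos x)
  (continuous_subspaceT (@continuous_cos R)).
rewrite in_itv /= => /andP[c0 cy]; rewrite cos0 subr0 => ->.
rewrite normrM normrN (ger0_norm y0) expr2; apply: ler_wpM2r => //.
by apply: le_trans (sin_le_norm _) _; rewrite ger0_norm.
Qed.

Lemma sin_sub_le (y : R) : `|y| <= 1 -> `|sin y - y| <= y ^+ 2.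
Proof.
wlog y0 : y / 0 <= y.
  move=> h; have [/h//|/ltW y0] := leP 0 y => y1.
  rewrite -normrN -sqrrN (_ : - (sin y - y) = sin (- y) - - y).
    by apply: h; rewrite ?oppr_ge0 ?normrN.
  by rewrite sinN; lra.
move=> y1.
have [c] := @MVT_segment R (fun x => sin x - x) (fun x => cos x - 1) 0 y y0
  (fun x _ => is_deriveB (is_derive_sin x) (is_derive_id x 1))
  (continuous_subspaceT (fun x => continuousB (@continuous_sin R x) (@cvg_id _ _))).
rewrite in_itv /= => /andP[c0 cy]; rewrite sin0 !subr0 => ->.
rewrite normrM (ger0_norm y0) expr2; apply: ler_wpM2r => //.
apply: le_trans (cos_sub1_le _) _; move: y1; rewrite ger0_norm//; nra.
Qed.

Lemma expR_sub1_le (x : R) : `|expR x - 1| <= `|x| * expR `|x|.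
Proof.
have h1 := expR_ge1Dx x; have h2 := expR_ge1Dx (- x); rewrite expRN in h2.
have E0 := expR_gt0 x.
have h3 : expR x - 1 <= x * expR x.
  have : (1 - x) * expR x <= 1 by rewrite -ler_pdivlMr// mul1r.
  by lra.
have [x0|x0] := leP 0 x.
  by rewrite ger0_norm; [rewrite ger0_norm//; lra|lra].
have x1 : expR x <= 1 by rewrite -expR0 ler_expR ltW.
rewrite ler0_norm ?subr_le0// ltr0_norm//; have : 1 <= expR (- x) by rewrite -expR0 ler_expR; lra.
by nra.
Qed.

Lemma expR_sub1D_le (x : R) : `|expR x - 1 - x| <= x ^+ 2 * expR `|x|.
Proof.
have h1 := expR_ge1Dx x; have E0 := expR_gt0 x.
rewrite ger0_norm; last by lra.
have h2 := expR_ge1Dx (- x); rewrite expRN in h2.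
have h3 : expR x - 1 <= x * expR x.
  have : (1 - x) * expR x <= 1 by rewrite -ler_pdivlMr// mul1r.
  by lra.
have [x0|x0] := leP 0 x; first by rewrite ger0_norm//; nra.
have : 1 <= expR `|x| by rewrite -expR0 ler_expR.
by nra.
Qed.

(** Quadratic remainder of the complex exponential; the constant 3 collects
    crude bounds on the real and imaginary contributions. *)
Lemma cexp_remainder (w : R[i]) :
  rnorm (cexp w - 1 - w) <= 3 * rnorm w ^+ 2 * expR (rnorm w).
Proof.
have [w1|w1] := leP `|complex.Im w| 1; last first.
  have w1' := lt_le_trans w1 (Im_rnorm w).
  apply: le_trans (rnormD _ _) _; rewrite rnormN.
  apply: le_trans (lerD (rnormD _ _) (lexx _)) _; rewrite rnormN rnorm1 rnorm_cexp.
  have : expR (complex.Re w) <= expR (rnorm w).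
    by rewrite ler_expR; apply: le_trans (Re_rnorm w); exact: ler_norm.
  have := expR_ge1Dx (rnorm w); set E := expR (rnorm w) => e1.
  have : E <= rnorm w ^+ 2 * E.
    by rewrite ler_peMl ?expR_ge0// expr2; apply: mulr_ege1; exact: ltW.
  by lra.
set x := complex.Re w; set y := complex.Im w.
have -> : cexp w - 1 - w = (expR x - 1 - x)%:C +
    ((expR x)%:C * (cis y - 1 - 'i * y%:C) + 'i * (y * (expR x - 1))%:C).
  by apply: complex_eq; rewrite /cexp /cis !(ReD, ImD, ReN, ImN, ReM, ImM) /= -/x -/y; ring.
have E1 : expR x <= expR (rnorm w).
  by rewrite ler_expR; apply: le_trans (Re_rnorm w); exact: ler_norm.
have E2 : expR `|x| <= expR (rnorm w) by rewrite ler_expR; exact: Re_rnorm.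
have E0 := expR_gt0 x.
apply: le_trans (rnormD _ _) _; apply: le_trans (lerD (lexx _) (rnormD _ _)) _.
rewrite !rnormM !rnormR rnorm_i mul1r normrM (gtr0_norm E0).
have h1 := expR_sub1D_le x; have h2 := expR_sub1_le x.
have h3 : rnorm (cis y - 1 - 'i * y%:C) <= 2 * y ^+ 2.
  apply: le_trans (rnorm_ReIm _) _.
  rewrite !(ReD, ImD, ReN, ImN, ReM, ImM) /=.
  rewrite !(mul0r, mul1r, mulr0, subr0, addr0, add0r, oppr0).
  by have := cos_sub1_le y; have := sin_sub_le w1; lra.
have xy : rnorm w ^+ 2 = `|x| ^+ 2 + `|y| ^+ 2.
  by rewrite rnorm_sqr !real_normK ?num_real.
have sqx : x ^+ 2 = `|x| ^+ 2 by rewrite real_normK ?num_real.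
have sqy : y ^+ 2 = `|y| ^+ 2 by rewrite real_normK ?num_real.
rewrite xy; rewrite sqx in h1; rewrite sqy in h3.
set E := expR (rnorm w) in E1 E2 *.
have a1 : `|expR x - 1 - x| <= `|x| ^+ 2 * E.
  by apply: le_trans h1 _; apply: ler_wpM2l => //; rewrite sqr_ge0.
have a2 : expR x * rnorm (cis y - 1 - 'i * y%:C) <= 2 * `|y| ^+ 2 * E.
  by rewrite [leRHS]mulrC; apply: ler_pM => //; rewrite ?rnorm_ge0 ?expR_ge0.
have a3 : `|y| * `|expR x - 1| <= `|y| * `|x| * E.
  rewrite -mulrA; apply: ler_wpM2l => //; apply: le_trans h2 _.
  by apply: ler_wpM2l.
have E0' : 0 < E by exact: expR_gt0.
have a4 : `|y| * `|x| * E <= (`|x| ^+ 2 + `|y| ^+ 2) * E.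
  by apply: ler_wpM2r; [exact: ltW|nra].
by have := sqr_ge0 `|x|; nra.
Qed.

Lemma cderiv_cexp (z : R[i]) : cderiv (cexp : R[i] -> R[i]) z (cexp z).
Proof.
move=> e e0; have E0 := expR_gt0 (complex.Re z : R).
pose M := 3 * expR 1 * expR (complex.Re z).
have M0 : 0 < M by rewrite !mulr_gt0// expR_gt0.
exists (Num.min 1 (e / M)); first by rewrite lt_min ltr01 divr_gt0.
move=> w; rewrite lt_min => /andP[w1 wM].
rewrite (_ : _ - _ = cexp z * (cexp (w - z) - 1 - (w - z))); last first.
  have -> : cexp w = cexp z * cexp (w - z) by rewrite -cexpD addrC subrK.
  by rewrite (_ : (w - z) *: cexp z = (w - z) * cexp z)//; ring.
rewrite rnormM rnorm_cexp.
apply: le_trans (ler_wpM2l (ltW E0) (cexp_remainder _)) _.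
have : rnorm (w - z) * M <= e by rewrite -ler_pdivlMr// ltW.
have : expR (rnorm (w - z)) <= expR 1 by rewrite ler_expR ltW.
have := rnorm_ge0 (w - z); rewrite /M; set n := rnorm _; set E := expR (complex.Re z); set F := expR 1.
move=> n0 EF nM.
have -> : E * (3 * n ^+ 2 * expR n) = (3 * E * n * expR n) * n by ring.
apply: ler_wpM2r => //; apply: le_trans nM.
have -> : n * (3 * F * E) = 3 * E * n * F by ring.
by apply: ler_wpM2l => //; rewrite !mulr_ge0// ltW.
Qed.

Lemma cexp_sub_le (w : R[i]) : rnorm (cexp w - 1) <= 4 * rnorm w * expR (2 * rnorm w).
Proof.
have n0 := rnorm_ge0 w.
have := cexp_remainder w => h.
have : rnorm (cexp w - 1) <= rnorm w + 3 * rnorm w ^+ 2 * expR (rnorm w).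
  rewrite -[cexp w - 1](subrK w) addrC.
  by apply: le_trans (rnormD _ _) _; lra.
have e1 := expR_ge1Dx (rnorm w).
rewrite (_ : 2 * rnorm w = rnorm w + rnorm w) ?expRD; last by ring.
set E := expR (rnorm w) in h e1 *.
have E0 : 0 < E by exact: expR_gt0.
have a1 : rnorm w * 1 <= rnorm w * (E * E) by apply: ler_wpM2l => //; nra.
have a2 : rnorm w * (rnorm w * E) <= rnorm w * (E * E).
  by apply: ler_wpM2l => //; apply: ler_wpM2r; [exact: ltW|lra].
by move: a1 a2; lra.
Qed.

Lemma cis_dist (a b : R) : rnorm (cis a - cis b) <= `|a - b|.
Proof.
have key (d c : R) : cis (d + c) - cis (d - c) = cis d * ('i * (2 * sin c)%:C).
  by apply: complex_eq;
    rewrite !(ReD, ImD, ReN, ImN, ReM, ImM) /= !(cosD, sinD) cosN sinN; ring.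
have -> : cis a - cis b = cis ((a + b) / 2) * ('i * (2 * sin ((a - b) / 2))%:C).
  by rewrite -key; congr (cis _ - cis _); lra.
rewrite !rnormM rnorm_cis rnorm_i !mul1r rnormR normrM ger0_norm//.
have := sin_le_norm ((a - b) / 2); rewrite normrM normfV (@ger0_norm _ 2)//; lra.
Qed.

End ExpBounds.

(** * Mean value inequalities *)

Section MeanValue.
Context {R : realType} {X : normedModType R[i]}.

Lemma is_derive_eps (B : R -> R) (s b e : R) : is_derive s 1 B b -> 0 < e ->
  exists2 r : R, 0 < r & forall y, `|y - s| < r ->
    `|B y - B s - (y - s) * b| <= e * `|y - s|.
Proof.
move=> [/cvg_ex[l hl] Bb] e0.
have lb : l = b by rewrite -Bb; apply/esym/cvg_lim.
have hp : nbhs l [set y | `|l - y| < e] by apply/nbhs_ballP; exists e.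
move: hl => /(_ _ hp) hl; have {hl} /nbhs_ballP[r /= r0 hr] : nbhs (0 : R)
  [set h | h != 0 -> `|l - h^-1 *: (B (h *: 1 + s) - B s)| < e] := hl.
exists r => // y yr; have [->|ys] := eqVneq y s.
  by rewrite !subrr mul0r subrr normr0 mulr0.
have ys0 : y - s != 0 by rewrite subr_eq0.
have := hr (y - s); rewrite /ball /= sub0r normrN => /(_ yr ys0).
rewrite (_ : (y - s) *: 1 + s = y) => [h|]; last by rewrite /GRing.scale /= mulr1 subrK.
rewrite (_ : B y - B s - (y - s) * b = - ((y - s) * (l - (y - s)^-1 *: (B y - B s)))).
  by rewrite normrN normrM mulrC; apply: ler_wpM2r => //; exact: ltW.
by rewrite lb /GRing.scale /=; field.
Qed.

(** Rolle's theorem fails for vector values. Instead the estimate, weakened by an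
    arbitrarily small slope, holds on short intervals around each point and is
    inherited from the two halves of an interval. *)
Lemma mean_value_majorant (f : R -> X) (B b : R -> R) (x0 x1 : R) : x0 <= x1 ->
  (forall s, x0 <= s <= x1 -> is_derive s 1 B (b s)) ->
  (forall s, x0 <= s <= x1 -> forall e : R, 0 < e -> exists2 r : R, 0 < r &
     forall y, x0 <= y <= x1 -> `|y - s| < r ->
       rnorm (f y - f s) <= (b s + e) * `|y - s|) ->
  rnorm (f x1 - f x0) <= B x1 - B x0.
Proof.
move=> x01 dB df; apply/ler_addgt0Pr => e' e'0.
pose e := e' / (x1 - x0 + 1).
have e0 : 0 < e by rewrite divr_gt0// ltr_wpDl// subr_ge0.
suff : rnorm (f x1 - f x0) <= B x1 - B x0 + e * (x1 - x0).
  move=> /le_trans; apply; rewrite lerD2l /e mulrAC ler_pdivrMr ?ltr_wpDl ?subr_ge0//.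
  by nra.
apply: (@cousin _ (fun x y => rnorm (f y - f x) <= B y - B x + e * (y - x)) x0 x1) => //.
  move=> x y _ _ _ /= h1 h2; set m := (x + y) / 2 in h1 h2.
  by apply: le_trans (rdist_triangle (f m) _ _) _; move: h1 h2; lra.
move=> s sx; have e4 : 0 < e / 2 by lra.
have [r r0 hr] := df s sx _ e4; have [q q0 hq] := is_derive_eps (dB s sx) e4.
exists (Num.min r q) => [|x y x0x xs sy yx1]; first by rewrite lt_min r0.
rewrite lt_min => /andP[xyr xyq].
have [/andP[xr xq] /andP[yr yq]] : (`|x - s| < r) && (`|x - s| < q) /\
    (`|y - s| < r) && (`|y - s| < q).
  by rewrite ler0_norm ?subr_le0// ger0_norm ?subr_ge0//; split; apply/andP; split; clear -x0x xs sy yx1 xyr xyq; lra.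
have xI : x0 <= x <= x1 by apply/andP; split; clear -x0x xs sy yx1; lra.
have yI : x0 <= y <= x1 by apply/andP; split; clear -x0x xs sy yx1; lra.
have := hr _ xI xr; have := hr _ yI yr; have := hq _ xq; have := hq _ yq.
rewrite (@ler0_norm _ (x - s)) ?subr_le0// (@ger0_norm _ (y - s)) ?subr_ge0//.
rewrite !ler_norml => /andP[a1 a2] /andP[a3 a4] a5 a6.
apply: le_trans (rdist_triangle (f s) _ _) _; rewrite (rdistC (f s)).
by apply: le_trans (lerD a5 a6) _; nra.
Qed.

(** The fundamental estimate of path integrals, read on primitives: the
    increment of a primitive along an [L]-Lipschitz path is bounded by the
    increment of any real primitive of a bound of the speed. *)
Lemma path_majorant (Phi f : R[i] -> X) (c : R -> R[i]) (B b : R -> R) (L x0 x1 : R) :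
  x0 <= x1 -> 0 <= L ->
  (forall s, x0 <= s <= x1 -> is_derive s 1 B (b s)) ->
  (forall x y, x0 <= x <= x1 -> x0 <= y <= x1 -> rnorm (c y - c x) <= L * `|y - x|) ->
  (forall s, x0 <= s <= x1 -> cderiv Phi (c s) (f (c s)) /\ rnorm (f (c s)) * L <= b s) ->
  rnorm (Phi (c x1) - Phi (c x0)) <= B x1 - B x0.
Proof.
move=> x01 L0 dB cL dPhi.
apply: (mean_value_majorant (f := fun s => Phi (c s)) x01 dB) => s sx e e0.
have [dP fb] := dPhi s sx; have L1 : 0 < L + 1 by lra.
have eL : 0 < e / (L + 1) by rewrite divr_gt0.
have [r r0 hr] := cderiv_bound dP eL.
exists (r / (L + 1)); first by rewrite divr_gt0.
move=> y yx; rewrite ltr_pdivlMr// => ysr; have cys := cL _ _ sx yx.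
have cyr : rnorm (c y - c s) < r.
  by apply: le_lt_trans cys _; apply: le_lt_trans ysr; have := normr_ge0 (y - s); nra.
apply: le_trans (hr _ cyr) _.
have n0 := rnorm_ge0 (f (c s)).
apply: le_trans (ler_wpM2l (addr_ge0 n0 (ltW eL)) cys) _.
rewrite mulrA; apply: ler_wpM2r => //; rewrite mulrDl; apply: lerD => //.
by rewrite mulrAC ler_pdivrMr//; nra.
Qed.

Lemma path_bound (Phi f : R[i] -> X) (c : R -> R[i]) (K L x0 x1 : R) :
  x0 <= x1 -> 0 <= L ->
  (forall x y, x0 <= x <= x1 -> x0 <= y <= x1 -> rnorm (c y - c x) <= L * `|y - x|) ->
  (forall s, x0 <= s <= x1 -> cderiv Phi (c s) (f (c s)) /\ rnorm (f (c s)) <= K) ->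
  rnorm (Phi (c x1) - Phi (c x0)) <= K * L * (x1 - x0).
Proof.
move=> x01 L0 cL dPhi.
have := @path_majorant Phi f c (fun s => K * L * s) (fun=> K * L) L x0 x1 x01 L0.
rewrite mulrBr; apply => //.
  move=> s _; have := @is_deriveZ _ _ _ id (K * L) s 1 1 (is_derive_id s 1).
  by rewrite /GRing.scale /= mulr1.
by move=> s /dPhi[? ?]; split => //; exact: ler_wpM2r.
Qed.

Lemma segment_bound (Phi f : R[i] -> X) (a b : R[i]) (K : R) :
  (forall s : R, 0 <= s <= 1 -> cderiv Phi (a + s%:C * (b - a)) (f (a + s%:C * (b - a))) /\
     rnorm (f (a + s%:C * (b - a))) <= K) ->
  rnorm (Phi b - Phi a) <= K * rnorm (b - a).
Proof.
move=> h; have := @path_bound Phi f (fun s => a + s%:C * (b - a)) K (rnorm (b - a)) 0 1.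
rewrite /= rmorph1 rmorph0 mul1r mul0r addr0 subr0 mulr1 (addrC a) subrK.
apply => //; first exact: rnorm_ge0.
move=> x y _ _; rewrite (_ : _ - _ = (y - x)%:C * (b - a)).
  by rewrite rnormM rnormR mulrC.
by rewrite rmorphB /=; ring.
Qed.

Lemma arc_bound (Phi f : R[i] -> X) (z0 : R[i]) (r x0 x1 K : R) : x0 <= x1 -> 0 <= r ->
  (forall s, x0 <= s <= x1 -> cderiv Phi (z0 + r%:C * cis s) (f (z0 + r%:C * cis s)) /\
     rnorm (f (z0 + r%:C * cis s)) <= K) ->
  rnorm (Phi (z0 + r%:C * cis x1) - Phi (z0 + r%:C * cis x0)) <= K * r * (x1 - x0).
Proof.
move=> x01 r0; apply: path_bound => // x y _ _.
rewrite (_ : _ - _ = r%:C * (cis y - cis x)); last by ring.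
by rewrite rnormM rnormR ger0_norm//; apply: ler_wpM2l => //; exact: cis_dist.
Qed.

(** The primitive [- N / r] of the quadratic bound is finite at infinity, which
    gives Cauchy sequences along rays. *)
Lemma ray_bound (Phi f : R[i] -> X) (z0 : R[i]) (t r0 r1 N : R) : 0 < r0 -> r0 <= r1 ->
  (forall r, r0 <= r <= r1 -> cderiv Phi (z0 + r%:C * cis t) (f (z0 + r%:C * cis t)) /\
     rnorm (f (z0 + r%:C * cis t)) <= N / r ^+ 2) ->
  rnorm (Phi (z0 + r1%:C * cis t) - Phi (z0 + r0%:C * cis t)) <= N / r0 - N / r1.
Proof.
move=> r00 r01 h.
have -> : N / r0 - N / r1 = - N * r1^-1 - - N * r0^-1 by ring.
have mj := @path_majorant Phi f (fun r => z0 + r%:C * cis t) (fun r => - N * r^-1)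
  (fun r => N / r ^+ 2) 1 r0 r1.
cbv beta in mj; apply: mj => //.
- move=> s /andP[s0 _]; have s00 : s != 0 by rewrite gt_eqF//; lra.
  have := @is_deriveZ _ _ _ (fun r : R => r^-1) (- N) s 1 _ (is_deriveV s00 (is_derive_id s 1)).
  by rewrite /GRing.scale /= mulr1 mulNr mulrN opprK.
- move=> x y _ _; rewrite mul1r (_ : _ - _ = (y - x)%:C * cis t).
    by rewrite rnormM rnormR rnorm_cis mulr1.
  by rewrite rmorphB /=; ring.
- by move=> s /h[? ?]; rewrite mulr1.
Qed.

End MeanValue.

(** * Primitives of functions of a real variable *)

Section RealPrimitive.
Context {R : realType}.

Definition rcont {X : normedModType R[i]} (f : R -> X) (a b : R) :=
  forall s, a <= s <= b -> forall e : R, 0 < e -> exists2 r : R, 0 < r &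
    forall y, a <= y <= b -> `|y - s| < r -> rnorm (f y - f s) < e.

Definition rosc {X : normedModType R[i]} (f : R -> X) (a b e d : R) :=
  forall s y, a <= s <= b -> a <= y <= b -> `|y - s| < d -> rnorm (f y - f s) <= e.

(** The difference quotient is taken between two points on either side of the
    tag [m], so that Riemann sums with arbitrary tags converge; the explicit
    precision [e] and scale [d] make the convergence uniform over families. *)
Definition rprim_at {X : normedModType R[i]} (f Phi : R -> X) (a b e d : R) :=
  forall s m y, a <= s -> s <= m -> m <= y -> y <= b -> y - s < d ->
    rnorm (Phi y - Phi s - (y - s)%:C *: f m) <= e * (y - s).

Definition rprim {X : normedModType R[i]} (f Phi : R -> X) (a b : R) :=
  forall e : R, 0 < e -> exists2 d : R, 0 < d & rprim_at f Phi a b e d.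

Section Properties.
Context {X : normedModType R[i]}.
Implicit Types (f g Phi Psi : R -> X) (a b : R).

Lemma rcont_unif f a b : a <= b -> rcont f a b ->
  forall e : R, 0 < e -> exists2 d : R, 0 < d & rosc f a b e d.
Proof.
move=> ab fc e e0.
apply: (@cousin _ (fun u v => exists2 d : R, 0 < d & forall s y,
  u <= s <= v -> a <= y <= b -> `|y - s| < d -> rnorm (f y - f s) <= e) a b) => //.
  move=> x y ax xy yb [d1 d10 h1] [d2 d20 h2].
  exists (Num.min d1 d2) => [|s t /andP[xs sy] tab]; first by rewrite lt_min d10.
  rewrite lt_min => /andP[td1 td2]; have [sm|/ltW sm] := leP s ((x + y) / 2).
    by apply: h1 => //; rewrite xs.
  by apply: h2 => //; rewrite sm.
move=> s sab; have e2 : 0 < e / 2 by lra.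
have [r r0 hr] := fc s sab _ e2; exists (r / 2); first by lra.
move=> x y ax xs sy yb xyr; exists (r / 2); first by lra.
move=> t u /andP[xt ty] uab utr.
have tab : a <= t <= b by apply/andP; split; lra.
have ts : `|t - s| < r / 2 by rewrite ltr_norml; apply/andP; split; lra.
have us : `|u - s| < r.
  by have := ler_normD (u - t) (t - s); rewrite addrA subrK; lra.
have h1 := hr t tab (lt_trans ts (_ : r / 2 < r)); have := hr u uab us.
have /h1 : r / 2 < r by lra.
by have := rdist_triangle (f s) (f u) (f t); rewrite (rdistC (f s)); lra.
Qed.

Lemma rprim_atW f Phi a b e d a' b' : a <= a' -> b' <= b ->
  rprim_at f Phi a b e d -> rprim_at f Phi a' b' e d.
Proof.
by move=> aa bb h s m y ? ? ? ? ?; apply: h => //; lra.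
Qed.

Lemma rprimW f Phi a b a' b' : a <= a' -> b' <= b ->
  rprim f Phi a b -> rprim f Phi a' b'.
Proof.
by move=> aa bb h e /h[d d0 hd]; exists d => //; apply: rprim_atW hd.
Qed.

Lemma rprim_bound f Phi a b (K : R) : a <= b -> rprim f Phi a b ->
  (forall s, a <= s <= b -> rnorm (f s) <= K) ->
  rnorm (Phi b - Phi a) <= K * (b - a).
Proof.
move=> ab fP fK; rewrite mulrBr.
apply: (@mean_value_majorant _ _ Phi (fun s => K * s) (fun=> K)) => //.
  move=> s _; have := @is_deriveZ _ _ _ id K s 1 1 (is_derive_id s 1).
  by rewrite /GRing.scale /= mulr1.
move=> s sab e e0; have [d d0 hd] := fP e e0; exists d => // y yab ysd.
have n0 := rnorm_ge0 (f s); have nK := fK s sab.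
have key x z : a <= x -> x <= z -> z <= b -> (s = x \/ s = z) -> z - x < d ->
    rnorm (Phi z - Phi x) <= (K + e) * (z - x).
  move=> ax xz zb sxz zxd.
  have h : rnorm (Phi z - Phi x - (z - x)%:C *: f s) <= e * (z - x).
    by apply: hd => //; case: sxz => ->.
  rewrite -[Phi z - Phi x](subrK ((z - x)%:C *: f s)).
  apply: le_trans (rnormD _ _) _; rewrite rnormZ rnormR ger0_norm ?subr_ge0//.
  by have : 0 <= z - x by [rewrite subr_ge0]; nra.
have [sy|/ltW ys] := leP s y.
  rewrite ger0_norm ?subr_ge0// in ysd *; apply: key => //; [lra|lra|by left].
rewrite ler0_norm ?subr_le0// in ysd *; rewrite rdistC opprB.
by apply: key => //; [lra|lra|by right|lra].
Qed.

Lemma rprim_comb (c : R[i]) f g Phi Psi a b :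
  rprim f Phi a b -> rprim g Psi a b ->
  rprim (fun s => c *: f s + g s) (fun s => c *: Phi s + Psi s) a b.
Proof.
move=> fP gP e e0; have c1 : 0 < 2 * (rnorm c + 1) by have := rnorm_ge0 c; lra.
have e2 : 0 < e / 2 by lra.
have [d d0 hd] := fP _ (divr_gt0 e0 c1); have [d' d'0 hd'] := gP _ e2.
exists (Num.min d d'); first by rewrite lt_min d0.
move=> s m y as_ sm my yb; rewrite lt_min => /andP[yd yd'].
rewrite (_ : _ - _ = c *: (Phi y - Phi s - (y - s)%:C *: f m) +
  (Psi y - Psi s - (y - s)%:C *: g m)); last by module.
apply: le_trans (rnormD _ _) _; rewrite rnormZ.
have a1 := hd _ _ _ as_ sm my yb yd; have a2 := hd' _ _ _ as_ sm my yb yd'.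
have ys : 0 <= y - s by lra.
have : rnorm c * rnorm (Phi y - Phi s - (y - s)%:C *: f m) <= e / 2 * (y - s).
  apply: le_trans (ler_wpM2l (rnorm_ge0 c) a1) _; rewrite mulrA; apply: ler_wpM2r => //.
  rewrite mulrA ler_pdivrMr//.
  by have := rnorm_ge0 c; nra.
by move: a2; lra.
Qed.

Lemma rprim_unique f Phi Psi a b : a <= b -> rprim f Phi a b -> rprim f Psi a b ->
  Phi b - Phi a = Psi b - Psi a.
Proof.
move=> ab fP fQ; have := rprim_comb (-1) fP fQ => /rprim_bound - /(_ 0 ab).
rewrite mul0r => h; apply/eqP; rewrite -subr_eq0; apply/eqP.
apply: rnorm_small => e e0; apply: le_trans (ltW e0); apply: le_trans (h _).
  by rewrite le_eqVlt; apply/orP; left; apply/eqP; rewrite -rnormN; congr rnorm; module.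
by move=> s _; rewrite scaleN1r addNr rnorm0.
Qed.

Lemma rprim_eq f g Phi a b : (forall s, a <= s <= b -> f s = g s) ->
  rprim f Phi a b -> rprim g Phi a b.
Proof.
move=> fg fP e /fP[d d0 hd]; exists d => // s m y as_ sm my yb ysd.
by rewrite -fg; [exact: hd|apply/andP; split; lra].
Qed.

Lemma rprim_scale f Phi a b (p q : R) : 0 < q -> rprim f Phi (p + q * a) (p + q * b) ->
  rprim (fun s => f (p + q * s)) (fun s => (q^-1)%:C *: Phi (p + q * s)) a b.
Proof.
move=> q0 fP e e0; have [d d0 hd] := fP _ e0; exists (d / q); first by rewrite divr_gt0.
move=> s m y as_ sm my yb; rewrite ltr_pdivlMr// => ysd.
have h := hd (p + q * s) (p + q * m) (p + q * y).
rewrite (_ : p + q * y - (p + q * s) = q * (y - s)) in h; last by ring.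
rewrite (_ : _ - _ = (q^-1)%:C *: (Phi (p + q * y) - Phi (p + q * s)
   - (q * (y - s))%:C *: f (p + q * m))); last first.
  have qC : q%:C != 0 :> R[i] by rewrite -[0]/(0%:C) (inj_eq (@complexI _)) gt_eqF.
  by rewrite !rmorphM /= fmorphV /= rmorphB /=; module; field.
rewrite rnormZ rnormR ger0_norm; last by rewrite invr_ge0 ltW.
rewrite ler_pdivrMl// mulrCA.
by apply: h; rewrite ?lerD2l ?ler_pM2l// mulrC.
Qed.

Lemma rprim_rev f Phi a b : rprim f Phi a b ->
  rprim (fun s => f (a + b - s)) (fun s => - Phi (a + b - s)) a b.
Proof.
move=> fP e e0; have [d d0 hd] := fP _ e0; exists d => // s m y as_ sm my yb ysd.
have h := hd (a + b - y) (a + b - m) (a + b - s).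
rewrite (_ : a + b - s - (a + b - y) = y - s) in h; last by ring.
rewrite (_ : - _ - - _ = Phi (a + b - s) - Phi (a + b - y)); last by module.
by apply: h => //; lra.
Qed.

Lemma rprim_lin (Y : normedModType R[i]) (L : X -> Y) (k : R) f Phi a b :
  linear L -> (forall x, rnorm (L x) <= k * rnorm x) ->
  rprim f Phi a b -> rprim (fun s => L (f s)) (fun s => L (Phi s)) a b.
Proof.
move=> Llin Lk fP e e0.
have k1 : 0 < `|k| + 1 by rewrite ltr_wpDl.
have [d d0 h] := fP _ (divr_gt0 e0 k1); exists d => // s m y as_ sm my yb ysd.
have LZB c x z t : L (x - z - c *: t) = L x - L z - c *: L t.
  rewrite (_ : x - z - c *: t = (- c) *: t + ((-1) *: z + x)); last by module.
  by rewrite !Llin; module.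
rewrite -LZB; apply: le_trans (Lk _) _.
apply: le_trans (ler_wpM2r (rnorm_ge0 _) (_ : k <= `|k| + 1)) _.
  by have := ler_norm k; lra.
apply: le_trans (ler_wpM2l (ltW k1) (h _ _ _ as_ sm my yb ysd)) _.
by rewrite mulrA mulrCA divff ?mulr1// gt_eqF.
Qed.

End Properties.

Section Existence.
Context {X : completeNormedModType R[i]}.
Variables (f : R -> X) (a b : R).
Hypothesis ab : a <= b.
Hypothesis fc : rcont f a b.

Let step (N : nat) : R := (b - a) / N.+1%:R.
Let knot (N k : nat) : R := a + k%:R * step N.
(* The polygon is written with the length of the part of each mesh interval that
   lies to the left of [s], so that its increments split into increments over
   the mesh intervals. *)
Let len (N k : nat) (s : R) : R := Num.min (Num.max (s - knot N k) 0) (step N).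
Let euler (N : nat) (s : R) : X := \sum_(k < N.+1) (len N k s)%:C *: f (knot N k).

Let step_ge0 N : 0 <= step N.
Proof. by rewrite divr_ge0 ?subr_ge0. Qed.

Let sum_len N m s : a <= s ->
  \sum_(k < m) len N k s = Num.min (s - a) (m%:R * step N).
Proof.
move=> as_; elim: m => [|m IHm].
  by rewrite big_ord0 mul0r min_r// subr_ge0.
rewrite big_ord_recr /= IHm /len /knot -natr1; have d0 := step_ge0 N.
set d := step N in d0 *; set M := m%:R * d.
rewrite mulrDl mul1r -/M.
have [h1|h1] := leP (s - a) M; clear -d0 h1; rewrite /Order.max.
  by do ?[case: ltP => ?]; rewrite /Order.min; do ?[case: ltP => ?]; lra.
by do ?[case: ltP => ?]; rewrite /Order.min; do ?[case: ltP => ?]; lra.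
Qed.

Let euler_step N e d s m y : 0 <= e -> rosc f a b e d ->
  a <= s -> s <= m -> m <= y -> y <= b -> y - s + step N < d ->
  rnorm (euler N y - euler N s - (y - s)%:C *: f m) <= e * (y - s).
Proof.
move=> e0 fo as_ sm my yb ysd; have d0 := step_ge0 N.
have Nd : N.+1%:R * step N = b - a by rewrite /step mulrC divfK.
have sumE t : a <= t -> t <= b -> \sum_(k < N.+1) len N k t = t - a.
  by move=> at_ tb; rewrite sum_len// Nd min_l//; lra.
have lenle k : len N k s <= len N k y.
  rewrite /len le_min !ge_min lexx orbT andbT ge_max !le_max lexx orbT andbT.
  by apply/orP; left; apply/orP; left; lra.
have -> : euler N y - euler N s - (y - s)%:C *: f m =
    \sum_(k < N.+1) (len N k y - len N k s)%:C *: (f (knot N k) - f m).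
  have -> : y - s = \sum_(k < N.+1) (len N k y - len N k s).
    by rewrite sumrB !sumE//; lra.
  rewrite rmorph_sum /= scaler_suml -!sumrB; apply: eq_bigr => k _.
  by rewrite rmorphB /=; module.
apply: le_trans (rnorm_sum _ (fun k => (len N k y - len N k s)%:C *: (f (knot N k) - f m))) _.
have -> : e * (y - s) = \sum_(k < N.+1) e * (len N k y - len N k s).
  by rewrite -mulr_sumr sumrB !sumE//; lra.
apply: ler_sum => k _; rewrite rnormZ rnormR ger0_norm ?subr_ge0//.
have [eq|lt] := eqVneq (len N k s) (len N k y); first by rewrite eq subrr mul0r mulr0.
rewrite mulrC; apply: ler_wpM2r; first by rewrite subr_ge0.
have {lenle} lt : len N k s < len N k y by rewrite lt_neqAle lt lenle.
have [ky ks] : knot N k < y /\ s < knot N k + step N.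
  split; rewrite ltNge; apply/negP => h; move: lt; rewrite /len.
    rewrite [Num.max (y - _) 0]max_r; last by lra.
    by rewrite (min_l d0) ltNge le_min le_max lexx orbT d0.
  rewrite [Num.max (s - _) 0]max_l; last by lra.
  by rewrite [Num.min (s - _) _]min_r; [rewrite ltNge ge_min lexx orbT|lra].
have ka : a <= knot N k by rewrite /knot lerDl mulr_ge0.
apply: fo; [by apply/andP; split; lra|by apply/andP; split; lra|].
by rewrite ltr_norml; apply/andP; split; lra.
Qed.

Let step_small (d : R) : 0 < d -> exists N0, forall N, (N0 <= N)%N -> step N < d.
Proof.
move=> d0; exists (Num.bound ((b - a) / d)) => N NN.
rewrite /step ltr_pdivrMr// mulrC -ltr_pdivrMr//.
apply: lt_le_trans (_ : (Num.bound ((b - a) / d))%:R <= _).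
  by apply: archi_boundP; rewrite divr_ge0 ?subr_ge0// ltW.
by rewrite ler_nat; apply: leq_trans NN _.
Qed.

Let euler_a N : euler N a = 0.
Proof.
rewrite /euler big1// => k _.
have d0 := step_ge0 N; have kd : 0 <= k%:R * step N by rewrite mulr_ge0.
have -> : len N k a = 0.
  by rewrite /len /knot /Order.max; do ?[case: ltP => ?]; rewrite /Order.min; do ?[case: ltP => ?]; lra.
by rewrite scale0r.
Qed.

Let euler_cauchy s : a <= s <= b -> cvg (euler n s @[n --> \oo]).
Proof.
move=> /andP[as_ sb]; apply: rnorm_cauchy => e e0.
pose e1 := e / (2 * (b - a) + 1).
have ba0 : 0 < 2 * (b - a) + 1 by move: ab; lra.
have e10 : 0 < e1 by rewrite divr_gt0.
have [d d0 fo] := rcont_unif ab fc e10; have d2 : 0 < d / 2 by lra.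
have [N0 hN] := step_small d2; exists N0 => n m /hN hn /hN hm.
have : rnorm ((euler n s - euler m s) - (euler n a - euler m a)) <= 2 * e1 * s - 2 * e1 * a.
  apply: (@mean_value_majorant _ _ (fun s => euler n s - euler m s)
    (fun s => 2 * e1 * s) (fun=> 2 * e1)) => //.
    move=> t _; have := @is_deriveZ _ _ _ id (2 * e1) t 1 1 (is_derive_id t 1).
    by rewrite /GRing.scale /= mulr1.
  move=> t /andP[at_ ts] e' e'0; exists (d / 2) => // y /andP[ay ys] ytd.
  have key x z : a <= x -> x <= z -> z <= b -> z - x < d / 2 ->
      rnorm ((euler n z - euler m z) - (euler n x - euler m x)) <= (2 * e1 + e') * (z - x).
    move=> ax xz zb zxd.
    have h1 : rnorm (euler n z - euler n x - (z - x)%:C *: f x) <= e1 * (z - x).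
      by apply: (euler_step (ltW e10) fo) => //; lra.
    have h2 : rnorm (euler m z - euler m x - (z - x)%:C *: f x) <= e1 * (z - x).
      by apply: (euler_step (ltW e10) fo) => //; lra.
    rewrite (_ : _ - _ = (euler n z - euler n x - (z - x)%:C *: f x) -
      (euler m z - euler m x - (z - x)%:C *: f x)); last by module.
    by apply: le_trans (rnormD _ _) _; rewrite rnormN; nra.
  have [ty|/ltW yt] := leP t y.
    by rewrite ger0_norm ?subr_ge0// in ytd *; apply: key => //; lra.
  rewrite ler0_norm ?subr_le0// in ytd *; rewrite rdistC (opprB y t).
  by apply: key => //; lra.
rewrite !euler_a subrr subr0 => h; apply: le_lt_trans h _.
rewrite -mulrBr /e1 mulrA mulrAC ltr_pdivrMr//.
by nra.
Qed.

(** A continuous function has a primitive, obtained as the limit of Euler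
    polygons; its precision is governed by the oscillation alone. *)
Lemma rprim_exists : exists Phi : R -> X,
  forall e d : R, 0 <= e -> rosc f a b e d -> rprim_at f Phi a b e d.
Proof.
exists (fun s => lim (euler n s @[n --> \oo])) => e d e0 fo s m y as_ sm my yb ysd.
have ds : 0 < d - (y - s) by lra.
have [N0 hN] := step_small ds.
have cs : a <= s <= b by apply/andP; split; lra.
have cy : a <= y <= b by apply/andP; split; lra.
have cv := cvgB (euler_cauchy cy) (euler_cauchy cs).
apply: (rnorm_lim_le (u := fun n => euler n y - euler n s)); first exact: cv.
exists N0 => n /hN nd.
by apply: (euler_step e0 fo) => //; lra.
Qed.

Lemma rprim_ex : exists Phi : R -> X, rprim f Phi a b.
Proof.
have [Phi hPhi] := rprim_exists; exists Phi => e e0.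
have [d d0 fo] := rcont_unif ab fc e0; exists d => //.
by apply: (hPhi _ _ (ltW e0) fo).
Qed.

End Existence.

End RealPrimitive.

(** * Segment integrals and the theorem of Goursat *)

Section SegmentIntegral.
Context {R : realType}.

Definition segpt (a b : R[i]) (s : R) : R[i] := a + s%:C * (b - a).

Section Integral.
Context {X : completeNormedModType R[i]}.
Implicit Types (f g : R[i] -> X) (a b : R[i]).

Definition segcont f a b := rcont (fun s => f (segpt a b s)) 0 1.

(** The integral of [f] over the oriented segment from [a] to [b]; primitives are
    unique up to a constant, so that the choice is immaterial. *)
Definition segint f a b : X :=
  let Phi := xget (fun=> 0) [set Phi : R -> X | rprim (fun s => f (segpt a b s)) Phi 0 1] in
  (b - a) *: (Phi 1 - Phi 0).

Lemma segcont_ccont f a b :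
  (forall s, 0 <= s <= 1 -> ccont f (segpt a b s)) -> segcont f a b.
Proof.
move=> fc s s01 e e0; have [r r0 hr] := fc s s01 e e0.
have n1 : 0 < rnorm (b - a) + 1 by rewrite ltr_wpDl ?rnorm_ge0.
exists (r / (rnorm (b - a) + 1)); first by rewrite divr_gt0.
move=> y _; rewrite ltr_pdivlMr// => ysr; apply: hr.
rewrite (_ : _ - _ = (y - s)%:C * (b - a)); last by rewrite /segpt !rcE; ring.
by rewrite rnormM rnormR; apply: le_lt_trans ysr; apply: ler_wpM2l => //; lra.
Qed.

Lemma segintE f a b (Phi : R -> X) :
  rprim (fun s => f (segpt a b s)) Phi 0 1 -> segint f a b = (b - a) *: (Phi 1 - Phi 0).
Proof.
move=> fP; rewrite /segint; case: xgetP => [Psi _ fQ|/(_ Phi)//].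
by congr (_ *: _); exact: rprim_unique ler01 fQ fP.
Qed.

Lemma segint_ex f a b : segcont f a b ->
  exists2 Phi : R -> X, rprim (fun s => f (segpt a b s)) Phi 0 1 &
    segint f a b = (b - a) *: (Phi 1 - Phi 0).
Proof. by move=> /(rprim_ex ler01)[Phi fP]; exists Phi => //; exact: segintE. Qed.

Lemma segint_comb (c : R[i]) f g a b : segcont f a b -> segcont g a b ->
  segint (fun w => c *: f w + g w) a b = c *: segint f a b + segint g a b.
Proof.
move=> /segint_ex[Phi fP ->] /segint_ex[Psi gP ->].
by rewrite (segintE (rprim_comb c fP gP)); module.
Qed.

Lemma segint_bound f a b (K : R) : segcont f a b ->
  (forall s, 0 <= s <= 1 -> rnorm (f (segpt a b s)) <= K) ->
  rnorm (segint f a b) <= K * rnorm (b - a).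
Proof.
move=> /segint_ex[Phi fP ->] fK; rewrite rnormZ mulrC; apply: ler_wpM2r; first exact: rnorm_ge0.
by apply: le_trans (rprim_bound ler01 fP fK) _; rewrite subr0 mulr1.
Qed.

Lemma segint_eq f g a b : (forall s, 0 <= s <= 1 -> f (segpt a b s) = g (segpt a b s)) ->
  segcont f a b -> segint f a b = segint g a b.
Proof.
move=> fg /segint_ex[Phi fP ->]; apply/esym/segintE.
exact: rprim_eq fP.
Qed.

Lemma segint_rev f a b : segcont f a b -> segint f b a = - segint f a b.
Proof.
move=> /segint_ex[Phi fP ->]; have fP' := rprim_rev fP.
rewrite (@segintE f b a (fun s => - Phi (0 + 1 - s))).
  have -> : 0 + 1 - 1 = 0 :> R by ring.
  have -> : 0 + 1 - 0 = 1 :> R by ring.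
  by module.
apply: rprim_eq fP' => s _; congr f; rewrite /segpt !rcE; ring.
Qed.

Lemma segint_mid f a b : segcont f a b ->
  segint f a b = segint f a ((a + b) / 2) + segint f ((a + b) / 2) b.
Proof.
move=> /segint_ex[Phi fP ->].
have h0 : (0 : R) < 2^-1 by rewrite invr_gt0.
have P1 := rprim_scale (p := 0) (a := 0) (b := 1) (f := fun s => f (segpt a b s)) (Phi := Phi) h0.
have P2 := rprim_scale (p := 2^-1) (a := 0) (b := 1) (f := fun s => f (segpt a b s)) (Phi := Phi) h0.
rewrite (@segintE f a _ (fun s => (2^-1^-1)%:C *: Phi (0 + 2^-1 * s))); last first.
  apply: rprim_eq (P1 _); last by apply: rprimW fP; lra.
  by move=> s _; congr f; rewrite /segpt !rcE; field.
rewrite (@segintE f _ b (fun s => (2^-1^-1)%:C *: Phi (2^-1 + 2^-1 * s))); last first.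
  apply: rprim_eq (P2 _); last by apply: rprimW fP; lra.
  by move=> s _; congr f; rewrite /segpt !rcE; field.
have -> : Phi (2^-1 + 2^-1 * 1) = Phi 1 by congr Phi; field.
have -> : Phi (2^-1 + 2^-1 * 0) = Phi 2^-1 by congr Phi; ring.
have -> : Phi (0 + 2^-1 * 1) = Phi 2^-1 by congr Phi; ring.
have -> : Phi (0 + 2^-1 * 0) = Phi 0 by congr Phi; ring.
by rewrite invrK rc_nat; module; field.
Qed.

Lemma segint_pp f a : segint f a a = 0.
Proof. by rewrite /segint subrr scale0r. Qed.

Lemma segcont_aff (c d : X) a b : segcont (fun w => c + w *: d) a b.
Proof.
apply: segcont_ccont => s _.
apply: (@cderiv_cont _ _ _ _ (0 + (1 *: d + segpt a b s *: 0))).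
apply: cderivD; first exact: cderiv_cst.
by apply: cderiv_mul; [exact: cderiv_id|exact: cderiv_cst].
Qed.

Lemma segint_aff (c d : X) a b :
  segint (fun w => c + w *: d) a b = (b - a) *: c + ((b ^+ 2 - a ^+ 2) / 2) *: d.
Proof.
pose Phi (s : R) : X := s%:C *: c + (s%:C * a + s%:C ^+ 2 / 2 * (b - a)) *: d.
rewrite (@segintE _ a b Phi); last first.
  move=> e e0; have n1 : 0 < rnorm (b - a) * rnorm d + 1.
    by rewrite ltr_wpDl ?mulr_ge0 ?rnorm_ge0.
  exists (e / (rnorm (b - a) * rnorm d + 1)); first by rewrite divr_gt0.
  move=> s m y s0 sm my y1; rewrite ltr_pdivlMr// => ysd.
  rewrite (_ : _ - _ = ((y - s) * ((y + s) / 2 - m))%:C *: ((b - a) *: d)); last first.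
    rewrite /Phi /segpt !rcE.
    by module; field.
  rewrite !rnormZ rnormR normrM ger0_norm ?subr_ge0; last by lra.
  rewrite [leRHS]mulrC -mulrA.
  apply: ler_wpM2l; first by lra.
  have hm : `|(y + s) / 2 - m| <= y - s by rewrite ler_norml; apply/andP; split; lra.
  have := ler_wpM2r (mulr_ge0 (rnorm_ge0 (b - a)) (rnorm_ge0 d)) hm.
  by move: ysd; set N := rnorm (b - a) * rnorm d; nra.
by rewrite /Phi rc0 rc1; module; field.
Qed.

End Integral.

Lemma segint_lin (X Y : completeNormedModType R[i]) (L : X -> Y) (k : R)
    (f : R[i] -> X) (a b : R[i]) :
  linear L -> (forall x, rnorm (L x) <= k * rnorm x) -> segcont f a b ->
  L (segint f a b) = segint (fun w => L (f w)) a b.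
Proof.
move=> Llin Lk /segint_ex[Phi fP ->].
rewrite (@segintE _ _ a b (fun s => L (Phi s))); last exact: rprim_lin Llin Lk fP.
rewrite (_ : (b - a) *: (Phi 1 - Phi 0) = (b - a) *: Phi 1 + ((- (b - a)) *: Phi 0 + 0)); last by module.
rewrite !Llin; have -> : L 0 = 0.
  by have := Llin (-1) 0 0; rewrite scaler0 addr0 scaleN1r addNr.
by module.
Qed.

Let bisect_square (x y u v : R) : y - x = v - u ->
  [/\ (x + y) / 2 - x = (y - x) / 2, y - (x + y) / 2 = (y - x) / 2,
      (u + v) / 2 - u = (y - x) / 2 & v - (u + v) / 2 = (y - x) / 2].
Proof. by move=> sq; split; lra. Qed.

Section Goursat.
Context {X : completeNormedModType R[i]}.
Variables (f : R[i] -> X) (p z h : R[i]).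

(* The triangle [p], [z], [z + h] as the image of the unit square; the edge
   [s = 0] is mapped to the point [p]. *)
Let q (s v : R) : R[i] := p + s%:C * (z + v%:C * h - p).
Hypothesis fd : forall s v, 0 <= s <= 1 -> 0 <= v <= 1 -> exists d, cderiv f (q s v) d.

Let contour (s0 s1 v0 v1 : R) : X :=
  segint f (q s0 v0) (q s1 v0) + segint f (q s1 v0) (q s1 v1) +
  segint f (q s1 v1) (q s0 v1) + segint f (q s0 v1) (q s0 v0).

Let edge_s (s0 s1 v t : R) : segpt (q s0 v) (q s1 v) t = q (s0 + t * (s1 - s0)) v.
Proof. by rewrite /segpt /q !rcE; ring. Qed.

Let edge_v (s v0 v1 t : R) : segpt (q s v0) (q s v1) t = q s (v0 + t * (v1 - v0)).
Proof. by rewrite /segpt /q !rcE; ring. Qed.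

Let conv_itv (x y t c d : R) : c <= x <= d -> c <= y <= d -> 0 <= t <= 1 ->
  c <= x + t * (y - x) <= d.
Proof.
move=> /andP[cx xd] /andP[cy yd] /andP[t0 t1]; apply/andP; split.
  have -> : x + t * (y - x) = (1 - t) * x + t * y by ring.
  have -> : c = (1 - t) * c + t * c by ring.
  by apply: lerD; apply: ler_wpM2l => //; lra.
have -> : x + t * (y - x) = (1 - t) * x + t * y by ring.
have -> : d = (1 - t) * d + t * d by ring.
by apply: lerD; apply: ler_wpM2l => //; lra.
Qed.

Let cont_s s0 s1 v : 0 <= s0 <= 1 -> 0 <= s1 <= 1 -> 0 <= v <= 1 ->
  segcont f (q s0 v) (q s1 v).
Proof.
move=> h0 h1 hv; apply: segcont_ccont => t t01; rewrite edge_s.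
by have [d /cderiv_cont] := fd (conv_itv h0 h1 t01) hv.
Qed.

Let cont_v s v0 v1 : 0 <= s <= 1 -> 0 <= v0 <= 1 -> 0 <= v1 <= 1 ->
  segcont f (q s v0) (q s v1).
Proof.
move=> hs h0 h1; apply: segcont_ccont => t t01; rewrite edge_v.
by have [d /cderiv_cont] := fd hs (conv_itv h0 h1 t01).
Qed.

Let two0 : (2 : R[i]) != 0. Proof. by rewrite pnatr_eq0. Qed.

Let mid_s s0 s1 v : q ((s0 + s1) / 2) v = (q s0 v + q s1 v) / 2.
Proof. by rewrite /q !rcE; field. Qed.

Let mid_v s v0 v1 : q s ((v0 + v1) / 2) = (q s v0 + q s v1) / 2.
Proof. by rewrite /q !rcE; field. Qed.

Let contour_split s0 s1 v0 v1 : 0 <= s0 -> s0 <= s1 -> s1 <= 1 ->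
  0 <= v0 -> v0 <= v1 -> v1 <= 1 ->
  let m := (s0 + s1) / 2 in let n := (v0 + v1) / 2 in
  contour s0 s1 v0 v1 =
    contour s0 m v0 n + contour s0 m n v1 + contour m s1 v0 n + contour m s1 n v1.
Proof.
move=> a1 a2 a3 b1 b2 b3 m n.
have s0I : 0 <= s0 <= 1 by apply/andP; split; clear -a1 a2 a3 b1 b2 b3 fd; lra.
have s1I : 0 <= s1 <= 1 by apply/andP; split; clear -a1 a2 a3 b1 b2 b3 fd; lra.
have mI : 0 <= m <= 1 by rewrite /m; apply/andP; split; clear -a1 a2 a3 b1 b2 b3 fd; lra.
have v0I : 0 <= v0 <= 1 by apply/andP; split; clear -a1 a2 a3 b1 b2 b3 fd; lra.
have v1I : 0 <= v1 <= 1 by apply/andP; split; clear -a1 a2 a3 b1 b2 b3 fd; lra.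
have nI : 0 <= n <= 1 by rewrite /n; apply/andP; split; clear -a1 a2 a3 b1 b2 b3 fd; lra.
rewrite /contour.
rewrite (segint_mid (cont_s s0I s1I v0I)) (segint_mid (cont_v s1I v0I v1I)).
rewrite (segint_mid (cont_s s1I s0I v1I)) (segint_mid (cont_v s0I v1I v0I)).
rewrite -!mid_s -!mid_v (addrC s1 s0) (addrC v1 v0) -/m -/n.
rewrite (segint_rev (cont_s s0I mI nI)) (segint_rev (cont_s mI s1I nI)).
rewrite (segint_rev (cont_v mI v0I nI)) (segint_rev (cont_v mI nI v1I)).
by module.
Qed.

(* Differentiability replaces [f] near a point by an affine function, whose
   contour integral vanishes, up to an error quadratic in the side length. *)
Let contour_local s v e : 0 <= s <= 1 -> 0 <= v <= 1 -> 0 < e ->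
  exists2 r : R, 0 < r & forall s0 s1 v0 v1, 0 <= s0 -> s0 <= s -> s <= s1 -> s1 <= 1 ->
    0 <= v0 -> v0 <= v -> v <= v1 -> v1 <= 1 -> s1 - s0 < r -> v1 - v0 < r ->
    s1 - s0 = v1 - v0 -> rnorm (contour s0 s1 v0 v1) <= e * (s1 - s0) ^+ 2.
Proof.
move=> sI vI e0; have [d fdd] := fd sI vI.
pose L := rnorm (z - p) + rnorm h + 1.
have nz := @rnorm_ge0 R _ (z - p); have nh := @rnorm_ge0 R _ h.
have L0 : 0 < L by rewrite /L; lra.
have qL s' v' t u : 0 <= s' <= 1 -> 0 <= u <= 1 ->
    rnorm (q t u - q s' v') <= L * (`|t - s'| + `|u - v'|).
  move=> /andP[s'0 s'1] /andP[u0 u1].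
  rewrite (_ : _ - _ = (t - s')%:C * (z - p) + ((t - s') * u + s' * (u - v'))%:C * h).
    apply: le_trans (rnormD _ _) _; rewrite !rnormM !rnormR.
    have : `|(t - s') * u + s' * (u - v')| <= `|t - s'| + `|u - v'|.
      apply: le_trans (ler_normD _ _) _; rewrite !normrM (ger0_norm u0) (ger0_norm s'0).
      by have := normr_ge0 (t - s'); have := normr_ge0 (u - v'); nra.
    by rewrite /L; have := normr_ge0 (t - s'); have := normr_ge0 (u - v'); nra.
  by rewrite /q !rcE; ring.
have e1 : 0 < e / (8 * L ^+ 2) by rewrite divr_gt0// mulr_gt0// exprn_gt0.
have [r r0 hr] := fdd _ e1.
exists (r / (2 * L)); first by rewrite divr_gt0// mulr_gt0.
move=> s0 s1 v0 v1 s00 s0s ss1 s11 v00 v0v vv1 v11 sr vr lv.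
set l := s1 - s0 in sr lv *.
have s01 : s0 <= s1 by exact: le_trans ss1.
have v01 : v0 <= v1 by exact: le_trans vv1.
have l0 : 0 <= l by rewrite /l subr_ge0.
have lr : 2 * L * l < r by move: sr; rewrite ltr_pdivlMr ?mulr_gt0// mulrC.
have s0I : 0 <= s0 <= 1 by rewrite s00 (le_trans s01).
have s1I : 0 <= s1 <= 1 by rewrite s11 (le_trans s00).
have v0I : 0 <= v0 <= 1 by rewrite v00 (le_trans v01).
have v1I : 0 <= v1 <= 1 by rewrite v11 (le_trans v00).
pose rho w := (-1) *: ((f (q s v) - q s v *: d) + w *: d) + f w.
have rho_small t u : s0 <= t <= s1 -> v0 <= u <= v1 ->
    rnorm (rho (q t u)) <= e / (8 * L ^+ 2) * (2 * L * l).
  move=> /andP[t0 t1] /andP[u0 u1].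
  have uI : 0 <= u <= 1 by rewrite (le_trans v00 u0) (le_trans u1 v11).
  have nq : rnorm (q t u - q s v) <= 2 * L * l.
    apply: le_trans (qL s v t u sI uI) _.
    rewrite (_ : 2 * L * l = L * (l + l)); last by ring.
    apply: ler_wpM2l; first exact: ltW.
    have lE : l = s1 - s0 by [].
    by apply: lerD; rewrite ler_norml; apply/andP; split; clear -lE lv t0 t1 u0 u1 s0s ss1 v0v vv1 fd; lra.
  rewrite (_ : rho _ = f (q t u) - f (q s v) - (q t u - q s v) *: d); last by rewrite /rho; module.
  apply: le_trans (hr _ (le_lt_trans nq lr)) _.
  by apply: ler_wpM2l => //; exact: ltW.
have edge a b : segcont f a b -> rnorm (b - a) <= L * l ->
    (forall t, 0 <= t <= 1 -> rnorm (rho (segpt a b t)) <= e / (8 * L ^+ 2) * (2 * L * l)) ->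
    rnorm (segint f a b - segint (fun w => (f (q s v) - q s v *: d) + w *: d) a b)
      <= e / 4 * l ^+ 2.
  move=> fc ab rs.
  have cr : segcont rho a b.
    move=> t tI e' e'0; have e'2 : 0 < e' / 2 by rewrite divr_gt0.
    have [r1 r10 h1] := fc t tI _ e'2.
    have [r2 r20 h2] := segcont_aff (f (q s v) - q s v *: d) d a b tI e'2.
    exists (Num.min r1 r2); first by rewrite lt_min r10.
    move=> y yI; rewrite lt_min => /andP[/(h1 _ yI) {}h1 /(h2 _ yI) {}h2].
    rewrite (_ : _ - _ = (f (segpt a b y) - f (segpt a b t)) -
      ((f (q s v) - q s v *: d + segpt a b y *: d) -
       (f (q s v) - q s v *: d + segpt a b t *: d))); last by rewrite /rho; module.
    by apply: le_lt_trans (rnormD _ _) _; rewrite rnormN; clear -h1 h2 fd; lra.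
  have -> : segint f a b - segint (fun w => (f (q s v) - q s v *: d) + w *: d) a b =
      segint rho a b.
    rewrite /rho segint_comb //; last exact: segcont_aff.
    by rewrite scaleN1r addrC.
  apply: le_trans (segint_bound cr rs) _.
  have K0 : 0 <= e / (8 * L ^+ 2) * (2 * L * l) by apply: mulr_ge0; [exact: ltW|apply: mulr_ge0 => //; apply: mulr_ge0 => //; exact: ltW].
  apply: le_trans (ler_wpM2l K0 ab) _.
  by rewrite le_eqVlt; apply/orP; left; apply/eqP; field; rewrite gt_eqF.
have len_s v' : 0 <= v' <= 1 -> rnorm (q s1 v' - q s0 v') <= L * l.
  by move=> v'I; apply: le_trans (qL _ _ _ _ s0I v'I) _; rewrite subrr normr0 addr0 ger0_norm.
have len_v s' : 0 <= s' <= 1 -> rnorm (q s' v1 - q s' v0) <= L * l.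
  by move=> s'I; apply: le_trans (qL _ _ _ _ s'I v1I) _; rewrite subrr normr0 add0r lv ger0_norm// -lv.
have sb : s0 <= s0 <= s1 by rewrite lexx.
have sb1 : s0 <= s1 <= s1 by rewrite lexx andbT.
have vb : v0 <= v0 <= v1 by rewrite lexx.
have vb1 : v0 <= v1 <= v1 by rewrite lexx andbT.
have E1 := edge _ _ (cont_s s0I s1I v0I) (len_s _ v0I).
have E2 := edge _ _ (cont_v s1I v0I v1I) (len_v _ s1I).
have E3 := edge _ _ (cont_s s1I s0I v1I).
rewrite (rdistC (q s0 v1)) in E3; have {}E3 := E3 (len_s _ v1I).
have E4 := edge _ _ (cont_v s0I v1I v0I).
rewrite (rdistC (q s0 v0)) in E4; have {}E4 := E4 (len_v _ s0I).
have {}E1 := E1 (fun t tI => eq_ind_r (fun w => rnorm (rho w) <= _)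
  (rho_small _ _ (conv_itv sb sb1 tI) vb) (edge_s _ _ _ _)).
have {}E2 := E2 (fun t tI => eq_ind_r (fun w => rnorm (rho w) <= _)
  (rho_small _ _ sb1 (conv_itv vb vb1 tI)) (edge_v _ _ _ _)).
have {}E3 := E3 (fun t tI => eq_ind_r (fun w => rnorm (rho w) <= _)
  (rho_small _ _ (conv_itv sb1 sb tI) vb1) (edge_s _ _ _ _)).
have {}E4 := E4 (fun t tI => eq_ind_r (fun w => rnorm (rho w) <= _)
  (rho_small _ _ sb (conv_itv vb1 vb tI)) (edge_v _ _ _ _)).
rewrite !segint_aff in E1 E2 E3 E4.
set A := q s0 v0 in E1 E2 E3 E4; set B := q s1 v0 in E1 E2 E3 E4.
set C := q s1 v1 in E1 E2 E3 E4; set D := q s0 v1 in E1 E2 E3 E4.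
rewrite /contour -/A -/B -/C -/D.
match type of E1 with is_true (rnorm ?a <= _) => match type of E2 with is_true (rnorm ?b <= _) =>
match type of E3 with is_true (rnorm ?c <= _) => match type of E4 with is_true (rnorm ?d <= _) =>
rewrite (_ : _ + _ + _ + _ = a + b + c + d); last by module; field end end end end.
apply: le_trans (rnormD _ _) _; apply: le_trans (lerD (rnormD _ _) (lexx _)) _.
apply: le_trans (lerD (lerD (rnormD _ _) (lexx _)) (lexx _)) _.
rewrite [leRHS](_ : _ = e / 4 * l ^+ 2 + e / 4 * l ^+ 2 + e / 4 * l ^+ 2 + e / 4 * l ^+ 2); last by field.
by rewrite !lerD.
Qed.

(** Cauchy's theorem on a triangle, without continuity of the derivative: the
    triangle is seen as the image of a square, which is bisected. *)
Lemma goursat : segint f p z + segint f z (z + h) = segint f p (z + h).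
Proof.
have I0 : 0 <= (0 : R) <= 1 by rewrite lexx ler01.
have I1 : 0 <= (1 : R) <= 1 by rewrite lexx ler01.
have c0 : contour 0 1 0 1 = 0.
  apply: rnorm_small => e e0; have : (1 : R) - 0 = 1 - 0 by [].
  rewrite (_ : e = e * (1 - 0) ^+ 2); last by rewrite subr0 expr1n mulr1.
  apply: (@cousin2 _ (fun s0 s1 v0 v1 => s1 - s0 = v1 - v0 ->
    rnorm (contour s0 s1 v0 v1) <= e * (s1 - s0) ^+ 2) 0 1 0 1) => //; last first.
    by move=> s v sI vI; exact: contour_local.
  move=> x y u v x0 xy y1 u0 uv v1 m n h1 h2 h3 h4 sq.
  rewrite contour_split// -/m -/n.
  have [e1 e2 e3 e4] := bisect_square sq; rewrite -/m -/n in e1 e2 e3 e4.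
  have {}h1 : rnorm (contour x m u n) <= e * ((y - x) / 2) ^+ 2 by rewrite -e1; apply: h1; rewrite e1.
  have {}h2 : rnorm (contour x m n v) <= e * ((y - x) / 2) ^+ 2 by rewrite -e1; apply: h2; rewrite e1.
  have {}h3 : rnorm (contour m y u n) <= e * ((y - x) / 2) ^+ 2 by rewrite -e2; apply: h3; rewrite e2.
  have {}h4 : rnorm (contour m y n v) <= e * ((y - x) / 2) ^+ 2 by rewrite -e2; apply: h4; rewrite e2.
  apply: le_trans (rnormD _ _) _; apply: le_trans (lerD (rnormD _ _) (lexx _)) _.
  apply: le_trans (lerD (lerD (rnormD _ _) (lexx _)) (lexx _)) _.
  set k := e * ((y - x) / 2) ^+ 2 in h1 h2 h3 h4.
  by rewrite [leRHS](_ : _ = k + k + k + k); [rewrite !lerD|rewrite /k; field].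
have q0 v : q 0 v = p by rewrite /q rc0 mul0r addr0.
have q10 : q 1 0 = z by rewrite /q rc0 rc1 mul1r mul0r addr0 addrC subrK.
have q11 : q 1 1 = z + h by rewrite /q rc1 !mul1r addrC subrK.
have cz : segcont f p (z + h) by rewrite -q11 -(q0 1); exact: cont_s.
move: c0; rewrite /contour !q0 q10 q11 segint_pp addr0 (segint_rev cz).
by move=> /eqP; rewrite subr_eq0 => /eqP.
Qed.

End Goursat.

(** By Goursat's theorem the increment of the integral from the centre is the
    integral over a short segment, and [f] is continuous. *)
Lemma star_primitive (X : completeNormedModType R[i]) (f : R[i] -> X) (U : set R[i]) (p : R[i]) :
  (forall z, U z -> exists2 r : R, 0 < r & forall w, rnorm (w - z) < r -> U w) ->
  (forall z s, U z -> 0 <= s <= 1 -> U (segpt p z s)) ->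
  (forall z, U z -> exists d, cderiv f z d) ->
  forall z, U z -> cderiv (segint f p) z (f z).
Proof.
move=> Uo Ustar fd z Uz e e0.
have [r r0 hr] := Uo z Uz; have [d fdz] := fd z Uz.
have [r1 r10 h1] := cderiv_cont fdz e0.
exists (Num.min r r1); first by rewrite lt_min r0.
move=> w; rewrite lt_min => /andP[wr wr1].
have short v : 0 <= v <= 1 -> rnorm (z + v%:C * (w - z) - z) <= rnorm (w - z).
  move=> /andP[v0 v1]; rewrite addrAC subrr add0r rnormM rnormR ger0_norm//.
  by apply: ler_piMl => //; exact: rnorm_ge0.
have G : segint f p z + segint f z (z + (w - z)) = segint f p (z + (w - z)).
  apply: goursat => s v sI vI; apply: fd.
  by apply: Ustar => //; apply: hr; apply: le_lt_trans (short _ vI) wr.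
rewrite (addrC z) subrK in G; rewrite -G.
have cf : segcont f z w.
  apply: segcont_ccont => v vI.
  by have [d' /cderiv_cont] := fd _ (hr _ (le_lt_trans (short _ vI) wr)).
have cc : segcont (fun=> - f z) z w.
  by apply: segcont_ccont => v vI; exact: cderiv_cont (cderiv_cst _ _).
have -> : segint f p z + segint f z w - segint f p z - (w - z) *: f z =
    segint (fun w => 1 *: f w + - f z) z w.
  rewrite segint_comb//.
  have -> : segint (fun=> - f z) z w = segint (fun u => - f z + u *: 0) z w.
    by congr segint; apply/funext => u; rewrite scaler0 addr0.
  by rewrite segint_aff; module.
apply: segint_bound.
  move=> t tI e' /(cf t tI)[r2 r20 h2]; exists r2 => // y yI /(h2 _ yI).
  by rewrite !scale1r opprD opprK addrACA addNr addr0.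
by move=> s sI; rewrite scale1r; apply/ltW/h1; apply: le_lt_trans (short _ sI) wr1.
Qed.

End SegmentIntegral.

(** * Sectors *)

Section Sector.
Context {R : realType}.
Implicit Types (z : R[i]) (w eta : R).

(** For [0 < eta < pi / 2] this is the open sector of vertex [w] and
    half-angle [pi / 2 + eta]; the linear inequality makes openness and
    star-shapedness immediate. *)
Definition lsector w eta : set R[i] :=
  [set z | 0 < (complex.Re z - w) * cos eta + `|complex.Im z| * sin eta].

Lemma pi_le4 : (pi : R) <= 4.
Proof. by have [/andP[_ h] _] := pihalf_02_cos_pihalf R; lra. Qed.

Lemma cos_nincr (x y : R) : 0 <= x -> x <= y -> y <= pi -> cos y <= cos x.
Proof.
move=> x0; rewrite le_eqVlt => /predU1P[->//|xy] ypi.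
by apply/ltW; rewrite ltr_cos// in_itv /=; apply/andP; split; lra.
Qed.

Lemma sin_ndecr (x y : R) : - (pi / 2) <= x -> x <= y -> y <= pi / 2 ->
  sin x <= sin y.
Proof.
move=> x0; rewrite le_eqVlt => /predU1P[->//|xy] ypi.
by apply/ltW; rewrite ltr_sin// in_itv /=; apply/andP; split; lra.
Qed.

Lemma cos_sin_pos eta : 0 < eta < pi / 2 -> 0 < cos eta /\ 0 < sin eta.
Proof.
move=> /andP[e0 e1]; split; first by apply: cos_gt0_pihalf; apply/andP; split; lra.
by apply: sin_gt0_pihalf; apply/andP.
Qed.

Lemma cos_abs_shift (psi eta : R) : `|psi| <= pi ->
  cos psi * cos eta + `|sin psi| * sin eta = cos (`|psi| - eta).
Proof.
move=> psi_pi; rewrite cosB cos_norm; congr (_ + _ * _).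
have s0 : 0 <= sin `|psi| by apply: sin_ge0_pi; rewrite normr_ge0.
have [p0|p0] := leP 0 psi; first by rewrite (ger0_norm p0) in s0 *; rewrite ger0_norm.
by rewrite (ltr0_norm p0) sinN in s0 *; rewrite ler0_norm -?oppr_ge0.
Qed.

Lemma lsector_open w eta z : 0 < eta < pi / 2 -> lsector w eta z ->
  exists2 r : R, 0 < r & forall u, rnorm (u - z) < r -> lsector w eta u.
Proof.
move=> /cos_sin_pos[c0 s0]; rewrite /lsector /= => Uz.
set D := _ + _ in Uz; exists (D / 2); first by lra.
move=> u ur.
have c1 : cos eta <= 1 by apply: le_trans (ler_norm _) _; exact: cos_max.
have s1 : sin eta <= 1 by apply: le_trans (ler_norm _) _; exact: sin_max.
have := Re_rnorm (u - z); have := Im_rnorm (u - z); rewrite ReD ImD ReN ImN.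
move=> h1 h2.
have h3 : `|complex.Im z| <= `|complex.Im u| + rnorm (u - z).
  have := ler_normD (complex.Im u) (complex.Im z - complex.Im u).
  by rewrite addrC subrK -(normrN (_ - complex.Im u)) opprB; lra.
have h4 : complex.Re z <= complex.Re u + rnorm (u - z).
  by move: h2; rewrite ler_norml => /andP[]; lra.
have n0 := rnorm_ge0 (u - z); move: ur; rewrite /D.
set n := rnorm _ in n0 h3 h4 *; move=> ur; nra.
Qed.

Lemma lsector_star w eta z (s : R) : 0 < eta < pi / 2 -> lsector w eta z ->
  0 <= s <= 1 -> lsector w eta (segpt (w + 1)%:C z s).
Proof.
move=> /cos_sin_pos[c0 s0]; rewrite /lsector /segpt /= => Uz /andP[s00 s1].
rewrite !(ReD, ImD, ReN, ImN, ReM, ImM) /= !(mul0r, mulr0, subr0, addr0, add0r, oppr0).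
rewrite normrM (ger0_norm s00).
have [->|sn] := eqVneq s 0; first by rewrite mul0r !addr0 mul0r; lra.
have s00' : 0 < s by rewrite lt_neqAle eq_sym sn.
rewrite (_ : _ + _ = (1 - s) * cos eta + s * ((complex.Re z - w) * cos eta + `|complex.Im z| * sin eta)); last by ring.
by rewrite ltr_wpDl ?mulr_ge0 ?mulr_gt0//; lra.
Qed.

Lemma lsector_polar w w' eta (r psi : R) : 0 < eta < pi / 2 -> w < w' -> 0 <= r ->
  `|psi| <= pi / 2 + eta -> lsector w eta (w'%:C + r%:C * cis psi).
Proof.
move=> e01 ww r0 psiE; have [c0 s0] := cos_sin_pos e01.
move/andP: e01 => [e0 e1].
rewrite /lsector /= !(mul0r, mulr0, subr0, addr0, add0r) normrM (ger0_norm r0).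
rewrite (_ : _ + _ = (w' - w) * cos eta + r * (cos psi * cos eta + `|sin psi| * sin eta)); last by ring.
rewrite cos_abs_shift; last by lra.
rewrite ltr_pwDl ?mulr_gt0 ?subr_gt0// mulr_ge0//.
by apply: cos_ge0_pihalf; have := normr_ge0 psi => ?; apply/andP; split; lra.
Qed.

Lemma polar_decomposition z : exists r psi : R,
  [/\ 0 <= r, - pi < psi <= pi, r = rnorm z & z = r%:C * cis psi].
Proof.
have [->|z0] := eqVneq z 0.
  exists 0, 0; rewrite rnorm0 rc0 mul0r; split => //.
  by have := pi_gt0 R; rewrite oppr_lt0 => ->; exact: pi_ge0.
have n0 : 0 < rnorm z.
  by rewrite lt_neqAle rnorm_ge0 andbT eq_sym; apply: contra z0 => /eqP/rnorm_eq0->.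
have c1 : -1 <= complex.Re z / rnorm z <= 1.
  have := Re_rnorm z; rewrite ler_norml => /andP[a b]; apply/andP; split.
    by rewrite ler_pdivlMr// mulN1r.
  by rewrite ler_pdivrMr// mul1r.
pose t := acos (complex.Re z / rnorm z).
have ct : rnorm z * cos t = complex.Re z.
  by rewrite /t acosK ?in_itv//= mulrC divfK// gt_eqF.
have st : rnorm z * sin t = `|complex.Im z|.
  rewrite /t sin_acos//; apply/eqP; rewrite -(@eqrXn2 _ 2)// ?mulr_ge0 ?rnorm_ge0 ?sqrtr_ge0//.
  rewrite exprMn sqr_sqrtr; last first.
    rewrite subr_ge0; move/andP: c1 => [a b]; nra.
  have -> : rnorm z ^+ 2 * (1 - (complex.Re z / rnorm z) ^+ 2) =
      rnorm z ^+ 2 - complex.Re z ^+ 2 by field; rewrite gt_eqF.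
  by rewrite rnorm_sqr real_normK ?num_real// addrAC subrr add0r.
have t0 : 0 <= t by exact: acos_ge0.
have tpi : t <= pi by exact: acos_lepi.
have [i0|i0] := leP 0 (complex.Im z).
  exists (rnorm z), t; split => //; first exact: rnorm_ge0.
    by apply/andP; split => //; have := pi_gt0 R; lra.
  by apply: complex_eq; rewrite ?(ReM, ImM) /= ?mul0r ?subr0 ?addr0 ?ct ?st ?ger0_norm.
have tlt : t < pi.
  rewrite lt_neqAle tpi andbT; apply/eqP => tp; move: st; rewrite tp sinpi mulr0.
  by rewrite ltr0_norm//; lra.
exists (rnorm z), (- t); split => //; first exact: rnorm_ge0.
  by apply/andP; split; lra.
apply: complex_eq; rewrite ?(ReM, ImM) /= ?mul0r ?subr0 ?addr0 ?cosN ?sinN ?mulrN ?ct ?st//.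
by rewrite ltr0_norm ?opprK.
Qed.

Lemma lsector_osector w eta z : 0 < eta < pi / 2 -> lsector w eta z ->
  osector w (eta + pi / 2) z.
Proof.
move=> e01 Uz; have [r [psi [r0 /andP[p0 p1] _ E]]] := polar_decomposition (z - w%:C).
have ez : z = w%:C + r%:C * cis psi by rewrite -E addrC subrK.
have [rz|rn] := eqVneq r 0.
  move: Uz; rewrite ez rz rc0 mul0r addr0 /lsector /= subrr mul0r normr0 mul0r.
  by rewrite addr0 ltxx.
have r1 : 0 < r by rewrite lt_neqAle eq_sym rn.
exists r, psi; split => //.
suff : `|psi| < eta + pi / 2 by rewrite ltr_norml.
move: Uz; rewrite ez /lsector /= !(mul0r, mulr0, subr0, addr0, add0r) normrM (ger0_norm r0).
rewrite (_ : _ + _ = r * (cos psi * cos eta + `|sin psi| * sin eta)); last by ring.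
have ap : `|psi| <= pi by rewrite ler_norml; apply/andP; split; lra.
rewrite cos_abs_shift// pmulr_rgt0// => cp; rewrite ltNge; apply/negP => h.
move/andP: e01 => [e0 e1].
have : 0 <= - cos (`|psi| - eta).
  rewrite -sinBpihalf; apply: sin_ge0_pi; apply/andP; split; lra.
by lra.
Qed.

Lemma lsector_osector_gt w w' eta z : 0 < eta < pi / 2 -> lsector w' eta z -> w < w' ->
  lsector w eta z.
Proof.
move=> /cos_sin_pos[c0 s0]; rewrite /lsector /= => h ww.
by apply: lt_le_trans h _; rewrite lerD2r ler_pM2r//; lra.
Qed.

Lemma lsector_rnorm w eta z : 0 < eta < pi / 2 -> lsector w eta z ->
  w * cos eta < rnorm z.
Proof.
move=> /cos_sin_pos[c0 s0]; rewrite /lsector /= => h.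
have := cos2Dsin2 eta; set c := cos eta in c0 h *; set s := sin eta in s0 h * => cs.
have n0 := rnorm_ge0 z; have := rnorm_sqr z.
rewrite -(real_normK (num_real (complex.Im z))).
move: h; set x := complex.Re z; set y := `|_|; set n := rnorm z in n0 * => h nE.
have : x * c + y * s <= n.
  rewrite leNgt; apply/negP => nlt.
  have : n ^+ 2 < (x * c + y * s) ^+ 2 by rewrite ltr_pXn2r// nnegrE//; lra.
  rewrite nE; have := sqr_ge0 (x * s - y * c).
  have -> : (x * c + y * s) ^+ 2 = (x ^+ 2 + y ^+ 2) * (c ^+ 2 + s ^+ 2) - (x * s - y * c) ^+ 2 by ring.
  by rewrite cs; lra.
by lra.
Qed.

(** Seen from the origin, points of a sector of vertex [w >= 0] are at least
    as far as a fixed multiple of their distance to the vertex. *)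
Lemma polar_rnorm w eta (r psi : R) : 0 <= w -> 0 < eta < pi / 2 -> 0 <= r ->
  `|psi| <= pi / 2 + eta -> r * cos eta <= rnorm (w%:C + r%:C * cis psi).
Proof.
move=> w0 e01 r0 pE; have [c0 s0] := cos_sin_pos e01; move/andP: e01 => [e0 e1].
have [cp|cp] := leP 0 (cos psi).
  apply: (@le_trans _ _ r).
    have c1 : cos eta <= 1 by apply: le_trans (ler_norm _) _; exact: cos_max.
    by apply: ler_piMr.
  rewrite -(@ler_pXn2r _ 2) ?nnegrE ?rnorm_ge0// rnorm_sqr /=.
  rewrite !(mul0r, mulr0, subr0, addr0, add0r) exprMn.
  have := cos2Dsin2 psi => cs; rewrite sqrrD !exprMn.
  rewrite -{1}[r ^+ 2]mulr1 -cs mulrDr.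
  by have := sqr_ge0 w; have := mulr_ge0 w0 (mulr_ge0 r0 cp); lra.
apply: le_trans (Im_rnorm _); rewrite /= !(mul0r, mulr0, subr0, addr0, add0r).
rewrite normrM (ger0_norm r0); apply: ler_wpM2l => //.
have p2 : pi / 2 < `|psi|.
  rewrite ltNge; apply/negP => h; move: cp; rewrite -cos_norm ltNge => /negP; apply.
  by apply: cos_ge0_pihalf; rewrite h andbT; have := normr_ge0 psi; have := pi_gt0 R; lra.
have -> : `|sin psi| = cos (`|psi| - pi / 2).
  by rewrite -cos_abs_shift ?cos_pihalf ?sin_pihalf ?mulr0 ?mulr1 ?add0r//; lra.
by apply: cos_nincr; lra.
Qed.

End Sector.

(** * Integrals between the rays of a sector *)

Section Contour.
Context {R : realType}.
Variables (w1 omega eta : R).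
Hypothesis w1_ge0 : 0 <= w1.
Hypothesis w1_lt : w1 < omega.
Hypothesis etaI : 0 < eta < pi / 2.

Definition ray_angle : R := pi / 2 + eta / 2.
(** Polar coordinates centred at [omega]. *)
Definition sector_pt (r psi : R) : R[i] := omega%:C + r%:C * cis psi.

Local Notation U := (lsector w1 eta).

Definition holo {X : normedModType R[i]} (f : R[i] -> X) :=
  forall z, U z -> exists d, cderiv f z d.

Lemma ray_angle_gt0 : 0 < ray_angle.
Proof. by move/andP: etaI => [? ?]; rewrite /ray_angle; have := pi_gt0 R; lra. Qed.

Lemma ray_angle_le : ray_angle <= pi / 2 + eta.
Proof. by move/andP: etaI => [? ?]; rewrite /ray_angle; lra. Qed.

Lemma ray_angle_ltpi : ray_angle < pi.
Proof. by move/andP: etaI => [? ?]; rewrite /ray_angle; lra. Qed.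

Lemma lsector_pt (r psi : R) : 0 <= r -> `|psi| <= ray_angle -> U (sector_pt r psi).
Proof.
by move=> r0 pt; apply: lsector_polar => //; apply: le_trans pt _; exact: ray_angle_le.
Qed.

Lemma rnorm_sector_pt (r psi : R) : 0 <= r -> `|psi| <= ray_angle -> r * cos eta <= rnorm (sector_pt r psi).
Proof.
move=> r0 pt; apply: polar_rnorm => //; first by rewrite (le_trans w1_ge0) ?ltW.
by apply: le_trans pt _; exact: ray_angle_le.
Qed.

Lemma rnorm_sector_pt_le (r psi : R) : 0 <= r -> rnorm (sector_pt r psi) <= omega + r.
Proof.
move=> r0; apply: le_trans (rnormD _ _) _.
by rewrite rnormM !rnormR rnorm_cis mulr1 !ger0_norm// (le_trans w1_ge0) ?ltW.
Qed.

Section Valued.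
Context {X : completeNormedModType R[i]}.
Implicit Types (f g : R[i] -> X).

(** The integral of [f] along a path in the sector, from the point at distance
    [n] on the lower ray to the point at distance [n] on the upper one; by
    Cauchy's theorem the choice of the path does not matter. *)
Definition sector_int f (n : nat) : X :=
  segint f (w1 + 1)%:C (sector_pt n%:R ray_angle) - segint f (w1 + 1)%:C (sector_pt n%:R (- ray_angle)).

Lemma holo_prim f : holo f -> forall z, U z -> cderiv (segint f (w1 + 1)%:C) z (f z).
Proof.
apply: star_primitive => [z|z s]; first exact: lsector_open.
exact: lsector_star.
Qed.

Let thetaU (n : nat) : U (sector_pt n%:R ray_angle) /\ U (sector_pt n%:R (- ray_angle)).
Proof.
by split; apply: lsector_pt => //; rewrite ?normrN ger0_norm//; exact: ltW ray_angle_gt0.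
Qed.

Lemma holo_segcont f z : holo f -> U z -> segcont f (w1 + 1)%:C z.
Proof.
move=> fh Uz; apply: segcont_ccont => s sI.
by have [d /cderiv_cont] := fh _ (lsector_star etaI Uz sI).
Qed.

Lemma sector_int_comb (c : R[i]) f g n : holo f -> holo g ->
  sector_int (fun w => c *: f w + g w) n = c *: sector_int f n + sector_int g n.
Proof.
move=> fh gh; have [U1 U2] := thetaU n; rewrite /sector_int.
rewrite (segint_comb _ (holo_segcont fh U1) (holo_segcont gh U1)).
by rewrite (segint_comb _ (holo_segcont fh U2) (holo_segcont gh U2)); module.
Qed.

Lemma sector_int_eq f g n : holo f -> (forall z, U z -> f z = g z) -> sector_int f n = sector_int g n.
Proof.
move=> fh fg; have [U1 U2] := thetaU n; rewrite /sector_int.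
rewrite (@segint_eq _ _ f g _ (sector_pt n%:R ray_angle)); last exact: holo_segcont.
  rewrite (@segint_eq _ _ f g _ (sector_pt n%:R (- ray_angle))) //; last exact: holo_segcont.
  by move=> s sI; apply/fg/lsector_star.
by move=> s sI; apply/fg/lsector_star.
Qed.

(** For a fixed [n] the contour is compact, so that locally uniform convergence
    of integrands can be used. *)
Lemma sector_int_bound (n : nat) : exists Lambda L : R, [/\ 0 <= Lambda, 0 <= L &
  forall f (K : R), holo f -> (forall z, U z -> rnorm z <= Lambda -> rnorm (f z) <= K) ->
    rnorm (sector_int f n) <= K * L].
Proof.
have [U1 U2] := thetaU n.
set a := sector_pt n%:R ray_angle in U1; set b := sector_pt n%:R (- ray_angle) in U2.
pose p : R[i] := (w1 + 1)%:C.
have np := @rnorm_ge0 R _ p; have na := @rnorm_ge0 R _ (a - p).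
have nb := @rnorm_ge0 R _ (b - p).
exists (rnorm p + rnorm (a - p) + rnorm (b - p)), (rnorm (a - p) + rnorm (b - p)).
split; [lra|lra|] => f K fh fK.
have short z s : 0 <= s <= 1 -> rnorm (segpt p z s) <= rnorm p + rnorm (z - p).
  move=> /andP[s0 s1]; apply: le_trans (rnormD _ _) _; rewrite lerD2l rnormM rnormR ger0_norm//.
  by apply: ler_piMl => //; exact: rnorm_ge0.
have h1 : rnorm (segint f p a) <= K * rnorm (a - p).
  apply: segint_bound; first exact: holo_segcont.
  move=> s sI; apply: fK; first exact: lsector_star.
  by apply: le_trans (short _ _ sI) _; lra.
have h2 : rnorm (segint f p b) <= K * rnorm (b - p).
  apply: segint_bound; first exact: holo_segcont.
  move=> s sI; apply: fK; first exact: lsector_star.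
  by apply: le_trans (short _ _ sI) _; lra.
by apply: le_trans (rnormD _ _) _; rewrite rnormN mulrDr; apply: lerD.
Qed.

Lemma holo_arc f (r x y K : R) : holo f -> 0 <= r -> - ray_angle <= x -> x <= y -> y <= ray_angle ->
  (forall psi, x <= psi <= y -> rnorm (f (sector_pt r psi)) <= K) ->
  rnorm (segint f (w1 + 1)%:C (sector_pt r y) - segint f (w1 + 1)%:C (sector_pt r x)) <= K * r * (y - x).
Proof.
move=> fh r0 tx xy yt fK; apply: (arc_bound (f := f)) => // s sI; split; last exact: fK.
apply: holo_prim => //; apply: lsector_pt => //; rewrite ler_norml.
by move/andP: sI => [? ?]; apply/andP; split; lra.
Qed.

Lemma holo_ray f (psi r0 r1 N : R) : holo f -> `|psi| <= ray_angle -> 0 < r0 -> r0 <= r1 ->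
  (forall r, r0 <= r <= r1 -> rnorm (f (sector_pt r psi)) <= N / r ^+ 2) ->
  rnorm (segint f (w1 + 1)%:C (sector_pt r1 psi) - segint f (w1 + 1)%:C (sector_pt r0 psi)) <= N / r0 - N / r1.
Proof.
move=> fh pt r00 r01 fK; apply: (ray_bound (f := f)) => // r rI; split; last exact: fK.
apply: holo_prim => //; apply: lsector_pt => //.
by move/andP: rI => [? ?]; lra.
Qed.

(** The scale-invariant convergence criterion: bounds at the scale [1 / tau]
    on the arc and quadratic decay beyond it on the rays. *)
Lemma sector_int_cvg f (tau N : R) : holo f -> 0 <= N -> 0 < tau ->
  (forall psi, `|psi| <= ray_angle -> rnorm (f (sector_pt tau^-1 psi)) <= N) ->
  (forall r psi, tau^-1 <= r -> `|psi| = ray_angle ->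
     rnorm (f (sector_pt r psi)) <= N / (tau * r) ^+ 2) ->
  exists L : X, [/\ sector_int f n @[n --> \oo] --> L, rnorm L <= 12 * N / tau &
    forall n : nat, tau^-1 <= n%:R -> rnorm (sector_int f n - L) <= 2 * N / (tau ^+ 2 * n%:R)].
Proof.
move=> fh N0 tau0 farc fray; have th0 := ray_angle_gt0.
have ti0 : 0 < tau^-1 by rewrite invr_gt0.
have tne : tau != 0 by rewrite gt_eqF.
pose Phi := segint f (w1 + 1)%:C.
have ray psi r0 r1 : `|psi| = ray_angle -> tau^-1 <= r0 -> r0 <= r1 ->
    rnorm (Phi (sector_pt r1 psi) - Phi (sector_pt r0 psi)) <= N / tau ^+ 2 / r0 - N / tau ^+ 2 / r1.
  move=> pt r0t r01; have r00 : 0 < r0 by lra.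
  apply: holo_ray => //; first by rewrite pt.
  move=> r /andP[r0r rr1]; apply: le_trans (fray r psi _ pt) _; first by lra.
  by rewrite exprMn invfM mulrA.
have tabs : `|ray_angle| = ray_angle by rewrite ger0_norm// ltW.
have tabsN : `|- ray_angle| = ray_angle by rewrite normrN.
have step (n m : nat) : tau^-1 <= n%:R -> (n <= m)%N ->
    rnorm (sector_int f m - sector_int f n) <= 2 * N / (tau ^+ 2 * n%:R).
  move=> tn nm; have nm' : n%:R <= m%:R :> R by rewrite ler_nat.
  rewrite (_ : sector_int f m - sector_int f n = (Phi (sector_pt m%:R ray_angle) - Phi (sector_pt n%:R ray_angle)) -
     (Phi (sector_pt m%:R (- ray_angle)) - Phi (sector_pt n%:R (- ray_angle)))); last by rewrite /sector_int -/Phi; module.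
  apply: le_trans (rnormD _ _) _; rewrite rnormN.
  have := ray _ _ _ tabs tn nm'; have := ray _ _ _ tabsN tn nm'.
  have n0 : 0 < n%:R :> R by lra.
  have : 0 <= N / tau ^+ 2 / m%:R by rewrite !divr_ge0// exprn_ge0// ltW.
  rewrite (_ : 2 * N / (tau ^+ 2 * n%:R) = 2 * (N / tau ^+ 2 / n%:R)); last by rewrite invfM; ring.
  by lra.
have t2 : 0 < tau ^+ 2 by rewrite exprn_gt0.
have large (e : R) : 0 < e -> exists n : nat, tau^-1 <= n%:R /\ 2 * N / (tau ^+ 2 * n%:R) < e.
  move=> e0; exists (Num.bound (tau^-1 + 2 * N / (tau ^+ 2 * e))).
  set b := tau^-1 + _; have b0 : 0 < b.
    by rewrite /b ltr_pwDl// divr_ge0 ?mulr_ge0// ltW.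
  have hb : b < (Num.bound b)%:R by exact: archi_boundP (ltW b0).
  have q0 : 0 <= 2 * N / (tau ^+ 2 * e) by rewrite divr_ge0 ?mulr_ge0// ltW.
  split; first by move: hb; rewrite {1}/b; lra.
  have nb : 2 * N / (tau ^+ 2 * e) < (Num.bound b)%:R by move: hb; rewrite {1}/b; lra.
  have bn0 : 0 < (Num.bound b)%:R :> R by lra.
  rewrite ltr_pdivrMr ?mulr_gt0//.
  by move: nb; rewrite ltr_pdivrMr ?mulr_gt0//; lra.
have /cvg_ex[L cL] : cvg (sector_int f n @[n --> \oo]).
  apply: rnorm_cauchy => e e0.
  have [n [tn ne]] := large (e / 2) (divr_gt0 e0 (ltr0n R 2)).
  exists n => k m nk nm; apply: le_lt_trans (rdist_triangle (sector_int f n) _ _) _.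
  by rewrite (rdistC (sector_int f n)); have := step _ _ tn nk; have := step _ _ tn nm; lra.
have cLn (n : nat) : tau^-1 <= n%:R -> rnorm (sector_int f n - L) <= 2 * N / (tau ^+ 2 * n%:R).
  move=> tn; rewrite rdistC; apply: (rnorm_lim_le cL); exists n => m nm.
  exact: step.
exists L; split => //.
rewrite -[L]subr0; apply: rnorm_lim_le cL _.
have [n [tn _]] := large 1 ltr01; exists n => m nm.
have tm : tau^-1 <= m%:R by apply: le_trans tn _; rewrite ler_nat.
rewrite subr0 (_ : sector_int f m = (Phi (sector_pt m%:R ray_angle) - Phi (sector_pt tau^-1 ray_angle)) +
   ((Phi (sector_pt tau^-1 ray_angle) - Phi (sector_pt tau^-1 (- ray_angle))) -
    (Phi (sector_pt m%:R (- ray_angle)) - Phi (sector_pt tau^-1 (- ray_angle))))); last by rewrite /sector_int -/Phi; module.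
apply: le_trans (rnormD _ _) _; apply: le_trans (lerD (lexx _) (rnormD _ _)) _.
rewrite rnormN.
have a1 := ray _ _ _ tabs (lexx _) tm; have a2 := ray _ _ _ tabsN (lexx _) tm.
have m0 : 0 < m%:R :> R by lra.
have q0 : 0 <= N / tau ^+ 2 / m%:R by rewrite !divr_ge0// exprn_ge0// ltW.
have a3 : rnorm (Phi (sector_pt tau^-1 ray_angle) - Phi (sector_pt tau^-1 (- ray_angle))) <=
    N * tau^-1 * (ray_angle - - ray_angle).
  apply: holo_arc => //; [exact: ltW|lra|].
  by move=> psi pI; apply: farc; rewrite ler_norml.
rewrite (_ : N / tau ^+ 2 / tau^-1 = N / tau) in a1 a2; last by field.
have pi4 := @pi_le4 R; have tp := ray_angle_ltpi.
have M0 : 0 <= N / tau by rewrite divr_ge0// ltW.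
have : N / tau * (ray_angle - - ray_angle) <= N / tau * 8 by apply: ler_wpM2l => //; lra.
by rewrite -mulrA; move: a1 a2 a3 q0; lra.
Qed.

(** A Jordan-type lemma: the integral over the large arc is small as soon as
    the integrand is small away from the vertical directions. *)
Lemma sector_int_jordan f (n : nat) (d K1 K2 K3 : R) : holo f -> 0 < d -> d < eta / 2 ->
  0 <= K1 -> 0 <= K3 ->
  (forall psi, `|psi| <= pi / 2 - d -> rnorm (f (sector_pt n%:R psi)) <= K1) ->
  (forall psi, pi / 2 - d <= `|psi| <= pi / 2 + d -> rnorm (f (sector_pt n%:R psi)) <= K2) ->
  (forall psi, pi / 2 + d <= `|psi| <= ray_angle -> rnorm (f (sector_pt n%:R psi)) <= K3) ->
  rnorm (sector_int f n) <= n%:R * (4 * K1 + 4 * d * K2 + 4 * K3).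
Proof.
move=> fh d0 de K10 K30 f1 f2 f3.
have pi4 := @pi_le4 R; have p0 := pi_gt0 R; have p2 := @pi_ge2 R.
move/andP: (etaI) => [e0 e1].
pose Phi := segint f (w1 + 1)%:C.
have tE : ray_angle = pi / 2 + eta / 2 by [].
have n0 : 0 <= n%:R :> R by [].
have arc x y K : - ray_angle <= x -> x <= y -> y <= ray_angle ->
    (forall psi, x <= psi <= y -> rnorm (f (sector_pt n%:R psi)) <= K) ->
    rnorm (Phi (sector_pt n%:R y) - Phi (sector_pt n%:R x)) <= K * n%:R * (y - x).
  by move=> *; apply: holo_arc.
have b1 : rnorm (Phi (sector_pt n%:R (pi / 2 - d)) - Phi (sector_pt n%:R (- (pi / 2 - d)))) <=
    K1 * n%:R * ((pi / 2 - d) - - (pi / 2 - d)).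
  by apply: arc; [(clear -tE d0 de e0 e1 p0 p2 pi4; lra)|(clear -tE d0 de e0 e1 p0 p2 pi4; lra)|(clear -tE d0 de e0 e1 p0 p2 pi4; lra)|move=> psi pI; apply: f1; rewrite ler_norml].
have b2 : rnorm (Phi (sector_pt n%:R (pi / 2 + d)) - Phi (sector_pt n%:R (pi / 2 - d))) <=
    K2 * n%:R * ((pi / 2 + d) - (pi / 2 - d)).
  apply: arc; [(clear -tE d0 de e0 e1 p0 p2 pi4; lra)|(clear -tE d0 de e0 e1 p0 p2 pi4; lra)|(clear -tE d0 de e0 e1 p0 p2 pi4; lra)|move=> psi /andP[q1 q2]; apply: f2].
  by rewrite ger0_norm; [apply/andP; split|]; clear -tE d0 de e0 e1 p0 p2 pi4 q1 q2; lra.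
have b3 : rnorm (Phi (sector_pt n%:R (- (pi / 2 - d))) - Phi (sector_pt n%:R (- (pi / 2 + d)))) <=
    K2 * n%:R * (- (pi / 2 - d) - - (pi / 2 + d)).
  apply: arc; [(clear -tE d0 de e0 e1 p0 p2 pi4; lra)|(clear -tE d0 de e0 e1 p0 p2 pi4; lra)|(clear -tE d0 de e0 e1 p0 p2 pi4; lra)|move=> psi /andP[q1 q2]; apply: f2].
  by rewrite ler0_norm; [apply/andP; split|]; clear -tE d0 de e0 e1 p0 p2 pi4 q1 q2; lra.
have b4 : rnorm (Phi (sector_pt n%:R ray_angle) - Phi (sector_pt n%:R (pi / 2 + d))) <=
    K3 * n%:R * (ray_angle - (pi / 2 + d)).
  apply: arc; [(clear -tE d0 de e0 e1 p0 p2 pi4; lra)|(clear -tE d0 de e0 e1 p0 p2 pi4; lra)|(clear -tE d0 de e0 e1 p0 p2 pi4; lra)|move=> psi /andP[q1 q2]; apply: f3].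
  by rewrite ger0_norm; [apply/andP; split|]; clear -tE d0 de e0 e1 p0 p2 pi4 q1 q2; lra.
have b5 : rnorm (Phi (sector_pt n%:R (- (pi / 2 + d))) - Phi (sector_pt n%:R (- ray_angle))) <=
    K3 * n%:R * (- (pi / 2 + d) - - ray_angle).
  apply: arc; [(clear -tE d0 de e0 e1 p0 p2 pi4; lra)|(clear -tE d0 de e0 e1 p0 p2 pi4; lra)|(clear -tE d0 de e0 e1 p0 p2 pi4; lra)|move=> psi /andP[q1 q2]; apply: f3].
  by rewrite ler0_norm; [apply/andP; split|]; clear -tE d0 de e0 e1 p0 p2 pi4 q1 q2; lra.
rewrite (_ : sector_int f n = (Phi (sector_pt n%:R ray_angle) - Phi (sector_pt n%:R (pi / 2 + d))) +
  ((Phi (sector_pt n%:R (pi / 2 + d)) - Phi (sector_pt n%:R (pi / 2 - d))) +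
  ((Phi (sector_pt n%:R (pi / 2 - d)) - Phi (sector_pt n%:R (- (pi / 2 - d)))) +
  ((Phi (sector_pt n%:R (- (pi / 2 - d))) - Phi (sector_pt n%:R (- (pi / 2 + d)))) +
   (Phi (sector_pt n%:R (- (pi / 2 + d))) - Phi (sector_pt n%:R (- ray_angle))))))); last by rewrite /sector_int -/Phi; module.
apply: le_trans (rnormD _ _) _; apply: le_trans (lerD b4 (rnormD _ _)) _.
apply: le_trans (lerD (lexx _) (lerD b2 (rnormD _ _))) _.
apply: le_trans (lerD (lexx _) (lerD (lexx _) (lerD b1 (rnormD _ _)))) _.
apply: le_trans (lerD (lexx _) (lerD (lexx _) (lerD (lexx _) (lerD b3 b5)))) _.
have c1 : n%:R * K1 * (pi - 2 * d) <= n%:R * K1 * 4 by apply: ler_wpM2l; [exact: mulr_ge0|clear -tE d0 de e0 e1 p0 p2 pi4; lra].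
have c3 : n%:R * K3 * (eta - 2 * d) <= n%:R * K3 * 4 by apply: ler_wpM2l; [exact: mulr_ge0|clear -tE d0 de e0 e1 p0 p2 pi4; lra].
by rewrite tE; move: c1 c3; lra.
Qed.

End Valued.
End Contour.

(** * The residue at the origin *)

Section Rates.
Context {R : realType}.

Lemma pow_exp_bound (k : nat) (kappa : R) : 0 < kappa -> exists C : R, 0 < C /\
  forall v : R, 0 <= v -> v ^+ k * expR (- (kappa * v)) <= C.
Proof.
move=> k0; case: k => [|k].
  exists 1; split=> // v v0; rewrite expr0 mul1r -expR0 ler_expR oppr_le0.
  by rewrite mulr_ge0// ltW.
exists (k.+1`!%:R / kappa ^+ k.+1); split.
  by rewrite divr_gt0 ?exprn_gt0// ltr0n fact_gt0.
move=> v v0; have kv : 0 <= kappa * v by rewrite mulr_ge0// ltW.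
have := expR_ge1Dxn k kv; rewrite exprMn => h.
have F0 : 0 < k.+1`!%:R :> R by rewrite ltr0n fact_gt0.
have K0 : 0 < kappa ^+ k.+1 by rewrite exprn_gt0.
rewrite expRN ler_pdivrMr ?expR_gt0// mulrAC ler_pdivlMr// -ler_pdivrMl//.
by rewrite mulrC [v ^+ _ * _]mulrC; lra.
Qed.

Lemma cvg_rate {X : normedModType R[i]} (u : nat -> X) (x : X) (C : R) (N0 : nat) :
  (forall n, (N0 <= n)%N -> (0 < n)%N -> rnorm (u n - x) <= C / n%:R) ->
  u n @[n --> \oo] --> x.
Proof.
move=> h; apply/cvg_rnorm => e e0.
exists (maxn N0 (Num.bound (`|C| / e))) => n; rewrite geq_max => /andP[n1 n2].
have c0 : 0 <= `|C| / e by rewrite divr_ge0// ltW.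
have hb : `|C| / e < (Num.bound (`|C| / e))%:R by exact: archi_boundP.
have hn : `|C| / e < n%:R by apply: lt_le_trans hb _; rewrite ler_nat.
have n0 : 0 < n%:R :> R by lra.
apply: le_lt_trans (h n n1 _) _; first by rewrite -(@ltr0n R).
rewrite ltr_pdivrMr//; move: hn; rewrite ltr_pdivrMr// mulrC => hn.
by apply: le_lt_trans hn; exact: ler_norm.
Qed.

End Rates.

Section Arcs.
Context {R : realType}.

Lemma cos_arc (eta a : R) : 0 < eta < pi / 2 -> `|a| <= ray_angle eta ->
  sin (eta / 2) * cos eta <= cos (`|a| - eta).
Proof.
move=> etaI; rewrite /ray_angle => at_; have [c0 s0] := cos_sin_pos etaI.
move/andP: (etaI) => [e0 e1]; have ai := normr_ge0 a; have p0 := pi_gt0 R.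
have kI : 0 < eta / 2 < pi / 2 by apply/andP; split; lra.
have [_ k0] := cos_sin_pos kI.
have [ae|ea] := leP `|a| eta.
  rewrite -(cosN (`|a| - eta)) opprB; apply: (@le_trans _ _ (cos eta)).
    by apply: ler_piMl; [exact: ltW|apply: le_trans (ler_norm _) _; exact: sin_max].
  by apply: cos_nincr; lra.
apply: (@le_trans _ _ (sin (eta / 2))).
  by apply: ler_piMr; [exact: ltW|apply: le_trans (ler_norm _) _; exact: cos_max].
rewrite -cosBpihalf -(cosN (eta / 2 - _)) opprB.
by apply: cos_nincr; lra.
Qed.

Lemma norm_between (a b s th k : R) : 0 <= s <= 1 -> a <= b -> 0 <= a * b ->
  th <= `|a| -> th <= `|b| -> `|a| <= k -> `|b| <= k -> th <= `|a + s * (b - a)| <= k.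
Proof.
move=> /andP[s0 s1] ab abs; have [a0|a0] := leP 0 a.
  have b0 : 0 <= b by exact: le_trans ab.
  have c0 : 0 <= a + s * (b - a) by nra.
  by rewrite !ger0_norm// => *; apply/andP; split; nra.
have b0 : b <= 0 by rewrite -(nmulr_rge0 _ a0).
have c0 : a + s * (b - a) <= 0 by nra.
by rewrite !ler0_norm ?(ltW a0)// => *; apply/andP; split; nra.
Qed.

End Arcs.

Section Residue.
Context {R : realType}.
Variables (w1 omega eta : R).
Hypothesis w1_gt0 : 0 < w1.
Hypothesis w1_lt : w1 < omega.
Hypothesis etaI : 0 < eta < pi / 2.
Context {X : completeNormedModType R[i]}.
Variables (x : X) (t : R).
Hypothesis t_gt0 : 0 < t.

Local Notation U := (lsector w1 eta).
Local Notation theta := (ray_angle eta).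
Let h (w : R[i]) : X := cexp (t%:C * cexp w) *: x.
Let E (w : R[i]) : X := segint h 0 w.

Lemma cderiv_cexp_lin (a z : R[i]) :
  cderiv (fun w : R[i] => cexp (a * w)) z (a * cexp (a * z)).
Proof.
have d1 := cderivZ a (cderiv_id z).
apply: cderiv_eq (cderiv_comp d1 (cderiv_cexp (a * z))).
by rewrite /GRing.scale /= mulr1.
Qed.

Let E_prim w : cderiv E w (h w).
Proof.
apply: (@star_primitive _ _ h setT 0) => //; first by move=> z _; exists 1.
move=> z _; have d1 := cderivZ t%:C (cderiv_cexp z).
have d2 := cderiv_comp d1 (cderiv_cexp (t%:C * cexp z)).
by have d3 := cderiv_mul d2 (cderiv_cst x z); eexists; exact: d3.
Qed.

Let cexp_pi (w : R[i]) : cexp (w + 'i * pi%:C) = cexp (w - 'i * pi%:C).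
Proof.
rewrite !cexpD; congr (_ * _); rewrite /cexp /cis.
rewrite !(ReN, ImN, ReM, ImM) /= !(mul0r, mulr0, mul1r, subr0, add0r, oppr0).
by rewrite cosN sinN !cospi !sinpi oppr0.
Qed.

Let ipi (a : R) : rnorm ('i * a%:C : R[i]) = `|a|.
Proof. by rewrite rnormM rnorm_i mul1r rnormR. Qed.

Let vert (u a b : R) : u%:C + 'i * b%:C - (u%:C + 'i * a%:C) = 'i * (b - a)%:C :> R[i].
Proof. by rewrite !rcE; ring. Qed.

Let vert_seg (u a b s : R) : u%:C + 'i * a%:C + s%:C * (u%:C + 'i * b%:C - (u%:C + 'i * a%:C)) =
  u%:C + 'i * (a + s * (b - a))%:C :> R[i].
Proof. by rewrite !rcE; ring. Qed.

Let cexp_vert (u a : R) : cexp (u%:C + 'i * a%:C) = (expR u)%:C * cis a :> R[i].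
Proof.
rewrite /cexp !(ReD, ImD, ReM, ImM) /=.
by rewrite !(mul0r, mulr0, mul1r, subr0, add0r, addr0).
Qed.

(* e^(t e^w) has period 2 pi i, so this increment of its primitive does not
   depend on w; letting Re w tend to -oo evaluates it. *)
Let period w : E (w + 'i * pi%:C) - E (w - 'i * pi%:C) = (2 * 'i * pi%:C) *: x.
Proof.
pose Psi (w : R[i]) := E (w + 'i * pi%:C) - E (w - 'i * pi%:C).
have shift (a z : R[i]) : cderiv (fun w => E (w + a)) z (h (z + a)).
  have d1 : cderiv (fun w : R[i] => w + a) z (1 + 0 : R[i]).
    by apply: cderivD; [exact: cderiv_id|exact: cderiv_cst].
  apply: cderiv_eq (cderiv_comp d1 (E_prim (z + a))).
  by rewrite addr0 scale1r.
have dPsi z : cderiv Psi z 0.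
  apply: cderiv_eq (cderivB (shift ('i * pi%:C) z) (shift (- ('i * pi%:C)) z)).
  by rewrite /h cexp_pi subrr.
have Pconst z z' : Psi z = Psi z'.
  apply/eqP; rewrite -subr_eq0; apply/eqP/rnorm_small => e e0.
  apply: le_trans (ltW e0); rewrite -[leRHS](mul0r (rnorm (z - z'))).
  apply: (segment_bound (Phi := Psi) (f := fun=> 0)) => s _; split; first exact: dPsi.
  by rewrite rnorm0.
rewrite -/(Psi w); apply/eqP; rewrite -subr_eq0; apply/eqP/rnorm_small => e e0.
have nx := rnorm_ge0 x; have p0 := pi_gt0 R.
pose A := (rnorm x + 1) * (4 * t * expR (2 * t)) * (2 * pi).
have A0 : 0 < A by rewrite !mulr_gt0 ?expR_gt0//; lra.
pose dl := Num.min 1 (e / A).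
have dl0 : 0 < dl by rewrite lt_min ltr01 divr_gt0.
have dl1 : dl <= 1 by rewrite ge_min lexx.
have dle : dl * A <= e by rewrite -ler_pdivlMr// ge_min lexx orbT.
pose u := ln dl; have Eu : expR u = dl by rewrite lnK// posrE.
rewrite (Pconst w u%:C) /Psi.
have -> : E (u%:C + 'i * pi%:C) - E (u%:C - 'i * pi%:C) - (2 * 'i * pi%:C) *: x =
   (E (u%:C + 'i * pi%:C) + (u%:C + 'i * pi%:C) *: (- x)) -
   (E (u%:C + 'i * (- pi)%:C) + (u%:C + 'i * (- pi)%:C) *: (- x)).
  have -> : u%:C - 'i * pi%:C = u%:C + 'i * (- pi)%:C :> R[i] by rewrite rcN; ring.
  by module; rewrite rcN; ring.
have dE z : cderiv (fun w => E w + w *: (- x)) z (h z - x).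
  apply: cderiv_eq (cderivD (E_prim z) (cderiv_mul (cderiv_id z) (cderiv_cst (- x) z))).
  by rewrite scaler0 addr0 scale1r.
apply: le_trans (segment_bound (Phi := fun w => E w + w *: (- x))
  (f := fun z => h z - x) (a := u%:C + 'i * (- pi)%:C) (b := u%:C + 'i * pi%:C) (K := (rnorm x + 1) * (4 * t * expR (2 * t)) * dl) _) _.
  move=> s _; split; first exact: dE.
  rewrite vert_seg /h cexp_vert Eu.
  rewrite (_ : _ *: x - x = (cexp (t%:C * (dl%:C * cis (- pi + s * (pi - - pi)))) - 1) *: x); last by module.
  rewrite rnormZ; set w' := t%:C * _.
  have nw : rnorm w' = t * dl.
    by rewrite /w' !rnormM !rnormR rnorm_cis mulr1 !ger0_norm// ltW.
  have := cexp_sub_le w'; rewrite nw => hw.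
  have EE : expR (2 * (t * dl)) <= expR (2 * t).
    by rewrite ler_expR ler_pM2l//; apply: ler_piMr => //; exact: ltW.
  have : rnorm (cexp w' - 1) <= 4 * t * dl * expR (2 * t).
    apply: le_trans hw _; rewrite (_ : 4 * (t * dl) = 4 * t * dl); last by ring.
    by apply: ler_wpM2l => //; rewrite !mulr_ge0// ltW.
  have -> : (rnorm x + 1) * (4 * t * expR (2 * t)) * dl =
    (4 * t * dl * expR (2 * t)) * (rnorm x + 1) by ring.
  by move=> h1; apply: ler_pM => //; [exact: rnorm_ge0|lra].
by rewrite vert ipi ger0_norm; [move: dle; rewrite /A; lra|lra].
Qed.

Let contour_rearrange (p1 p2 a b c d e e' : X) : a - b = c - d ->
  p1 - p2 - (e - e') = (p1 - a) - (p2 - b) - (e - c) - (d - e').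
Proof. by move=> abcd; transitivity (p1 - p2 - (e - e') - (a - b) + (c - d)); [rewrite abcd; module|module]. Qed.

Let f (z : R[i]) : X := (cexp (t%:C * z) / z) *: x.

Let U_neq0 z : U z -> z != 0.
Proof.
move=> Uz; apply/eqP => z0; have := lsector_rnorm etaI Uz.
have [c0 _] := cos_sin_pos etaI.
by rewrite z0 rnorm0 ltNge; rewrite mulr_ge0// ltW.
Qed.

Lemma holo_residue : holo w1 eta f.
Proof.
move=> z Uz.
have d1 := cderiv_mul (cderiv_cexp_lin t%:C z) (cderiv_inv (U_neq0 Uz)).
by have d2 := cderiv_mul d1 (cderiv_cst x z); eexists; exact: d2.
Qed.

(** The substitution [l = e^w] turns the arc of radius [n] into a vertical segment
    and the integrand into the entire function [e^(t e^w)], whose increment over a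
    period is known. Only the parts of the period beyond [theta] and the shift of
    the vertex from [omega] to [0] remain, and there the integrand is
    exponentially small in [n]. *)
Lemma sector_int_residue : sector_int w1 omega eta f n @[n --> \oo] --> (2 * 'i * pi%:C) *: x.
Proof.
have [c0 s0] := cos_sin_pos etaI; have nx := rnorm_ge0 x.
have p0 := pi_gt0 R; move/andP: (etaI) => [e0 e1].
have kI : 0 < eta / 2 < pi / 2 by apply/andP; split; lra.
have [_ k0] := cos_sin_pos kI; set kappa := sin (eta / 2) in k0.
have costh : cos theta = - kappa by rewrite /ray_angle addrC cosDpihalf.
pose Phi := segint f (w1 + 1)%:C.
have dPhi z : U z -> cderiv Phi z (f z) by apply: holo_prim => //; exact: holo_residue.
have th0 := ray_angle_gt0 etaI; have thpi := ray_angle_ltpi etaI.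
pose n0 := Num.bound (w1 / kappa).
have hn0 (n : nat) : (n0 <= n)%N -> w1 < n%:R * kappa.
  move=> n0n; rewrite -ltr_pdivrMr//.
  apply: lt_le_trans (_ : n0%:R <= _); last by rewrite ler_nat.
  by apply: archi_boundP; rewrite divr_ge0// ltW.
pose C := rnorm x * expR (t * omega) / (w1 * cos eta) * omega.
have wc0 : 0 < w1 * cos eta by exact: mulr_gt0.
have om0 : 0 < omega by exact: lt_trans w1_lt.
have C0 : 0 <= C.
  by apply: mulr_ge0; [apply: divr_ge0; [apply: mulr_ge0 => //; exact: expR_ge0|exact: ltW]|exact: ltW].
pose M := (2 * C + 2 * pi * rnorm x) / (kappa * t).
apply: (@cvg_rate _ _ _ _ M (maxn n0 1)) => n; rewrite geq_max => /andP[n0n n1] _.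
have nn0 : 0 < n%:R :> R by rewrite ltr0n.
pose u : R := ln n%:R.
have Eu : expR u = n%:R by rewrite lnK// posrE.
pose eps := expR (- (kappa * t * n%:R)).
have Uarc (a s : R) : 0 <= s -> `|a| <= theta -> U (s%:C + n%:R%:C * cis a).
  move=> s00 at_; rewrite /lsector /= !(mul0r, mulr0, subr0, addr0, add0r).
  rewrite normrM (@ger0_norm _ n%:R)//.
  rewrite (_ : _ + _ = s * cos eta + (n%:R * (cos a * cos eta + `|sin a| * sin eta) - w1 * cos eta)); last by ring.
  rewrite cos_abs_shift; last by lra.
  have ck : kappa * cos eta <= cos (`|a| - eta) by exact: cos_arc.
  rewrite ltr_wpDl ?mulr_ge0 ?(ltW c0)// subr_gt0.
  apply: lt_le_trans (ler_wpM2l (ltW nn0) ck).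
  by rewrite mulrA ltr_pM2r//; exact: hn0.
have far (a s : R) : `|a| = theta -> 0 <= s <= omega ->
    rnorm (f (s%:C + n%:R%:C * cis a)) <= rnorm x * expR (t * omega) / (w1 * cos eta) * eps.
  move=> at_ /andP[s00 so]; rewrite /f rnormZ rnormM rnormV rnorm_cexp.
  have Uz : U (s%:C + n%:R%:C * cis a) by apply: Uarc => //; rewrite at_.
  have := lsector_rnorm etaI Uz; set z := _ + _ => wz.
  have Rz : complex.Re (t%:C * z) = t * (s - kappa * n%:R).
    rewrite ReM /z /= !(mul0r, mulr0, subr0, addr0, add0r).
    by rewrite -cos_norm at_ costh; ring.
  rewrite Rz.
  have h1 : expR (t * (s - kappa * n%:R)) <= expR (t * omega) * eps.
    by rewrite -expRD ler_expR; have := ler_wpM2l (ltW t_gt0) so; lra.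
  have h2 : (rnorm z)^-1 <= (w1 * cos eta)^-1 by rewrite lef_pV2 ?posrE//; [exact: ltW|exact: lt_trans wz].
  rewrite mulrC -!mulrA; apply: ler_wpM2l => //; rewrite mulrA mulrAC.
  by apply: ler_pM => //; rewrite ?invr_ge0 ?rnorm_ge0 ?expR_ge0.
(* the shift of the vertex from [omega] to [0] *)
have close a : `|a| = theta -> rnorm (Phi (sector_pt omega n%:R a) - Phi (0%:C + n%:R%:C * cis a)) <= C * eps.
  move=> at_; pose q : R[i] := 0%:C + n%:R%:C * cis a.
  have E1 : sector_pt omega n%:R a - q = omega%:C by rewrite /sector_pt /q rc0; ring.
  rewrite (_ : C * eps = rnorm x * expR (t * omega) / (w1 * cos eta) * eps * rnorm (sector_pt omega n%:R a - q)); last first.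
    by rewrite E1 rnormR gtr0_norm// /C; ring.
  apply: (segment_bound (f := f)) => s /andP[s00 s1].
  rewrite E1 (_ : q + s%:C * omega%:C = (s * omega)%:C + n%:R%:C * cis a); last by rewrite /q !rcE; ring.
  split; first by apply/dPhi/Uarc; [rewrite mulr_ge0// ltW|rewrite at_].
  by apply: far => //; apply/andP; split; [rewrite mulr_ge0// ltW|apply: ler_piMl => //; exact: ltW].
(* both sides are primitives along the arc of radius [n = e^u] *)
have logE : Phi (0%:C + n%:R%:C * cis theta) - Phi (0%:C + n%:R%:C * cis (- theta)) =
    E (u%:C + 'i * theta%:C) - E (u%:C + 'i * (- theta)%:C).
  pose Th (w : R[i]) := Phi (cexp w) - E w.
  suff : Th (u%:C + 'i * theta%:C) - Th (u%:C + 'i * (- theta)%:C) = 0.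
    rewrite /Th !cexp_vert Eu !rc0 !add0r => hT.
    by apply/eqP; rewrite -subr_eq0; apply/eqP; rewrite -[RHS]hT; module.
  apply: rnorm_small => e e0'; apply: le_trans (ltW e0').
  rewrite -[leRHS](mul0r (rnorm (u%:C + 'i * theta%:C - (u%:C + 'i * (- theta)%:C)))).
  apply: (segment_bound (Phi := Th) (f := fun=> 0)) => s /andP[s00 s1]; split; last by rewrite rnorm0.
  rewrite vert_seg; set a := - theta + _; set w := _ + _.
  have aI : `|a| <= theta by rewrite ler_norml /a; apply/andP; split; nra.
  have Uw : U (cexp w).
    by rewrite /w cexp_vert Eu -[X in U X]add0r -rc0; apply: Uarc.
  apply: cderiv_eq (cderivB (cderiv_comp (cderiv_cexp w) (dPhi _ Uw)) (E_prim w)).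
  by rewrite /f /h scalerA mulrC divfK ?subrr// cexp_neq0.
(* beyond [theta] the real part of [e^w] is at most [- kappa n] *)
have edge a b : a <= b -> theta <= `|a| -> theta <= `|b| -> `|a| <= pi -> `|b| <= pi -> 0 <= a * b ->
    rnorm (E (u%:C + 'i * b%:C) - E (u%:C + 'i * a%:C)) <= rnorm x * eps * (b - a).
  move=> ab ta tb api bpi abs.
  apply: le_trans (segment_bound (f := h) (K := rnorm x * eps) _) _.
    move=> s /andP[s00 s1]; split; first exact: E_prim.
    rewrite vert_seg /h cexp_vert Eu rnormZ rnorm_cexp mulrC; apply: ler_wpM2l => //.
    rewrite ler_expR !ReM /= !(mul0r, mulr0, subr0).
    set c := a + _.
    have cI : theta <= `|c| <= pi by apply: norm_between => //; rewrite s00.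
    move/andP: cI => [tc cpi].
    have : cos c <= - kappa by rewrite -cos_norm -costh; apply: cos_nincr => //; exact: ltW.
    move=> hc; have := ler_wpM2l (ltW nn0) hc => h1; have := ler_wpM2l (ltW t_gt0) h1.
    by rewrite (_ : t * (n%:R * - kappa) = - (kappa * t * n%:R)) //; ring.
  by rewrite vert ipi ger0_norm// subr_ge0.
have k1 := period u%:C.
have tabs : `|theta| = theta by rewrite ger0_norm// ltW.
have pabs : `|pi : R| = pi by rewrite ger0_norm// ltW.
have g1 : rnorm (E (u%:C + 'i * pi%:C) - E (u%:C + 'i * theta%:C)) <= rnorm x * eps * (pi - theta).
  by apply: edge; rewrite ?tabs ?pabs//; [exact: ltW|exact: ltW|exact: ltW|exact: mulr_ge0 (ltW th0) (ltW p0)].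
have g2 : rnorm (E (u%:C + 'i * (- theta)%:C) - E (u%:C + 'i * (- pi)%:C)) <= rnorm x * eps * (- theta - - pi).
  by apply: edge; rewrite ?normrN ?tabs ?pabs//; [by rewrite lerN2 ltW|exact: ltW|exact: ltW|by rewrite mulrNN; exact: mulr_ge0 (ltW p0) (ltW th0)].
have cl1 := close theta tabs.
have cl2 := close (- theta) (etrans (normrN _) tabs).
have -> : sector_int w1 omega eta f n - (2 * 'i * pi%:C) *: x =
    (Phi (sector_pt omega n%:R theta) - Phi (0%:C + n%:R%:C * cis theta)) -
    (Phi (sector_pt omega n%:R (- theta)) - Phi (0%:C + n%:R%:C * cis (- theta))) -
    (E (u%:C + 'i * pi%:C) - E (u%:C + 'i * theta%:C)) -
    (E (u%:C + 'i * (- theta)%:C) - E (u%:C + 'i * (- pi)%:C)).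
  have -> : u%:C + 'i * (- pi)%:C = u%:C - 'i * pi%:C :> R[i] by rewrite rcN mulrN.
  by rewrite -k1 /sector_int -/Phi; exact: contour_rearrange logE.
apply: le_trans (rnormD _ _) _; apply: le_trans (lerD (rnormD _ _) (lexx _)) _.
apply: le_trans (lerD (lerD (rnormD _ _) (lexx _)) (lexx _)) _.
rewrite !rnormN.
have pth : pi - theta <= pi by rewrite lerBlDr lerDl ltW.
have ee : eps <= (kappa * t)^-1 / n%:R.
  have v0 : 0 < kappa * t * n%:R by rewrite !mulr_gt0.
  rewrite -invfM /eps expRN lef_pV2 ?posrE ?expR_gt0//.
  by apply: le_trans _ (expR_ge1Dx _); rewrite lerDr.
have e00 : 0 <= eps by exact: expR_ge0.
rewrite (_ : M / n%:R = (2 * C + 2 * pi * rnorm x) * ((kappa * t)^-1 / n%:R)); last by rewrite /M; ring.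
have := ler_wpM2l (_ : 0 <= 2 * C + 2 * pi * rnorm x) ee.
have xe : 0 <= rnorm x * eps by exact: mulr_ge0.
have := ler_wpM2l xe pth.
have Q0 : 0 <= 2 * C + 2 * pi * rnorm x.
  by apply: addr_ge0; [exact: mulr_ge0|apply: mulr_ge0 nx; exact: mulr_ge0 (ltW p0)].
move=> h1 /(_ Q0) h2; clear -cl1 cl2 g1 g2 h1 h2; lra.
Qed.

End Residue.

(** * Lebesgue integrals of complex-valued functions *)

Section Reflection.
Context {R : realType}.
Local Notation mu := (@lebesgue_measure R).
Variable u : R.
Let phi : measurableTypeR R -> measurableTypeR R := fun r => u - r.

Let mphi : measurable_fun [set: measurableTypeR R] phi.
Proof. by apply: measurable_funB => //; exact: measurable_cst. Qed.

Let pushforwardE (A : set R) : measurable A -> pushforward mu phi A = mu A.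
Proof.
move=> mA; apply/esym/(@lebesgue_measure_unique R (pushforward mu phi)) => //= _ [[a b]] _ <-.
rewrite /pushforward (_ : phi @^-1` _ = `[u - b, u - a[%classic).
  rewrite !lebesgue_measure_itv/= !lte_fin ltrD2l ltrN2 -!EFinB.
  by rewrite (_ : u - a - (u - b) = b - a)//; ring.
apply/seteqP; split => r /=; rewrite /phi !in_itv /= => /andP[? ?]; apply/andP; split; lra.
Qed.

Let preimE : phi @^-1` `[0, u] = `[0, u]%classic.
Proof.
by apply/seteqP; split => r /=; rewrite /phi !in_itv /= => /andP[? ?]; apply/andP; split; lra.
Qed.

Let ge0_reflect (f : R -> \bar R) : measurable_fun `[0, u] f ->
  (forall r, (0 <= f r)%E) ->
  (\int[mu]_(r in `[0%R, u]) f (u - r)%R = \int[mu]_(r in `[0%R, u]) f r)%E.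
Proof.
move=> mf f0; rewrite -[in LHS]preimE.
rewrite -(@ge0_integral_pushforward _ _ _ _ R phi mphi mu `[0, u]%classic f)//.
by apply: eq_measure_integral => //= A mA _; exact: pushforwardE.
Qed.

(** Lebesgue measure is its own image under [r |-> u - r], because the two agree on
    intervals. *)
Lemma Rintegral_reflect (f : R -> R) : measurable_fun `[0, u] f ->
  Rintegral mu `[0, u] (fun r => f (u - r)) = Rintegral mu `[0, u] f.
Proof.
move=> mf; rewrite /Rintegral; congr fine; rewrite [LHS]integralE [RHS]integralE.
have mf' : measurable_fun `[0, u] (EFin \o f) by exact/measurable_EFinP.
congr (_ - _)%E.
  rewrite -(ge0_reflect (measurable_funepos mf') (fun r => funepos_ge0 _ r)).
  by apply: eq_integral => r _; rewrite !funeposE.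
rewrite -(ge0_reflect (measurable_funeneg mf') (fun r => funeneg_ge0 _ r)).
by apply: eq_integral => r _; rewrite !funenegE.
Qed.

End Reflection.

Section ComplexIntegral.
Context {R : realType}.
Local Notation mu := (@lebesgue_measure R).
Implicit Types (D A B : set (measurableTypeR R)) (f g phi psi : R -> R[i]).

(** The taxicab modulus is additive in the real and imaginary parts, which are
    integrated separately; it costs the factor 2 in [cintegral_mul_le]. *)
Definition cint_taxicab D f : R :=
  Rintegral mu D (fun t => `|complex.Re (f t)| + `|complex.Im (f t)|).

Definition cmeasurable D phi :=
  measurable_fun D (fun t => complex.Re (phi t)) /\
  measurable_fun D (fun t => complex.Im (phi t)).

Lemma cintegrable_taxicab D f : measurable D -> cintegrable D f ->
  mu.-integrable D (EFin \o (fun t => `|complex.Re (f t)| + `|complex.Im (f t)|)).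
Proof.
move=> mD [h1 h2].
have := integrableD mD (integrable_abse h1) (integrable_abse h2).
by apply: eq_integrable => // t _.
Qed.

Lemma cint_taxicab_ge0 D f : 0 <= cint_taxicab D f.
Proof. by apply: Rintegral_ge0 => t _; rewrite addr_ge0. Qed.

Lemma cintegral_norm D f : measurable D -> cintegrable D f ->
  rnorm (cintegral D f) <= cint_taxicab D f.
Proof.
move=> mD fi; have [h1 h2] := fi.
apply: le_trans (rnorm_ReIm _) _; rewrite /cintegral /=.
have i1 : mu.-integrable D (EFin \o (fun t => `|complex.Re (f t)|)).
  by have := integrable_abse h1; apply: eq_integrable.
have i2 : mu.-integrable D (EFin \o (fun t => `|complex.Im (f t)|)).
  by have := integrable_abse h2; apply: eq_integrable.
rewrite /cint_taxicab RintegralD//.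
by apply: lerD; apply: le_normr_Rintegral.
Qed.

Lemma cintegral_comb D (c : R[i]) f g : measurable D ->
  cintegrable D f -> cintegrable D g ->
  cintegral D (fun t => c * f t + g t) = c * cintegral D f + cintegral D g.
Proof.
move=> mD [f1 f2] [g1 g2].
have Zi (a : R) (h : R -> R) : mu.-integrable D (EFin \o h) ->
    mu.-integrable D (EFin \o (fun t => a * h t)).
  by move=> /(integrableZl mD a); apply: eq_integrable.
have Di (h k : R -> R) : mu.-integrable D (EFin \o h) -> mu.-integrable D (EFin \o k) ->
    mu.-integrable D (EFin \o (fun t => h t + k t)).
  by move=> h1 /(integrableD mD h1); apply: eq_integrable.
case: c => a b; apply: complex_eq; rewrite /cintegral ?(ReD, ImD, ReM, ImM) /=.
  rewrite (@eq_Rintegral _ _ _ mu D (fun t => (a * complex.Re (f t) + (- b) * complex.Im (f t)) + complex.Re (g t))); last first.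
    by move=> t _; rewrite ReD ReM /= mulNr.
  rewrite (@RintegralD _ _ _ mu D (fun t => a * complex.Re (f t) + - b * complex.Im (f t)))//; last first.
    by apply: (Di (fun t => _) (fun t => _)); apply: Zi.
  rewrite (@RintegralD _ _ _ mu D (fun t => a * complex.Re (f t)))//; [|exact: Zi|exact: Zi].
  by rewrite !RintegralZl// mulNr.
rewrite (@eq_Rintegral _ _ _ mu D (fun t => (a * complex.Im (f t) + b * complex.Re (f t)) + complex.Im (g t))); last first.
  by move=> t _; rewrite ImD ImM.
rewrite (@RintegralD _ _ _ mu D (fun t => a * complex.Im (f t) + b * complex.Re (f t)))//; last first.
  by apply: (Di (fun t => _) (fun t => _)); apply: Zi.
rewrite (@RintegralD _ _ _ mu D (fun t => a * complex.Im (f t)))//; [|exact: Zi|exact: Zi].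
by rewrite !RintegralZl.
Qed.

Lemma cintegral_ext D f g : (forall t, D t -> f t = g t) ->
  cintegral D f = cintegral D g.
Proof.
move=> fg; rewrite /cintegral; congr (_ +i* _);
  by apply: eq_Rintegral => t; rewrite inE => /fg ->.
Qed.

Lemma cintegrable_ext D f g : measurable D -> (forall t, D t -> f t = g t) ->
  cintegrable D f -> cintegrable D g.
Proof.
move=> mD fg [f1 f2]; split.
  by apply: eq_integrable f1 => // t; rewrite inE => /fg ->.
by apply: eq_integrable f2 => // t; rewrite inE => /fg ->.
Qed.

Lemma cintegrable_mul D phi f (K : R) : measurable D -> cmeasurable D phi ->
  (forall t, D t -> rnorm (phi t) <= K) -> cintegrable D f ->
  cintegrable D (fun t => phi t * f t).
Proof.
move=> mD [p1 p2] pK fi; have [h1 h2] := fi.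
have mf1 : measurable_fun D (fun t => complex.Re (f t)) by apply/measurable_EFinP; case/integrableP: h1.
have mf2 : measurable_fun D (fun t => complex.Im (f t)) by apply/measurable_EFinP; case/integrableP: h2.
have i1 := cintegrable_taxicab mD fi.
have iK := integrableZl mD K i1.
have bnd t : D t -> K * (`|complex.Re (f t)| + `|complex.Im (f t)|) >= rnorm (phi t * f t).
  move=> Dt; rewrite rnormM; apply: ler_pM; rewrite ?rnorm_ge0 ?pK//.
  exact: rnorm_ReIm.
split.
  apply: (le_integrable mD _ _ iK).
    apply/measurable_EFinP.
    rewrite (_ : (fun t => _) = (fun t => complex.Re (phi t) * complex.Re (f t) - complex.Im (phi t) * complex.Im (f t))); last first.
      by apply/funext => t; rewrite ReM.
    by apply: measurable_funB; apply: measurable_funM.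
  move=> t Dt /=; rewrite lee_fin; apply: le_trans (Re_rnorm _) _.
  by apply: le_trans (bnd t Dt) _; exact: ler_norm.
apply: (le_integrable mD _ _ iK).
  apply/measurable_EFinP.
  rewrite (_ : (fun t => _) = (fun t => complex.Re (phi t) * complex.Im (f t) + complex.Im (phi t) * complex.Re (f t))); last first.
    by apply/funext => t; rewrite ImM.
  by apply: measurable_funD; apply: measurable_funM.
move=> t Dt /=; rewrite lee_fin; apply: le_trans (Im_rnorm _) _.
by apply: le_trans (bnd t Dt) _; exact: ler_norm.
Qed.

Lemma cintegral_mul_le D phi f (K : R) : measurable D -> cmeasurable D phi ->
  (forall t, D t -> rnorm (phi t) <= K) -> cintegrable D f ->
  rnorm (cintegral D (fun t => phi t * f t)) <= 2 * K * cint_taxicab D f.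
Proof.
move=> mD mp pK fi; have pfi := cintegrable_mul mD mp pK fi.
apply: le_trans (cintegral_norm mD pfi) _.
have i1 := cintegrable_taxicab mD fi.
rewrite /cint_taxicab -RintegralZl//; apply: le_Rintegral => //.
- exact: cintegrable_taxicab.
- by have := integrableZl mD (2 * K) i1; apply: eq_integrable.
move=> t Dt.
have h : rnorm (phi t * f t) <= K * (`|complex.Re (f t)| + `|complex.Im (f t)|).
  by rewrite rnormM; apply: ler_pM; rewrite ?rnorm_ge0 ?pK//; exact: rnorm_ReIm.
have := Re_rnorm (phi t * f t); have := Im_rnorm (phi t * f t).
by rewrite -mulrA; lra.
Qed.

Lemma cintegral_setU A B f : measurable A -> measurable B ->
  cintegrable (A `|` B) f -> [disjoint A & B]%classic ->
  cintegral (A `|` B) f = cintegral A f + cintegral B f.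
Proof.
move=> mA mB [f1 f2] AB.
by apply: complex_eq; rewrite /cintegral ?(ReD, ImD) /= Rintegral_setU.
Qed.

Lemma cintegrableS A B f : measurable A -> measurable B -> A `<=` B ->
  cintegrable B f -> cintegrable A f.
Proof. by move=> mA mB AB [f1 f2]; split; [apply: integrableS f1|apply: integrableS f2]. Qed.

Lemma cintegral_reflect (u : R) f : cintegrable `[0, u] f ->
  cintegral `[0, u] (fun r => f (u - r)) = cintegral `[0, u] f.
Proof.
move=> [/integrableP[/measurable_EFinP f1 _] /integrableP[/measurable_EFinP f2 _]].
rewrite /cintegral; congr (_ +i* _).
  exact: (Rintegral_reflect f1).
exact: (Rintegral_reflect f2).
Qed.

Lemma cmeasurable_cst D (c : R[i]) : cmeasurable D (fun=> c).
Proof. by split; exact: measurable_cst. Qed.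

Lemma cmeasurable_mul D phi psi : cmeasurable D phi -> cmeasurable D psi ->
  cmeasurable D (fun t => phi t * psi t).
Proof.
move=> [p1 p2] [q1 q2]; split.
  rewrite (_ : (fun t => _) = (fun t => complex.Re (phi t) * complex.Re (psi t) - complex.Im (phi t) * complex.Im (psi t))); last first.
    by apply/funext => t; rewrite ReM.
  by apply: measurable_funB; apply: measurable_funM.
rewrite (_ : (fun t => _) = (fun t => complex.Re (phi t) * complex.Im (psi t) + complex.Im (phi t) * complex.Re (psi t))); last first.
  by apply/funext => t; rewrite ImM.
by apply: measurable_funD; apply: measurable_funM.
Qed.

Lemma cmeasurableD D phi psi : cmeasurable D phi -> cmeasurable D psi ->
  cmeasurable D (fun t => phi t + psi t).
Proof.
move=> [p1 p2] [q1 q2]; split.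
  rewrite (_ : (fun t => _) = (fun t => complex.Re (phi t) + complex.Re (psi t))).
    exact: measurable_funD.
  by apply/funext => t; rewrite ReD.
rewrite (_ : (fun t => _) = (fun t => complex.Im (phi t) + complex.Im (psi t))).
  exact: measurable_funD.
by apply/funext => t; rewrite ImD.
Qed.

Lemma cmeasurable_real D (h : R -> R) : measurable_fun D h ->
  cmeasurable D (fun t => (h t)%:C).
Proof. by move=> mh; split => //=; exact: measurable_cst. Qed.

Lemma cmeasurable_cexp D (a b : R[i]) : cmeasurable D (fun t => cexp (a + b * t%:C)).
Proof.
have mE (h : R -> R) : continuous h -> measurable_fun D h.
  by move=> ch; apply: measurable_funTS; exact: continuous_measurable_fun.
have lin (p q : R) : continuous (fun t : R => p + q * t).
  move=> t; apply: cvgD; first exact: cvg_cst.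
  by apply: cvgM; [exact: cvg_cst|exact: cvg_id].
have EE t : cexp (a + b * t%:C) = (expR (complex.Re a + complex.Re b * t))%:C *
    cis (complex.Im a + complex.Im b * t).
  by rewrite /cexp ReD ImD ReM ImM /= !(mulr0, subr0, add0r).
rewrite (_ : (fun t => _) = fun t => (expR (complex.Re a + complex.Re b * t))%:C *
    cis (complex.Im a + complex.Im b * t)); last by apply/funext.
apply: cmeasurable_mul.
  apply: cmeasurable_real; apply: mE => t.
  by apply: continuous_comp; [exact: lin|exact: continuous_expR].
split => /=; apply: mE => t.
  by apply: continuous_comp; [exact: lin|exact: continuous_cos].
by apply: continuous_comp; [exact: lin|exact: continuous_sin].
Qed.

End ComplexIntegral.

(** * The kernel and its truncated transforms *)

Section Kernel.
Context {R : realType}.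
Local Notation mu := (@lebesgue_measure R).
Variable g : R -> R[i].
Hypothesis gloc : L1loc g.

(** The primitive of [g], in the form in which it enters the resolvent
    equation. *)
Definition int_kernel (u : R) : R[i] := cintegral `[0, u] (fun r => g (u - r)).

Section Fixed.
Variable t : R.
Hypothesis t_gt0 : 0 < t.

Let D : set (measurableTypeR R) := `[0, t]%classic.
Let mD : measurable D. Proof. exact: measurable_itv. Qed.
Let gD : cintegrable D g. Proof. by apply: gloc; exact: ltW. Qed.

(** Every integral over [[0, t]] below is written as the integral of [g] against a
    bounded weight; such integrals are compared by comparing the weights. *)
Definition weight (phi : R -> R[i]) := cmeasurable D phi /\
  exists K : R, forall u, 0 <= u <= t -> rnorm (phi u) <= K.

Definition weighted_int (phi : R -> R[i]) : R[i] := cintegral D (fun u => phi u * g u).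

Let inD u : D u -> 0 <= u <= t. Proof. by rewrite /D /= in_itv. Qed.

Let weight_int phi : weight phi -> cintegrable D (fun u => phi u * g u).
Proof.
by move=> [mp [K pK]]; apply: (cintegrable_mul mD mp (K := K)) => // u /inD; exact: pK.
Qed.

Lemma weighted_int_comb (c : R[i]) phi psi : weight phi -> weight psi ->
  weighted_int (fun u => c * phi u + psi u) = c * weighted_int phi + weighted_int psi.
Proof.
move=> wp wq; rewrite /weighted_int -(cintegral_comb c mD (weight_int wp) (weight_int wq)).
by apply: cintegral_ext => u _; ring.
Qed.

Lemma weighted_int_bound phi (K : R) : cmeasurable D phi ->
  (forall u, 0 <= u <= t -> rnorm (phi u) <= K) -> rnorm (weighted_int phi) <= 2 * K * cint_taxicab D g.
Proof. by move=> mp pK; apply: cintegral_mul_le => // u /inD; exact: pK. Qed.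

Lemma weight_comb (c : R[i]) phi psi : weight phi -> weight psi ->
  weight (fun u => c * phi u + psi u).
Proof.
move=> [mp [K pK]] [mq [L qL]]; split.
  by apply: cmeasurableD => //; apply: cmeasurable_mul => //; exact: cmeasurable_cst.
exists (rnorm c * K + L) => u uI; apply: le_trans (rnormD _ _) _.
by rewrite rnormM; apply: lerD; [apply: ler_wpM2l; [exact: rnorm_ge0|exact: pK]|exact: qL].
Qed.

Lemma weight_cst (c : R[i]) : weight (fun=> c).
Proof. by split; [exact: cmeasurable_cst|exists (rnorm c)]. Qed.

Let Re_exp_le (l : R[i]) (c u : R) : 0 <= c -> complex.Re l <= c -> 0 <= u <= t ->
  rnorm (cexp (l * t%:C + - l * u%:C)) <= expR (c * t).
Proof.
move=> c0 lc /andP[u0 ut]; rewrite rnorm_cexp ler_expR ReD !ReM ReN /=.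
rewrite !mulr0 !subr0.
have : complex.Re l * (t - u) <= c * (t - u) by apply: ler_wpM2r => //; lra.
by have := mulr_ge0 c0 u0; lra.
Qed.

Lemma weight_cexp (l : R[i]) : weight (fun u => cexp (l * t%:C + - l * u%:C)).
Proof.
split; first exact: cmeasurable_cexp.
exists (expR (`|complex.Re l| * t)) => u uI; apply: Re_exp_le => //.
exact: ler_norm.
Qed.

Definition step_fun (v u : R) : R[i] := (if u <= v then 1 else 0)%:C.

Lemma weight_step v : weight (step_fun v).
Proof.
split.
  apply: cmeasurable_real.
  rewrite (_ : (fun u => _) = \1_(`]-oo, v]%classic : set (measurableTypeR R))).
    by apply: measurable_indic; exact: measurable_itv.
  apply/funext => u; rewrite indicE (_ : (u \in _) = (u <= v)); first by case: ifP.
  by rewrite mem_setE /= in_itv.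
by exists 1 => u _; rewrite rnormR; case: ifP; rewrite ?normr1 ?normr0.
Qed.

(** Reflection turns the primitive of [g] into an integral against an indicator
    function. *)
Lemma int_kernel_step v : 0 <= v <= t -> int_kernel v = weighted_int (step_fun v).
Proof.
move=> /andP[v0 vt]; rewrite /int_kernel cintegral_reflect; last exact: gloc.
have E : `[0, v]%classic = D `&` [set` `[0, v]] :> set R.
  apply/seteqP; split => u; rewrite /D /= !in_itv /=; last by case.
  by move=> /andP[u0 uv]; rewrite u0 uv (le_trans uv vt).
rewrite /weighted_int /cintegral E; congr (_ +i* _).
  rewrite Rintegral_mkcondr; apply: eq_Rintegral => u; rewrite inE /D /= in_itv /= => /andP[u0 ut].
  rewrite /patch /step_fun ReM /= mul0r subr0.
  by rewrite mem_setE /= in_itv /= u0 /=; case: ifP => _; rewrite ?mul1r ?mul0r.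
rewrite Rintegral_mkcondr; apply: eq_Rintegral => u; rewrite inE /D /= in_itv /= => /andP[u0 ut].
rewrite /patch /step_fun ImM /= mul0r addr0.
by rewrite mem_setE /= in_itv /= u0 /=; case: ifP => _; rewrite ?mul1r ?mul0r.
Qed.

Lemma int_kernel_bound v : 0 <= v <= t -> rnorm (int_kernel v) <= 2 * cint_taxicab D g.
Proof.
move=> vI; rewrite int_kernel_step//; have [ms _] := weight_step v.
rewrite -[2]mulr1; apply: weighted_int_bound => // u _.
by rewrite rnormR; case: ifP; rewrite ?normr1 ?normr0.
Qed.

(** [trunc_laplace l] is [e^(l t)] times the Laplace integral of [g] truncated to [[0, t]],
    and [kernel_exp l] is the integral of [s |-> int_kernel (t - s) * e^(l s)] over [[0, t]]
    after integration by parts. *)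
Definition trunc_laplace (l : R[i]) : R[i] := weighted_int (fun u => cexp (l * t%:C + - l * u%:C)).
Definition kernel_exp (l : R[i]) : R[i] := (trunc_laplace l - int_kernel t) / l.

Lemma trunc_laplace_bound (c : R) l : 0 <= c -> complex.Re l <= c ->
  rnorm (trunc_laplace l) <= 2 * expR (c * t) * cint_taxicab D g.
Proof.
move=> c0 lc; apply: weighted_int_bound; first by have [] := weight_cexp l.
by move=> u uI; exact: Re_exp_le.
Qed.

Lemma kernel_exp_bound (c : R) l : 0 <= c -> complex.Re l <= c ->
  rnorm (kernel_exp l) <= (2 * expR (c * t) * cint_taxicab D g + 2 * cint_taxicab D g) / rnorm l.
Proof.
move=> c0 lc; rewrite rnormM rnormV; apply: ler_wpM2r; first by rewrite invr_ge0 rnorm_ge0.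
apply: le_trans (rnormD _ _) _; rewrite rnormN; apply: lerD; first exact: trunc_laplace_bound.
by apply: int_kernel_bound; rewrite lexx ltW.
Qed.

Let cderiv_trunc_laplace l : exists d, cderiv trunc_laplace l d.
Proof.
have [me [K eK]] := weight_cexp l.
have wt : weight (fun u => cexp (l * t%:C + - l * u%:C) * (t - u)%:C).
  split.
    apply: cmeasurable_mul => //; apply: cmeasurable_real.
    by apply: measurable_funB => //; exact: measurable_cst.
  exists (`|K| * t) => u uI; rewrite rnormM rnormR; apply: ler_pM; rewrite ?rnorm_ge0//.
    by apply: le_trans (eK u uI) _; exact: ler_norm.
  by move/andP: uI => [u0 ut]; rewrite ger0_norm; lra.
pose d := weighted_int (fun u => cexp (l * t%:C + - l * u%:C) * (t - u)%:C).
exists d => e e0.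
pose M := 2 * (`|K| * (3 * t ^+ 2 * expR t)) * cint_taxicab D g + 1.
have M0 : 0 < M.
  rewrite /M ltr_wpDl// mulr_ge0 ?cint_taxicab_ge0// mulr_ge0// mulr_ge0//.
  by rewrite mulr_ge0 ?expR_ge0// mulr_ge0 ?sqr_ge0.
exists (Num.min 1 (e / M)); first by rewrite lt_min ltr01 divr_gt0.
move=> w; rewrite lt_min => /andP[w1 wM]; set h := w - l in w1 wM *.
have we := weight_cexp l; have ww := weight_cexp w.
have -> : trunc_laplace w - trunc_laplace l - h *: d = weighted_int (fun u => - h * (cexp (l * t%:C + - l * u%:C) * (t - u)%:C) +
    (-1 * cexp (l * t%:C + - l * u%:C) + cexp (w * t%:C + - w * u%:C))).
  rewrite weighted_int_comb//; last exact: weight_comb.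
  rewrite weighted_int_comb// /trunc_laplace -/d; rewrite (_ : h *: d = h * d)//; ring.
apply: le_trans (weighted_int_bound (K := `|K| * (3 * t ^+ 2 * expR t) * rnorm h ^+ 2) _ _) _.
- by have [] := weight_comb (- h) wt (weight_comb (-1) we ww).
- move=> u uI.
  have -> : - h * (cexp (l * t%:C + - l * u%:C) * (t - u)%:C) +
    (-1 * cexp (l * t%:C + - l * u%:C) + cexp (w * t%:C + - w * u%:C)) =
    cexp (l * t%:C + - l * u%:C) * (cexp (h * (t - u)%:C) - 1 - h * (t - u)%:C).
    have -> : w * t%:C + - w * u%:C = (l * t%:C + - l * u%:C) + h * (t - u)%:C.
      by rewrite /h !rcE; ring.
    by rewrite [cexp (_ + h * _)]cexpD; ring.
  rewrite rnormM -mulrA; apply: ler_pM; rewrite ?rnorm_ge0//.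
    by apply: le_trans (eK u uI) _; exact: ler_norm.
  apply: le_trans (cexp_remainder _) _.
  have nh := rnorm_ge0 h; move/andP: uI => [u0 ut].
  have nv : rnorm (h * (t - u)%:C) <= rnorm h * t.
    by rewrite rnormM rnormR ger0_norm; [apply: ler_wpM2l => //; lra|lra].
  have nv0 := rnorm_ge0 (h * (t - u)%:C).
  have e1 : expR (rnorm (h * (t - u)%:C)) <= expR t.
    by rewrite ler_expR; apply: le_trans nv _; apply: ler_piMl; [exact: ltW|exact: ltW].
  rewrite (_ : 3 * t ^+ 2 * expR t * rnorm h ^+ 2 = 3 * (rnorm h * t) ^+ 2 * expR t); last by ring.
  apply: ler_pM; rewrite ?expR_ge0// ?mulr_ge0 ?sqr_ge0//.
  apply: ler_wpM2l => //; rewrite ler_pXn2r ?nnegrE ?mulr_ge0//; exact: ltW.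
have : rnorm h * M <= e by rewrite -ler_pdivlMr// ltW.
have nh := rnorm_ge0 h; rewrite /M => hM.
have := ler_wpM2r nh hM; have := sqr_ge0 (rnorm h); lra.
Qed.

Lemma cderiv_kernel_exp l : l != 0 -> exists d, cderiv kernel_exp l d.
Proof.
move=> l0; have [d dg] := cderiv_trunc_laplace l.
have d1 := cderivB dg (cderiv_cst (int_kernel t) l).
by have d2 := cderiv_mul d1 (cderiv_inv l0); eexists; exact: d2.
Qed.

(** The Riemann sums of [s |-> int_kernel (t - s) * e^(l s)] converge to [kernel_exp l],
    uniformly for bounded [l]: under the integral against [g] they are Riemann
    sums of an exponential. *)
Lemma kernel_exp_riemann (Lambda : R) : exists C : R, forall (N : nat) (l : R[i]),
  (0 < N)%N -> l != 0 -> rnorm l <= Lambda ->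
  rnorm (\sum_(j < N) (t / N%:R)%:C * (int_kernel (t - j%:R * (t / N%:R)) * cexp (l * (j%:R * (t / N%:R))%:C))
    - kernel_exp l) <= C * (t / N%:R).
Proof.
pose Q := expR (`|Lambda| * t).
pose C1 := 3 * `|Lambda| * Q * Q.
pose C2 := (1 + 4 * expR (2 * `|Lambda| * t)) * Q.
exists (2 * (C1 * t + C2) * cint_taxicab D g) => N l N0 l0 lL.
have N0' : 0 < N%:R :> R by rewrite ltr0n.
set h := t / N%:R.
have h0 : 0 < h by rewrite divr_gt0.
have Nh : N%:R * h = t by rewrite /h mulrC divfK// gt_eqF.
have ht : h <= t.
  by rewrite -[leRHS]Nh; apply: ler_peMl; [exact: ltW|rewrite ler1n].
have L0 := normr_ge0 Lambda.
have nl : rnorm l <= `|Lambda| by apply: le_trans lL _; exact: ler_norm.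
have nl0 := rnorm_ge0 l.
have nlp : 0 < rnorm l.
  by rewrite lt_neqAle rnorm_ge0 andbT eq_sym; apply: contra l0 => /eqP/rnorm_eq0->.
pose q (v : R) : R[i] := (cexp (l * v%:C) - 1) / l.
pose psum (J : nat) (u : R) : R[i] := \sum_(j < J) (h%:C * cexp (l * (j%:R * h)%:C)) * step_fun (t - j%:R * h) u.
have wpsum J : weight (psum J).
  elim: J => [|J IHJ].
    rewrite (_ : psum 0%N = fun=> 0); first exact: weight_cst.
    by apply/funext => u; rewrite /psum big_ord0.
  rewrite (_ : psum J.+1 = fun u => (h%:C * cexp (l * (J%:R * h)%:C)) * step_fun (t - J%:R * h) u + psum J u).
    by apply: weight_comb => //; exact: weight_step.
  by apply/funext => u; rewrite /psum big_ord_recr /= addrC.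
have sumE J : (J <= N)%N -> \sum_(j < J) h%:C * (int_kernel (t - j%:R * h) * cexp (l * (j%:R * h)%:C)) = weighted_int (psum J).
  elim: J => [|J IHJ] JN.
    rewrite big_ord0 /psum /weighted_int (_ : (fun u => _) = fun u => 0 * g u).
      have h1 := cintegral_mul_le mD (cmeasurable_cst D 0) (K := 0) (fun u _ => _) gD.
      apply/esym/rnorm_eq0/eqP; rewrite eq_le rnorm_ge0 andbT.
      by have := h1; rewrite mulr0 mul0r rnorm0; apply.
    by apply/funext => u; rewrite big_ord0.
  rewrite big_ord_recr /= IHJ 1?ltnW//.
  rewrite (_ : psum J.+1 = fun u => (h%:C * cexp (l * (J%:R * h)%:C)) * step_fun (t - J%:R * h) u + psum J u).
    rewrite weighted_int_comb//; last exact: weight_step.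
    rewrite -int_kernel_step; first by rewrite addrC; congr (_ + _); ring.
    have : J.+1%:R * h <= t by rewrite -[leRHS]Nh ler_pM2r// ler_nat.
    have : 0 <= J%:R * h by rewrite mulr_ge0// ltW.
    by rewrite -natr1 mulrDl mul1r => ? ?; apply/andP; split; lra.
  by apply/funext => u; rewrite /psum big_ord_recr /= addrC.
have expE (v : R) : 0 <= v <= t -> rnorm (cexp (l * v%:C)) <= Q.
  move=> /andP[v0 vt]; rewrite rnorm_cexp ler_expR ReM /= mulr0 subr0.
  have : complex.Re l <= `|Lambda| by apply: le_trans nl; apply: le_trans (Re_rnorm l); exact: ler_norm.
  move=> h1; have := ler_wpM2r v0 h1; have := ler_wpM2l L0 vt; lra.
(* one mesh interval of the exponential *)
have qstep (v k : R) : 0 <= v -> 0 <= k -> v + k <= t -> k <= h ->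
    rnorm (k%:C * cexp (l * v%:C) - (q (v + k) - q v)) <= C1 * h ^+ 2.
  move=> v0 k0 vkt kh.
  have -> : k%:C * cexp (l * v%:C) - (q (v + k) - q v) =
      - (cexp (l * v%:C) * (cexp (l * k%:C) - 1 - l * k%:C) / l).
    rewrite /q (_ : l * (v + k)%:C = l * v%:C + l * k%:C); last by rewrite rcD; ring.
    by rewrite cexpD; field.
  rewrite rnormN [rnorm (_ / l)]rnormM rnormV ler_pdivrMr// rnormM.
  have := cexp_remainder (l * k%:C); rewrite rnormM rnormR (ger0_norm k0) => hr.
  have e1 : rnorm (cexp (l * v%:C)) <= Q by apply: expE; apply/andP; split; lra.
  have e2 : expR (rnorm l * k) <= Q.
    by rewrite ler_expR; apply: ler_pM => //; lra.
  have Q0 : 0 <= Q by exact: expR_ge0.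
  apply: le_trans (ler_pM (rnorm_ge0 _) (rnorm_ge0 _) e1 hr) _.
  have k2 : k ^+ 2 <= h ^+ 2 by rewrite ler_pXn2r ?nnegrE//; lra.
  have -> : C1 * h ^+ 2 * rnorm l = Q * (3 * (rnorm l * `|Lambda| * h ^+ 2) * Q) by rewrite /C1; ring.
  apply: ler_wpM2l => //; apply: ler_pM; rewrite ?expR_ge0//.
    by apply: mulr_ge0 => //; exact: sqr_ge0.
  apply: ler_wpM2l => //; rewrite exprMn; apply: ler_pM; rewrite ?sqr_ge0//.
  by rewrite expr2; apply: ler_wpM2l.
have q1 (k : R) : 0 <= k <= h -> forall v, 0 <= v -> v + k <= t ->
    rnorm (h%:C * cexp (l * v%:C) - (q (v + k) - q v)) <= C2 * h.
  move=> /andP[k0 kh] v v0 vkt.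
  have e1 : rnorm (cexp (l * v%:C)) <= Q by apply: expE; apply/andP; split; lra.
  have Q0 : 0 <= Q by exact: expR_ge0.
  apply: le_trans (rnormD _ _) _; rewrite rnormN rnormM rnormR gtr0_norm//.
  have -> : q (v + k) - q v = cexp (l * v%:C) * ((cexp (l * k%:C) - 1) / l).
    rewrite /q (_ : l * (v + k)%:C = l * v%:C + l * k%:C); last by rewrite rcD; ring.
    by rewrite cexpD; field.
  rewrite rnormM [rnorm (_ / l)]rnormM rnormV.
  have := cexp_sub_le (l * k%:C); rewrite rnormM rnormR (ger0_norm k0) => hr.
  have h1 : rnorm (cexp (l * k%:C) - 1) / rnorm l <= 4 * expR (2 * `|Lambda| * t) * h.
    rewrite ler_pdivrMr//; apply: le_trans hr _.
    have e2 : expR (2 * (rnorm l * k)) <= expR (2 * `|Lambda| * t).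
      rewrite ler_expR -mulrA ler_pM2l//.
      by apply: ler_pM => //; lra.
    have -> : 4 * expR (2 * `|Lambda| * t) * h * rnorm l = 4 * (rnorm l * h) * expR (2 * `|Lambda| * t) by ring.
    apply: ler_pM; rewrite ?expR_ge0//; first by rewrite !mulr_ge0.
    by rewrite ler_pM2l//; apply: ler_wpM2l.
  have := ler_wpM2l (ltW h0) e1.
  have := ler_pM (rnorm_ge0 _) (mulr_ge0 (rnorm_ge0 (cexp (l * k%:C) - 1)) _) e1 h1.
  rewrite invr_ge0 => /(_ nl0) a1 a2; rewrite /C2.
  by apply: le_trans (lerD a2 a1) _; rewrite le_eqVlt; apply/orP; left; apply/eqP; ring.
have partial (J : nat) (u : R) : (J <= N)%N -> 0 <= u <= t ->
    rnorm (psum J u - q (Num.min (J%:R * h) (t - u))) <=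
      C1 * h ^+ 2 * J%:R + C2 * h * (if t - u < J%:R * h then 1 else 0).
  move=> + /andP[u0 ut]; set v := t - u.
  have v0 : 0 <= v by rewrite /v; lra.
  have vt : v <= t by rewrite /v; lra.
  have C10 : 0 <= C1 by rewrite /C1 !mulr_ge0// expR_ge0.
  have C20 : 0 <= C2 by rewrite /C2 mulr_ge0 ?expR_ge0// addr_ge0 ?mulr_ge0 ?expR_ge0.
  elim: J => [|J IHJ] JN.
    rewrite /psum big_ord0 mul0r min_l// /q mulr0 cexp0 subrr mul0r subrr rnorm0 mulr0.
    by rewrite ltNge v0 /= mulr0 addr0.
  have {}IHJ := IHJ (ltnW JN).
  have Jh0 : 0 <= J%:R * h by rewrite mulr_ge0// ltW.
  have JS : J.+1%:R * h = J%:R * h + h by rewrite -natr1 mulrDl mul1r.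
  have JSt : J.+1%:R * h <= t by rewrite -[leRHS]Nh ler_pM2r// ler_nat.
  have -> : psum J.+1 u = psum J u + (h%:C * cexp (l * (J%:R * h)%:C)) * step_fun (t - J%:R * h) u.
    by rewrite /psum big_ord_recr.
  have C1h : 0 <= C1 * h ^+ 2 by rewrite mulr_ge0// sqr_ge0.
  have sE : step_fun (t - J%:R * h) u = (if J%:R * h <= v then 1 else 0)%:C.
    by rewrite /step_fun /v; congr (_%:C); congr (if _ then _ else _); apply/idP/idP; lra.
  rewrite sE JS -natr1 mulrDr mulr1; case: (leP (J%:R * h) v) => Jv.
    have {}IHJ : rnorm (psum J u - q (J%:R * h)) <= C1 * h ^+ 2 * J%:R.
      move: IHJ; rewrite (min_l Jv) ifF ?mulr0 ?addr0//.
      by apply/negbTE; rewrite -leNgt.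
    rewrite rc1 mulr1; case: (ltP v (J%:R * h + h)) => vJ.
      rewrite mulr1.
      have vE : v = J%:R * h + (v - J%:R * h) by ring.
      have kI : 0 <= v - J%:R * h <= h by apply/andP; split; lra.
      have := q1 _ kI _ Jh0; rewrite -vE => /(_ vt) a1.
      have -> : psum J u + h%:C * cexp (l * (J%:R * h)%:C) - q v = (psum J u - q (J%:R * h)) +
        (h%:C * cexp (l * (J%:R * h)%:C) - (q v - q (J%:R * h))) by ring.
      by apply: le_trans (rnormD _ _) _; move: a1 IHJ C1h; lra.
    rewrite mulr0 addr0.
    have a1 := qstep _ _ Jh0 (ltW h0) (le_trans vJ vt) (lexx h).
    have -> : psum J u + h%:C * cexp (l * (J%:R * h)%:C) - q (J%:R * h + h) = (psum J u - q (J%:R * h)) +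
        (h%:C * cexp (l * (J%:R * h)%:C) - (q (J%:R * h + h) - q (J%:R * h))) by ring.
    by apply: le_trans (rnormD _ _) _; move: a1 IHJ; lra.
  rewrite rc0 mulr0 addr0.
  have vJ : v < J%:R * h + h by lra.
  rewrite (min_r (ltW vJ)) vJ.
  move: IHJ; rewrite (min_r (ltW Jv)) Jv => IHJ.
  by apply: le_trans IHJ _; lra.
rewrite sumE//.
have we := weight_cexp l; have wc := weight_cst 1; have wp := wpsum N.
have -> : weighted_int (psum N) - kernel_exp l = weighted_int (fun u => - l^-1 * cexp (l * t%:C + - l * u%:C) + (l^-1 * 1 + psum N u)).
  rewrite weighted_int_comb//; last exact: weight_comb.
  rewrite weighted_int_comb// /kernel_exp /trunc_laplace (_ : int_kernel t = weighted_int (fun=> 1)); first by field.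
  rewrite int_kernel_step; last by rewrite ltW//=.
  apply: cintegral_ext => u /inD/andP[_ ut]; rewrite /step_fun ut rc1//.
apply: le_trans (weighted_int_bound (K := (C1 * t + C2) * h) _ _) _; last first.
- by rewrite le_eqVlt; apply/orP; left; apply/eqP; ring.
- move=> u uI; have /andP[u0 ut] := uI.
  have := partial N u (leqnn N) uI; rewrite Nh (min_r (_ : t - u <= t)); last by lra.
  have -> : psum N u - q (t - u) = - l^-1 * cexp (l * t%:C + - l * u%:C) + (l^-1 * 1 + psum N u).
    rewrite /q (_ : l * (t - u)%:C = l * t%:C + - l * u%:C); first by field.
    by rewrite !rcE; ring.
  move=> hp; apply: le_trans hp _.
  have C20 : 0 <= C2 by rewrite /C2 mulr_ge0 ?expR_ge0// addr_ge0 ?mulr_ge0 ?expR_ge0.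
  have -> : C1 * h ^+ 2 * N%:R = C1 * t * h by rewrite -Nh; ring.
  rewrite mulrDl lerD2l; case: ifP => _; first by rewrite mulr1.
  by rewrite mulr0 mulr_ge0// ltW.
by have [] := weight_comb (- l^-1) we (weight_comb l^-1 wc wp).
Qed.

(** For [u >= t] the modulus of [e^(l (t - u))] is at most that of [e^(z0 (t - u))],
    uniformly in [l]. *)
Lemma laplace_tail (z0 l : R[i]) : laplace_cvg g z0 -> complex.Re z0 <= complex.Re l ->
  laplace_cvg g l /\
  rnorm (cexp (l * t%:C) * laplace g l - trunc_laplace l) <=
    2 * expR (complex.Re z0 * t) * cint_taxicab `[0, +oo[ (laplace_integrand g z0).
Proof.
move=> cz0 zl.
pose E : set (measurableTypeR R) := `[0, +oo[%classic.
pose T : set (measurableTypeR R) := `]t, +oo[%classic.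
have mE : measurable E by exact: measurable_itv.
have mT : measurable T by exact: measurable_itv.
pose f0 := laplace_integrand g z0.
have f0E : cintegrable E f0 by exact: cz0.
have fE u : laplace_integrand g l u = cexp (0 + - (l - z0) * u%:C) * f0 u.
  rewrite /f0 /laplace_integrand mulrA -cexpD; congr (cexp _ * _); ring.
have cl : laplace_cvg g l.
  apply: (cintegrable_ext mE (f := fun u => cexp (0 + - (l - z0) * u%:C) * f0 u)) => //.
  apply: (cintegrable_mul mE (cmeasurable_cexp _ _ _) (K := 1)) => // u.
  rewrite /E /= in_itv /= andbT => u0; rewrite rnorm_cexp -expR0 ler_expR.
  rewrite ReD ReM !ReN ReD ReN /= mulr0 subr0 add0r.
  by rewrite mulNr oppr_le0 mulr_ge0//; lra.
split => //.
have UE : E = D `|` T.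
  apply/seteqP; split => u; rewrite /E /D /T /= !in_itv /= ?andbT.
    by move=> u0; rewrite u0 /=; have [ut|tu] := leP u t; [left|right].
  by move=> [/andP[]//|tu]; rewrite (le_trans (ltW t_gt0)) ?ltW.
have dis : [disjoint D & T]%classic.
  apply/disj_setPS => u; rewrite /D /T /= !in_itv /= andbT => -[/andP[_ h1] h2].
  by move: h2; rewrite ltNge h1.
have f0T : cintegrable T f0 by apply: (cintegrableS mT mE) => //; rewrite UE; right.
have clD : cintegrable (D `|` T) (laplace_integrand g l) by rewrite -UE.
have fD : cintegrable D (laplace_integrand g l).
  by apply: (cintegrableS mD mE) => //; rewrite UE; left.
have fT : cintegrable T (laplace_integrand g l).
  by apply: (cintegrableS mT mE) => //; rewrite UE; right.
have -> : laplace g l = cintegral D (laplace_integrand g l) + cintegral T (laplace_integrand g l).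
  by rewrite /laplace -(cintegral_setU mD mT clD dis) -UE.
have scal (A : set (measurableTypeR R)) (k : R -> R[i]) (c : R[i]) : measurable A -> cintegrable A k ->
    c * cintegral A k = cintegral A (fun u => c * k u).
  move=> mA kA; have k0 : cintegrable A (fun u => 0 * k u).
    by apply: (cintegrable_mul mA (cmeasurable_cst A 0) (K := 0)) => // u _; rewrite rnorm0.
  have z : cintegral A (fun u => 0 * k u) = 0.
    apply/rnorm_eq0/eqP; rewrite eq_le rnorm_ge0 andbT.
    have := cintegral_mul_le mA (cmeasurable_cst A 0) (K := 0) _ kA.
    by rewrite mulr0 mul0r; apply => u _; rewrite rnorm0.
  rewrite -[LHS]addr0 -z -cintegral_comb//.
  by apply: cintegral_ext => u _; rewrite mul0r addr0.
have -> : cexp (l * t%:C) * (cintegral D (laplace_integrand g l) + cintegral T (laplace_integrand g l)) - trunc_laplace l =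
   cexp (l * t%:C) * cintegral T (laplace_integrand g l).
  suff -> : trunc_laplace l = cexp (l * t%:C) * cintegral D (laplace_integrand g l) by ring.
  rewrite scal// /trunc_laplace /weighted_int; apply: cintegral_ext => u _.
  by rewrite /laplace_integrand mulrA -cexpD; congr (cexp _ * _); ring.
rewrite scal//.
have -> : cintegral T (fun u => cexp (l * t%:C) * laplace_integrand g l u) =
    cintegral T (fun u => cexp (l * t%:C + - (l - z0) * u%:C) * f0 u).
  by apply: cintegral_ext => u _; rewrite fE mulrA -cexpD add0r.
apply: le_trans (cintegral_mul_le mT (cmeasurable_cexp _ _ _) (K := expR (complex.Re z0 * t)) _ f0T) _.
  move=> u; rewrite /T /= in_itv /= andbT => tu; rewrite rnorm_cexp ler_expR.
  rewrite ReD ReM !ReM !ReN ReD ReN /= !mulr0 !subr0.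
  have : 0 <= (complex.Re l - complex.Re z0) * (u - t) by rewrite mulr_ge0//; lra.
  by lra.
apply: ler_wpM2l; first by rewrite mulr_ge0// expR_ge0.
have i1 := cintegrable_taxicab mE f0E; have i2 := cintegrable_taxicab mT f0T.
rewrite /cint_taxicab -/f0 -/E UE Rintegral_setU//; last by rewrite -UE.
by rewrite lerDr; exact: cint_taxicab_ge0.
Qed.

(** The primitive of an integrable function is continuous, applied to the real
    and imaginary parts. *)
Lemma int_kernel_cont : rcont int_kernel 0 t.
Proof.
have key (f : R -> R) : mu.-integrable `[0, t] (EFin \o f) ->
    forall s, 0 <= s <= t -> forall e : R, 0 < e -> exists2 r : R, 0 < r &
    forall y, 0 <= y <= t -> `|y - s| < r ->
      `|Rintegral mu `[0, y] f - Rintegral mu `[0, s] f| < e.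
  move=> fi s sI e e0.
  have /subspace_continuousP/(_ s) := parameterized_integral_continuous (ltW t_gt0) fi.
  rewrite /= in_itv /= => /(_ sI) hs.
  have hb : nbhs (Rintegral mu `[0, s] f) [set y | `|Rintegral mu `[0, s] f - y| < e].
    by apply/nbhs_ballP; exists e.
  have {hs hb} := hs _ hb; rewrite /within /= => /nbhs_ballP[r /= r0 hr].
  exists r => // y yI ys; rewrite distrC; apply: hr; last by rewrite /= in_itv.
  by rewrite /ball /= distrC.
move=> s sI e e0; have e2 : 0 < e / 2 by lra.
have [gD1 gD2] := gD.
have [r1 r10 h1] := key _ gD1 s sI _ e2; have [r2 r20 h2] := key _ gD2 s sI _ e2.
exists (Num.min r1 r2); first by rewrite lt_min r10.
move=> y yI; rewrite lt_min => /andP[/(h1 _ yI) {}h1 /(h2 _ yI) {}h2].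
have aE v : 0 <= v <= t -> int_kernel v = cintegral `[0, v] g.
  by move=> /andP[v0 _]; rewrite /int_kernel cintegral_reflect//; exact: gloc.
rewrite !aE//; apply: le_lt_trans (rnorm_ReIm _) _.
by rewrite ReD ImD ReN ImN /cintegral /=; lra.
Qed.

End Fixed.

Lemma int_kernel0 : int_kernel 0 = 0.
Proof. by rewrite /int_kernel /cintegral set_itv1 !Rintegral_set1. Qed.

End Kernel.

(** * The transform of the resolvent family *)

Section Local.
Context {R : realType} {X : normedModType R[i]}.

Lemma cderiv_near (f g : R[i] -> X) z d (r : R) : 0 < r ->
  (forall w, rnorm (w - z) < r -> f w = g w) -> cderiv f z d -> cderiv g z d.
Proof.
move=> r0 fg fd e /fd[q q0 hq]; exists (Num.min q r); first by rewrite lt_min q0.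
move=> w; rewrite lt_min => /andP[wq wr].
by rewrite -!fg ?hq// subrr rnorm0.
Qed.

(** A quadratic error does not affect the derivative; the resolvent identity
    produces such an error. *)
Lemma cderiv_quad (f g : R[i] -> X) z d (r K : R) : 0 < r -> 0 <= K ->
  (forall w, rnorm (w - z) < r ->
     rnorm (f w - f z - (g w - g z)) <= K * rnorm (w - z) ^+ 2) ->
  cderiv g z d -> cderiv f z d.
Proof.
move=> r0 K0 fg gd e e0; have e2 : 0 < e / 2 by lra.
have [q q0 hq] := gd _ e2; have K1 : 0 < 2 * (K + 1) by lra.
exists (Num.min (Num.min q r) (e / (2 * (K + 1)))).
  by rewrite !lt_min q0 r0 divr_gt0.
move=> w; rewrite !lt_min => /andP[/andP[/hq {}hq /fg {}fg] wK].
rewrite (_ : _ - _ = (f w - f z - (g w - g z)) + (g w - g z - (w - z) *: d)); last by module.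
apply: le_trans (rnormD _ _) _; apply: le_trans (lerD fg hq) _.
move: wK; rewrite ltr_pdivlMr// => wK; have n0 := rnorm_ge0 (w - z).
have := ler_wpM2r n0 (ltW wK); have := sqr_ge0 (rnorm (w - z)); lra.
Qed.

End Local.

Section OperatorNorm.
Context {R : realType} {X : completeNormedModType R[i]}.
Implicit Types (T : X -> X) (nY : X -> R).

Lemma opnorm_le nY T (K : R) : (forall x, rnorm x <= 1 -> nY (T x) <= K) ->
  opnorm nY T <= K.
Proof.
move=> TK; apply: ge_sup; last by move=> _ [x /= x1 <-]; exact: TK.
by exists (nY (T 0)), 0 => //=; rewrite rnorm0.
Qed.

Lemma opnorm_ge T x : bounded_linop rnorm T -> rnorm (T x) <= opnorm rnorm T * rnorm x.
Proof.
move=> [Tlin [c Tc]].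
have TZ (a : R[i]) y : T (a *: y) = a *: T y.
  have T0 : T 0 = 0 by have := Tlin (-1) 0 0; rewrite scaler0 addr0 scaleN1r addNr.
  by have := Tlin a y 0; rewrite !addr0 T0 addr0.
have ub y : rnorm y <= 1 -> rnorm (T y) <= opnorm rnorm T.
  move=> y1; apply: sup_upper_bound; last by exists y.
  split; first by exists (rnorm (T y)), y.
  exists `|c| => _ [u /= u1 <-]; apply: le_trans (Tc u) _.
  apply: le_trans (ler_norm _) _; rewrite normrM (ger0_norm (rnorm_ge0 u)).
  exact: ler_piMr.
have [x0|xn] := eqVneq (rnorm x) 0.
  by rewrite (rnorm_eq0 x0) -(scale0r x) TZ !scale0r rnorm0 mulr0.
have nx : 0 < rnorm x by rewrite lt_neqAle eq_sym xn rnorm_ge0.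
have := ub ((rnorm x)^-1%:C *: x); rewrite TZ !rnormZ rnormR ger0_norm ?invr_ge0 ?rnorm_ge0//.
by rewrite mulVf// lexx => /(_ isT); rewrite ler_pdivrMl// mulrC.
Qed.

End OperatorNorm.

Section Resolvent.
Context {R : realType} {X : completeNormedModType R[i]}.
Variable B : linop X.

Definition resolvent (z : R[i]) : X -> X := xget (fun=> 0) [set Q | is_resolvent B z Q].

Lemma resolventP z : (exists Q, is_resolvent B z Q) -> is_resolvent B z (resolvent z).
Proof. by move=> [Q hQ]; rewrite /resolvent; case: xgetP => [P _ //|/(_ Q)]. Qed.

Lemma linB (T : X -> X) x y : linear T -> T (x - y) = T x - T y.
Proof.
move=> Tl; rewrite (_ : x - y = (-1) *: y + x); last by module.
by rewrite Tl; module.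
Qed.

Lemma linZ (T : X -> X) (a : R[i]) x : linear T -> T (a *: x) = a *: T x.
Proof.
move=> Tl; have T0 : T 0 = 0 by have := Tl (-1) 0 0; rewrite scaler0 addr0 scaleN1r addNr.
by have := Tl a x 0; rewrite !addr0 T0 addr0.
Qed.

Lemma linD (T : X -> X) x y : linear T -> T (x + y) = T x + T y.
Proof. by move=> Tl; have := Tl 1 x y; rewrite !scale1r. Qed.

Lemma resolvent_identity z1 z2 x : is_resolvent B z1 (resolvent z1) -> is_resolvent B z2 (resolvent z2) ->
  resolvent z1 x - resolvent z2 x = (z2 - z1) *: resolvent z1 (resolvent z2 x).
Proof.
move=> [[l1 _] _ h1] [_ h2 _]; have [dy Ey] := h2 x.
set y := resolvent z2 x in dy Ey *.
rewrite -[in LHS]Ey (_ : z2 *: y - B y = (z2 - z1) *: y + (z1 *: y - B y)); last by module.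
by rewrite l1 h1//; module.
Qed.

End Resolvent.

(** The Laplace transform [F l] of the resolvent family to be constructed,
    together with the properties that the construction uses; [m] is the
    reciprocal of the transform of the kernel. *)
Record transform_data {R : realType} {X : completeNormedModType R[i]} (A : linop X)
    (g : R -> R[i]) (w1 omega eta zeta : R) (m : R[i] -> R[i]) (F : R[i] -> X -> X)
    (Q : X -> X) := TransformData {
  td_lin : forall l, linear (F l);
  td_bound : exists2 C : R, 0 < C & forall l x, lsector w1 eta l ->
    rnorm (F l x) <= C / rnorm l * rnorm x;
  td_holo : forall x, holo w1 eta (fun l => F l x);
  td_Q : bounded_linop rnorm Q;
  td_Qdom : forall x, dom A (Q x) /\ Q x - A (Q x) = x;
  td_QK : forall x, dom A x -> Q (x - A x) = x;
  td_FQ : forall l x, lsector w1 eta l -> F l (Q x) = Q (F l x);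
  td_eq : forall l x, lsector w1 eta l -> F l x = Q (F l x - m l *: (l *: F l x - x));
  td_dom : forall l x, lsector w1 eta l -> dom A x -> m l *: (l *: F l x - x) = F l (A x);
  td_m : holo w1 eta m;
  td_growth : exists2 C : R, 0 < C & forall r psi, 0 <= r -> `|psi| <= ray_angle eta ->
    rnorm (m (sector_pt omega r psi)) <= C * (1 + r `^ (zeta - 1));
  td_laplace : forall l, lsector w1 eta l -> laplace_cvg g l -> m l * laplace g l = 1
}.

Section Data.
Context {R : realType} {X : completeNormedModType R[i]}.
Variables (A : linop X) (psi0 : R).
Hypothesis hpsi0 : 0 <= psi0 < pi / 2.
Hypothesis hA : sectorial (oppop A) psi0.

Lemma csector0 (psi : R) : 0 <= psi -> csector 0 psi 0.
Proof.
by move=> p0; exists 0, 0; rewrite rc0 mul0r addr0; split => //; rewrite oppr_le0 p0.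
Qed.

Lemma csector_mono (a b : R) z : a <= b -> csector 0 a z -> csector 0 b z.
Proof.
move=> ab [r [psi [r0 /andP[p1 p2] ->]]]; exists r, psi; split => //.
by apply/andP; split; lra.
Qed.

Lemma sectorial_resolvent (psi1 : R) z : psi0 < psi1 -> ~ csector 0 psi1 z ->
  is_resolvent (oppop A) z (resolvent (oppop A) z).
Proof.
move=> p01 nz; apply: resolventP; have [_ _ _ sp _] := hA.
apply: contrapT => h; apply: nz; apply: csector_mono (sp z h); exact: ltW.
Qed.

Lemma sectorial_bound (psi1 : R) : psi0 < psi1 < pi -> exists2 C : R, 0 < C &
  forall z x, ~ csector 0 psi1 z -> rnorm (resolvent (oppop A) z x) <= C / rnorm z * rnorm x.
Proof.
move=> p1; have [_ _ _ _ /(_ _ p1)[C hC]] := hA; move/andP: p1 => [p01 _].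
exists (`|C| + 1) => [|z x nz]; first by rewrite ltr_wpDl.
have hr := sectorial_resolvent p01 nz.
have := hC z _ nz hr; have [bl _ _] := hr; have := opnorm_ge x bl.
move=> h1 h2; apply: le_trans h1 _; apply: ler_wpM2r; first exact: rnorm_ge0.
apply: le_trans h2 _; apply: ler_wpM2r; first by rewrite invr_ge0 rnorm_ge0.
by have := ler_norm C; lra.
Qed.

Let hz1 : ~ csector 0 psi0 (-1 : R[i]).
Proof.
move=> [r [psi [r0 /andP[p1 p2]]]]; move/andP: hpsi0 => [_ pp].
have c0 : 0 < cos psi by apply: cos_gt0_pihalf; apply/andP; split; lra.
move=> /(congr1 (@complex.Re R)); rewrite ReD ReM /= mul0r subr0 add0r.
by have := mulr_ge0 r0 (ltW c0); lra.
Qed.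

(** The resolvent [(1 - A)^-1], in terms of the resolvents of [- A]. *)
Definition resolvent1 (x : X) : X := - resolvent (oppop A) (-1) x.

Let rs1 : is_resolvent (oppop A) (-1) (resolvent (oppop A) (-1)).
Proof.
apply: resolventP; have [_ _ _ sp _] := hA.
by apply: contrapT => h; apply: hz1; apply: sp.
Qed.

Lemma opZ (a : R[i]) (x : X) : dom A x -> dom A (a *: x) /\ A (a *: x) = a *: A x.
Proof.
move=> dx; have d0 := dom0 A.
have A0 : A 0 = 0.
  by have := @op_lin _ _ A (-1) 0 0 d0 d0; rewrite scaler0 addr0 scaleN1r addNr.
by have := dom_lin a dx d0; have := op_lin a dx d0; rewrite !addr0 A0 addr0.
Qed.

Lemma resolvent1P x : dom A (resolvent1 x) /\ resolvent1 x - A (resolvent1 x) = x.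
Proof.
have [_ h _] := rs1; have [dx e] := h x.
have [d1 e1] := opZ (-1) dx; rewrite !scaleN1r in d1 e1; split => //.
by rewrite /resolvent1 e1 -[RHS]e /=; module.
Qed.

Lemma resolvent1K x : dom A x -> resolvent1 (x - A x) = x.
Proof.
move=> dx; have [[l _] _ h] := rs1.
have := h x dx; rewrite /= opprK => hx.
rewrite /resolvent1 -[in RHS]hx (_ : x - A x = (-1) *: (-1 *: x + A x)); last by module.
by rewrite linZ//; module.
Qed.

Lemma resolvent1_bounded : bounded_linop rnorm resolvent1.
Proof.
have [[l [c hc]] _ _] := rs1; split.
  by move=> a x y; rewrite /resolvent1 l; module.
by exists c => x; rewrite rnormN; exact: hc.
Qed.

Variables (g : R -> R[i]) (omega0 eta0 : R).
Hypothesis homega0 : 0 <= omega0.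
Hypothesis heta0 : 0 < eta0 <= pi / 2.
Variables (ghat : R[i] -> R[i]) (P : set R[i]).
Hypothesis B1 : meromorphic_extension (laplace g) (laplace_cvg g)
  (osector omega0 (eta0 + pi / 2)) ghat P /\
  forall z, osector omega0 (eta0 + pi / 2) z -> ~ P z -> ghat z <> 0.
Hypothesis B2 : forall omega1 eta1 : R, omega0 < omega1 -> 0 < eta1 < eta0 ->
  exists psi1 : R, psi0 < psi1 < pi / 2 /\
    forall z, osector omega1 (eta1 + pi / 2) z ->
      ~ csector 0 psi1 (- (z * recip ghat P z)).
Variables (omega eta zeta : R).
Hypothesis homega : omega0 < omega.
Hypothesis heta : 0 < eta < eta0.
Hypothesis hzeta : 1 < zeta.
Hypothesis B3 : (limf_esup
  (fun z : R[i] => (rnorm (recip ghat P z) / (rnorm z `^ (zeta - 1)))%:E)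
  (infty_in (osector omega (eta + pi / 2))) < +oo)%E.

Let w1 := (omega0 + omega) / 2.
Let m := recip ghat P.
Let U := lsector w1 eta.

Let w1_gt : omega0 < w1. Proof. by move: homega; rewrite /w1; lra. Qed.
Let w1_pos : 0 < w1. Proof. exact: le_lt_trans homega0 w1_gt. Qed.
Let w1_lt : w1 < omega. Proof. by move: homega; rewrite /w1; lra. Qed.
Let etaI : 0 < eta < pi / 2.
Proof. by move/andP: heta0 => [? ?]; move/andP: heta => [? ?]; apply/andP; split; lra. Qed.

Let psi1_ex : {psi1 : R | psi0 < psi1 < pi / 2 /\ forall z, U z ->
  ~ csector 0 psi1 (- (z * m z))}.
Proof.
apply: cid; have [psi1 [p1 h]] := B2 w1_gt heta; exists psi1; split => // z Uz.
by apply: h; exact: lsector_osector.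
Qed.
Let psi1 := projT1 psi1_ex.
Let psi1I : psi0 < psi1 < pi / 2. Proof. by have [] := projT2 psi1_ex. Qed.
Let numid z : U z -> ~ csector 0 psi1 (- (z * m z)).
Proof. by have [_] := projT2 psi1_ex; apply. Qed.

Let psi1_ge0 : 0 <= psi1.
Proof. by move/andP: psi1I => [? _]; move/andP: hpsi0 => [? _]; lra. Qed.

Let U_omega0 z : U z -> osector omega0 (eta0 + pi / 2) z.
Proof.
move=> Uz; have U0 := lsector_osector_gt etaI Uz w1_gt.
have [r [psi [r0 /andP[p1 p2] ->]]] := lsector_osector etaI U0.
exists r, psi; split => //; move/andP: heta => [_ h].
by apply/andP; split; lra.
Qed.

Let mu_neq0 z : U z -> m z != 0 /\ z != 0.
Proof.
move=> Uz; have h : z * m z != 0.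
  by apply/eqP => e; apply: (numid Uz); rewrite e oppr0; exact: csector0.
by move: h; rewrite mulf_eq0 negb_or => /andP[].
Qed.

(* at a pole the reciprocal vanishes, and 0 lies in every closed sector *)
Let U_nopole z : U z -> ~ P z.
Proof.
move=> Uz Pz; have [/eqP h _] := mu_neq0 Uz; apply: h.
by rewrite /m /recip; case: asboolP.
Qed.

Let mE z : U z -> m z = (ghat z)^-1.
Proof. by move=> /U_nopole nP; rewrite /m /recip; case: asboolP. Qed.

Let m_holo : holo w1 eta m.
Proof.
move=> z Uz; have [[[_ _ hd _] _] hn] := B1.
have [d dg] := derivable_cderiv (hd z (U_omega0 Uz) (U_nopole Uz)).
have g0 : ghat z != 0 by apply/eqP/hn; [exact: U_omega0|exact: U_nopole].
have di := cderiv_comp dg (cderiv_inv g0).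
have [r r0 hr] := lsector_open etaI Uz.
by eexists; apply: (cderiv_near r0 _ di) => w /hr Uw; rewrite -mE.
Qed.

Let m_laplace l : U l -> laplace_cvg g l -> m l * laplace g l = 1.
Proof.
move=> Ul cl; have [[_ hl] hn] := B1.
rewrite -(hl l cl (U_omega0 Ul) (U_nopole Ul)) mE// mulVf//.
by apply/eqP/hn; [exact: U_omega0|exact: U_nopole].
Qed.

(* [F l = m l (l m l - A)^-1 = (l - ghat l A)^-1] for [m = 1 / ghat] *)
Let F (l : R[i]) (x : X) : X :=
  if `[< U l >] then (- m l) *: resolvent (oppop A) (- (l * m l)) x else 0.

Let FE l x : U l -> F l x = (- m l) *: resolvent (oppop A) (- (l * m l)) x.
Proof. by move=> Ul; rewrite /F asboolT. Qed.

Let nu_res l : U l -> is_resolvent (oppop A) (- (l * m l)) (resolvent (oppop A) (- (l * m l))).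
Proof. by move=> Ul; move/andP: psi1I => [p _]; exact: sectorial_resolvent p (numid Ul). Qed.

Let psi1pi : psi0 < psi1 < pi.
Proof. by move/andP: psi1I => [-> ?] /=; have := pi_gt0 R; lra. Qed.

Let F_lin l : linear (F l).
Proof.
move=> a x y; rewrite /F; case: asboolP => [Ul|_]; last by rewrite scaler0 addr0.
by have [[lin _] _ _] := nu_res Ul; rewrite lin; module.
Qed.

Let F_bound : exists2 C : R, 0 < C & forall l x, U l -> rnorm (F l x) <= C / rnorm l * rnorm x.
Proof.
have [C C0 hC] := sectorial_bound psi1pi; exists C => // l x Ul.
rewrite FE// rnormZ rnormN; have := hC _ x (numid Ul); rewrite rnormN rnormM.
have [m0 l0] := mu_neq0 Ul.
have pos (z : R[i]) : z != 0 -> 0 < rnorm z.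
  by move=> z0; rewrite lt_neqAle rnorm_ge0 andbT eq_sym; apply: contra z0 => /eqP/rnorm_eq0->.
have pm := pos _ m0; have pl := pos _ l0.
move=> h; apply: le_trans (ler_wpM2l (ltW pm) h) _.
by rewrite le_eqVlt; apply/orP; left; apply/eqP; field; rewrite !gt_eqF.
Qed.

(* by the resolvent identity the derivative of the resolvent is minus its square,
   with a quadratic error *)
Let F_holo x : holo w1 eta (fun l => F l x).
Proof.
move=> z Uz; have [p dm] := m_holo Uz.
have [r r0 hr] := lsector_open etaI Uz.
pose nu (l : R[i]) : R[i] := - (l * m l).
have [q dnu] : exists q, cderiv nu z q.
  have d1 := cderiv_mul (cderiv_id z) dm; have d2 := cderivZ (-1) d1.
  by eexists; apply: cderiv_ext d2 => w; rewrite /nu scaleN1r.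
suff [d dr] : exists d, cderiv (fun l => resolvent (oppop A) (nu l) x) z d.
  have d1 := cderiv_mul (cderivZ (-1) dm) dr.
  eexists; apply: (cderiv_near r0 _ d1) => w /hr Uw.
  by rewrite FE// scaleN1r.
have [C C0 hC] := sectorial_bound psi1pi.
pose y := resolvent (oppop A) (nu z) (resolvent (oppop A) (nu z) x).
have nun : nu z != 0.
  have [m0 z0] := mu_neq0 Uz; by rewrite /nu oppr_eq0 mulf_neq0.
have pn : 0 < rnorm (nu z).
  by rewrite lt_neqAle rnorm_ge0 andbT eq_sym; apply: contra nun => /eqP/rnorm_eq0->.
have [r1 r10 h1] := cderiv_cont dnu (divr_gt0 pn (ltr0n R 2)).
have [r2 r20 h2] := cderiv_bound dnu ltr01.
exists ((-1) *: (q *: y)).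
pose K := (rnorm q + 1) ^+ 2 * (C / (rnorm (nu z) / 2) * rnorm y).
apply: (@cderiv_quad _ _ _ (fun l => (-1) *: (nu l *: y)) z _ (Num.min r (Num.min r1 r2)) K).
- by rewrite !lt_min r0 r10.
- apply: mulr_ge0; first exact: sqr_ge0.
  by apply: mulr_ge0; [apply: divr_ge0; [exact: ltW|apply: divr_ge0]|]; rewrite ?rnorm_ge0.
- move=> w; rewrite !lt_min => /andP[/hr Uw /andP[/h1 {}h1 /h2 {}h2]].
  have rz := nu_res Uz; have rw := nu_res Uw; rewrite -/(nu z) in rz; rewrite -/(nu w) in rw.
  have i1 := resolvent_identity x rw rz.
  have i2 := resolvent_identity (resolvent (oppop A) (nu z) x) rw rz; rewrite -/y in i2.
  have i3 : resolvent (oppop A) (nu w) (resolvent (oppop A) (nu z) x) = y + (nu z - nu w) *: resolvent (oppop A) (nu w) y.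
    by rewrite -i2 addrC subrK.
  rewrite i1 i3.
  rewrite (_ : _ - _ = ((nu w - nu z) ^+ 2) *: resolvent (oppop A) (nu w) y); last by module.
  rewrite rnormZ rnormX.
  have hw := hC _ y (numid Uw); rewrite -/(nu w) in hw.
  have nw : rnorm (nu z) / 2 <= rnorm (nu w).
    by have := rdist_triangle (nu w) (nu z) 0; rewrite !subr0 (rdistC (nu z)); lra.
  have a1 : rnorm (nu w - nu z) ^+ 2 <= ((rnorm q + 1) * rnorm (w - z)) ^+ 2.
    by rewrite ler_pXn2r ?nnegrE ?mulr_ge0 ?addr_ge0 ?rnorm_ge0.
  have a2 : rnorm (resolvent (oppop A) (nu w) y) <= C / (rnorm (nu z) / 2) * rnorm y.
    apply: le_trans hw _; apply: ler_wpM2r; first exact: rnorm_ge0.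
    apply: ler_wpM2l; first exact: ltW.
    by rewrite lef_pV2 ?posrE//; lra.
  apply: le_trans (ler_pM (sqr_ge0 _) (rnorm_ge0 _) a1 a2) _.
  by rewrite exprMn /K le_eqVlt; apply/orP; left; apply/eqP; ring.
apply: cderivZ; apply: cderiv_eq (cderiv_mul dnu (cderiv_cst y z)).
by rewrite scaler0 addr0.
Qed.

Let F_op l x : U l -> dom A (F l x) /\ A (F l x) = m l *: (l *: F l x - x).
Proof.
move=> Ul; have [_ h _] := nu_res Ul; have [dy e] := h x.
set y := resolvent _ _ _ in dy e; rewrite FE// -/y.
have [d1 e1] := opZ (- m l) dy; split => //.
rewrite e1 -[in RHS]e /=.
by module.
Qed.

Let F_eq l x : U l -> F l x = resolvent1 (F l x - m l *: (l *: F l x - x)).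
Proof. by move=> Ul; have [d e] := F_op x Ul; rewrite -e resolvent1K. Qed.

Let F_dom l x : U l -> dom A x -> m l *: (l *: F l x - x) = F l (A x).
Proof.
move=> Ul dx; have [[lin _] _ h] := nu_res Ul; have := h x dx.
rewrite /= opprK linD// linZ//; set y := resolvent _ _ x; set y' := resolvent _ _ (A x).
rewrite !FE// -/y -/y' => e; rewrite -[X in _ - X]e; module.
Qed.

Let F_Q l x : U l -> F l (resolvent1 x) = resolvent1 (F l x).
Proof.
move=> Ul; have [[lin _] h h3] := nu_res Ul; have [dy e] := h x.
set y := resolvent _ _ x in dy e; have [dQ eQ] := resolvent1P y.
have [lQ _] := resolvent1_bounded.
rewrite !FE// linZ// -/y; congr (_ *: _).
rewrite -[RHS](h3 _ dQ) /= opprK; congr resolvent.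
have hy := resolvent1K dy; rewrite linB// in hy.
have -> : x = (- (l * m l)) *: y + A y by rewrite -[LHS]e /= opprK.
rewrite lQ; congr (_ + _).
have -> : A (resolvent1 y) = resolvent1 y - y by rewrite -[X in _ = _ - X]eQ; module.
by rewrite -[X in _ = _ - X]hy; module.
Qed.

(* The growth condition bounds [m] near infinity; the rest of the closed sector is
   compact, and [m] is continuous there. *)
Let m_growth : exists2 C : R, 0 < C & forall r psi, 0 <= r -> `|psi| <= ray_angle eta ->
  rnorm (m (sector_pt omega r psi)) <= C * (1 + r `^ (zeta - 1)).
Proof.
have [c0 s0] := cos_sin_pos etaI; have om0 : 0 < omega by exact: le_lt_trans homega.
have th0 := ray_angle_gt0 etaI.
have [M [r0 hM]] : exists M r0 : R, forall z, osector omega (eta + pi / 2) z -> r0 < rnorm z ->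
    rnorm (m z) / (rnorm z `^ (zeta - 1)) <= M.
  move: B3 => /ereal_inf_lt[_ [V [r0 _ hV] <-] hlt].
  exists (fine (ereal_sup [set (rnorm (m z) / (rnorm z `^ (zeta - 1)))%:E | z in V])), r0 => z oz zr.
  have Vz : V z by apply: hV; split.
  have hle : ((rnorm (m z) / (rnorm z `^ (zeta - 1)))%:E <=
      ereal_sup [set (rnorm (m z) / (rnorm z `^ (zeta - 1)))%:E | z in V])%E.
    by apply: ereal_sup_ubound; exists z.
  rewrite -lee_fin fineK// fin_numElt hlt andbT.
  by apply: lt_le_trans hle; rewrite ltNyr.
pose r1 := Num.max 1 (r0 / cos eta + 1).
have r11 : 1 <= r1 by rewrite le_max lexx.
have r1r0 : r0 / cos eta + 1 <= r1 by rewrite le_max lexx orbT.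
have [K hK] : exists K : R, forall r psi, 0 <= r <= r1 -> - ray_angle eta <= psi <= ray_angle eta ->
    rnorm (m (sector_pt omega r psi)) <= K.
  have tt : - ray_angle eta <= ray_angle eta by lra.
  apply: (@cousin2 _ (fun x y u v => exists K : R, forall r psi, x <= r <= y -> u <= psi <= v ->
    rnorm (m (sector_pt omega r psi)) <= K) 0 r1 (- ray_angle eta) (ray_angle eta)) => //; first lra.
    move=> x y u v _ _ _ _ _ _ a b [K1 h1] [K2 h2] [K3 h3] [K4 h4].
    exists (Num.max (Num.max K1 K2) (Num.max K3 K4)) => r psi /andP[xr ry] /andP[up pv].
    rewrite !le_max; have [ra|/ltW ar] := leP r a; have [pb|/ltW bp] := leP psi b.
    - by rewrite h1 ?xr ?up.
    - by rewrite h2 ?xr ?bp ?orbT.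
    - by rewrite h3 ?ar ?up ?orbT.
    - by rewrite h4 ?ar ?bp ?orbT.
  move=> s t /andP[s00 s1] tI.
  have Uz : U (sector_pt omega s t) by apply: lsector_pt => //; rewrite ler_norml.
  have [d dm] := m_holo Uz; have [q q0 hq] := cderiv_cont dm ltr01.
  exists (q / (r1 + 2)); first by rewrite divr_gt0//; lra.
  move=> x y u v x0 xs sy yr1 u0 ut tv v1; rewrite !ltr_pdivlMr; [|lra|lra] => xyq uvq.
  exists (rnorm (m (sector_pt omega s t)) + 1) => r psi /andP[xr ry] /andP[up pv].
  have dist : rnorm (sector_pt omega r psi - sector_pt omega s t) < q.
    rewrite (_ : _ - _ = (r - s)%:C * cis psi + s%:C * (cis psi - cis t)); last by rewrite /sector_pt !rcE; ring.
    apply: le_lt_trans (rnormD _ _) _; rewrite !rnormM !rnormR rnorm_cis mulr1 (ger0_norm s00).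
    have h1 : `|r - s| <= y - x by rewrite ler_norml; apply/andP; split; lra.
    have h2 : rnorm (cis psi - cis t) <= v - u.
      by apply: le_trans (cis_dist _ _) _; rewrite ler_norml; apply/andP; split; lra.
    have h3 := ler_pM s00 (rnorm_ge0 _) s1 h2.
    have vu : 0 <= v - u by lra. have yx : 0 <= y - x by lra.
    have r12 : 0 < r1 + 2 by lra.
    have : r1 * (v - u) * (r1 + 2) <= r1 * q.
      by rewrite -mulrA; apply: ler_wpM2l; [lra|exact: ltW].
    have : (`|r - s| + s * rnorm (cis psi - cis t)) * (r1 + 2) <= (y - x) * (r1 + 2) + r1 * (v - u) * (r1 + 2).
      by rewrite -mulrDl; apply: ler_wpM2r; [exact: ltW|exact: lerD].
    rewrite -(ltr_pM2r r12); nra.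
  have := hq _ dist; have := rdist_triangle (m (sector_pt omega s t)) (m (sector_pt omega r psi)) 0.
  by rewrite !subr0; lra.
pose C1 := `|M| * ((omega + 1) `^ (zeta - 1)).
have C10 : 0 <= C1 by rewrite /C1 mulr_ge0// powR_ge0.
exists (`|K| + C1 + 1) => [|r psi r0' psi_t]; first by rewrite ltr_wpDl ?addr_ge0.
have pr := @powR_ge0 R r (zeta - 1).
have [rr|/ltW rr] := leP r r1.
  have := hK r psi; rewrite r0' rr -ler_norml => /(_ isT psi_t) h.
  have := ler_norm K; have := normr_ge0 K; nra.
have rp : 0 < r by lra.
have oz : osector omega (eta + pi / 2) (sector_pt omega r psi).
  exists r, psi; split => //.
  by move: psi_t; rewrite /ray_angle ler_norml => /andP[? ?]; move/andP: etaI => [? ?]; apply/andP; split; lra.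
have zr : r * cos eta <= rnorm (sector_pt omega r psi).
  exact: (rnorm_sector_pt (ltW w1_pos) w1_lt).
have hr0 : r0 < rnorm (sector_pt omega r psi).
  apply: lt_le_trans zr; rewrite -ltr_pdivrMr//; lra.
have zle : rnorm (sector_pt omega r psi) <= (omega + 1) * r.
  apply: le_trans (rnorm_sector_pt_le (ltW w1_pos) w1_lt _ r0') _.
  by nra.
have zp : 0 < rnorm (sector_pt omega r psi) by apply: lt_le_trans zr; exact: mulr_gt0.
have := hM _ oz hr0; rewrite ler_pdivrMr ?powR_gt0// => hm.
have pw : rnorm (sector_pt omega r psi) `^ (zeta - 1) <= (omega + 1) `^ (zeta - 1) * r `^ (zeta - 1).
  have z10 : 0 <= zeta - 1 by rewrite subr_ge0; exact: ltW.
  rewrite -powRM//; last by lra.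
  by apply: ge0_ler_powR => //; rewrite nnegrE; [exact: ltW|rewrite mulr_ge0//; lra].
apply: le_trans hm _; apply: (@le_trans _ _ (C1 * r `^ (zeta - 1))).
  rewrite /C1 -mulrA; apply: le_trans (ler_wpM2r (powR_ge0 _ _) (ler_norm M)) _.
  by apply: ler_wpM2l.
by have := normr_ge0 K; nra.
Qed.

Lemma transform_data_ex : exists w1 m F Q, [/\ 0 < w1, w1 < omega &
  @transform_data R X A g w1 omega eta zeta m F Q].
Proof.
exists w1, m, F, resolvent1; split; [exact: w1_pos|exact: w1_lt|].
split => //; [exact: resolvent1_bounded|exact: resolvent1P|exact: resolvent1K].
Qed.

End Data.

(** * Inverse Laplace transforms over a sector *)

Section LinearLimits.
Context {R : realType} {X : completeNormedModType R[i]}.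

Lemma cvg_comb (c : R[i]) (u v : nat -> X) (x y : X) :
  u n @[n --> \oo] --> x -> v n @[n --> \oo] --> y ->
  (fun n => c *: u n + v n) n @[n --> \oo] --> c *: x + y.
Proof. by move=> ux vy; apply: cvgD => //; exact: (@cvgZl_tmp _ _ _ _ _ c _ _ ux). Qed.

Lemma lin_cvg (L : X -> X) (u : nat -> X) (x : X) : bounded_linop rnorm L ->
  u n @[n --> \oo] --> x -> L (u n) @[n --> \oo] --> L x.
Proof.
move=> [Ll [c Lc]] /cvg_rnorm ux; apply/cvg_rnorm => e e0.
have c1 : 0 < `|c| + 1 by rewrite ltr_wpDl.
have [N hN] := ux _ (divr_gt0 e0 c1); exists N => n /hN; rewrite ltr_pdivlMr// => h.
rewrite -linB//; apply: le_lt_trans (Lc _) _; apply: le_lt_trans h; rewrite mulrC.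
by apply: ler_wpM2l; [exact: rnorm_ge0|have := ler_norm c; lra].
Qed.

Lemma sector_int_lin (w1 omega eta : R) (L : X -> X) (f : R[i] -> X) n :
  w1 < omega -> 0 < eta < pi / 2 -> bounded_linop rnorm L -> holo w1 eta f ->
  L (sector_int w1 omega eta f n) = sector_int w1 omega eta (fun l => L (f l)) n.
Proof.
move=> w1o etaI [Ll [c Lc]] fh; rewrite /sector_int linB//.
have tU psi : `|psi| = ray_angle eta -> lsector w1 eta (sector_pt omega n%:R psi).
  by move=> pt; apply: lsector_pt => //; rewrite pt.
have th0 := ray_angle_gt0 etaI.
rewrite (segint_lin Ll Lc (holo_segcont etaI fh (tU _ (gtr0_norm th0)))).
by rewrite (segint_lin Ll Lc (holo_segcont etaI fh (tU _ (etrans (normrN _) (gtr0_norm th0))))).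
Qed.

Lemma scaler_comb_inj (c a : R[i]) (u v w : X) : c != 0 ->
  c *: u = a *: (c *: v) + c *: w -> u = a *: v + w.
Proof.
move=> c0 e; apply: (scalerI c0); rewrite e scalerDr !scalerA.
by rewrite [c * a]mulrC.
Qed.

Lemma taylor_cancel (c h : R[i]) (a b d : X) : c != 0 ->
  c^-1 *: (h *: (c *: d) + (1 *: (c *: a) + b)) - a - h *: d = c^-1 *: b.
Proof.
move=> c0; apply: (scalerI c0); rewrite !scalerBr ![c *: (c^-1 *: _)]scalerA !mulfV// !scale1r.
by module.
Qed.

End LinearLimits.
Arguments cvg_comb {R X} c {u v x y} _ _.

Section Family.
Context {R : realType} {X : completeNormedModType R[i]}.
Variables (A : linop X) (g : R -> R[i]) (w1 omega eta zeta : R).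
Variables (m : R[i] -> R[i]) (F : R[i] -> X -> X) (Q : X -> X).
Hypothesis w1_gt0 : 0 < w1.
Hypothesis w1_lt : w1 < omega.
Hypothesis etaI : 0 < eta < pi / 2.
Hypothesis zeta_gt1 : 1 < zeta.
Hypothesis td : transform_data A g w1 omega eta zeta m F Q.

Local Notation U := (lsector w1 eta).
Local Notation theta := (ray_angle eta).
Local Notation pt := (sector_pt omega).
Local Notation sector_int := (sector_int w1 omega eta).
Local Notation twopii := (2 * 'i * pi%:C : R[i]).

(** The rays at angle [pi / 2 + eta / 2], turned by at most [eta / 4], still make an
    angle of at least [pi / 2 + eta / 4] with the positive axis. *)
Definition ray_decay : R := sin (eta / 4).
Local Notation kappa := ray_decay.

Let omega_gt0 : 0 < omega. Proof. exact: lt_trans w1_lt. Qed.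
Let w1_ge0 : 0 <= w1. Proof. exact: ltW. Qed.
Let cos0 : 0 < cos eta. Proof. by have [] := cos_sin_pos etaI. Qed.

Lemma ray_decay_gt0 : 0 < kappa.
Proof.
have /andP[e0 e1] := etaI; have h : 0 < eta / 4 < pi / 2 by apply/andP; split; lra.
by have [_] := cos_sin_pos h.
Qed.

Let kappa_gt0 : 0 < kappa. Proof. exact: ray_decay_gt0. Qed.

Lemma rnorm_twopii : rnorm twopii = 2 * pi.
Proof.
by rewrite !rnormM rnorm_i mulr1 rnormR ger0_norm ?pi_ge0// -rc_nat rnormR ger0_norm.
Qed.

Lemma twopii_neq0 : twopii != 0.
Proof.
apply/eqP => h; have := rnorm_twopii; rewrite h rnorm0.
by have := pi_gt0 R; lra.
Qed.

Lemma rnorm_twopii_inv_le1 : rnorm twopii^-1 <= 1.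
Proof. by rewrite rnormV rnorm_twopii invf_le1; have := @pi_ge2 R; lra. Qed.

Lemma holo_cexp (z : R[i]) (h : R[i] -> X) : holo w1 eta h ->
  holo w1 eta (fun l => cexp (l * z) *: h l).
Proof.
move=> hh l Ul; have [d dh] := hh l Ul.
have d1 := cderiv_mul (cderiv_id l) (cderiv_cst z l).
have d2 := cderiv_mul (cderiv_comp d1 (cderiv_cexp (l * z))) dh.
by eexists; exact: d2.
Qed.

Lemma holo_mul (p : R[i] -> R[i]) (h : R[i] -> X) : holo w1 eta p -> holo w1 eta h ->
  holo w1 eta (fun l => p l *: h l).
Proof.
move=> hp hh l Ul; have [d dh] := hh l Ul; have [d' dp] := hp l Ul.
by eexists; exact: cderiv_mul dp dh.
Qed.

Lemma holo_comb (c : R[i]) (h k : R[i] -> X) : holo w1 eta h -> holo w1 eta k ->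
  holo w1 eta (fun l => c *: h l + k l).
Proof.
move=> hh hk l Ul; have [d dh] := hh l Ul; have [d' dk] := hk l Ul.
by eexists; exact: cderivD (cderivZ c dh) dk.
Qed.

Lemma holo_id : holo w1 eta (fun l : R[i] => l).
Proof. by move=> l _; eexists; exact: cderiv_id. Qed.

Lemma holo_cst (x : X) : holo w1 eta (fun=> x).
Proof. by move=> l _; eexists; exact: cderiv_cst. Qed.

Lemma cexp_arc (tau phi r psi : R) : 0 <= tau -> 0 <= r ->
  rnorm (cexp (pt r psi * (tau%:C * cis phi))) <= expR (omega * (tau * cos phi) + r * tau).
Proof.
move=> tau0 r0; rewrite rnorm_cexp ler_expR /sector_pt !(ReM, ReD, ImM, ImD) /=.
rewrite !(mul0r, mulr0, subr0, addr0, add0r).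
have -> : (omega + r * cos psi) * (tau * cos phi) - r * sin psi * (tau * sin phi) =
  omega * (tau * cos phi) + r * tau * cos (psi + phi) by rewrite cosD; ring.
rewrite lerD2l; apply: ler_piMr; first exact: mulr_ge0.
by apply: le_trans (ler_norm _) _; exact: cos_max.
Qed.

Lemma cexp_ray (tau phi r psi : R) : 0 <= tau -> 0 <= r -> `|phi| <= eta / 4 -> `|psi| = theta ->
  rnorm (cexp (pt r psi * (tau%:C * cis phi))) <=
    expR (omega * (tau * cos phi)) * expR (- (kappa * (tau * r))).
Proof.
move=> tau0 r0 phiI psiE; rewrite -expRD rnorm_cexp ler_expR /sector_pt !(ReM, ReD, ImM, ImD) /=.
rewrite !(mul0r, mulr0, subr0, addr0, add0r).
have -> : (omega + r * cos psi) * (tau * cos phi) - r * sin psi * (tau * sin phi) =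
  omega * (tau * cos phi) + r * tau * cos (psi + phi) by rewrite cosD; ring.
have /andP[e0 e1] := etaI; have pp := pi_gt0 R.
have key (a : R) : `|a| <= eta / 4 -> cos (theta + a) <= - kappa.
  rewrite ler_norml => /andP[a0 a1].
  rewrite /ray_angle (_ : pi / 2 + eta / 2 + a = (eta / 2 + a) + pi / 2); last by ring.
  by rewrite cosDpihalf lerN2; apply: sin_ndecr; lra.
have : cos (psi + phi) <= - kappa.
  have [p0|p0] := leP 0 psi; first by rewrite -(ger0_norm p0) psiE; exact: key.
  rewrite -cosN opprD -(ltr0_norm p0) psiE; apply: key; by rewrite normrN.
have rt : 0 <= r * tau by exact: mulr_ge0.
by move=> /(ler_wpM2l rt); rewrite lerD2l; lra.
Qed.

(** Every bound for the family reduces to a bound for its integrand: at the scale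
    [1 / tau] the exponential is bounded on the arc, and on the rays its decay
    [e^(- kappa tau r)] absorbs both a power of [tau r] and half of itself. *)
Lemma sector_integral (k : nat) : exists2 C : R, 0 < C &
  forall (h : R[i] -> X) (tau phi H : R), holo w1 eta h -> 0 < tau -> `|phi| <= eta / 4 -> 0 <= H ->
  (forall r psi, tau^-1 <= r -> `|psi| <= theta ->
     rnorm (h (pt r psi)) <= H * (tau * r) ^+ k * expR (kappa / 2 * (tau * r))) ->
  exists L : X, [/\ sector_int (fun l => cexp (l * (tau%:C * cis phi)) *: h l) n @[n --> \oo] --> L,
    rnorm L <= C * H * expR (omega * (tau * cos phi)) / tau &
    forall n : nat, tau^-1 <= n%:R ->
      rnorm (sector_int (fun l => cexp (l * (tau%:C * cis phi)) *: h l) n - L) <=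
        C * H * expR (omega * (tau * cos phi)) / (tau ^+ 2 * n%:R)].
Proof.
have k2 : 0 < kappa / 2 by move: ray_decay_gt0; lra.
have [D [D0 hD]] := pow_exp_bound (k + 2) k2.
pose M := expR 1 * expR (kappa / 2) + D.
have M0 : 0 < M by rewrite addr_gt0// mulr_gt0// expR_gt0.
exists (12 * M) => [|h tau phi H hh tau0 phiI H0 hH]; first by rewrite mulr_gt0.
have ti0 : 0 < tau^-1 by rewrite invr_gt0.
set E := expR (omega * (tau * cos phi)); have E0 : 0 < E by exact: expR_gt0.
have N0 : 0 <= M * H * E by rewrite !mulr_ge0// ltW.
have [|r psi|L [cL L1 L2]] := @sector_int_cvg R w1 omega eta w1_lt etaI X
    (fun l => cexp (l * (tau%:C * cis phi)) *: h l) tau (M * H * E) (holo_cexp _ hh) N0 tau0.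
- move=> psi psiI; rewrite rnormZ.
  have a1 := cexp_arc phi psi (ltW tau0) (ltW ti0).
  rewrite mulVf ?gt_eqF// expRD in a1.
  have a2 := hH tau^-1 psi (lexx _) psiI; rewrite mulfV ?gt_eqF// expr1n !mulr1 in a2.
  apply: le_trans (ler_pM (rnorm_ge0 _) (rnorm_ge0 _) a1 a2) _; rewrite -/E.
  rewrite (_ : E * _ * _ = expR 1 * expR (kappa / 2) * (H * E)); last by ring.
  rewrite -[leRHS]mulrA; apply: ler_wpM2r; first by rewrite mulr_ge0// ltW.
  by rewrite lerDl ltW.
- move=> tr psiE; rewrite rnormZ; have r0 : 0 < r by lra.
  have v0 : 0 < tau * r by exact: mulr_gt0.
  have a1 := cexp_ray (ltW tau0) (ltW r0) phiI psiE.
  have a2 := hH r psi tr _; rewrite psiE lexx in a2; have {}a2 := a2 isT.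
  apply: le_trans (ler_pM (rnorm_ge0 _) (rnorm_ge0 _) a1 a2) _; rewrite -/E.
  have := hD _ (ltW v0); set v := tau * r in v0 *.
  have -> : expR (- (kappa * v)) = expR (- (kappa / 2 * v)) * expR (- (kappa / 2 * v)).
    by rewrite -expRD; congr expR; lra.
  have ee : expR (- (kappa / 2 * v)) * expR (kappa / 2 * v) = 1.
    by rewrite -expRD addNr expR0.
  move=> hv; rewrite ler_pdivlMr ?exprn_gt0//.
  set e1 := expR (- (kappa / 2 * v)) in hv ee *; set e2 := expR (kappa / 2 * v) in ee *.
  rewrite [leLHS](_ : _ = (H * E) * (v ^+ (k + 2) * e1) * (e1 * e2)); last by rewrite exprD; ring.
  rewrite ee mulr1 (_ : M * H * E = (H * E) * M); last by ring.
  apply: ler_wpM2l; first by rewrite mulr_ge0// ltW.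
  apply: le_trans hv _; rewrite /M lerDr mulr_ge0// expR_ge0.
exists L; split => //; first by apply: le_trans L1 _; rewrite !mulrA.
move=> n /L2 h2; apply: le_trans h2 _.
apply: ler_wpM2r; first by rewrite invr_ge0 mulr_ge0// sqr_ge0.
rewrite (_ : 12 * M * H * E = 12 * (M * H * E)); last by ring.
by apply: ler_wpM2r => //; rewrite ler_nat.
Qed.

Definition invlap_integrand (z : R[i]) (x : X) (l : R[i]) : X := cexp (l * z) *: F l x.

Lemma holo_invlap_integrand z x : holo w1 eta (invlap_integrand z x).
Proof. exact: holo_cexp (td_holo td x). Qed.

(** The inverse Laplace transform of [F], as a limit over truncated contours. *)
Definition invlap (z : R[i]) (x : X) : X := twopii^-1 *: lim (sector_int (invlap_integrand z x) n @[n --> \oo]).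

Let invr_le (tau r : R) : 0 < tau -> tau^-1 <= r -> r^-1 <= tau.
Proof.
move=> t0 tr; rewrite -[leRHS]invrK lef_pV2 ?posrE ?invr_gt0//.
by apply: lt_le_trans tr; rewrite invr_gt0.
Qed.

Let expk1 (tau r : R) : 0 < tau -> tau^-1 <= r -> 1 <= expR (kappa / 2 * (tau * r)).
Proof.
move=> t0 tr; have r0 : 0 < r by apply: lt_le_trans tr; rewrite invr_gt0.
rewrite -expR0 ler_expR; apply: mulr_ge0; first by rewrite divr_ge0// ltW.
by rewrite mulr_ge0// ltW.
Qed.

Lemma F_sector_pt : exists2 C : R, 0 < C & forall r psi x, 0 < r -> `|psi| <= theta ->
  rnorm (F (pt r psi) x) <= C / r * rnorm x /\
  rnorm (pt r psi *: F (pt r psi) x) <= C * rnorm x.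
Proof.
have [C C0 hC] := td_bound td; exists (C / cos eta + C).
  by rewrite addr_gt0// divr_gt0.
move=> r psi x r0 psiI; have Up := lsector_pt w1_lt etaI (ltW r0) psiI.
have nr := rnorm_sector_pt w1_ge0 w1_lt etaI (ltW r0) psiI.
have pr : 0 < rnorm (pt r psi) by apply: lt_le_trans nr; exact: mulr_gt0.
have nx := rnorm_ge0 x; have := hC _ x Up => h.
have Cc : 0 <= C / cos eta by rewrite divr_ge0// ltW.
split.
  apply: le_trans h _; apply: ler_wpM2r => //.
  have -> : (C / cos eta + C) / r = C / (r * cos eta) + C / r.
    by field; rewrite !gt_eqF.
  apply: (@le_trans _ _ (C / (r * cos eta))); last by rewrite lerDl divr_ge0// ltW.
  by apply: ler_wpM2l; [exact: ltW|rewrite lef_pV2 ?posrE// mulr_gt0].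
rewrite rnormZ; apply: le_trans (ler_wpM2l (ltW pr) h) _.
rewrite [leLHS](_ : _ = C * rnorm x); last by field; rewrite gt_eqF.
by rewrite mulrDl lerDr mulr_ge0.
Qed.

Lemma invlap_integral : exists2 M : R, 0 < M & forall tau phi x, 0 < tau -> `|phi| <= eta / 4 ->
  let z := tau%:C * cis phi in let E := expR (omega * (tau * cos phi)) in
  [/\ sector_int (invlap_integrand z x) n @[n --> \oo] --> twopii *: invlap z x,
      rnorm (invlap z x) <= M * E * rnorm x &
      forall n : nat, tau^-1 <= n%:R ->
        rnorm (twopii^-1 *: sector_int (invlap_integrand z x) n - invlap z x) <= M * E * rnorm x / (tau * n%:R)].
Proof.
have [C C0 hC] := F_sector_pt; have [D D0 hD] := sector_integral 0.
exists (D * C) => [|tau phi x tau0 phiI z E]; first exact: mulr_gt0.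
have nx := rnorm_ge0 x.
have H0 : 0 <= C * tau * rnorm x by rewrite !mulr_ge0// ltW.
have [|L [cL L1 L2]] := hD (fun l => F l x) tau phi _ (td_holo td x) tau0 phiI H0.
  move=> r psi tr psiI; have r0 : 0 < r by apply: lt_le_trans tr; rewrite invr_gt0.
  have [h _] := hC r psi x r0 psiI; apply: le_trans h _.
  rewrite expr0 mulr1; apply: (@le_trans _ _ (C * tau * rnorm x)).
    by apply: ler_wpM2r => //; apply: ler_wpM2l; [exact: ltW|exact: invr_le].
  by apply: ler_peMr => //; exact: expk1.
have t0 : tau != 0 by rewrite gt_eqF.
have tn := twopii_neq0; have ti := rnorm_twopii_inv_le1.
have lL : lim (sector_int (invlap_integrand z x) n @[n --> \oo]) = L by exact/cvg_lim.
have fE : invlap z x = twopii^-1 *: L by rewrite /invlap lL.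
split.
- by rewrite fE scalerA mulfV// scale1r.
- rewrite fE rnormZ; apply: le_trans (_ : rnorm L <= _).
    by apply: ler_piMl => //; exact: rnorm_ge0.
  by apply: le_trans L1 _; rewrite /E le_eqVlt; apply/orP; left; apply/eqP; field.
move=> n tn'; have n0 : 0 < n%:R :> R by apply: lt_le_trans tn'; rewrite invr_gt0.
rewrite fE -scalerBr rnormZ; apply: le_trans (_ : rnorm (sector_int (invlap_integrand z x) n - L) <= _).
  by apply: ler_piMl => //; exact: rnorm_ge0.
apply: le_trans (L2 n tn') _; rewrite /E le_eqVlt; apply/orP; left; apply/eqP.
by field; rewrite t0 gt_eqF.
Qed.

Lemma sector_polar (z : R[i]) : osector 0 (eta / 4) z -> exists tau phi : R,
  [/\ 0 < tau, `|phi| <= eta / 4 & z = tau%:C * cis phi].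
Proof.
move=> [tau [phi [t0 /andP[p1 p2] ->]]]; exists tau, phi; split => //; last by rewrite rc0 add0r.
by rewrite ler_norml; apply/andP; split; exact: ltW.
Qed.

Lemma invlap_lin (tau phi : R) : 0 < tau -> `|phi| <= eta / 4 -> linear (invlap (tau%:C * cis phi)).
Proof.
move=> t0 pI a x y; have [M _ hM] := invlap_integral.
have [c1 _ _] := hM _ _ x t0 pI; have [c2 _ _] := hM _ _ y t0 pI.
have [c3 _ _] := hM _ _ (a *: x + y) t0 pI.
set z := _ * _ in c1 c2 c3 *.
have E n : sector_int (invlap_integrand z (a *: x + y)) n = a *: sector_int (invlap_integrand z x) n + sector_int (invlap_integrand z y) n.
  rewrite -sector_int_comb//; [|exact: holo_invlap_integrand|exact: holo_invlap_integrand].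
  congr sector_int; apply/funext => l; rewrite /invlap_integrand (td_lin td); module.
have c4 := cvg_comb a c1 c2.
have : twopii *: invlap z (a *: x + y) = a *: (twopii *: invlap z x) + twopii *: invlap z y.
  apply: (@cvg_unique _ (@norm_hausdorff _ _) _ _ _ _ c3).
  by rewrite (funext E : sector_int _ = _).
exact: scaler_comb_inj twopii_neq0.
Qed.

(** Differentiation under the integral multiplies the transform by [l]. *)
Definition dinvlap (z : R[i]) (x : X) : X :=
  twopii^-1 *: lim (sector_int (fun l => cexp (l * z) *: (l *: F l x)) n @[n --> \oo]).

Let holo_lF x : holo w1 eta (fun l => l *: F l x).
Proof. exact: holo_mul holo_id (td_holo td x). Qed.

Lemma dinvlap_integral : exists2 M : R, 0 < M & forall tau phi x, 0 < tau -> `|phi| <= eta / 4 ->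
  let z := tau%:C * cis phi in let E := expR (omega * (tau * cos phi)) in
  sector_int (fun l => cexp (l * z) *: (l *: F l x)) n @[n --> \oo] --> twopii *: dinvlap z x /\
  rnorm (dinvlap z x) <= M * E / tau * rnorm x.
Proof.
have [C C0 hC] := F_sector_pt; have [D D0 hD] := sector_integral 0.
exists (D * C) => [|tau phi x tau0 phiI z E]; first exact: mulr_gt0.
have nx := rnorm_ge0 x.
have H0 : 0 <= C * rnorm x by rewrite !mulr_ge0// ltW.
have [|L [cL L1 L2]] := hD (fun l => l *: F l x) tau phi _ (holo_lF x) tau0 phiI H0.
  move=> r psi tr psiI; have r0 : 0 < r by apply: lt_le_trans tr; rewrite invr_gt0.
  have [_ h] := hC r psi x r0 psiI; apply: le_trans h _.
  by rewrite expr0 mulr1; apply: ler_peMr => //; exact: expk1.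
have tn := twopii_neq0; have ti := rnorm_twopii_inv_le1.
have lL : lim (sector_int (fun l => cexp (l * z) *: (l *: F l x)) n @[n --> \oo]) = L by exact/cvg_lim.
have fE : dinvlap z x = twopii^-1 *: L by rewrite /dinvlap lL.
split; first by rewrite fE scalerA mulfV// scale1r.
rewrite fE rnormZ; apply: le_trans (_ : rnorm L <= _).
  by apply: ler_piMl => //; exact: rnorm_ge0.
by apply: le_trans L1 _; rewrite /E le_eqVlt; apply/orP; left; apply/eqP; field; rewrite gt_eqF.
Qed.

Lemma dinvlap_lin (tau phi : R) : 0 < tau -> `|phi| <= eta / 4 -> linear (dinvlap (tau%:C * cis phi)).
Proof.
move=> t0 pI a x y; have [M _ hM] := dinvlap_integral.
have [c1 _] := hM _ _ x t0 pI; have [c2 _] := hM _ _ y t0 pI.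
have [c3 _] := hM _ _ (a *: x + y) t0 pI.
set z := _ * _ in c1 c2 c3 *.
pose f x l := cexp (l * z) *: (l *: F l x).
have E n : sector_int (f (a *: x + y)) n = a *: sector_int (f x) n + sector_int (f y) n.
  rewrite -sector_int_comb//; [|exact: holo_cexp|exact: holo_cexp].
  congr sector_int; apply/funext => l; rewrite /f (td_lin td); module.
have c4 := cvg_comb a c1 c2.
have : twopii *: dinvlap z (a *: x + y) = a *: (twopii *: dinvlap z x) + twopii *: dinvlap z y.
  apply: (@cvg_unique _ (@norm_hausdorff _ _) _ _ _ _ c3).
  by rewrite (funext E : sector_int _ = _).
exact: scaler_comb_inj twopii_neq0.
Qed.

(** Taylor expansion of the family, uniform in the vector; the increment [h]
    is small enough for the exponential decay to absorb [e^(l h)]. *)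
Lemma invlap_expand (tau phi : R) : 0 < tau -> `|phi| <= eta / 4 ->
  exists2 C : R, 0 < C & exists2 d : R, 0 < d & forall (h : R[i]) (x : X), rnorm h < d ->
    let z := tau%:C * cis phi in
    rnorm (invlap (z + h) x - invlap z x - h *: dinvlap z x) <= C * rnorm h ^+ 2 * rnorm x.
Proof.
move=> tau0 pI; have [C C0 hC] := F_sector_pt; have [D D0 hD] := sector_integral 1.
have [M _ hM] := invlap_integral; have [M' _ hM'] := dinvlap_integral.
set z := tau%:C * cis phi.
pose K := D * (3 * C * (omega + tau^-1) * expR omega) * expR (omega * (tau * cos phi)) / tau.
have ti0 : 0 < tau^-1 by rewrite invr_gt0.
have K0 : 0 < K.
  rewrite divr_gt0// mulr_gt0 ?expR_gt0// mulr_gt0// mulr_gt0 ?expR_gt0//.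
  by rewrite mulr_gt0 ?addr_gt0// mulr_gt0.
exists K => //; exists (Num.min 1 (kappa / 2 * tau)).
  by rewrite lt_min ltr01 mulr_gt0//; move: ray_decay_gt0; lra.
move=> h x; rewrite lt_min => /andP[h1 h2].
have nx := rnorm_ge0 x; have nh := rnorm_ge0 h.
pose rem l : X := (cexp (l * h) - 1 - l * h) *: F l x.
have hrem : holo w1 eta rem.
  apply: holo_mul; last exact: (td_holo td x).
  move=> l _; have d1 := cderiv_mul (cderiv_id l) (cderiv_cst h l).
  have d2 := cderiv_comp d1 (cderiv_cexp (l * h)).
  have d3 := cderivB d2 (cderiv_cst (1 : R[i]) l).
  have d4 := cderivB d3 d1.
  by eexists; exact: d4.
have H0 : 0 <= (3 * C * (omega + tau^-1) * expR omega) * rnorm h ^+ 2 * rnorm x.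
  rewrite mulr_ge0// mulr_ge0 ?sqr_ge0// mulr_ge0 ?expR_ge0// mulr_ge0//.
    by rewrite mulr_ge0// ltW.
  by rewrite addr_ge0// ltW.
have [|L [cL L1 _]] := hD rem tau phi _ hrem tau0 pI H0.
  move=> r psi tr psiI; have r0 : 0 < r by apply: lt_le_trans tr.
  have [_ hF] := hC r psi x r0 psiI.
  have nl := rnorm_sector_pt_le w1_ge0 w1_lt psi (ltW r0).
  set l := pt r psi in hF nl *; rewrite /rem rnormZ.
  have := cexp_remainder (l * h); rewrite rnormM => hr.
  have nl0 := rnorm_ge0 l; have nF := rnorm_ge0 (F l x).
  rewrite rnormZ in hF.
  apply: le_trans (ler_wpM2r nF hr) _.
  have e1 : expR (rnorm l * rnorm h) <= expR omega * expR (kappa / 2 * (tau * r)).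
    rewrite -expRD ler_expR.
    have : rnorm l * rnorm h <= (omega + r) * rnorm h by apply: ler_wpM2r.
    have : omega * rnorm h <= omega * 1 by rewrite ler_pM2l// ltW.
    have : r * rnorm h <= r * (kappa / 2 * tau) by rewrite ler_pM2l// ltW.
    lra.
  have lr : rnorm l <= (omega + tau^-1) * (tau * r).
    have : omega * 1 <= omega * (tau * r).
      by rewrite ler_pM2l// -(mulfV (_ : tau != 0)) ?gt_eqF// ler_pM2l.
    by rewrite mulrDl [tau^-1 * _]mulrA mulVf ?gt_eqF// mul1r; lra.
  rewrite [leLHS](_ : _ = 3 * rnorm h ^+ 2 * (rnorm l * rnorm (F l x)) * (rnorm l * expR (rnorm l * rnorm h))); last by ring.
  rewrite [leRHS](_ : _ = 3 * rnorm h ^+ 2 * (C * rnorm x) * (((omega + tau^-1) * (tau * r)) * (expR omega * expR (kappa / 2 * (tau * r))))); last by ring.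
  apply: ler_pM.
  - by rewrite mulr_ge0 ?mulr_ge0 ?sqr_ge0.
  - by rewrite mulr_ge0 ?expR_ge0.
  - by apply: ler_wpM2l => //; rewrite mulr_ge0 ?sqr_ge0.
  - by apply: ler_pM => //; exact: expR_ge0.
have [c1 _ _] := hM _ _ x tau0 pI; have [c2 _] := hM' _ _ x tau0 pI.
rewrite -/z in c1 c2 cL.
have E n : sector_int (invlap_integrand (z + h) x) n = h *: sector_int (fun l => cexp (l * z) *: (l *: F l x)) n +
   (1 *: sector_int (invlap_integrand z x) n + sector_int (fun l => cexp (l * z) *: rem l) n).
  rewrite -sector_int_comb//; [|exact: holo_invlap_integrand|exact: holo_cexp].
  rewrite -sector_int_comb//; [|by apply: holo_cexp; exact: holo_lF|]; last first.
    by apply: holo_comb; [exact: holo_invlap_integrand|exact: holo_cexp].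
  congr sector_int; apply/funext => l; rewrite /invlap_integrand /rem mulrDr cexpD; module.
have c3 := cvg_comb h c2 (cvg_comb 1 c1 cL).
have lE : lim (sector_int (invlap_integrand (z + h) x) n @[n --> \oo]) = h *: (twopii *: dinvlap z x) + (1 *: (twopii *: invlap z x) + L).
  by apply/cvg_lim => //; rewrite (funext E : sector_int _ = _).
have tn := twopii_neq0.
cbv zeta.
have -> : invlap (z + h) x - invlap z x - h *: dinvlap z x = twopii^-1 *: L.
  by rewrite [invlap (z + h) x]/invlap lE; exact: taylor_cancel.
rewrite rnormZ; apply: le_trans (_ : rnorm L <= _).
  by apply: ler_piMl; [exact: rnorm_ge0|exact: rnorm_twopii_inv_le1].
apply: le_trans L1 _; rewrite /K le_eqVlt; apply/orP; left; apply/eqP.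
by field; rewrite gt_eqF.
Qed.

Lemma invlap_holomorphic : op_holomorphic_on (osector 0 (eta / 4)) invlap.
Proof.
move=> z /sector_polar[tau [phi [t0 pI ->]]].
have [M M0 hM] := invlap_integral; have [M' M'0 hM'] := dinvlap_integral.
split.
  split; first exact: invlap_lin.
  exists (M * expR (omega * (tau * cos phi))) => x.
  by have [_ h _] := hM _ _ x t0 pI.
exists (dinvlap (tau%:C * cis phi)).
  split; first exact: dinvlap_lin.
  by eexists => x; have [_ h] := hM' _ _ x t0 pI; exact: h.
have [C C0 [d d0 hC]] := invlap_expand t0 pI.
apply/cvgrPdist_le => /= e e0; rewrite /dnbhs /within /= nearE.
apply/rnorm_near; exists (Num.min d (e / C)); first by rewrite lt_min d0 divr_gt0.
move=> h; rewrite subr0 lt_min => /andP[hd he] hn.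
have nh : 0 < rnorm h.
  by rewrite lt_neqAle rnorm_ge0 andbT eq_sym; apply: contra hn => /eqP/rnorm_eq0->.
have bound x : rnorm x <= 1 ->
    rnorm (h^-1 *: (invlap (tau%:C * cis phi + h) x - invlap (tau%:C * cis phi) x) - dinvlap (tau%:C * cis phi) x) <= e.
  move=> x1; have := hC h x hd => /= hh.
  rewrite (_ : _ - _ = h^-1 *: (invlap (tau%:C * cis phi + h) x - invlap (tau%:C * cis phi) x - h *: dinvlap (tau%:C * cis phi) x)); last first.
    by rewrite [in RHS]scalerBr scalerA mulVf// scale1r.
  rewrite rnormZ rnormV ler_pdivrMl//; apply: le_trans hh _.
  move: he; rewrite ltr_pdivlMr// => he.
  apply: (@le_trans _ _ (C * rnorm h ^+ 2)).
    by apply: ler_piMr => //; rewrite mulr_ge0 ?sqr_ge0// ltW.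
  by rewrite expr2; nra.
rewrite sub0r normrN ger0_norm; first exact: opnorm_le.
apply: (@le_trans _ _ (rnorm (h^-1 *: (invlap (tau%:C * cis phi + h) 0 - invlap (tau%:C * cis phi) 0) - dinvlap (tau%:C * cis phi) 0))).
  exact: rnorm_ge0.
apply: sup_upper_bound; last by exists 0 => //=; rewrite rnorm0.
split; last by exists e => _ [x /= x1 <-]; exact: bound.
by eexists; exists 0 => //=; rewrite rnorm0.
Qed.

End Family.

(** * Bounds for the resolvent family *)

Section FamilyBounds.
Context {R : realType} {X : completeNormedModType R[i]}.
Variables (A : linop X) (g : R -> R[i]) (w1 omega eta zeta : R).
Variables (m : R[i] -> R[i]) (F : R[i] -> X -> X) (Q : X -> X).
Hypothesis w1_gt0 : 0 < w1.
Hypothesis w1_lt : w1 < omega.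
Hypothesis etaI : 0 < eta < pi / 2.
Hypothesis zeta_gt1 : 1 < zeta.
Hypothesis td : transform_data A g w1 omega eta zeta m F Q.

Local Notation theta := (ray_angle eta).
Local Notation pt := (sector_pt omega).
Local Notation sector_int := (sector_int w1 omega eta).
Local Notation invlap := (invlap w1 omega eta F).
Local Notation dinvlap := (dinvlap w1 omega eta F).
Local Notation invlap_integrand := (invlap_integrand F).
Local Notation twopii := (2 * 'i * pi%:C : R[i]).

Let omega_gt0 : 0 < omega. Proof. exact: lt_trans w1_lt. Qed.

Let phi0 : `|0 : R| <= eta / 4.
Proof. by have /andP[e0 _] := etaI; rewrite normr0 divr_ge0// ltW. Qed.

Lemma cis0 : cis (0 : R) = 1.
Proof. by rewrite /cis cos0 sin0 complexr0. Qed.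

Let realE (t : R) : t%:C * cis 0 = t%:C.
Proof. by rewrite cis0 mulr1. Qed.

Definition rfam (t : R) (x : X) : X := if 0 < t then invlap t%:C x else x.

Lemma rfamE t x : 0 < t -> rfam t x = invlap t%:C x.
Proof. by rewrite /rfam => ->. Qed.

Lemma rfam_integral : exists2 M : R, 0 < M & forall t x, 0 < t ->
  [/\ sector_int (invlap_integrand t%:C x) n @[n --> \oo] --> twopii *: rfam t x,
      rnorm (rfam t x) <= M * expR (omega * t) * rnorm x &
      forall n : nat, t^-1 <= n%:R ->
        rnorm (twopii^-1 *: sector_int (invlap_integrand t%:C x) n - rfam t x) <=
          M * expR (omega * t) * rnorm x / (t * n%:R)].
Proof.
have [M M0 hM] := invlap_integral w1_gt0 w1_lt etaI td; exists M => // t x t0.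
by rewrite rfamE//; have /= := hM t 0 x t0 phi0; rewrite realE cos0 mulr1.
Qed.

Lemma rfam_bound : exists2 M : R, 1 <= M & forall t x, 0 <= t ->
  rnorm (rfam t x) <= M * expR (omega * t) * rnorm x.
Proof.
have [M M0 hM] := rfam_integral; exists (M + 1) => [|t x t0]; first by rewrite lerDr ltW.
have nx := rnorm_ge0 x; have e1 : 1 <= expR (omega * t).
  by rewrite -expR0 ler_expR mulr_ge0// ltW.
have [t1|] := ltP 0 t; last first.
  rewrite /rfam ltNge => ->; rewrite -[leLHS]mul1r; apply: ler_wpM2r => //.
  by rewrite -[leLHS]mulr1; apply: ler_pM => //; rewrite lerDr ltW.
have [_ h _] := hM t x t1; apply: le_trans h _; apply: ler_wpM2r => //.
by apply: ler_wpM2r; [exact: expR_ge0|rewrite lerDl].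
Qed.

Lemma rfam_linear t : 0 <= t -> linear (rfam t).
Proof.
rewrite /rfam => t0; case: ltP => // t1 a x y.
by have := invlap_lin w1_gt0 w1_lt etaI td t1 phi0 a x y; rewrite realE.
Qed.

Lemma rfam_bounded t : 0 <= t -> bounded_linop rnorm (rfam t).
Proof.
move=> t0; split; first exact: rfam_linear.
by have [M _ hM] := rfam_bound; exists (M * expR (omega * t)) => x; exact: hM.
Qed.

(** Unlike the family itself, its truncations are contour integrals over a fixed path. *)
Definition rfam_trunc (n : nat) (t : R) (x : X) : X := twopii^-1 *: sector_int (invlap_integrand t%:C x) n.

(** For [t n >= 1] the truncation is close to the family; for [t n <= 1] the
    exponential is bounded on the arc of radius [n], which closes the contour
    within the sector. *)
Lemma rfam_trunc_bound : exists2 M : R, 0 < M & forall n t x, (0 < n)%N -> 0 <= t ->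
  rnorm (rfam_trunc n t x) <= M * expR (omega * t) * rnorm x.
Proof.
have [M M0 hM] := rfam_integral; have [C C0 hC] := F_sector_pt w1_gt0 w1_lt etaI td.
have pp := pi_gt0 R; have th0 := ray_angle_gt0 etaI.
exists (2 * M + expR 1 * C * (2 * theta)).
  by rewrite addr_gt0 ?mulr_gt0// expR_gt0.
move=> n t x n0 t0; have nx := rnorm_ge0 x; have E0 := expR_gt0 (omega * t).
set E := expR _ in E0 *; have n0' : 0 < n%:R :> R by rewrite ltr0n.
have p1 : 0 <= M * E * rnorm x by rewrite !mulr_ge0// ltW.
have p2 : 0 <= expR 1 * C * (2 * theta) * E * rnorm x.
  by rewrite !mulr_ge0 ?expR_ge0// ltW.
rewrite [_ * E]mulrDl mulrDl.
have [tn|tn] := leP 1 (t * n%:R).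
  have t1 : 0 < t.
    by rewrite lt_neqAle t0 andbT; apply/eqP => te; move: tn; rewrite -te mul0r ler10.
  have [_ h1 h2] := hM t x t1; have := h2 n; rewrite -/E in h1 *.
  rewrite -[t^-1]mul1r ler_pdivrMr// mulrC => /(_ tn) h3.
  have h4 : M * E * rnorm x / (t * n%:R) <= M * E * rnorm x.
    by apply: ler_piMr => //; rewrite invf_le1// mulr_gt0.
  have := rnormD (twopii^-1 *: sector_int (invlap_integrand t%:C x) n - rfam t x) (rfam t x).
  rewrite subrK -/(rfam_trunc n t x) => h5; lra.
rewrite /rfam_trunc rnormZ.
apply: le_trans (_ : rnorm (sector_int (invlap_integrand t%:C x) n) <= _).
  by apply: ler_piMl; [exact: rnorm_ge0|exact: rnorm_twopii_inv_le1].
have h := @holo_arc R w1 omega eta w1_lt etaI X (invlap_integrand t%:C x) n%:R (- theta) theta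
  (E * expR 1 * (C / n%:R * rnorm x)) (holo_invlap_integrand td _ _) (ltW n0').
have {h}h : rnorm (sector_int (invlap_integrand t%:C x) n) <= E * expR 1 * (C / n%:R * rnorm x) * n%:R * (theta - - theta).
  apply: h => //; first by lra.
  move=> psi psiI; have psiI' : `|psi| <= theta by rewrite ler_norml.
  rewrite /invlap_integrand rnormZ; apply: ler_pM; [exact: rnorm_ge0|exact: rnorm_ge0| |].
    have := @cexp_arc R omega t 0 n%:R psi t0 (ltW n0').
    rewrite realE cos0 mulr1 => h; apply: le_trans h _.
    by rewrite -expRD ler_expR lerD2l mulrC ltW.
  by have [] := hC n%:R psi x n0' psiI'.
apply: le_trans h _; rewrite [leLHS](_ : _ = expR 1 * C * (2 * theta) * E * rnorm x).
  by lra.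
by field; rewrite gt_eqF.
Qed.

(** The values of the family lie in the domain of [A]: they are the images
    under the resolvent [Q] of an integral that still converges absolutely. *)
Lemma rfam_smoothing : exists2 M : R, 0 < M & forall t x, 0 < t ->
  exists2 w : X, rfam t x = Q w &
    rnorm w <= M * expR (omega * t) * (1 + t `^ (- zeta)) * rnorm x.
Proof.
have [C C0 hC] := F_sector_pt w1_gt0 w1_lt etaI td; have [D D0 hD] := td_growth td.
have [M _ hM] := rfam_integral.
pose k := Num.bound (zeta - 1).
have zk : zeta - 1 <= k%:R.
  by have := @archi_boundP R (zeta - 1); rewrite subr_ge0 ltW// => /(_ isT) /ltW.
have [K K0 hK] := @sector_integral R X w1 omega eta w1_lt etaI k.
exists (2 * K * (C + D * (C + 1))) => [|t x t0].
  by rewrite mulr_gt0 ?mulr_gt0 ?addr_gt0 ?mulr_gt0// addr_gt0.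
have nx := rnorm_ge0 x.
pose h l : X := F l x - m l *: (l *: F l x - x).
have hh : holo w1 eta h.
  have h1 := @holo_mul R X w1 eta (fun l => l) (fun l => F l x) (@holo_id R w1 eta) (td_holo td x).
  have h2 := holo_mul (td_m td) (holo_comb (-1) (@holo_cst R X w1 eta x) h1).
  have h3 := holo_comb (-1) h2 (td_holo td x).
  rewrite (_ : h = fun l => (-1) *: (m l *: ((-1) *: x + l *: F l x)) + F l x) => [|]; first exact: h3.
  by apply/funext => l; rewrite /h; module.
have tz0 : 0 <= t `^ (1 - zeta) by exact: powR_ge0.
pose H := (C * t + D * (C + 1) * (1 + t `^ (1 - zeta))) * rnorm x.
have C1 : 0 < C + 1 by rewrite addr_gt0.
have DC : 0 <= D * (C + 1) by rewrite mulr_ge0// ltW.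
have H0 : 0 <= H.
  rewrite mulr_ge0// addr_ge0// ?mulr_ge0 ?addr_ge0//; by rewrite ltW.
have ti0 : 0 < t^-1 by rewrite invr_gt0.
have [|L [cL L1 _]] := hK h t 0 H hh t0 phi0 H0.
  move=> r psi tr psiI; have r0 : 0 < r by apply: lt_le_trans tr.
  have tr1 : 1 <= t * r by rewrite -(mulfV (_ : t != 0)) ?gt_eqF// ler_pM2l.
  have [h1 h2] := hC r psi x r0 psiI; have h3 := hD r psi (ltW r0) psiI.
  set l := pt r psi in h1 h2 h3 *.
  apply: (@le_trans _ _ (H * (t * r) ^+ k)); last first.
    apply: ler_peMr; first by rewrite mulr_ge0// exprn_ge0// mulr_ge0// ltW.
    rewrite -expR0 ler_expR; apply: mulr_ge0; last by rewrite mulr_ge0// ltW.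
    by rewrite divr_ge0// ltW//; exact: ray_decay_gt0.
  have k1 : 1 <= (t * r) ^+ k by exact: exprn_ege1.
  have k0 : 0 <= (t * r) ^+ k by exact: le_trans k1.
  have b1 : rnorm (F l x) <= C * t * (t * r) ^+ k * rnorm x.
    apply: le_trans h1 _; apply: ler_wpM2r => //.
    rewrite -[leLHS]mulr1; apply: ler_pM => //; first by rewrite divr_ge0// ltW.
    apply: ler_wpM2l; first exact: ltW.
    by rewrite -[leRHS]invrK lef_pV2 ?posrE.
  have b2 : rnorm (m l *: (l *: F l x - x)) <=
      D * (C + 1) * (1 + t `^ (1 - zeta)) * (t * r) ^+ k * rnorm x.
    rewrite rnormZ; apply: le_trans (_ : D * (1 + r `^ (zeta - 1)) * ((C + 1) * rnorm x) <= _).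
      apply: ler_pM => //; [exact: rnorm_ge0|exact: rnorm_ge0|].
      apply: le_trans (rnormD _ _) _; rewrite rnormN.
      by rewrite mulrDl mul1r lerD2r.
    have p1 : 1 + r `^ (zeta - 1) <= (1 + t `^ (1 - zeta)) * (t * r) ^+ k.
      have -> : r `^ (zeta - 1) = t `^ (1 - zeta) * (t * r) `^ (zeta - 1).
        rewrite powRM ?ltW// mulrA -powRD; last by rewrite (gt_eqF t0) implybT.
        by rewrite (_ : 1 - zeta + (zeta - 1) = 0) ?powRr0 ?mul1r//; ring.
      have : (t * r) `^ (zeta - 1) <= (t * r) ^+ k.
        rewrite -powR_mulrn; last by rewrite mulr_ge0// ltW.
        exact: ler_powR.
      by move=> /(ler_wpM2l tz0); rewrite mulrDl mul1r; lra.
    rewrite [leLHS](_ : _ = D * (C + 1) * rnorm x * (1 + r `^ (zeta - 1))); last by ring.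
    rewrite [leRHS](_ : _ = D * (C + 1) * rnorm x * ((1 + t `^ (1 - zeta)) * (t * r) ^+ k)); last by ring.
    by apply: ler_wpM2l => //; exact: mulr_ge0.
  apply: le_trans (rnormD _ _) _; rewrite rnormN.
  apply: le_trans (lerD b1 b2) _; rewrite /H le_eqVlt; apply/orP; left; apply/eqP; ring.
have [c1 _ _] := hM t x t0; rewrite realE in cL.
have QE : twopii *: rfam t x = Q L.
  apply: (@cvg_unique _ (@norm_hausdorff _ _) _ _ _ _ c1).
  have := lin_cvg (td_Q td) cL.
  rewrite (_ : (fun n => Q (sector_int _ n)) = sector_int (invlap_integrand t%:C x))//; apply/funext => n.
  have hc := holo_cexp t%:C hh.
  rewrite (sector_int_lin n w1_lt etaI (td_Q td) hc).
  apply/esym/sector_int_eq => //; first exact: (holo_invlap_integrand td).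
  move=> l Ul; have [Ql _] := td_Q td; rewrite /invlap_integrand linZ//.
  by rewrite {1}(td_eq td x Ul).
exists (twopii^-1 *: L).
  have [Ql _] := td_Q td; rewrite linZ// -QE scalerA mulVf ?scale1r//; exact: twopii_neq0.
rewrite rnormZ; apply: le_trans (_ : rnorm L <= _).
  by apply: ler_piMl; [exact: rnorm_ge0|exact: rnorm_twopii_inv_le1].
apply: le_trans L1 _; rewrite cos0 mulr1.
set E := expR _; have E0 : 0 < E by exact: expR_gt0.
have p0 : 0 <= t `^ (- zeta) by exact: powR_ge0.
have pE : t `^ (1 - zeta) = t * t `^ (- zeta).
  by rewrite powRD ?(gt_eqF t0) ?implybT// powRr1// ltW.
have ti : t^-1 <= 1 + t `^ (- zeta).
  have [t1|t1] := leP 1 t.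
    by apply: (@le_trans _ _ 1); [rewrite invf_le1|rewrite lerDl].
  apply: (@le_trans _ _ (t `^ (- zeta))); last by rewrite lerDr.
  have -> : t `^ (- zeta) = (t^-1) `^ zeta.
    by rewrite -(powR_inv1 (ltW t0)) -powRrM mulN1r.
  have ti1 : 1 <= t^-1 by rewrite invf_ge1// ltW.
  by have := ler_powR ti1 (ltW zeta_gt1); rewrite powRr1// ltW.
set p := t `^ (- zeta) in p0 pE ti *.
rewrite [leLHS](_ : _ = K * E * rnorm x * (C + D * (C + 1) * (t^-1 + p))); last first.
  by rewrite /H pE; field; rewrite gt_eqF.
rewrite [leRHS](_ : _ = K * E * rnorm x * (2 * (C + D * (C + 1)) * (1 + p))); last by ring.
apply: ler_wpM2l; first by rewrite !mulr_ge0// ltW.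
have := ler_wpM2l DC ti; have := mulr_ge0 (ltW C0) p0; have := mulr_ge0 DC p0.
by move: C0; lra.
Qed.

Lemma rfam_commute t x : 0 < t -> rfam t (Q x) = Q (rfam t x).
Proof.
move=> t0; have [M _ hM] := rfam_integral; have [Ql _] := td_Q td.
have [c1 _ _] := hM t (Q x) t0; have [c2 _ _] := hM t x t0.
apply: (scalerI twopii_neq0); rewrite -(linZ _ _ Ql).
apply: (@cvg_unique _ (@norm_hausdorff _ _) _ _ _ _ c1).
have := lin_cvg (td_Q td) c2.
rewrite (_ : (fun n => Q (sector_int _ n)) = sector_int (invlap_integrand t%:C (Q x)))//; apply/funext => n.
have hc := holo_invlap_integrand td t%:C x.
rewrite (sector_int_lin n w1_lt etaI (td_Q td) hc).
apply/esym/sector_int_eq => //; first exact: (holo_invlap_integrand td).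
by move=> l Ul; rewrite /invlap_integrand linZ// (td_FQ td).
Qed.

Lemma rfam_dom t x : 0 <= t -> dom A x -> dom A (rfam t x) /\ A (rfam t x) = rfam t (A x).
Proof.
have [t1|t1] := ltP 0 t; last by rewrite /rfam ltNge t1.
move=> _ dx; have xE := td_QK td dx.
have := rfam_commute (x - A x) t1; rewrite xE => SE.
have [d1 d2] := td_Qdom td (rfam t (x - A x)); rewrite -SE in d1 d2; split => //.
move: d2; rewrite linB; last by apply: rfam_linear; exact: ltW.
by move=> /addrI/oppr_inj.
Qed.

Lemma rfam_lipschitz : exists2 M : R, 0 < M & forall t, 0 < t ->
  exists2 C : R, 0 < C & exists2 d : R, 0 < d & forall s x, 0 < s -> `|s - t| < d ->
    rnorm (rfam s x - rfam t x) <=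
      (M * expR (omega * t) / t + C * `|s - t|) * `|s - t| * rnorm x.
Proof.
have [M M0 hM] := dinvlap_integral w1_gt0 w1_lt etaI td; exists M => // t t0.
have [C C0 [d d0 hC]] := invlap_expand w1_gt0 w1_lt etaI td t0 phi0.
exists C => //; exists d => // s x s0 sd; rewrite !rfamE//.
have [_ h1] := hM t 0 x t0 phi0; rewrite realE cos0 mulr1 in h1.
have h2 := hC (s - t)%:C x; rewrite rnormR realE in h2; have {}h2 := h2 sd.
cbv zeta in h2; have e : t%:C + (s - t)%:C = s%:C by rewrite -rcD addrC subrK.
rewrite e rcD rcN in h2.
have nx := rnorm_ge0 x; set k := `|s - t| in h2 *.
have k0 : 0 <= k by exact: normr_ge0.
have h3 : rnorm (invlap s%:C x - invlap t%:C x) <=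
    rnorm (invlap s%:C x - invlap t%:C x - (s%:C - t%:C) *: dinvlap t%:C x) + k * rnorm (dinvlap t%:C x).
  have kE : rnorm (s%:C - t%:C) = k by rewrite -rcN -rcD rnormR.
  by rewrite -kE -rnormZ; apply: le_trans (rnormD _ _); rewrite subrK.
apply: le_trans h3 _; have := ler_wpM2l k0 h1.
rewrite expr2 in h2; lra.
Qed.

(** The derivative is bounded by [M e^(omega t) / t], that is by the derivative of a
    multiple of the logarithm. *)
Lemma rfam_log : exists2 M : R, 0 < M & forall t0 t1 x, 0 < t0 -> t0 <= t1 ->
  rnorm (rfam t1 x - rfam t0 x) <= M * expR (omega * t1) * ln (t1 / t0) * rnorm x.
Proof.
have [M M0 hM] := rfam_lipschitz; exists M => // t0 t1 x t00 t01.
have nx := rnorm_ge0 x; pose K := M * expR (omega * t1) * rnorm x.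
have t10 : 0 < t1 by exact: lt_le_trans t01.
have -> : M * expR (omega * t1) * ln (t1 / t0) * rnorm x = K * ln t1 - K * ln t0.
  by rewrite ln_div ?posrE// /K; ring.
have mv := @mean_value_majorant R X (fun s => rfam s x) (fun s => K * ln s) (fun s => K * s^-1) t0 t1 t01.
cbv beta in mv; apply: mv.
  move=> s /andP[s0 s1]; have sp : 0 < s by exact: lt_le_trans s0.
  have := is_derive1_ln sp => h.
  by have := is_deriveZ K (is_derive1_ln sp).
move=> s /andP[s0 s1] e e0; have sp : 0 < s by exact: lt_le_trans s0.
have [C C0 [d d0 hC]] := hM s sp.
pose r := Num.min d (e / (C * (rnorm x + 1))).
have n1 : 0 < rnorm x + 1 by lra.
have cn : 0 < C * (rnorm x + 1) by exact: mulr_gt0.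
exists r; first by rewrite lt_min d0 divr_gt0.
move=> y /andP[y0 _]; rewrite lt_min => /andP[yd ye].
have yp : 0 < y by exact: lt_le_trans y0.
apply: le_trans (hC y x yp yd) _; set k := `|y - s| in ye *.
have k0 : 0 <= k by exact: normr_ge0.
rewrite mulrAC; apply: ler_wpM2r => //; rewrite mulrDl; apply: lerD.
  rewrite /K [leRHS](_ : _ = M * expR (omega * t1) / s * rnorm x); last by ring.
  apply: ler_wpM2r => //; apply: ler_wpM2r; first by rewrite invr_ge0 ltW.
  by apply: ler_wpM2l; [exact: ltW|rewrite ler_expR ler_pM2l].
move: ye; rewrite ltr_pdivlMr// => ye.
have := mulr_ge0 (ltW C0) k0; lra.
Qed.

End FamilyBounds.

(** * Inversion of the resolvent equation *)

Section RiemannIntegral.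
Context {R : realType} {X : completeNormedModType R[i]}.

(** The increment of the primitive telescopes over the partition. *)
Lemma rprim_rint (f Phi : R -> X) (a b : R) : a <= b -> rprim f Phi a b ->
  is_rint f a b (Phi b - Phi a).
Proof.
move=> ab fP e e0; have b1 : 0 < b - a + 1 by lra.
have [d d0 hd] := fP _ (divr_gt0 e0 b1); exists d => // n p xi p0 pn hp.
have mono k : (k <= n)%N -> a <= p k.
  elim: k => [|k IH] kn; first by rewrite p0.
  by have [/andP[h1 h2] _] := hp k kn; have := IH (ltnW kn); lra.
have mono' k : (k <= n)%N -> p (n - k)%N <= b.
  elim: k => [|k IH] kn; first by rewrite subn0 pn.
  have h : (n - k.+1 < n)%N by rewrite ltn_subrL (leq_ltn_trans _ kn).
  have [/andP[h1 h2] _] := hp _ h; have := IH (ltnW kn).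
  by rewrite -(subnSK kn); lra.
have tele : Phi b - Phi a = \sum_(i < n) (Phi (p i.+1) - Phi (p i)).
  by rewrite -(big_mkord xpredT (fun i => Phi (p i.+1) - Phi (p i))) telescope_sumr// pn p0.
have tele' : b - a = \sum_(i < n) (p i.+1 - p i).
  by rewrite -(big_mkord xpredT (fun i => p i.+1 - p i)) telescope_sumr// pn p0.
rewrite tele -sumrB; apply: le_lt_trans (rnorm_sum n
  (fun i => (p i.+1 - p i)%:C *: f (xi i) - (Phi (p i.+1) - Phi (p i)))) _.
apply: (@le_lt_trans _ _ (\sum_(i < n) e / (b - a + 1) * (p i.+1 - p i))).
  apply: ler_sum => i _; have [/andP[h1 h2] h3] := hp i (ltn_ord i).
  rewrite -rnormN opprB; apply: hd => //; first exact/mono/ltnW.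
  by have := mono' (n - i.+1)%N (leq_subr _ _); rewrite subKn.
rewrite -mulr_sumr -tele' mulrAC ltr_pdivrMr// ltr_pM2l//; lra.
Qed.

Lemma rint_riemann (f : R -> X) (t : R) v : 0 < t -> is_rint f 0 t v ->
  forall e : R, 0 < e -> exists2 N0 : nat, (0 < N0)%N & forall N : nat, (N0 <= N)%N ->
    rnorm (\sum_(j < N) (t / N%:R)%:C *: f (j%:R * (t / N%:R)) - v) < e.
Proof.
move=> t0 fi e /fi[d d0 hd].
exists (Num.bound (t / d)).+1 => // N hN.
have N0 : 0 < N%:R :> R by rewrite ltr0n (leq_trans _ hN).
have td : t / N%:R < d.
  rewrite ltr_pdivrMr// -ltr_pdivrMl// mulrC.
  have := @archi_boundP R (t / d); rewrite divr_ge0 ?ltW// => /(_ isT) h.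
  by apply: lt_le_trans h _; rewrite ler_nat ltnW.
have sE j : j.+1%:R * (t / N%:R) - j%:R * (t / N%:R) = t / N%:R :> R.
  by rewrite -natr1; ring.
have := hd N (fun j => j%:R * (t / N%:R)) (fun j => j%:R * (t / N%:R)).
under eq_bigr do rewrite sE.
apply => [||i iN]; rewrite ?mul0r//; first by field; rewrite gt_eqF.
rewrite sE lexx; split => //; rewrite -subr_ge0 sE; apply: divr_ge0; exact: ltW.
Qed.

Lemma rprim_riemann (f Phi : R -> X) (t : R) : 0 < t -> rprim f Phi 0 t ->
  forall e : R, 0 < e -> exists2 N0 : nat, (0 < N0)%N & forall N : nat, (N0 <= N)%N ->
    rnorm (\sum_(j < N) (t / N%:R)%:C *: f (j%:R * (t / N%:R)) - (Phi t - Phi 0)) < e.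
Proof. by move=> t0 /(rprim_rint (ltW t0)); exact: rint_riemann. Qed.

Lemma rint_unique (f : R -> X) (t : R) v w : 0 <= t -> is_rint f 0 t v -> is_rint f 0 t w -> v = w.
Proof.
move=> t0 fv fw; apply/eqP; rewrite -subr_eq0; apply/eqP/rnorm_small => e e0.
have e2 : 0 < e / 2 by rewrite divr_gt0.
have [z h1 h2] : exists2 z : X, rnorm (z - v) < e / 2 & rnorm (z - w) < e / 2.
  move: t0; rewrite le_eqVlt => /predU1P[t0|t0].
    rewrite -t0 in fv fw; have [d1 _ h1] := fv _ e2; have [d2 _ h2] := fw _ e2.
    by eexists; [apply: (h1 0%N (fun=> 0) (fun=> 0))|apply: (h2 0%N (fun=> 0) (fun=> 0))].
  have [N1 _ h1] := rint_riemann t0 fv e2; have [N2 _ h2] := rint_riemann t0 fw e2.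
  by eexists; [apply: h1 (leq_maxl N1 N2)|apply: h2 (leq_maxr N1 N2)].
rewrite rdistC in h1; have := rdist_triangle z v w; lra.
Qed.

End RiemannIntegral.

Section Vanishing.
Context {R : realType} {X : completeNormedModType R[i]}.
Variables (w1 omega eta : R).
Hypothesis w1_lt : w1 < omega.
Hypothesis etaI : 0 < eta < pi / 2.
Local Notation theta := (ray_angle eta).
Local Notation pt := (sector_pt omega).

Lemma Re_sector_pt r psi : complex.Re (pt r psi) = omega + r * cos psi.
Proof. by rewrite /sector_pt !(ReM, ReD, ImM, ImD) /= mul0r subr0. Qed.

Let expVle (v : R) : 0 < v -> expR (- v) <= v^-1.
Proof.
by move=> v0; rewrite expRN lef_pV2 ?posrE ?expR_gt0//; have := expR_ge1Dx v; lra.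
Qed.

(** Jordan's lemma. The exponential term is small on the left part of the arc, and
    of order [1 / n] on a part of length [4 d n] around the vertical direction,
    where [d] is arbitrarily small. *)
Lemma sector_int_vanish (K : R[i] -> X) (t c C : R) : holo w1 eta K -> 0 < t -> 0 < C -> omega <= c ->
  (forall r psi, 0 < r -> `|psi| <= theta -> c <= complex.Re (pt r psi) ->
     rnorm (K (pt r psi)) <= C / r ^+ 2) ->
  (forall r psi, 0 < r -> `|psi| <= theta -> complex.Re (pt r psi) <= c ->
     rnorm (K (pt r psi)) <= C / r ^+ 2 + C * expR (t * complex.Re (pt r psi)) / r) ->
  sector_int w1 omega eta K n @[n --> \oo] --> 0.
Proof.
move=> Kh t0 C0 oc hr hl; apply/cvg_rnorm => e e0.
have /andP[et0 et1] := etaI; have pp := pi_gt0 R; have p4 := @pi_le4 R.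
set E := expR (t * c); have E0 : 0 < E by exact: expR_gt0.
have CE : 0 < C * E by exact: mulr_gt0.
pose d := Num.min (eta / 4) (e / (8 * (C * E))).
have d0 : 0 < d by rewrite lt_min !divr_gt0// mulr_gt0.
have d1 : d <= eta / 4 by rewrite ge_min lexx.
have d2 : 4 * d * (C * E) <= e / 2.
  have : d <= e / (8 * (C * E)) by rewrite ge_min lexx orbT.
  by rewrite ler_pdivlMr ?mulr_gt0//; clear; lra.
have dI : 0 < d < pi / 2 by apply/andP; split; lra.
have [_ s0] := cos_sin_pos dI; set sd := sin d in s0.
pose G := 4 * C + 4 * d * C + 4 * (C + C * E / (t * sd)).
have G0 : 0 < G by rewrite !addr_gt0 ?mulr_gt0// ?addr_gt0 ?divr_gt0 ?mulr_gt0.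
exists (maxn (Num.bound ((c - omega) / sd)) (Num.bound (2 * G / e))).+1 => n.
rewrite gtn_max => /andP[n1 n2].
have n0 : 0 < n%:R :> R by rewrite ltr0n (leq_ltn_trans _ n1).
have {}n1 : c - omega <= n%:R * sd.
  rewrite -ler_pdivrMr//; have := @archi_boundP R ((c - omega) / sd).
  rewrite divr_ge0 ?subr_ge0 ?(ltW s0)// => /(_ isT) h.
  by apply/ltW/(lt_le_trans h); rewrite ler_nat ltnW.
have {}n2 : G / n%:R < e / 2.
  rewrite ltr_pdivrMr//; have := @archi_boundP R (2 * G / e).
  rewrite divr_ge0 ?mulr_ge0 ?(ltW e0) ?(ltW G0)// => /(_ isT).
  rewrite ltr_pdivrMr// => h.
  have : e * (Num.bound (2 * G / e))%:R <= e * n%:R.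
    by rewrite ler_pM2l// ler_nat ltnW.
  by clear -h; lra.
rewrite subr0.
have n2' : 0 < n%:R ^+ 2 :> R by exact: exprn_gt0.
have Cn0 : 0 <= C / n%:R ^+ 2 by rewrite divr_ge0// ltW.
have cE psi : complex.Re (pt n%:R psi) = omega + n%:R * cos `|psi|.
  by rewrite Re_sector_pt; have [p0|p0] := leP 0 psi; rewrite ?(ger0_norm p0) ?(ltr0_norm p0) ?cosN.
have K1 psi : `|psi| <= pi / 2 - d -> rnorm (K (pt n%:R psi)) <= C / n%:R ^+ 2.
  move=> pI; apply: hr => //; first by rewrite /ray_angle; lra.
  have : sd <= cos `|psi|.
    by rewrite /sd -cosBpihalf -cosN opprB; apply: cos_nincr => //; lra.
  by rewrite cE => /(ler_wpM2l (ltW n0)); clear -n1; lra.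
have K2 psi : `|psi| <= theta -> rnorm (K (pt n%:R psi)) <= C / n%:R ^+ 2 + C * E / n%:R.
  move=> pI; have [ch|ch] := leP c (complex.Re (pt n%:R psi)).
    apply: le_trans (hr _ _ n0 pI ch) _; rewrite lerDl divr_ge0// ltW//.
  apply: le_trans (hl _ _ n0 pI (ltW ch)) _; rewrite lerD2l.
  apply: ler_wpM2r; first by rewrite invr_ge0 ltW.
  by apply: ler_wpM2l; [exact: ltW|rewrite ler_expR ler_pM2l// ltW].
have ts : 0 < t * sd by exact: mulr_gt0.
have K3 psi : pi / 2 + d <= `|psi| <= theta ->
    rnorm (K (pt n%:R psi)) <= (C + C * E / (t * sd)) / n%:R ^+ 2.
  move=> /andP[p1 p2].
  have cs : cos `|psi| <= - sd.
    by rewrite /sd -cosDpihalf addrC; apply: cos_nincr; rewrite /ray_angle in p2; clear -p1 p2 d0 d1 et0 et1 pp; lra.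
  have {}cs : complex.Re (pt n%:R psi) <= omega + - (n%:R * sd).
    by rewrite cE lerD2l -mulrN ler_pM2l.
  have ch : complex.Re (pt n%:R psi) <= c.
    by have := mulr_gt0 n0 s0; clear -cs oc; lra.
  apply: le_trans (hl _ _ n0 p2 ch) _; rewrite mulrDl lerD2l.
  have : expR (t * complex.Re (pt n%:R psi)) <= E / (t * sd * n%:R).
    apply: (@le_trans _ _ (E * expR (- (t * sd * n%:R)))).
      rewrite -expRD ler_expR; have := ler_wpM2l (ltW t0) cs; have := ler_wpM2l (ltW t0) oc.
      by clear; lra.
    by apply: ler_wpM2l; [exact: ltW|apply: expVle; exact: mulr_gt0].
  move=> h; apply: (@le_trans _ _ (C * (E / (t * sd * n%:R)) / n%:R)).
    apply: ler_wpM2r; first by rewrite invr_ge0 ltW.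
    by apply: ler_wpM2l => //; exact: ltW.
  rewrite le_eqVlt; apply/orP; left; apply/eqP; field.
  by rewrite !gt_eqF.
have j := @sector_int_jordan R w1 omega eta w1_lt etaI X K n d (C / n%:R ^+ 2)
  (C / n%:R ^+ 2 + C * E / n%:R) ((C + C * E / (t * sd)) / n%:R ^+ 2) Kh d0.
have {}j := j (ltac:(clear -d1 et0; lra)) Cn0.
have {}j : rnorm (sector_int w1 omega eta K n) <= G / n%:R + 4 * d * (C * E).
  apply: le_trans (j _ K1 _ K3) _.
  - rewrite divr_ge0 ?(ltW n2')// addr_ge0 ?(ltW C0)// divr_ge0 ?(ltW CE) ?(ltW ts)//.
  - by move=> psi /andP[_ p2]; apply: K2; rewrite /ray_angle; lra.
  rewrite /G le_eqVlt; apply/orP; left; apply/eqP; field.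
  by rewrite !gt_eqF.
by apply: le_lt_trans j _; clear -n2 d2; lra.
Qed.
End Vanishing.

Section ResolventEquation.
Context {R : realType} {X : completeNormedModType R[i]}.
Variables (A : linop X) (g : R -> R[i]) (w1 omega eta zeta : R).
Variables (m : R[i] -> R[i]) (F : R[i] -> X -> X) (Q : X -> X).
Hypothesis w1_gt0 : 0 < w1.
Hypothesis w1_lt : w1 < omega.
Hypothesis etaI : 0 < eta < pi / 2.
Hypothesis td : transform_data A g w1 omega eta zeta m F Q.
Hypothesis gloc : L1loc g.
Hypothesis glap : laplace_transformable g.

Local Notation U := (lsector w1 eta).
Local Notation theta := (ray_angle eta).
Local Notation pt := (sector_pt omega).
Local Notation sector_int := (sector_int w1 omega eta).
Local Notation rfam := (rfam w1 omega eta F).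
Local Notation rfam_trunc := (rfam_trunc w1 omega eta F).
Local Notation twopii := (2 * 'i * pi%:C : R[i]).

Let w1_ge0 : 0 <= w1. Proof. exact: ltW. Qed.
Let omega_gt0 : 0 < omega. Proof. exact: lt_trans w1_lt. Qed.
Let cos0 : 0 < cos eta. Proof. by have [] := cos_sin_pos etaI. Qed.

Lemma lsector_neq0 l : U l -> l != 0.
Proof.
move=> /(lsector_rnorm etaI) h; apply/eqP => l0; move: h; rewrite l0 rnorm0.
by rewrite ltNge mulr_ge0// ltW.
Qed.

Lemma holo_ext (f h : R[i] -> X) : holo w1 eta f -> (forall l, f l = h l) -> holo w1 eta h.
Proof. by move=> fh /funext <-. Qed.

Lemma holo_kernel_exp t x : 0 < t -> holo w1 eta (fun l => kernel_exp g t l *: F l x).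
Proof.
move=> t0; apply: holo_mul; last exact: (td_holo td).
by move=> l /lsector_neq0; exact: cderiv_kernel_exp.
Qed.

Lemma holo_inv_cst (x : X) : holo w1 eta (fun l => l^-1 *: x).
Proof.
apply: holo_mul; last exact: holo_cst.
by move=> l /lsector_neq0 l0; eexists; exact: cderiv_inv.
Qed.

(** The Laplace inversion of the resolvent equation: [F x - x / l] equals
    [ghat F (A x) / l], and [ghat e^(l t)] may be replaced by its truncation to
    [[0, t]] by deforming the contour to the right. *)
Lemma sector_int_kernel_exp t x : 0 < t -> dom A x ->
  sector_int (fun l => kernel_exp g t l *: F l (A x)) n @[n --> \oo] --> twopii *: (rfam t x - x).
Proof.
move=> t0 dx; have [M _ hM] := rfam_integral w1_gt0 w1_lt etaI td; have [c1 _ _] := hM t x t0.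
have [z0 hz0] := glap; have [C C0 hC] := td_bound td.
set y := A x; have nx := rnorm_ge0 x; have ny := rnorm_ge0 y.
pose D l : X := cexp (l * t%:C) *: (F l x - l^-1 *: x).
have Dh : holo w1 eta D.
  apply: holo_cexp; apply: holo_ext (holo_comb (-1) (holo_inv_cst x) (td_holo td x)) _ => l.
  by rewrite scaleN1r addrC.
have cD : sector_int D n @[n --> \oo] --> twopii *: (rfam t x - x).
  have cr := @sector_int_residue R w1 omega eta w1_gt0 w1_lt etaI X x t t0.
  have := cvg_comb (-1) cr c1.
  rewrite (_ : (-1) *: _ + _ = twopii *: (rfam t x - x)); last by module.
  rewrite (_ : (fun n => (-1) *: _ + _) = sector_int D) => [//|]; apply/funext => n.
  have hr : holo w1 eta (fun z : R[i] => (cexp (t%:C * z) / z) *: x).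
    apply: holo_ext (holo_cexp t%:C (holo_inv_cst x)) _ => l.
    by rewrite scalerA [l * _]mulrC.
  rewrite -sector_int_comb//; last exact: (holo_invlap_integrand td).
  congr (sector_int _ n); apply/funext => l; rewrite /D /invlap_integrand scalerBr [t%:C * l]mulrC scalerA; module.
pose K l : X := (-1) *: (kernel_exp g t l *: F l y) + D l.
have Kh : holo w1 eta K by exact: (@holo_comb R X w1 eta (-1) (fun l => kernel_exp g t l *: F l y) D (holo_kernel_exp y t0) Dh).
pose c := Num.max (complex.Re z0) omega.
have cz : complex.Re z0 <= c by rewrite le_max lexx.
have co : omega <= c by rewrite le_max lexx orbT.
have c0 : 0 <= c by exact: le_trans (ltW omega_gt0) co.
pose I1 := cint_taxicab `[0, t] g; have I10 : 0 <= I1 by exact: cint_taxicab_ge0.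
pose G := 2 * expR (complex.Re z0 * t) * cint_taxicab `[0, +oo[ (laplace_integrand g z0).
have G0 : 0 <= G by rewrite mulr_ge0 ?cint_taxicab_ge0// mulr_ge0 ?expR_ge0.
pose B := 2 * expR (c * t) * I1 + 2 * I1.
have B0 : 0 <= B by rewrite addr_ge0 ?mulr_ge0 ?expR_ge0.
pose k := cos eta.
pose T1 := (G + 2 * I1) * C * rnorm y / k ^+ 2.
pose T2 := B * C * rnorm y / k ^+ 2.
pose T3 := (C + 1) * rnorm x / k.
have k2 : 0 < k ^+ 2 by exact: exprn_gt0.
have C1 : 0 <= C + 1 by rewrite addr_ge0// ltW.
have GI : 0 <= G + 2 * I1 by rewrite addr_ge0// mulr_ge0.
have T10 : 0 <= T1.
  by apply: divr_ge0 (ltW k2); apply: mulr_ge0 ny; apply: mulr_ge0 (ltW C0).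
have T20 : 0 <= T2.
  by apply: divr_ge0 (ltW k2); apply: mulr_ge0 ny; apply: mulr_ge0 (ltW C0).
have T30 : 0 <= T3 by apply: divr_ge0 (ltW cos0); exact: mulr_ge0.
have T0 : 0 < T1 + T2 + T3 + 1 by lra.
(* the product of two bounds of order [1 / |l|] is of order [1 / r ^ 2] *)
have two (a b r : R) (l : R[i]) : 0 <= a -> 0 <= b -> 0 < r -> r * k <= rnorm l ->
    (a / rnorm l) * (C / rnorm l * b) <= a * C * b / k ^+ 2 / r ^+ 2.
  move=> a0 b0 r0 rl; have rk : 0 < r * k by exact: mulr_gt0.
  have l0 : 0 < rnorm l by exact: lt_le_trans rl.
  rewrite [leLHS](_ : _ = a * C * b / rnorm l ^+ 2); last by field; rewrite gt_eqF.
  rewrite [leRHS](_ : _ = a * C * b / (r * k) ^+ 2); last by field; rewrite !gt_eqF.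
  apply: ler_wpM2l; first by rewrite !mulr_ge0// ltW.
  rewrite lef_pV2 ?posrE ?exprn_gt0//; apply: lerXn2r => //; rewrite nnegrE ltW//.
have cK : sector_int K n @[n --> \oo] --> 0.
  apply: (@sector_int_vanish R X w1 omega eta w1_lt etaI K t c (T1 + T2 + T3 + 1)) => // r psi r0 pI.
    have Ul := lsector_pt w1_lt etaI (ltW r0) pI.
    have rl := rnorm_sector_pt w1_ge0 w1_lt etaI (ltW r0) pI.
    set l := pt r psi in Ul rl * => cl; have l0 := lsector_neq0 Ul.
    have [lc lt] := @laplace_tail R g t t0 z0 l hz0 (le_trans cz cl).
    have KE : K l = ((cexp (l * t%:C) * laplace g l - trunc_laplace g t l + int_kernel g t) / l) *: F l y.
      have := td_laplace td Ul lc => ml; rewrite /K /D /kernel_exp.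
      have xE : F l x - l^-1 *: x = (laplace g l / l) *: F l y.
        rewrite -(td_dom td Ul dx) scalerA mulrAC [laplace g l * _]mulrC ml mul1r scalerBr scalerA.
        by rewrite mulVf// scale1r.
      by rewrite xE; module; field.
    rewrite KE rnormZ rnormM rnormV.
    have ab : rnorm (int_kernel g t) <= 2 * I1 by apply: int_kernel_bound => //; rewrite lexx ltW.
    have h1 : rnorm (cexp (l * t%:C) * laplace g l - trunc_laplace g t l + int_kernel g t) <= G + 2 * I1.
      by apply: le_trans (rnormD _ _) _; apply: lerD.
    have nl : 0 <= (rnorm l)^-1 by rewrite invr_ge0 rnorm_ge0.
    have h2 := hC l y Ul.
    apply: le_trans (_ : ((G + 2 * I1) / rnorm l) * (C / rnorm l * rnorm y) <= _).
      apply: ler_pM => //; [|exact: rnorm_ge0|exact: ler_wpM2r].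
      by rewrite mulr_ge0 ?rnorm_ge0.
    apply: le_trans (two _ _ _ _ GI ny r0 rl) _.
    by apply: ler_wpM2r; [rewrite invr_ge0 exprn_ge0// ltW|rewrite -/T1; lra].
  have Ul := lsector_pt w1_lt etaI (ltW r0) pI.
  have rl := rnorm_sector_pt w1_ge0 w1_lt etaI (ltW r0) pI.
  set l := pt r psi in Ul rl * => cl; have l0 := lsector_neq0 Ul.
  have rk : 0 < r * k by exact: mulr_gt0.
  have nl : 0 < rnorm l by exact: lt_le_trans rl.
  apply: le_trans (rnormD _ _) _; apply: lerD.
    rewrite scaleN1r rnormN rnormZ.
    have h1 := @kernel_exp_bound R g gloc t t0 c l c0 cl; rewrite -/I1 -/B in h1.
    apply: le_trans (ler_pM (rnorm_ge0 _) (rnorm_ge0 _) h1 (hC l y Ul)) _.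
    apply: le_trans (two _ _ _ _ B0 ny r0 rl) _.
    by apply: ler_wpM2r; [rewrite invr_ge0 exprn_ge0// ltW|rewrite -/T2; lra].
  rewrite /D rnormZ rnorm_cexp.
  have -> : complex.Re (l * t%:C) = t * complex.Re l by rewrite ReM /= mulr0 subr0 mulrC.
  set E := expR _; have E0 : 0 <= E by exact: expR_ge0.
  have h1 : rnorm (F l x - l^-1 *: x) <= (C + 1) * rnorm x / rnorm l.
    apply: le_trans (rnormD _ _) _; rewrite rnormN rnormZ rnormV.
    have := hC l x Ul; rewrite mulrAC => h; rewrite mulrDl mul1r mulrDl; apply: lerD => //.
    by rewrite mulrC.
  have h2 : (C + 1) * rnorm x / rnorm l <= T3 / r.
    rewrite /T3 -[leRHS]mulrA -invfM [k * r]mulrC; apply: ler_wpM2l; first exact: mulr_ge0.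
    by rewrite lef_pV2 ?posrE.
  rewrite mulrC [leRHS]mulrAC; apply: ler_wpM2r => //.
  apply: le_trans h1 (le_trans h2 _); apply: ler_wpM2r; first by rewrite invr_ge0 ltW.
  by lra.
have := cvg_comb (-1) cK cD; rewrite scaler0 add0r.
rewrite (_ : (fun n => (-1) *: _ + _) = sector_int (fun l => kernel_exp g t l *: F l y)) => [//|].
apply/funext => n; rewrite -sector_int_comb//; congr (sector_int _ n); apply/funext => l; rewrite /K; module.
Qed.

End ResolventEquation.

(** * Strong continuity and the resolvent equation *)

Section ContinuousFunctions.
Context {R : realType} {X : normedModType R[i]}.

Lemma rcont_mul (c : R -> R[i]) (f : R -> X) (a b : R) : rcont c a b -> rcont f a b ->
  rcont (fun s => c s *: f s) a b.
Proof.
move=> cc fc s sI e e0; have nc := rnorm_ge0 (c s); have nf := rnorm_ge0 (f s).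
have k1 : 0 < 2 * (rnorm (f s) + 1) by rewrite mulr_gt0// ltr_wpDl.
have k2 : 0 < 2 * (rnorm (c s) + 1) by rewrite mulr_gt0// ltr_wpDl.
have [r1 r10 h1] := cc s sI _ (divr_gt0 e0 k1).
have [r2 r20 h2] := fc s sI _ (divr_gt0 e0 k2).
have [r3 r30 h3] := fc s sI _ ltr01.
exists (Num.min r1 (Num.min r2 r3)) => [|y yI]; first by rewrite !lt_min r10 r20 r30.
rewrite !lt_min => /and3P[/(h1 y yI) l1 /(h2 y yI) l2 /(h3 y yI) l3].
have -> : c y *: f y - c s *: f s = (c y - c s) *: f y + c s *: (f y - f s) by module.
apply: le_lt_trans (rnormD _ _) _; rewrite !rnormZ.
have fy : rnorm (f y) <= rnorm (f s) + 1.
  by have := rnormD (f y - f s) (f s); rewrite subrK; lra.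
move: l1 l2; rewrite !ltr_pdivlMr// => l1 l2.
have := ler_wpM2l (rnorm_ge0 (c y - c s)) fy.
have := mulr_ge0 (rnorm_ge0 (c s)) (rnorm_ge0 (f y - f s)).
have := rnorm_ge0 (f y - f s); lra.
Qed.

Lemma rcont_rev (f : R -> X) (t : R) : rcont f 0 t -> rcont (fun s => f (t - s)) 0 t.
Proof.
move=> fc s /andP[s0 s1] e e0.
have [|r r0 hr] := fc (t - s) _ e e0; first by apply/andP; split; lra.
exists r => // y /andP[y0 y1] ys; apply: hr; first by apply/andP; split; lra.
by rewrite (_ : t - y - (t - s) = - (y - s)) ?normrN//; ring.
Qed.

(** The terms are increments of [j |-> min (j h) (d + h)] where they do not
    vanish. *)
Lemma sum_short (t d : R) (N : nat) : 0 < t -> 0 < d -> (0 < N)%N ->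
  \sum_(j < N) (t / N%:R) * (if j%:R * (t / N%:R) < d then 1 else 0) <= d + t / N%:R.
Proof.
move=> t0 d0 N0; set h := t / N%:R; have h0 : 0 < h by rewrite divr_gt0// ltr0n.
pose u (j : nat) := Num.min (j%:R * h) (d + h).
apply: (@le_trans _ _ (\sum_(j < N) (u j.+1 - u j))).
  apply: ler_sum => j _; rewrite /u -natr1 mulrDl mul1r; case: ifPn => jd.
    by rewrite mulr1 (min_idPl _) ?(min_idPl _); [lra|lra|lra].
  rewrite mulr0 subr_ge0 le_min !ge_min lexx orbT andbT; apply/orP; left.
  by rewrite lerDl ltW.
rewrite -(big_mkord xpredT (fun j => u j.+1 - u j)) telescope_sumr// /u mul0r.
rewrite [Num.min 0 _](min_idPl _) ?subr0; last by lra.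
by rewrite ge_min lexx orbT.
Qed.

End ContinuousFunctions.

Section StrongContinuity.
Context {R : realType} {X : completeNormedModType R[i]}.
Variables (A : linop X) (g : R -> R[i]) (w1 omega eta zeta : R).
Variables (m : R[i] -> R[i]) (F : R[i] -> X -> X) (Q : X -> X).
Hypothesis w1_gt0 : 0 < w1.
Hypothesis w1_lt : w1 < omega.
Hypothesis etaI : 0 < eta < pi / 2.
Hypothesis td : transform_data A g w1 omega eta zeta m F Q.
Hypothesis gloc : L1loc g.
Hypothesis glap : laplace_transformable g.

Local Notation U := (lsector w1 eta).
Local Notation theta := (ray_angle eta).
Local Notation pt := (sector_pt omega).
Local Notation sector_int := (sector_int w1 omega eta).
Local Notation rfam := (rfam w1 omega eta F).
Local Notation rfam_trunc := (rfam_trunc w1 omega eta F).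
Local Notation invlap_integrand := (invlap_integrand F).
Local Notation twopii := (2 * 'i * pi%:C : R[i]).

Let omega_gt0 : 0 < omega. Proof. exact: lt_trans w1_lt. Qed.
Let cos0 : 0 < cos eta. Proof. by have [] := cos_sin_pos etaI. Qed.

Lemma sector_int_sum (c : nat -> R[i]) (f : nat -> R[i] -> X) n N : (forall j, holo w1 eta (f j)) ->
  holo w1 eta (fun l => \sum_(j < N) c j *: f j l) /\
  sector_int (fun l => \sum_(j < N) c j *: f j l) n = \sum_(j < N) c j *: sector_int (f j) n.
Proof.
move=> fh; elim: N => [|N [IH1 IH2]].
  have h0 := @holo_cst R X w1 eta 0; rewrite big_ord0; split.
    by apply: holo_ext h0 _ => l; rewrite big_ord0.
  have e : sector_int (fun=> (-1) *: 0 + 0) n = 0 :> X.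
    by apply: etrans (sector_int_comb w1_lt etaI (-1) n h0 h0) _; module.
  by rewrite -[RHS]e; congr (sector_int _ n); apply/funext => l; rewrite big_ord0; module.
have h := holo_comb (c N) (fh N) IH1; split.
  by apply: holo_ext h _ => l; rewrite big_ord_recr /= addrC.
rewrite big_ord_recr /= -IH2 addrC -sector_int_comb//.
by congr (sector_int _ n); apply/funext => l; rewrite big_ord_recr /= addrC.
Qed.

Local Notation rsum := (fun N t (f : R -> X) => \sum_(j < N) (t / N%:R)%:C *: f (j%:R * (t / N%:R))).

(** For a fixed truncation the exchange of the contour integral and the time
    integral is a uniform limit of Riemann sums. *)
Lemma rfam_trunc_riemann n t y : 0 < t -> forall e : R, 0 < e -> exists N0 : nat, forall N : nat, (N0 <= N)%N ->
  rnorm (rsum N t (fun s => int_kernel g (t - s) *: rfam_trunc n s y) -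
    twopii^-1 *: sector_int (fun l => kernel_exp g t l *: F l y) n) < e.
Proof.
move=> t0 e e0; have [C C0 hC] := td_bound td; have ny := rnorm_ge0 y.
have [Lam [L [Lam0 L0 hL]]] := @sector_int_bound R w1 omega eta w1_lt etaI X n.
have [D hD] := kernel_exp_riemann gloc t0 Lam.
have wc : 0 < w1 * cos eta by exact: mulr_gt0.
pose K := `|D| * t * (C / (w1 * cos eta) * rnorm y) * L.
have K0 : 0 <= K.
  have q0 : 0 <= C / (w1 * cos eta) by exact: ltW (divr_gt0 C0 wc).
  by apply: mulr_ge0 L0; apply: mulr_ge0; [exact: mulr_ge0 (ltW t0)|exact: mulr_ge0].
exists (Num.bound (K / e)).+1 => N hN.
have N0 : 0 < N%:R :> R by rewrite ltr0n (leq_trans _ hN).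
pose h := t / N%:R; have h0 : 0 < h by rewrite divr_gt0.
pose s j : R := j%:R * h.
have fh j : holo w1 eta (invlap_integrand (s j)%:C y) by exact: (holo_invlap_integrand td).
pose c j := h%:C * int_kernel g (t - s j).
have [sh sE] := sector_int_sum c n N fh.
have -> : rsum N t (fun s => int_kernel g (t - s) *: rfam_trunc n s y) =
    twopii^-1 *: \sum_(j < N) c j *: sector_int (invlap_integrand (s j)%:C y) n.
  rewrite scaler_sumr; apply: eq_bigr => j _; rewrite /rfam_trunc -/h -/(s j) /c !scalerA.
  by congr (_ *: _); ring.
rewrite -sE -scalerBr rnormZ.
have bh := @holo_kernel_exp R X A g w1 omega eta zeta m F Q w1_gt0 etaI td gloc t y t0.
have -> : sector_int (fun l => \sum_(j < N) c j *: invlap_integrand (s j)%:C y l) n - sector_int (fun l => kernel_exp g t l *: F l y) n =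
  sector_int (fun l => (-1) *: (kernel_exp g t l *: F l y) + \sum_(j < N) c j *: invlap_integrand (s j)%:C y l) n.
  by rewrite sector_int_comb// scaleN1r addrC.
apply: (@le_lt_trans _ _ (rnorm (sector_int (fun l => (-1) *: (kernel_exp g t l *: F l y) + \sum_(j < N) c j *: invlap_integrand (s j)%:C y l) n))).
  by apply: ler_piMl; [exact: rnorm_ge0|exact: rnorm_twopii_inv_le1].
have hh := holo_comb (-1) bh sh.
apply: le_lt_trans (hL _ (`|D| * h * (C / (w1 * cos eta) * rnorm y)) hh _) _.
  move=> l Ul lL; have l0 := lsector_neq0 w1_gt0 etaI Ul.
  have lr := lsector_rnorm etaI Ul; have nl : 0 < rnorm l by exact: lt_trans lr.
  rewrite (_ : _ + _ = (\sum_(j < N) h%:C * (int_kernel g (t - s j) * cexp (l * (s j)%:C)) - kernel_exp g t l) *: F l y); last first.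
    rewrite scalerBl scaler_suml scaleN1r addrC; congr (_ - _).
    by apply: eq_bigr => j _; rewrite /invlap_integrand /c scalerA; congr (_ *: _); ring.
  have N0' : (0 < N)%N by rewrite -(ltr0n R).
  rewrite rnormZ; have := hD N l N0' l0 lL; rewrite -/h => h1.
  apply: ler_pM; [exact: rnorm_ge0|exact: rnorm_ge0| |].
    apply: le_trans h1 _; apply: ler_wpM2r; [exact: ltW|exact: ler_norm].
  apply: le_trans (hC l y Ul) _; apply: ler_wpM2r => //.
  apply: ler_wpM2l; first exact: ltW.
  by rewrite lef_pV2 ?posrE// ltW.
rewrite [ltLHS](_ : _ = K / N%:R); last by rewrite /K /h; ring.
rewrite ltr_pdivrMr// mulrC -ltr_pdivrMr//.
have := @archi_boundP R (K / e); rewrite divr_ge0 ?(ltW e0)// => /(_ isT) h1.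
by apply: lt_le_trans h1 _; rewrite ler_nat ltnW.
Qed.

(** The integral equation holds for the truncations up to an error that vanishes
    in the limit, and their integrals are bounded by a multiple of [t]. *)
Lemma rfam_near0 T x : 0 < T -> dom A x -> exists2 C : R, 0 < C & forall t, 0 < t <= T ->
  rnorm (rfam t x - x) <= C * t.
Proof.
move=> T0 dx; have [M M0 hM] := rfam_trunc_bound w1_gt0 w1_lt etaI td.
set y := A x; have ny := rnorm_ge0 y.
pose I1 := cint_taxicab `[0, T] g; have I10 : 0 <= I1 by exact: cint_taxicab_ge0.
pose K := 2 * I1 * (M * expR (omega * T) * rnorm y).
have E0 := expR_ge0 (omega * T).
have K0 : 0 <= K by rewrite !mulr_ge0// ltW.
exists (K + 1) => [|t /andP[t0 tT]]; first by rewrite ltr_wpDl.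
apply: (@le_trans _ _ (K * t)); last by rewrite ler_pM2r// lerDl.
have c1 := sector_int_kernel_exp w1_gt0 w1_lt etaI td gloc glap t0 dx; rewrite -/y in c1.
have c2 : (fun n => twopii^-1 *: sector_int (fun l => kernel_exp g t l *: F l y) n) n @[n --> \oo] --> rfam t x - x.
  have := @cvgZl_tmp _ _ _ _ _ twopii^-1 _ _ c1.
  by rewrite scalerA mulVf ?twopii_neq0// scale1r; exact.
rewrite -[X in rnorm X]subr0; apply: (rnorm_lim_le c2).
exists 1%N => n n1; rewrite subr0; apply/ler_addgt0Pr => e e0.
have [N0 hN0] := rfam_trunc_riemann n y t0 e0.
pose N := N0.+1; have {hN0} := hN0 N (leqnSn _); set V := \sum_(j < N) _.
set W := _ *: sector_int _ n => VW.
have N1 : 0 < N%:R :> R by rewrite ltr0n.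
have Vb : rnorm V <= K * t.
  apply: le_trans (rnorm_sum N (fun j => (t / N%:R)%:C *: (int_kernel g (t - j%:R * (t / N%:R)) *: rfam_trunc n (j%:R * (t / N%:R)) y))) _.
  apply: (@le_trans _ _ (\sum_(j < N) K * (t / N%:R))).
    apply: ler_sum => j _; rewrite rnormZ rnormR ger0_norm; last by rewrite divr_ge0// ltW.
    rewrite mulrC; apply: ler_wpM2r; first by rewrite divr_ge0// ltW.
    have s0 : 0 <= j%:R * (t / N%:R) by rewrite mulr_ge0// divr_ge0// ltW.
    have s1 : j%:R * (t / N%:R) <= t.
      rewrite mulrA ler_pdivrMr// mulrC ler_pM2l// ler_nat; apply: ltnW; exact: ltn_ord.
    set s := j%:R * _ in s0 s1 *; rewrite rnormZ.
    have h1 : rnorm (int_kernel g (t - s)) <= 2 * I1.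
      by apply: (int_kernel_bound gloc T0); apply/andP; split; lra.
    have h2 := hM n s y n1 s0; apply: ler_pM; rewrite ?rnorm_ge0//.
    apply: le_trans h2 _; apply: ler_wpM2r => //; apply: ler_wpM2l; first exact: ltW.
    by rewrite ler_expR ler_pM2l//; lra.
  rewrite sumr_const card_ord -mulrnAr -[(t / _) *+ _]mulr_natr mulfVK ?gt_eqF//.
have := rnormD V (W - V); rewrite addrC subrK rdistC => h.
by apply: le_trans h _; apply: lerD => //; exact: ltW.
Qed.

Hypothesis Adense : dense (dom A).

Lemma dense_rnorm x (e : R) : 0 < e -> exists2 y, dom A y & rnorm (y - x) < e.
Proof.
move=> e0; have [||y [yO dy]] := Adense (O := [set y : X | rnorm (y - x) < e]).
- by exists x; rewrite /= subrr rnorm0.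
- rewrite openE => y /= yx; apply/rnorm_near; exists (e - rnorm (y - x)); first by rewrite subr_gt0.
  by move=> z /= zy; apply: le_lt_trans (rdist_triangle y _ _) _; rewrite -ltrBrDr.
by exists y.
Qed.

Lemma rfam_continuous0 x (e : R) : 0 < e -> exists2 d : R, 0 < d & forall t, 0 <= t < d ->
  rnorm (rfam t x - x) < e.
Proof.
move=> e0; have [M M1 hM] := rfam_bound w1_gt0 w1_lt etaI td.
pose K := M * expR omega + 1.
have E0 := expR_gt0 omega; have M0 : 0 < M by exact: lt_le_trans M1.
have ME : 0 < M * expR omega by exact: mulr_gt0.
have K0 : 0 < K by rewrite addr_gt0.
have [|y dy yx] := @dense_rnorm x (e / 2 / K); first by rewrite !divr_gt0.
have [C C0 hC] := rfam_near0 ltr01 dy.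
exists (Num.min 1 (e / 2 / C)) => [|t]; first by rewrite lt_min ltr01 !divr_gt0.
rewrite lt_min => /and3P[t0 t1 t2].
have [tp|tp] := ltP 0 t; last by rewrite /rfam (le_gtF tp) subrr rnorm0.
have h1 : rnorm (rfam t y - y) < e / 2.
  apply: (@le_lt_trans _ _ (C * t)); first by apply: hC; rewrite tp ltW.
  by rewrite mulrC -ltr_pdivlMr.
have h2 : rnorm (rfam t (x - y)) <= M * expR omega * rnorm (y - x).
  rewrite rdistC; apply: le_trans (hM t _ t0) _; apply: ler_wpM2r; first exact: rnorm_ge0.
  apply: ler_wpM2l; first exact: ltW.
  by rewrite ler_expR -[leRHS]mulr1 ler_pM2l// ltW.
have h3 : K * rnorm (y - x) < e / 2 by rewrite mulrC -ltr_pdivlMr.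
have -> : rfam t x - x = (rfam t (x - y) + (rfam t y - y)) + (y - x).
  by rewrite (linB _ _ (rfam_linear w1_gt0 w1_lt etaI td t0)); module.
apply: le_lt_trans (rnormD _ _) _; have := rnormD (rfam t (x - y)) (rfam t y - y).
by rewrite /K mulrDl mul1r in h3; move=> h4; lra.
Qed.

Lemma rfam_continuous x s (e : R) : 0 <= s -> 0 < e -> exists2 d : R, 0 < d & forall t, 0 <= t ->
  `|t - s| < d -> rnorm (rfam t x - rfam s x) < e.
Proof.
rewrite le_eqVlt => /predU1P[<- e0|s0 e0].
  have [d d0 hd] := rfam_continuous0 x e0; exists d => // t t0.
  by rewrite subr0 ger0_norm// => td'; rewrite {2}/rfam ltxx; apply: hd; rewrite t0.
have [M M0 hM] := rfam_lipschitz w1_gt0 w1_lt etaI td.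
have [C C0 [d d0 hd]] := hM s s0.
pose B := M * expR (omega * s) / s.
have B0 : 0 < B by rewrite divr_gt0// mulr_gt0// expR_gt0.
have nx := rnorm_ge0 x; pose K := (B + C) * (rnorm x + 1).
have K0 : 0 < K by apply: mulr_gt0; [exact: addr_gt0|exact: ltr_wpDl].
exists (Num.min (Num.min d s) (Num.min 1 (e / K))).
  by rewrite !lt_min d0 s0 ltr01 divr_gt0.
move=> t t0; rewrite !lt_min => /andP[/andP[k1 k2] /andP[k3 k4]].
have tp : 0 < t by move: k2; rewrite ltr_norml => /andP[? _]; lra.
apply: le_lt_trans (hd t x tp k1) _; rewrite -/B; set k := `|t - s| in k1 k2 k3 k4 *.
have kp : 0 <= k by exact: normr_ge0.
move: k4; rewrite ltr_pdivlMr// => k4; apply: le_lt_trans k4.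
rewrite [leLHS](_ : _ = k * ((B + C * k) * rnorm x)); last by ring.
apply: ler_wpM2l => //; apply: ler_pM => //; last by rewrite lerDl.
  by apply: addr_ge0; [exact: ltW|apply: mulr_ge0 kp; exact: ltW].
by rewrite lerD2l -[leRHS]mulr1 ler_pM2l// ltW.
Qed.

Lemma rfam_rcont x t : rcont (fun s => rfam s x) 0 t.
Proof.
move=> s /andP[s0 s1] e e0; have [d d0 hd] := rfam_continuous x s0 e0.
by exists d => // y /andP[y0 y1] ys; exact: hd.
Qed.

(* Linear arithmetic from the facts in the goal alone: it is slow when the
   context is large. *)
Ltac goal_lra := clear -w1_gt0 w1_lt etaI td gloc glap Adense; lra.

(** The Riemann sums of the convolution are compared with those of its
    truncations. The truncations converge uniformly away from [s = 0] and are
    bounded near it, so that a short initial interval contributes little. *)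
Lemma rfam_equation t x : 0 <= t -> dom A x -> exists2 v : X,
  is_rint (fun s => int_kernel g (t - s) *: A (rfam s x)) 0 t v & rfam t x = x + v.
Proof.
move=> t0 dx; set y := A x; pose f s : X := int_kernel g (t - s) *: rfam s y.
have fE s : 0 <= s <= t -> f s = int_kernel g (t - s) *: A (rfam s x).
  by move=> /andP[s0 _]; have [_ ->] := rfam_dom w1_gt0 w1_lt etaI td s0 dx.
move: t0; rewrite le_eqVlt => /predU1P[te|t0].
  have fc : rcont f 0 t.
    by move=> s; rewrite -te -eq_le => /eqP<- e e0; exists 1 => // z; rewrite -eq_le => /eqP<-; rewrite (subrr (f _)) rnorm0.
  have tt : 0 <= t by rewrite te.
  have [Phi hPhi] := rprim_ex tt fc; exists (Phi t - Phi 0).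
    by apply: rprim_rint => //; exact: rprim_eq hPhi.
  by rewrite -te subrr addr0 /rfam ltxx.
have fc : rcont f 0 t.
  apply: rcont_mul; last exact: rfam_rcont.
  by apply: rcont_rev; exact: int_kernel_cont.
have [Phi hPhi] := rprim_ex (ltW t0) fc; exists (Phi t - Phi 0).
  by apply: rprim_rint (ltW t0) _; exact: rprim_eq hPhi.
set v := Phi t - Phi 0; apply/eqP; rewrite addrC -subr_eq -subr_eq0; apply/eqP/rnorm_small => e e0.
have [M1 M10 hM1] := rfam_trunc_bound w1_gt0 w1_lt etaI td.
have [M2 M20 hM2] := rfam_integral w1_gt0 w1_lt etaI td.
have ny := rnorm_ge0 y; pose I1 := cint_taxicab `[0, t] g; have I10 : 0 <= I1 by exact: cint_taxicab_ge0.
pose E := expR (omega * t); have E0 : 0 < E by exact: expR_gt0.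
pose B := (M1 + M2 + 1) * E * rnorm y.
have M0 : 0 < M1 + M2 + 1 by rewrite !addr_gt0.
have B0 : 0 <= B by rewrite !mulr_ge0// ltW.
pose k := 2 * I1 * B + 1.
have k0 : 0 < k by apply: ltr_wpDl => //; apply: mulr_ge0 B0; exact: mulr_ge0.
have [d d0 dE] : exists2 d : R, 0 < d & d = e / (32 * k).
  by eexists; last reflexivity; apply: divr_gt0 => //; exact: mulr_gt0.
have y1 s : 0 <= s <= t -> expR (omega * s) <= E.
  by move=> /andP[_ s1]; rewrite ler_expR ler_pM2l.
have ME s (M : R) : 0 <= s <= t -> 0 <= M -> M <= M1 + M2 + 1 -> M * expR (omega * s) * rnorm y <= B.
  move=> sI m0 m1; apply: ler_wpM2r => //; apply: ler_pM => //; exact: y1.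
have c1 := sector_int_kernel_exp w1_gt0 w1_lt etaI td gloc glap t0 dx; rewrite -/y in c1.
have c2 : (fun n => twopii^-1 *: sector_int (fun l => kernel_exp g t l *: F l y) n) n @[n --> \oo] --> rfam t x - x.
  have := @cvgZl_tmp _ _ _ _ _ twopii^-1 _ _ c1.
  by rewrite scalerA mulVf ?twopii_neq0// scale1r; exact.
have e4 : 0 < e / 4 by rewrite divr_gt0.
have [n1 hn1] := (cvg_rnorm _ _).1 c2 _ e4.
pose n := (maxn n1 (Num.bound (d^-1 + 8 * t * k / (d * e)))).+1.
have {}hn1 := hn1 n (leqW (leq_maxl _ _)).
have n0 : 0 < n%:R :> R by rewrite ltr0n.
have di : 0 < d^-1 by rewrite invr_gt0.
have q0 : 0 < 8 * t * k / (d * e) by apply: divr_gt0; [apply: mulr_gt0 => //; exact: mulr_gt0|exact: mulr_gt0].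
have nb : d^-1 + 8 * t * k / (d * e) <= n%:R.
  have := @archi_boundP R (d^-1 + 8 * t * k / (d * e)).
  have -> : 0 <= d^-1 + 8 * t * k / (d * e).
    by apply: addr_ge0; exact: ltW.
  move=> /(_ isT)/ltW h; apply: le_trans h _; rewrite ler_nat; apply: leqW; exact: leq_maxr.
have dn : 1 <= d * n%:R.
  rewrite -[leLHS](mulfV (_ : d != 0)) ?gt_eqF// ler_pM2l//; apply: le_trans nb; rewrite lerDl; exact: ltW.
have tn : t * (k / (d * n%:R)) <= e / 8.
  have : 8 * t * k / (d * e) <= n%:R by apply: le_trans nb; rewrite lerDr ltW.
  rewrite ler_pdivrMr ?mulr_gt0// => h.
  rewrite mulrA ler_pdivrMr ?mulr_gt0//; move: h; goal_lra.
have [N1 hN1] := rfam_trunc_riemann n y t0 e4.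
have [N2 N20 hN2] := rprim_riemann t0 hPhi e4.
pose N := (maxn (maxn N1 N2) (Num.bound (t / d))).+1.
have {}hN1 := hN1 N (leqW (leq_trans (leq_maxl N1 N2) (leq_maxl _ _))).
have {}hN2 := hN2 N (leqW (leq_trans (leq_maxr N1 N2) (leq_maxl _ _))).
have N0 : 0 < N%:R :> R by rewrite ltr0n.
set h := t / N%:R in hN1 hN2; have h0 : 0 < h by rewrite divr_gt0.
have hd : h <= d.
  rewrite /h ler_pdivrMr// mulrC -ler_pdivrMr//.
  have /ltW h1 := archi_boundP (divr_ge0 (ltW t0) (ltW d0)).
  by apply: le_trans h1 _; rewrite ler_nat; apply: leqW; exact: leq_maxr.
have point (s : R) : 0 <= s <= t -> rnorm (int_kernel g (t - s) *: rfam_trunc n s y - f s) <=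
    k / (d * n%:R) + 2 * k * (if s < d then 1 else 0).
  move=> sI; have /andP[s0 s1] := sI; rewrite /f -scalerBr rnormZ.
  have h1 : rnorm (int_kernel g (t - s)) <= 2 * I1.
    by apply: (int_kernel_bound gloc t0); apply/andP; split; move: s0 s1; goal_lra.
  have kn : 0 <= k / (d * n%:R) by rewrite divr_ge0 ?mulr_ge0// ltW.
  have [sd|sd] := ltP s d.
    rewrite mulr1; apply: (@le_trans _ _ (2 * I1 * (2 * B))); last by move: kn I10 B0; rewrite /k; goal_lra.
    apply: ler_pM; rewrite ?rnorm_ge0//; apply: le_trans (rnormD _ _) _; rewrite rnormN.
    have l1 := hM1 n s y isT s0.
    have l2 := ME s M1 sI (ltW M10); have {}l2 := l2 (ltac:(move: M20; goal_lra)).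
    have l3 : rnorm (rfam s y) <= B.
      move: s0; rewrite le_eqVlt => /predU1P[<-|sp].
        rewrite /rfam ltxx /B -[leLHS]mul1r; apply: ler_wpM2r => //.
        rewrite -[leLHS]mulr1; apply: ler_pM => //; first by move: M10 M20; goal_lra.
        by rewrite -expR0 ler_expR mulr_ge0// ltW.
      have [_ l _] := hM2 s y sp; apply: le_trans l _; apply: ME => //; [exact: ltW|move: M10; goal_lra].
    by move: l1 l2 l3; goal_lra.
  have sp : 0 < s by exact: lt_le_trans sd.
  have sn : 0 < s * n%:R by exact: mulr_gt0.
  have dsn : d * n%:R <= s * n%:R by rewrite ler_pM2r.
  rewrite mulr0 addr0; have [_ _ l] := hM2 s y sp.
  have l1 : s^-1 <= n%:R by rewrite -[leLHS]mul1r ler_pdivrMr// mulrC; exact: le_trans dsn.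
  have {}l := l n l1; rewrite -/(rfam_trunc n s y) in l.
  have l2 := ME s M2 sI (ltW M20); have {}l2 := l2 (ltac:(move: M10; goal_lra)).
  apply: (@le_trans _ _ (2 * I1 * (B / (d * n%:R)))).
    apply: ler_pM; rewrite ?rnorm_ge0//; apply: le_trans l _; apply: ler_pM => //.
    - by apply: mulr_ge0 ny; rewrite mulr_ge0 ?expR_ge0// ltW.
    - by rewrite invr_ge0 ltW.
    - by rewrite lef_pV2 ?posrE// mulr_gt0.
  rewrite mulrA; apply: ler_wpM2r; first by rewrite invr_ge0 mulr_ge0// ltW.
  by rewrite /k lerDl.
have VV : rnorm (\sum_(j < N) h%:C *: (int_kernel g (t - j%:R * h) *: rfam_trunc n (j%:R * h) y) -
    \sum_(j < N) h%:C *: f (j%:R * h)) <= e / 4.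
  rewrite -sumrB; apply: le_trans (rnorm_sum N (fun j =>
    h%:C *: (int_kernel g (t - j%:R * h) *: rfam_trunc n (j%:R * h) y) - h%:C *: f (j%:R * h))) _.
  apply: (@le_trans _ _ (\sum_(j < N) (h * (k / (d * n%:R)) +
      2 * k * (h * (if j%:R * h < d then 1 else 0))))).
    apply: ler_sum => j _; rewrite -scalerBr rnormZ rnormR gtr0_norm//.
    have sI : 0 <= j%:R * h <= t.
      apply/andP; split; first by rewrite mulr_ge0// ltW.
      by rewrite /h mulrA ler_pdivrMr// mulrC ler_pM2l// ler_nat ltnW.
    by have := ler_wpM2l (ltW h0) (point _ sI); rewrite mulrDr [h * (2 * k * _)]mulrCA.
  rewrite big_split /= sumr_const card_ord -mulr_sumr.
  have -> : h * (k / (d * n%:R)) *+ N = t * (k / (d * n%:R)).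
    by rewrite -mulr_natr mulrAC /h mulfVK// gt_eqF.
  have := sum_short t0 d0 (ltn0Sn _ : (0 < N)%N); rewrite -/h => ss.
  have kk : 0 <= 2 * k by rewrite mulr_ge0// ltW.
  have := ler_wpM2l kk ss.
  have : 2 * k * (d + h) <= 2 * k * (d + d) by apply: ler_wpM2l => //; rewrite lerD2l.
  have -> : 2 * k * (d + d) = e / 8 by rewrite dE; field; rewrite gt_eqF.
  by move: tn; goal_lra.
set V := \sum_(j < N) _ in hN1 VV; set V' := \sum_(j < N) _ in hN2 VV.
set W := _ *: sector_int _ n in hn1 hN1.
have -> : rfam t x - x - v = - (W - (rfam t x - x)) + (- (V - W) + ((V - V') + (V' - v))) by module.
apply: le_trans (rnormD _ _) _; rewrite rnormN.
have := rnormD (- (V - W)) ((V - V') + (V' - v)); rewrite rnormN.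
have := rnormD (V - V') (V' - v); move: hn1 hN1 hN2 VV; goal_lra.
Qed.

End StrongContinuity.

(** * Uniqueness of the resolvent family *)

Section Boundedness.
Context {R : realType} {X : normedModType R[i]}.

Lemma rcont_bounded (f : R -> X) (a b : R) : a <= b -> rcont f a b ->
  exists2 K : R, 0 < K & forall s, a <= s <= b -> rnorm (f s) <= K.
Proof.
move=> ab fc.
apply: (@cousin _ (fun u v => exists2 K : R, 0 < K & forall s, u <= s <= v -> rnorm (f s) <= K) a b) => //.
  move=> x y ax xy yb [K1 K10 h1] [K2 K20 h2]; exists (K1 + K2); first exact: addr_gt0.
  move=> s /andP[s0 s1]; have [sm|/ltW sm] := leP s ((x + y) / 2).
    have : x <= s <= (x + y) / 2 by rewrite s0.
    by move=> /h1; lra.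
  have : (x + y) / 2 <= s <= y by rewrite sm.
  by move=> /h2; lra.
move=> s sI; have [r r0 hr] := fc s sI _ ltr01; exists r => // x y ax xs sy yb yx.
exists (rnorm (f s) + 1) => [|z /andP[z0 z1]]; first by rewrite ltr_wpDl ?rnorm_ge0.
have zI : a <= z <= b by apply/andP; split; lra.
have zs : `|z - s| < r by rewrite ltr_norml; apply/andP; split; lra.
by have := rnormD (f z - f s) (f s); rewrite subrK; have := hr z zI zs; lra.
Qed.

End Boundedness.

Section Fubini.
Context {R : realType} {X : completeNormedModType R[i]}.
Implicit Types (f : R -> X) (t : R).

(** The precision of the Riemann sums depends on the oscillation of [f] alone. *)
Lemma rprim_grid f Phi t (e d : R) (N : nat) : 0 < t -> 0 <= e -> rcont f 0 t ->
  rprim f Phi 0 t -> rosc f 0 t e d -> (0 < N)%N -> t / N%:R < d ->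
  rnorm (\sum_(j < N) (t / N%:R)%:C *: f (j%:R * (t / N%:R)) - (Phi t - Phi 0)) <= e * t.
Proof.
move=> t0 e0 fc fP fo N0 hd; have n0 : 0 < N%:R :> R by rewrite ltr0n.
have [Psi hPsi] := @rprim_exists R X f 0 t (ltW t0) fc.
have fPsi : rprim f Psi 0 t.
  move=> e' e'0; have [d' d'0 o'] := rcont_unif (ltW t0) fc e'0.
  by exists d' => //; apply: (hPsi _ _ (ltW e'0) o').
rewrite (rprim_unique (ltW t0) fP fPsi); set h := t / N%:R in hd *.
have h0 : 0 < h by rewrite divr_gt0.
have Nh : N%:R * h = t by rewrite mulrC /h divfK// gt_eqF.
have -> : Psi t - Psi 0 = \sum_(j < N) (Psi (j.+1%:R * h) - Psi (j%:R * h)).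
  by rewrite -(big_mkord xpredT (fun j => Psi (j.+1%:R * h) - Psi (j%:R * h))) telescope_sumr// Nh mul0r.
rewrite -sumrB; apply: le_trans (rnorm_sum N (fun j => h%:C *: f (j%:R * h) - (Psi (j.+1%:R * h) - Psi (j%:R * h)))) _.
apply: (@le_trans _ _ (\sum_(j < N) e * h)).
  apply: ler_sum => j _; rewrite -rnormN opprB.
  have jE : j.+1%:R * h - j%:R * h = h by rewrite -natr1; ring.
  have := hPsi e d e0 fo (j%:R * h) (j%:R * h) (j.+1%:R * h); rewrite jE; apply => //.
  - by rewrite mulr_ge0// ltW.
  - by rewrite -subr_ge0 jE ltW.
  - by rewrite -Nh ler_pM2r// ler_nat.
by rewrite sumr_const card_ord -mulrnAr -mulr_natl Nh.
Qed.

Definition uc2 (f : R -> R -> X) t := forall e : R, 0 < e -> exists2 d : R, 0 < d &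
  forall q q' s s', 0 <= q <= t -> 0 <= q' <= t -> 0 <= s <= t -> 0 <= s' <= t ->
    `|q' - q| < d -> `|s' - s| < d -> rnorm (f q' s' - f q s) <= e.

Lemma uc2_rcontl (f : R -> R -> X) t s : uc2 f t -> 0 <= s <= t -> rcont (f^~ s) 0 t.
Proof.
move=> fu sI q qI e e0; have e2 : 0 < e / 2 by rewrite divr_gt0.
have [d d0 hd] := fu _ e2; exists d => // q' q'I qq.
apply: le_lt_trans (hd q q' s s qI q'I sI sI qq _) _; last by lra.
by rewrite subrr normr0.
Qed.

Lemma uc2_rcontr (f : R -> R -> X) t q : uc2 f t -> 0 <= q <= t -> rcont (f q) 0 t.
Proof.
move=> fu qI s sI e e0; have e2 : 0 < e / 2 by rewrite divr_gt0.
have [d d0 hd] := fu _ e2; exists d => // s' s'I ss.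
apply: le_lt_trans (hd q q s s' qI qI sI s'I _ ss) _; last by lra.
by rewrite subrr normr0.
Qed.

(** Both iterated integrals are limits of the same double Riemann sums. *)
Lemma rprim_fubini (f : R -> R -> X) t (alpha beta PA PB : R -> X) : 0 < t -> uc2 f t ->
  (forall s, 0 <= s <= t -> forall Phi, rprim (f^~ s) Phi 0 t -> Phi t - Phi 0 = alpha s) ->
  (forall q, 0 <= q <= t -> forall Phi, rprim (f q) Phi 0 t -> Phi t - Phi 0 = beta q) ->
  rprim alpha PA 0 t -> rprim beta PB 0 t -> PA t - PA 0 = PB t - PB 0.
Proof.
move=> t0 fu fa fb aP bP; apply/eqP; rewrite -subr_eq0; apply/eqP/rnorm_small => e e0.
pose e1 := e / (4 * t ^+ 2); have t2 : 0 < t ^+ 2 by exact: exprn_gt0.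
have e10 : 0 < e1 by rewrite divr_gt0// mulr_gt0.
have e4 : 0 < e / 4 by rewrite divr_gt0.
have [d d0 hd] := fu _ e10.
have [N1 N10 hN1] := rprim_riemann t0 aP e4.
have [N2 N20 hN2] := rprim_riemann t0 bP e4.
pose N := (maxn (maxn N1 N2) (Num.bound (t / d))).+1.
have {}hN1 := hN1 N (leqW (leq_trans (leq_maxl N1 N2) (leq_maxl _ _))).
have {}hN2 := hN2 N (leqW (leq_trans (leq_maxr N1 N2) (leq_maxl _ _))).
have n0 : 0 < N%:R :> R by rewrite ltr0n.
have N0 : (0 < N)%N by [].
have td : t / N%:R < d.
  rewrite ltr_pdivrMr// mulrC -ltr_pdivrMr//.
  have h1 := archi_boundP (divr_ge0 (ltW t0) (ltW d0)).
  by apply: lt_le_trans h1 _; rewrite ler_nat; apply: leqW; exact: leq_maxr.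
clearbody N; set h := t / N%:R in td hN1 hN2.
have h0 : 0 < h by rewrite divr_gt0.
have Nh : N%:R * h = t by rewrite mulrC /h divfK// gt_eqF.
have gI (j : 'I_N) : 0 <= j%:R * h <= t.
  apply/andP; split; first by rewrite mulr_ge0// ltW.
  by rewrite -[leRHS]Nh ler_pM2r// ler_nat ltnW.
have inner (u : R -> X) (V : X) : rcont u 0 t -> rosc u 0 t e1 d ->
    (forall Phi, rprim u Phi 0 t -> Phi t - Phi 0 = V) ->
    rnorm (\sum_(i < N) h%:C *: u (i%:R * h) - V) <= e1 * t.
  move=> uc uo uV; have [Phi hPhi] := rprim_ex (ltW t0) uc.
  by rewrite -(uV Phi hPhi); apply: rprim_grid uo _ _ => //; exact: ltW.
have z0 (a b : R) : 0 < b -> `|a - a| < b by rewrite subrr normr0.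
have outer (u : nat -> nat -> X) (V : nat -> X) :
    (forall j : 'I_N, rnorm (\sum_(i < N) h%:C *: u i j - V j) <= e1 * t) ->
    rnorm (\sum_(j < N) h%:C *: (\sum_(i < N) h%:C *: u i j) - \sum_(j < N) h%:C *: V j) <= e / 4.
  move=> uV; rewrite -sumrB.
  apply: le_trans (rnorm_sum N (fun j => h%:C *: (\sum_(i < N) h%:C *: u i j) - h%:C *: V j)) _.
  apply: (@le_trans _ _ (\sum_(j < N) h * (e1 * t))).
    apply: ler_sum => j _; rewrite -scalerBr rnormZ rnormR gtr0_norm//.
    by rewrite ler_pM2l.
  rewrite sumr_const card_ord -mulrnAl -mulr_natl Nh /e1 le_eqVlt; apply/orP; left; apply/eqP.
  by field; rewrite gt_eqF.
have hA := outer (fun i j => f (i%:R * h) (j%:R * h)) (fun j => alpha (j%:R * h)).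
have {}hA := hA (fun j => inner (f^~ (j%:R * h)) _ (uc2_rcontl fu (gI j))
  (fun q q' qI q'I qq => hd _ _ _ _ qI q'I (gI j) (gI j) qq (z0 _ _ d0)) (fa _ (gI j))).
have hB := outer (fun j i => f (i%:R * h) (j%:R * h)) (fun i => beta (i%:R * h)).
have {}hB := hB (fun i => inner (f (i%:R * h)) _ (uc2_rcontr fu (gI i))
  (fun s s' sI s'I ss => hd _ _ _ _ (gI i) (gI i) sI s'I (z0 _ _ d0) ss) (fb _ (gI i))).
have swap : \sum_(j < N) h%:C *: (\sum_(i < N) h%:C *: f (i%:R * h) (j%:R * h)) =
    \sum_(i < N) h%:C *: (\sum_(j < N) h%:C *: f (i%:R * h) (j%:R * h)).
  under eq_bigr do rewrite scaler_sumr; rewrite exchange_big /=.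
  by apply: eq_bigr => i _; rewrite scaler_sumr.
rewrite swap in hA; set D := \sum_(i < N) h%:C *: (\sum_(j < N) _) in hA hB.
set SA := \sum_(j < N) h%:C *: alpha _ in hA hN1.
set SB := \sum_(j < N) h%:C *: beta _ in hB hN2.
have -> : PA t - PA 0 - (PB t - PB 0) = - (SA - (PA t - PA 0)) + (- (D - SA) + ((D - SB) + (SB - (PB t - PB 0)))).
  by module.
apply: le_trans (rnormD _ _) _; rewrite rnormN.
have := rnormD (- (D - SA)) ((D - SB) + (SB - (PB t - PB 0))); rewrite rnormN.
have := rnormD (D - SB) (SB - (PB t - PB 0)); move: hA hB hN1 hN2; clear; lra.
Qed.

Lemma rprim_truncated (f k Phi : R -> X) (u t : R) v : 0 <= u <= t -> rprim f Phi 0 t ->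
  (forall q, 0 <= q <= u -> f q = k q) -> (forall q, u <= q <= t -> f q = 0) ->
  is_rint k 0 u v -> Phi t - Phi 0 = v.
Proof.
move=> /andP[u0 ut] fP fk f0 kv.
have f1 := rprim_eq fk (rprimW (lexx 0) ut fP).
have f2 := rprimW u0 (lexx t) fP.
have <- := rint_unique u0 (rprim_rint u0 f1) kv.
have e : Phi t - Phi u = 0.
  apply: rnorm_small => e e0; apply: le_trans (rprim_bound (K := 0) ut f2 _) _.
    by move=> q /f0->; rewrite rnorm0.
  by rewrite mul0r ltW.
by rewrite -[LHS](subrK (Phi u)) addrAC -[in RHS](add0r (Phi u)) -e; module.
Qed.

(** Strong continuity and local boundedness give joint uniform continuity of
    [S q (w s)], because the range of [w] is compact. *)
Lemma family_uc2 (S : R -> X -> X) (w : R -> X) (t M : R) : 0 < t -> 0 < M ->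
  (forall q, 0 <= q <= t -> linear (S q)) ->
  (forall q x, 0 <= q <= t -> rnorm (S q x) <= M * rnorm x) ->
  (forall x, rcont (fun q => S q x) 0 t) -> rcont w 0 t -> uc2 (fun q s => S q (w s)) t.
Proof.
move=> t0 M0 Sl SM Sc wc e e0; have e2 : 0 < e / 2 by rewrite divr_gt0.
have e4 : 0 < e / 4 by rewrite divr_gt0.
have [d d0 hd] : exists2 d : R, 0 < d & forall s, 0 <= s <= t -> forall q q', 0 <= q <= t -> 0 <= q' <= t ->
    `|q' - q| < d -> rnorm (S q' (w s) - S q (w s)) <= e / 2.
  apply: (@cousin _ (fun u v => exists2 d : R, 0 < d & forall s, u <= s <= v -> forall q q',
    0 <= q <= t -> 0 <= q' <= t -> `|q' - q| < d -> rnorm (S q' (w s) - S q (w s)) <= e / 2) 0 t).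
  - exact: ltW.
  - move=> x y ax xy yb [d1 d10 h1] [d2 d20 h2]; exists (Num.min d1 d2); first by rewrite lt_min d10.
    move=> s /andP[s0 s1] q q' qI q'I; rewrite lt_min => /andP[k1 k2].
    have [sm|/ltW sm] := leP s ((x + y) / 2).
      by apply: (h1 s) => //; rewrite s0.
    by apply: (h2 s) => //; rewrite sm.
  move=> s sI; have e8 : 0 < e / 8 / M by rewrite !divr_gt0.
  have [r r0 hr] := wc s sI _ e8.
  have [d d0 hd] := rcont_unif (ltW t0) (Sc (w s)) e4.
  exists r => // x y ax xs sy yb yx; exists d => // z /andP[z0 z1] q q' qI q'I qq.
  have zI : 0 <= z <= t by apply/andP; split; lra.
  have zs : `|z - s| < r by rewrite ltr_norml; apply/andP; split; lra.
  have := hr z zI zs; rewrite ltr_pdivlMr// mulrC => l1.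
  have l2 := hd _ _ qI q'I qq.
  have -> : S q' (w z) - S q (w z) = S q' (w z - w s) + (- S q (w z - w s) + (S q' (w s) - S q (w s))).
    by rewrite (linB _ _ (Sl _ q'I)) (linB _ _ (Sl _ qI)); module.
  apply: le_trans (rnormD _ _) _.
  have := rnormD (- S q (w z - w s)) (S q' (w s) - S q (w s)); rewrite rnormN.
  have := SM q (w z - w s) qI; have := SM q' (w z - w s) q'I; lra.
have eM : 0 < e / 2 / M by rewrite !divr_gt0.
have [d' d'0 hd'] := rcont_unif (ltW t0) wc eM.
exists (Num.min d d'); first by rewrite lt_min d0.
move=> q q' s s' qI q'I sI s'I; rewrite !lt_min => /andP[k1 _] /andP[_ k2].
have -> : S q' (w s') - S q (w s) = S q' (w s' - w s) + (S q' (w s) - S q (w s)).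
  by rewrite (linB _ _ (Sl _ q'I)); module.
apply: le_trans (rnormD _ _) _; have := hd s sI q q' qI q'I k1.
have := hd' s s' sI s'I k2; rewrite ler_pdivlMr// mulrC.
have := SM q' (w s' - w s) q'I; lra.
Qed.

Lemma uc2_mul (c : R -> R[i]) (G : R -> R -> X) (t B K : R) : 0 < t -> 0 < B -> 0 < K ->
  rcont c (- t) t -> (forall v, - t <= v <= t -> rnorm (c v) <= B) ->
  uc2 G t -> (forall q s, 0 <= q <= t -> 0 <= s <= t -> rnorm (G q s) <= K) ->
  uc2 (fun q s => c (t - s - q) *: G q s) t.
Proof.
move=> t0 B0 K0 cc cB Gu GK e e0.
have tt : - t <= t by lra.
have e1 : 0 < e / 2 / K by rewrite !divr_gt0.
have e2 : 0 < e / 2 / B by rewrite !divr_gt0.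
have [d1 d10 h1] := rcont_unif tt cc e1; have [d2 d20 h2] := Gu _ e2.
exists (Num.min (d1 / 2) d2); first by rewrite lt_min d20 divr_gt0.
move=> q q' s s' qI q'I sI s'I; rewrite !lt_min => /andP[k1 k2] /andP[k3 k4].
have vI u v : 0 <= u <= t -> 0 <= v <= t -> - t <= t - u - v <= t.
  by move=> /andP[? ?] /andP[? ?]; apply/andP; split; lra.
have l1 : rnorm (c (t - s' - q') - c (t - s - q)) <= e / 2 / K.
  apply: h1; [exact: vI|exact: vI|].
  move: k1 k3; rewrite !ltr_norml => /andP[? ?] /andP[? ?]; apply/andP; split; lra.
have l2 := h2 _ _ _ _ qI q'I sI s'I k2 k4.
have -> : c (t - s' - q') *: G q' s' - c (t - s - q) *: G q s =
  (c (t - s' - q') - c (t - s - q)) *: G q' s' + c (t - s - q) *: (G q' s' - G q s) by module.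
apply: le_trans (rnormD _ _) _; rewrite !rnormZ.
have m1 := ler_pM (rnorm_ge0 _) (rnorm_ge0 _) l1 (GK _ _ q'I s'I).
have m2 := ler_pM (rnorm_ge0 _) (rnorm_ge0 _) (cB _ (vI _ _ sI qI)) l2.
apply: le_trans (lerD m1 m2) _.
by rewrite le_eqVlt; apply/orP; left; apply/eqP; field; rewrite !gt_eqF.
Qed.

End Fubini.

Section WithinContinuity.
Context {R : realType} {X : normedModType R[i]}.
Implicit Types f : R -> X.

Lemma within_cont_rcont f (t : R) : {within `[0, +oo[, continuous f} -> rcont f 0 t.
Proof.
move=> /subspace_continuousP fc s /andP[s0 s1] e e0.
have sI : `[0, +oo[%classic s by rewrite /= in_itv /= s0.
have nx : nbhs (f s) [set y | rnorm (y - f s) < e] by apply/rnorm_near; exists e.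
have := fc s sI _ nx; rewrite /within /= => /nbhs_ballP[r /= r0 hr].
exists r => // y /andP[y0 y1] ys; apply: hr; last by rewrite /= in_itv /= y0.
by rewrite /ball /= distrC.
Qed.

Lemma rcont_within_cont f : (forall s (e : R), 0 <= s -> 0 < e -> exists2 d : R, 0 < d &
    forall t, 0 <= t -> `|t - s| < d -> rnorm (f t - f s) < e) ->
  {within `[0, +oo[, continuous f}.
Proof.
move=> fc; apply/subspace_continuousP => s; rewrite /= in_itv /= andbT => s0 B /rnorm_near[e e0 eB].
have [d d0 hd] := fc s e s0 e0; rewrite /within /=; apply/nbhs_ballP; exists d => //= t.
rewrite /ball /= distrC => td; rewrite in_itv /= andbT => t0.
by apply: eB; exact: hd.
Qed.

End WithinContinuity.

Section Uniqueness.
Context {R : realType} {X : completeNormedModType R[i]}.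
Variables (A : linop X) (g : R -> R[i]).
Hypothesis gloc : L1loc g.
Hypothesis Adense : dense (dom A).

Lemma int_kernel_le0 (v : R) : v <= 0 -> int_kernel g v = 0.
Proof.
rewrite le_eqVlt => /predU1P[->|v0]; first exact: int_kernel0.
rewrite /int_kernel (_ : [set` `[0, v]] = set0); first by rewrite /cintegral !Rintegral_set0.
by apply/seteqP; split => // z /=; rewrite in_itv /= => /andP[]; lra.
Qed.

(** Vanishing on the negative axis, the primitive extends continuously, and an
    integral over a triangle becomes an integral over the square. *)
Lemma int_kernel_rcont (t : R) : 0 < t -> rcont (int_kernel g) (- t) t.
Proof.
move=> t0; have ac := int_kernel_cont gloc t0; have h00 : 0 <= (0 : R) <= t by rewrite lexx ltW.
move=> s /andP[sl sr] e e0; have [s0|s0] := leP s 0.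
  have [r r0 hr] := ac 0 h00 e e0; exists r => // y /andP[yl yr] ys.
  rewrite (int_kernel_le0 s0); have [y0|y0] := leP y 0; first by rewrite (int_kernel_le0 y0) subrr rnorm0.
  rewrite -(int_kernel_le0 (lexx 0)); apply: hr; first by rewrite ltW.
  by move: ys; rewrite !ltr_norml => /andP[? ?]; apply/andP; split; lra.
have [|r r0 hr] := ac s _ e e0; first by rewrite ltW.
exists r => // y /andP[yl yr] ys; have [y0|y0] := leP 0 y; first by apply: hr => //; rewrite y0.
rewrite (int_kernel_le0 (ltW y0)) -(int_kernel_le0 (lexx 0)); apply: hr => //.
by move: ys; rewrite !ltr_norml => /andP[? ?]; apply/andP; split; lra.
Qed.

Lemma int_kernel_rcont_shift (t q : R) : 0 < t -> 0 <= q <= t -> rcont (fun s => int_kernel g (t - s - q)) 0 t.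
Proof.
move=> t0 /andP[q0 q1] s /andP[s0 s1] e e0.
have [|r r0 hr] := @int_kernel_rcont t t0 (t - s - q) _ e e0; first by apply/andP; split; lra.
exists r => // y /andP[y0 y1] ys; apply: hr; first by apply/andP; split; lra.
by rewrite (_ : t - y - q - (t - s - q) = - (y - s)) ?normrN//; ring.
Qed.

Variables S S' : R -> X -> X.
Hypothesis Sf : resolvent_family A g S.
Hypothesis Sf' : resolvent_family A g S'.
Hypothesis Sbound : forall T : R, 0 < T -> exists2 M : R, 0 < M & forall q x,
  0 <= q <= T -> rnorm (S q x) <= M * rnorm x.

(** In the convolution of [S] and [S'] either factor is expanded by its resolvent
    equation. The resulting double integrals agree by Fubini's theorem, and what
    is left are the integrals of [S] and of [S']. *)
Lemma resolvent_primitives x (t : R) (PS PS' : R -> X) : dom A x -> 0 < t ->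
  rprim (fun s => S s x) PS 0 t -> rprim (fun s => S' s x) PS' 0 t ->
  PS' t - PS' 0 = PS t - PS 0.
Proof.
move=> dx t0 hPS hPS'; have [S1 S2 S3 S4 S5] := Sf; have [S1' S2' S3' S4' S5'] := Sf'.
set y := A x; have [M M0 hM] := Sbound t0.
have Sl q : 0 <= q <= t -> linear (S q) by move=> /andP[q0 _]; have [] := S1 q q0.
have Sc z : rcont (fun q => S q z) 0 t by exact: within_cont_rcont.
have Sc' z : rcont (fun q => S' q z) 0 t by exact: within_cont_rcont.
have Gu := family_uc2 t0 M0 Sl hM Sc (Sc' y).
have Hu := family_uc2 t0 M0 Sl hM Sc (Sc' x).
have [B B0 hB] : exists2 B : R, 0 < B & forall v, - t <= v <= t -> rnorm (int_kernel g v) <= B.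
  by apply: (@rcont_bounded R R[i]) (int_kernel_rcont t0); lra.
have [K K0 hK] := rcont_bounded (ltW t0) (Sc' y).
pose f q s : X := int_kernel g (t - s - q) *: S q (S' s y).
have fu : uc2 f t.
  apply: (uc2_mul (B := B) (K := M * K) t0 B0 (mulr_gt0 M0 K0) (int_kernel_rcont t0) hB Gu).
  move=> q s qI sI; apply: le_trans (hM q _ qI) _; apply: ler_wpM2l; [exact: ltW|exact: hK].
have rev s : 0 <= s <= t -> 0 <= t - s <= t by move=> /andP[? ?]; apply/andP; split; lra.
have Hc : rcont (fun s => S (t - s) (S' s x)) 0 t.
  move=> s sI e e0; have [d d0 hd] := Hu _ (divr_gt0 e0 (ltr0Sn _ 1)).
  exists d => // s' sI' ss; apply: le_lt_trans (hd _ _ _ _ (rev _ sI) (rev _ sI') sI sI' _ ss) _.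
    by rewrite (_ : t - s' - (t - s) = - (s' - s)) ?normrN//; ring.
  by rewrite -[2%:R]/(2 : R); lra.
have [PH hPH] := rprim_ex (ltW t0) Hc.
pose alpha s : X := (-1) *: S' s x + S (t - s) (S' s x).
pose beta q : X := (-1) *: S q x + S q (S' (t - q) x).
have hA : rprim alpha (fun s => (-1) *: PS' s + PH s) 0 t by exact: rprim_comb.
have hH := rprim_rev hPH.
have hH' : rprim (fun q => S q (S' (t - q) x)) (fun q => - PH (0 + t - q)) 0 t.
  by apply: rprim_eq hH => s _; rewrite add0r subKr.
have hB' : rprim beta (fun s => (-1) *: PS s + - PH (0 + t - s)) 0 t.
  exact: rprim_comb hPS hH'.
have fa s : 0 <= s <= t -> forall Phi, rprim (f^~ s) Phi 0 t -> Phi t - Phi 0 = alpha s.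
  move=> sI Phi hPhi; have /andP[s0 s1] := sI; have /andP[u0 u1] := rev s sI.
  have [dz Az] := S4' s x s0 dx; set z := S' s x in dz Az.
  have [v vI vE] := S5 (t - s) z u0 dz.
  have -> : alpha s = v by rewrite /alpha -/z vE; module.
  apply: (rprim_truncated (rev s sI) hPhi _ _ vI).
    move=> q /andP[q0 _]; have [_ ->] := S4 q z q0 dz.
    by rewrite Az.
  move=> q /andP[q0 q1]; rewrite /f int_kernel_le0 ?scale0r//; lra.
have fb q : 0 <= q <= t -> forall Phi, rprim (f q) Phi 0 t -> Phi t - Phi 0 = beta q.
  move=> qI Phi hPhi; have /andP[q0 q1] := qI; have /andP[u0 u1] := rev q qI.
  have [v vI vE] := S5' (t - q) x u0 dx.
  have kc := rcont_mul (int_kernel_rcont_shift t0 qI) (Sc' y).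
  have [phi hphi] := rprim_ex (ltW t0) kc.
  have pv : phi t - phi 0 = v.
    apply: (rprim_truncated (rev q qI) hphi _ _ vI).
      move=> s /andP[s0 _]; have [_ ->] := S4' s x s0 dx.
      by rewrite [t - s - q]addrAC.
    move=> s /andP[s0 s1]; rewrite int_kernel_le0 ?scale0r//; lra.
  have hS := rprim_lin (Sl q qI) (fun z => hM q z qI) hphi.
  have hS' : rprim (f q) (fun s => S q (phi s)) 0 t.
    by apply: rprim_eq hS => s _; rewrite (linZ _ _ (Sl q qI)).
  rewrite (rprim_unique (ltW t0) hPhi hS') -(linB _ _ (Sl q qI)) pv /beta vE.
  by rewrite (linD _ _ (Sl q qI)); module.
have := rprim_fubini t0 fu fa fb hA hB'.
rewrite /= !add0r subrr subr0 => h.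
have {}h : (-1) *: (PS' t - PS' 0) + (PH t - PH 0) = (-1) *: (PS t - PS 0) + (PH t - PH 0).
  by transitivity ((-1) *: PS' t + PH t - ((-1) *: PS' 0 + PH 0)); [module|rewrite h; module].
move/addIr: h; rewrite !scaleN1r; exact: oppr_inj.
Qed.

Lemma resolvent_unique_dom x (t : R) : dom A x -> 0 <= t -> S' t x = S t x.
Proof.
move=> dx t0; have [_ S2 _ _ _] := Sf; have [_ S2' _ _ _] := Sf'.
pose T := t + 1; have T0 : 0 <= T by rewrite addr_ge0.
have [PS hPS] := rprim_ex T0 (@within_cont_rcont R X _ T (S2 x)).
have [PS' hPS'] := rprim_ex T0 (@within_cont_rcont R X _ T (S2' x)).
have inc u : 0 <= u <= T -> PS' u - PS' 0 = PS u - PS 0.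
  move=> /andP[u0 uT]; move: u0; rewrite le_eqVlt => /predU1P[<-|u0]; first by rewrite !subrr.
  exact: resolvent_primitives dx u0 (rprimW (lexx 0) uT hPS) (rprimW (lexx 0) uT hPS').
have hD := rprim_comb (-1) hPS hPS'.
apply/eqP; rewrite -subr_eq0; apply/eqP/rnorm_small => e e0.
have [d d0 hd] := hD e e0; pose k := Num.min 1 (d / 2).
have k0 : 0 < k by rewrite lt_min ltr01 divr_gt0.
have k1 : k <= 1 by rewrite ge_min lexx.
have kd : k < d by rewrite gt_min; apply/orP; right; lra.
have := hd t t (t + k) t0 (lexx t); rewrite (_ : t + k - t = k); last by ring.
have tk : t + k <= T by rewrite /T lerD2l.
have tt : t <= t + k by lra.
move=> /(_ tt tk kd).
have i1 : PS' (t + k) - PS' 0 = PS (t + k) - PS 0 by apply: inc; rewrite tk andbT addr_ge0// ltW.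
have i2 : PS' t - PS' 0 = PS t - PS 0 by apply: inc; rewrite t0 /T lerDl ler01.
have -> : (-1) *: PS (t + k) + PS' (t + k) - ((-1) *: PS t + PS' t) - k%:C *: ((-1) *: S t x + S' t x) =
  (PS' (t + k) - PS' 0 - (PS (t + k) - PS 0)) - (PS' t - PS' 0 - (PS t - PS 0)) - k%:C *: (S' t x - S t x).
  by module.
rewrite i1 i2 !subrr sub0r rnormN rnormZ rnormR gtr0_norm// mulrC.
by rewrite ler_pM2r.
Qed.

Lemma resolvent_unique x (t : R) : 0 <= t -> S' t x = S t x.
Proof.
move=> t0; have [S1 _ _ _ _] := Sf; have [S1' _ _ _ _] := Sf'.
have [l [c hc]] := S1 t t0; have [l' [c' hc']] := S1' t t0.
apply/eqP; rewrite -subr_eq0; apply/eqP/rnorm_small => e e0.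
pose K := `|c| + `|c'| + 1; have K0 : 0 < K by rewrite ltr_wpDl// addr_ge0.
have [y dy yx] := @dense_rnorm R X A Adense x (e / K) (divr_gt0 e0 K0).
have -> : S' t x - S t x = S t (y - x) - S' t (y - x).
  by rewrite (linB _ _ l) (linB _ _ l') (resolvent_unique_dom dy t0); module.
move: yx; rewrite ltr_pdivlMr// => yx; have nn := rnorm_ge0 (y - x).
apply: le_trans (rnormD _ _) _; rewrite rnormN.
have := hc (y - x); have := hc' (y - x).
have := ler_wpM2r nn (ler_norm c); have := ler_wpM2r nn (ler_norm c').
by rewrite /K !mulrDr mulr1 in yx; lra.
Qed.

End Uniqueness.

(** * The generation theorem *)

Theorem theorem1 (R : realType) (X0 : completeNormedModType R[i])
    (A : linop X0) (psi0 : R) (hpsi0 : 0 <= psi0 < pi / 2)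
    (hA : sectorial (oppop A) psi0)
    (g : R -> R[i]) (hgloc : L1loc g)
    (hgnz : ~ {ae (@lebesgue_measure R), forall t, 0 <= t -> g t = 0})
    (hglap : laplace_transformable g)
    (omega0 eta0 : R) (homega0 : 0 <= omega0) (heta0 : 0 < eta0 <= pi / 2)
    (ghat : R[i] -> R[i]) (P : set R[i])
    (B1 : meromorphic_extension (laplace g) (laplace_cvg g)
            (osector omega0 (eta0 + pi / 2)) ghat P
          /\ forall z, osector omega0 (eta0 + pi / 2) z -> ~ P z ->
               ghat z <> 0)
    (B2 : forall omega1 eta1 : R, omega0 < omega1 -> 0 < eta1 < eta0 ->
          exists psi1 : R, psi0 < psi1 < pi / 2 /\
            forall z, osector omega1 (eta1 + pi / 2) z ->
              ~ csector 0 psi1 (- (z * recip ghat P z)))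
    (omega eta zeta : R) (homega : omega0 < omega) (heta : 0 < eta < eta0)
    (hzeta : 1 < zeta)
    (B3 : (limf_esup
             (fun z : R[i] =>
                (rnorm (recip ghat P z) / (rnorm z `^ (zeta - 1)))%:E)
             (infty_in (osector omega (eta + pi / 2))) < +oo)%E) :
  exists S : R -> X0 -> X0,
    [/\ resolvent_family A g S,
        analytic_family S,
        (forall S' : R -> X0 -> X0, resolvent_family A g S' ->
           forall t x, 0 <= t -> S' t x = S t x)
      & exists M : R, 1 <= M /\
        [/\ (forall t : R, 0 <= t ->
               opnorm rnorm (S t) <= M * expR (omega * t)),
            (forall t : R, 0 < t ->
               [/\ (forall x, dom A (S t x)),
                   bounded_linop (norm1 A) (S t)
                 & opnorm (norm1 A) (S t)
                     <= M * expR (omega * t) * (1 + t `^ (- zeta))])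
          & (forall t0 t1 : R, 0 < t0 < t1 ->
               opnorm rnorm (fun x => S t1 x - S t0 x)
                 <= M * expR (omega * (1 + sin eta) * t1) / sin eta
                      * ln (t1 / t0))]].

Proof.
have eta_lt : 0 < eta < pi / 2.
  by move/andP: heta => [? ?]; move/andP: heta0 => [? ?]; apply/andP; split; lra.
have [w1 [m [F [Q [w10 w1o td]]]]] := transform_data_ex hpsi0 hA homega0 heta0 B1 B2 homega heta hzeta B3.
have Adense : dense (dom A) by have [_ _ h _ _] := hA.
pose S := rfam w1 omega eta F.
have omega_gt0 : 0 < omega by exact: lt_trans w1o.
have Sf : resolvent_family A g S.
  split.
  - by move=> t t0; exact: (rfam_bounded w10 w1o eta_lt td).
  - move=> x; apply: rcont_within_cont => s e s0 e0.
    exact: (rfam_continuous w10 w1o eta_lt td hgloc hglap Adense x s0 e0).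
  - by move=> x; rewrite /S /rfam ltxx.
  - by move=> t x t0 dx; exact: (rfam_dom w10 w1o eta_lt td t0 dx).
  - by move=> t x t0 dx; exact: (rfam_equation w10 w1o eta_lt td hgloc hglap Adense t0 dx).
have [M1 M1_ge1 hM1] := rfam_bound w10 w1o eta_lt td.
exists S; split => //.
- exists (eta / 4); split; first by move/andP: eta_lt => [? ?]; have pp := pi_gt0 R; apply/andP; split; lra.
  exists (invlap w1 omega eta F); split; first exact: (invlap_holomorphic w10 w1o eta_lt td).
  by move=> t x t0; rewrite /S rfamE.
- move=> S' Sf' t x t0.
  apply: (resolvent_unique hgloc Adense Sf Sf') => // T T0.
  exists (M1 * expR (omega * T)) => [|q y /andP[q0 qT]].
    by rewrite mulr_gt0 ?expR_gt0// (lt_le_trans ltr01).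
  apply: le_trans (hM1 q y q0) _; apply: ler_wpM2r; first exact: rnorm_ge0.
  apply: ler_wpM2l; first exact: le_trans ler01 M1_ge1.
  by rewrite ler_expR ler_pM2l.
have [M2 M2_gt0 hM2] := rfam_smoothing w10 w1o eta_lt hzeta td.
have [M3 M3_gt0 hM3] := rfam_log w10 w1o eta_lt td.
have M1_gt0 : 0 < M1 by exact: lt_le_trans M1_ge1.
pose M := M1 + M2 + M3.
have M1M : M1 <= M by rewrite /M -addrA lerDl addr_ge0// ltW.
have M2M : M2 <= M by rewrite /M addrAC lerDr addr_ge0// ltW.
have M3M : M3 <= M by rewrite /M lerDr addr_ge0// ltW.
have M_gt0 : 0 < M by exact: lt_le_trans M1M.
have le1 (a b c : R) : 0 <= b -> c <= 1 -> a <= b -> 0 <= c -> a * c <= b.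
  move=> b0 c1 ab c0; apply: (@le_trans _ _ (b * c)); first exact: ler_wpM2r.
  exact: ler_piMr.
exists M; split; first exact: le_trans M1M.
split.
- move=> t t0; apply: opnorm_le => x x1; apply: le_trans (hM1 t x t0) _.
  apply: le1 (rnorm_ge0 x) => //; first by rewrite mulr_ge0 ?expR_ge0// ltW.
  by apply: ler_wpM2r => //; exact: expR_ge0.
- move=> t t0; have dS x : dom A (S t x) /\ norm1 A (S t x) <= M2 * expR (omega * t) * (1 + t `^ (- zeta)) * rnorm x.
    have [w SE hw] := hM2 t x t0; have [d1 d2] := td_Qdom td w.
    by rewrite /norm1 /S SE d2.
  split; first by move=> x; have [] := dS x.
    split; first by apply: (rfam_linear w10 w1o eta_lt td); exact: ltW.
    by eexists => x; have [_ h] := dS x; exact: h.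
  have p0 : 0 <= 1 + t `^ (- zeta) by rewrite addr_ge0// powR_ge0.
  apply: opnorm_le => x x1; have [_ h] := dS x; apply: le_trans h _.
  apply: le1 (rnorm_ge0 x) => //; first by rewrite !mulr_ge0 ?expR_ge0// ltW.
  by apply: ler_wpM2r => //; apply: ler_wpM2r => //; exact: expR_ge0.
move=> t0 t1 /andP[t00 t01]; have t10 : 0 < t1 by exact: lt_trans t01.
have [_ s0] := cos_sin_pos eta_lt.
have l0 : 0 <= ln (t1 / t0) by rewrite ln_ge0// ler_pdivlMr// mul1r ltW.
apply: opnorm_le => x x1; apply: le_trans (hM3 t0 t1 x t00 (ltW t01)) _.
have K0 : 0 <= M * expR (omega * (1 + sin eta) * t1) / sin eta.
  by rewrite divr_ge0 ?(ltW s0)// mulr_ge0 ?expR_ge0// ltW.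
apply: le1 (rnorm_ge0 x) => //; first exact: mulr_ge0.
apply: ler_wpM2r => //; rewrite ler_pdivlMr//.
apply: (@le_trans _ _ (M * expR (omega * (1 + sin eta) * t1) * 1)); last by rewrite mulr1.
apply: ler_pM => //.
- by rewrite mulr_ge0 ?expR_ge0// ltW.
- exact: ltW.
- apply: ler_pM => //; first exact: ltW.
  rewrite ler_expR mulrDr mulr1 mulrDl lerDl; apply: mulr_ge0; last exact: ltW.
  by apply: mulr_ge0; exact: ltW.
Qed.
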